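(* For any $q\in[1,+\infty)$, the homogeneous solution map $$\mathrm{W}_{0,\natural}:L^q(\mathbb{R}^n)\to C^\infty(\mathbb{R}_+,W^{q,\infty}(\mathbb{R}^n))\cap C([0,+\infty),L^q(\mathbb{R}^n)),\qquad(\mathrm{W}_{0,\natural}h)(t)=\operatorname{W}_{0,t}h,\quad t\in[0,+\infty),$$ and the inhomogeneous solution map $$\int_0^\natural\mathrm{W}_{\sharp,\natural}:C^\infty(\mathbb{R}_+,W^{q,\infty}(\mathbb{R}^n))\cap C([0,+\infty),W^{q,\infty}(\mathbb{R}^n))\to C^\infty(\mathbb{R}_+,W^{q,\infty}(\mathbb{R}^n))\cap C([0,+\infty),L^q(\mathbb{R}^n)),$$ $$\Big(\int_0^\natural\mathrm{W}_{\sharp,\natural}h\Big)(t)=\int_0^t\operatorname{W}_{s,t}h(s)\,ds,\quad t\in[0,+\infty),$$ are continuous and linear.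
   Context: $n\in\mathbb{N}$ (positive), $\mathbb{R}_+=(0,\infty)$. $W^{q,k}(\mathbb{R}^n)$ is the Sobolev space of functions whose weak derivatives up to order $k$ lie in $L^q(\mathbb{R}^n)$, and $W^{q,\infty}(\mathbb{R}^n)=\bigcap_{k\ge0}W^{q,k}(\mathbb{R}^n)$, with the Fréchet topology given by the seminorms $\|\partial_x^\ell h\|_q$, $\ell\in\mathbb{N}_0^n$. Standing assumption: $a\in C^\infty(\mathbb{R}_+,\mathrm{GL}(n))\cap C([0,\infty),\mathrm{GL}(n))$ is a real matrix-valued function such that $a(t)$ is symmetric positive definite for every $t\in[0,\infty)$. Put $A(t)=\int_0^ta(s)\,ds$ ($A(0)=0$), $\Delta=\{(s,t)\in[0,\infty)\times\mathbb{R}_+: s<t\}$, and for $(s,t)\in\Delta$ $$\mathcal{W}(x;s,t)=\frac{1}{\sqrt{(4\pi)^n\det[A(t)-A(s)]}}\,e^{-\frac14\langle x,[A(t)-A(s)]^{-1}x\rangle},\quad x\in\mathbb{R}^n.$$ The operators are $\operatorname{W}_{s,t}v=\mathcal{W}(\cdot;s,t)\ast v$ (convolution in $x$) for $(s,t)\in\Delta$, and $\operatorname{W}_{t,t}v=v$ for $t\ge0$. Topologies: $C^\infty(\mathbb{R}_+,W^{q,\infty}(\mathbb{R}^n))$ carries the seminorms $\|h\|_{q,j,\ell,K}=\sup_{t\in K}\|\partial_t^j\partial_x^\ell h(t)\|_q$ for $j\in\mathbb{N}_0$, $\ell\in\mathbb{N}_0^n$, $K\subset\mathbb{R}_+$ compact;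 $C([0,+\infty),L^q(\mathbb{R}^n))$ carries the seminorms $\|h\|_{q,b}=\sup_{t\in[0,b]}\|h(t)\|_q$, $b\in\mathbb{N}$; $C([0,+\infty),W^{q,\infty}(\mathbb{R}^n))$ carries the seminorms $\|h\|_{q,\ell,b}=\sup_{t\in[0,b]}\|\partial_x^\ell h(t)\|_q$, $\ell\in\mathbb{N}_0^n$, $b\in\mathbb{N}$; each intersection carries the topology generated by both families of seminorms. *)

(* Defs.v *)
From HB Require Import structures.
From mathcomp Require Import all_boot all_order all_algebra.
From mathcomp Require Import all_classical all_reals all_analysis.
From mathcomp Require Import ess_sup_inf measurable_realfun.
Set Implicit Arguments.
Unset Strict Implicit.
Unset Printing Implicit Defensive.
Import Order.TTheory GRing.Theory Num.Theory numFieldNormedType.Exports.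
Local Open Scope classical_set_scope.
Local Open Scope ring_scope.

Fact measure_rV_display : measure_display -> measure_display.
Proof. exact. Qed.

Section measurable_rV.
Context {d} {T : measurableType d} (n : nat).

Let coor : 'I_n -> 'rV[T]_n -> T := fun i x => x 0 i.

Let rV_set0 : g_sigma_preimage coor set0.
Proof. exact: sigma_algebra0. Qed.

Let rV_setC A : g_sigma_preimage coor A -> g_sigma_preimage coor (~` A).
Proof. exact: sigma_algebraC. Qed.

Let rV_bigcup (F : (set 'rV[T]_n)^nat) :
  (forall i, g_sigma_preimage coor (F i)) ->
  g_sigma_preimage coor (\bigcup_i F i).
Proof. exact: sigma_algebra_bigcup. Qed.
HB.instance Definition _ := @isMeasurable.Build (measure_rV_display d)
  'rV[T]_n (g_sigma_preimage coor) rV_set0 rV_setC rV_bigcup.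

Lemma measurable_coor (i : 'I_n) :
  measurable_fun [set: 'rV[T]_n] (fun x : 'rV[T]_n => x 0 i).
Proof.
move=> _ Y mY; rewrite setTI; apply: sub_sigma_algebra => /=.
rewrite -bigcup_seq/=; exists i => /=; first by rewrite mem_index_enum.
by exists Y => //; rewrite setTI.
Qed.

End measurable_rV.

Lemma measurable_fun_rVP d1 d2 (T1 : measurableType d1) (T2 : measurableType d2)
    n (f : T1 -> 'rV[T2]_n) :
  (forall i, measurable_fun [set: T1] (fun x => f x 0 i)) ->
  measurable_fun [set: T1] f.
Proof.
move=> mf _ A mA; rewrite setTI.
pose G := [set B : set 'rV[T2]_n | measurable (f @^-1` B)].
suff: g_sigma_preimage (fun i (x : 'rV[T2]_n) => x 0 i) `<=` G by exact.
apply: smallest_sub.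
  split => /=; rewrite /G/=.
  - by rewrite preimage_set0.
  - by move=> B mB; rewrite setTD preimage_setC; exact: measurableC.
  - by move=> F mF; rewrite preimage_bigcup; exact: bigcup_measurable.
move=> B; rewrite -bigcup_seq/= => -[i _ [C mC <-]].
by rewrite /G/= setTI -comp_preimage -[X in measurable X]setTI; exact: mf.
Qed.

(* R^n is 'rV[R]_n with the sigma-algebra generated by the coordinates. The
   Lebesgue measure is built by induction on n through
   R * 'rV[R]_n -> 'rV[R]_n.+1; it is the one of lebesgue_rV_box. *)
Section lebesgue_measure_rV.
Context {R : realType}.

Definition rV_cons n (x : measurableTypeR R * 'rV[R]_n) : 'rV[R]_n.+1 :=
  \row_i oapp (x.2 0) x.1 (unlift ord0 i).

Lemma measurable_rV_cons n : measurable_fun setT (@rV_cons n).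
Proof.
apply: measurable_fun_rVP => i; rewrite /rV_cons.
under eq_fun do rewrite mxE.
case: (unliftP ord0 i) => [j|] _ /=; last exact: measurable_fst.
apply: (@measurableT_comp _ _ _ _ _ _ (fun x : 'rV[R]_n => x 0 j)).
  exact: measurable_coor.
exact: measurable_snd.
Qed.


Definition rV_uncons n (x : 'rV[R]_n.+1) : measurableTypeR R * 'rV[R]_n :=
  (x 0 ord0, \row_i x 0 (lift ord0 i)).

Lemma rV_consK n : cancel (@rV_cons n) (@rV_uncons n).
Proof.
move=> [x y]; rewrite /rV_uncons /rV_cons mxE unlift_none/=; congr pair.
by apply/rowP => i; rewrite !mxE liftK.
Qed.

Lemma measurable_rV_uncons n : measurable_fun setT (@rV_uncons n).
Proof.
apply: measurable_fun_pair; first exact: measurable_coor.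
apply: measurable_fun_rVP => i; rewrite /comp/=.
by under eq_fun do rewrite mxE; exact: measurable_coor.
Qed.

Section step.
Variables (n : nat) (m1 : {sigma_finite_measure set (measurableTypeR R) -> \bar R}).
Variable m : {sigma_finite_measure set 'rV[R]_n -> \bar R}.
Local Open Scope ereal_scope.

Definition lebesgue_rV_step : set 'rV[R]_n.+1 -> \bar R :=
  pushforward (m1 \x m) (@rV_cons n).

Let step0 : lebesgue_rV_step set0 = 0.
Proof. by rewrite /lebesgue_rV_step /pushforward preimage_set0 measure0. Qed.

Let step_ge0 A : 0 <= lebesgue_rV_step A.
Proof. by rewrite /lebesgue_rV_step /pushforward measure_ge0. Qed.

Let mcons (A : set 'rV[R]_n.+1) : measurable A -> measurable (@rV_cons n @^-1` A).
Proof.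
by move=> mA; rewrite -[X in measurable X]setTI; exact: measurable_rV_cons.
Qed.

Let step_sigma_additive : semi_sigma_additive lebesgue_rV_step.
Proof.
move=> F mF tF mUF; rewrite /lebesgue_rV_step /pushforward preimage_bigcup.
apply: measure_semi_sigma_additive.
- by move=> k; exact: mcons.
- apply/trivIsetP => /= i j _ _ ij; rewrite -preimage_setI.
  by move/trivIsetP : tF => /(_ _ _ _ _ ij) ->//; rewrite preimage_set0.
- by rewrite -preimage_bigcup; exact: mcons.
Qed.

HB.instance Definition _ := isMeasure.Build _ _ _
  lebesgue_rV_step step0 step_ge0 step_sigma_additive.

Let step_sigma_finite : sigma_finite setT lebesgue_rV_step.
Proof.
have /sigma_finiteP[F [TF ndF Foo]] := sigma_finiteT m1.
have /sigma_finiteP[G [TG ndG Goo]] := sigma_finiteT m.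
exists (fun k => @rV_uncons n @^-1` (F k `*` G k)).
  rewrite -preimage_bigcup (_ : \bigcup_k _ = setT) ?preimage_setT//.
  apply/seteqP; split => // -[x y] _.
  have [i _ Fix] : (\bigcup_i F i) x by rewrite -TF.
  have [j _ Gjy] : (\bigcup_i G i) y by rewrite -TG.
  exists (maxn i j) => //; split => /=.
  - by move: x Fix; exact/subsetPset/ndF/leq_maxl.
  - by move: y Gjy; exact/subsetPset/ndG/leq_maxr.
move=> k; have [? ?] := Foo k; have [? ?] := Goo k; split.
  rewrite -[X in measurable X]setTI; apply: measurable_rV_uncons => //.
  exact: measurableX.
rewrite /lebesgue_rV_step /pushforward -comp_preimage (_ : _ \o _ = id).
  by rewrite preimage_id product_measure1E// lte_mul_pinfty// ge0_fin_numE.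
by apply/funext => x /=; rewrite rV_consK.
Qed.

HB.instance Definition _ := Measure_isSigmaFinite.Build _ _ _
  lebesgue_rV_step step_sigma_finite.

End step.

Fixpoint lebesgue_rV n : {sigma_finite_measure set 'rV[R]_n -> \bar R} :=
  if n is k.+1 return {sigma_finite_measure set 'rV[R]_n -> \bar R}
  then lebesgue_rV_step lebesgue_measure (lebesgue_rV k) else \d_(0 : 'rV[R]_0).

Lemma lebesgue_rV_box n (A : 'I_n -> set R) :
  (forall i, measurable (A i)) ->
  lebesgue_rV n [set x | forall i, A i (x 0 i)] =
  (\prod_(i < n) lebesgue_measure (A i))%E.
Proof.
elim: n A => [|n IH] A mA /=.
  rewrite big_ord0 diracE mem_set//= => -[]//.
rewrite /lebesgue_rV_step /pushforward big_ord_recl -(IH (A \o lift ord0))//.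
rewrite -product_measure1E//.
- congr (product_measure1 _ _ _); apply/seteqP; split => -[x y]/=.
    move=> h; split => /=.
      by have := h ord0; rewrite mxE unlift_none.
    by move=> i; have := h (lift ord0 i); rewrite mxE liftK.
  move=> -[/= hx hy] i; rewrite mxE; case: (unliftP ord0 i) => [j|] -> //=.
- exact: mA.
- rewrite (_ : (fun x => _) = \bigcap_(i in [set: 'I_n])
    ((fun x : 'rV[R]_n => x 0 i) @^-1` A (lift ord0 i))); last first.
    by apply/seteqP; split => x /= h i; [move=> _; exact: h|exact: h].
  apply: fin_bigcap_measurable => // i _.
  by rewrite -[X in measurable X]setTI; exact: measurable_coor.
- by move=> i; exact: mA.
Qed.

End lebesgue_measure_rV.

(* LspaceType mu p1 is the quotient of the p-integrable functions by equality
   almost everywhere; it becomes a normedModType R for the norm 'N[mu]_p. *)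
Section Lspace_normed.
Context d (T : measurableType d) (R : realType).
Variables (mu : {measure set T -> \bar R}) (p : \bar R) (p1 : (1 <= p)%E).
Local Notation L := (LspaceType mu p1).
Local Notation Lf := (LfunType mu p1).

Lemma ae_eq_Lnorm (f g : T -> R) : measurable_fun setT f ->
  measurable_fun setT g -> f = g %[ae mu] ->
  'N[mu]_p[EFin \o f]%E = 'N[mu]_p[EFin \o g]%E.
Proof.
move=> mf mg fg; rewrite unlock; case: p p1 => [r r1|_|//].
- have mpow (h : T -> R) : measurable_fun setT h ->
      measurable_fun setT (fun x => (`|(EFin \o h) x| `^ r)%E : \bar R).
    move=> mh; apply/measurable_EFinP => /=; apply: (@measurableT_comp _ _ _ _ _ _ (@powR R ^~ r)) => //.
    exact: measurableT_comp.
  congr (_ `^ _)%E; apply: ae_eq_integral => //; [exact: mpow|exact: mpow|].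
  by apply: filterS fg => x /= fg _; rewrite fg.
- by case: ifPn => // mu0; apply: eq_ess_sup; apply: filterS fg => x /= ->.
Qed.

Fact mfun_measurableTypeR (f : {mfun T >-> R}) :
  measurable_fun setT (f : T -> measurableTypeR R).
Proof. by have := @measurable_funPT _ _ _ _ f. Qed.

Definition mfunR (f : {mfun T >-> R}) : {mfun T >-> measurableTypeR R} :=
  HB.pack (f : T -> measurableTypeR R)
    (isMeasurableFun.Build _ _ _ _ _ (mfun_measurableTypeR f)).

Fact Lspace_mfun (u : L) : measurable_fun setT (repr (LebesgueSpace.sort u) : T -> R).
Proof.
by have := @measurable_funPT _ _ _ _ (repr (LebesgueSpace.sort u)).
Qed.

Fact Lspace_repr_subproof (u : L) :
  (repr (LebesgueSpace.sort u) : T -> R) \in Lfun mu p.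
Proof.
rewrite inE; apply/andP; split; rewrite inE/=; first exact: Lspace_mfun.
exact: Lebesgue_finite.
Qed.

Definition Lspace_repr (u : L) : Lf := Lfun_Sub p1 (Lspace_repr_subproof u).

Let cls (f : {mfun T >-> R}) : {mfun_ mu, T >-> measurableTypeR R} :=
  \pi_({mfun_ mu, T >-> measurableTypeR R})%qT (mfunR f).

Lemma repr_cls (f : {mfun T >-> R}) : (repr (cls f) : T -> R) = f %[ae mu].
Proof.
have /eqP : (repr (cls f) = mfunR f %[mod {mfun_ mu, T >-> measurableTypeR R}])%qT.
  by rewrite reprK.
by rewrite eqmodE => /asboolP.
Qed.

Fact Lspace_of_subproof (f : Lf) : finite_norm mu p (cls f).
Proof.
rewrite /finite_norm (_ : 'N[mu]_p[_] = 'N[mu]_p[EFin \o f])%E.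
  exact: Lfunction_finite.
apply: ae_eq_Lnorm; [|exact: measurable_funPT|exact: repr_cls].
by have := @measurable_funPT _ _ _ _ (repr (cls f)).
Qed.

Definition Lspace_of (f : Lf) : L :=
  HB.pack (cls f) (isFinLebesgue.Build _ _ _ _ _ p1 (cls f) (Lspace_of_subproof f)).

Lemma Lspace_ofK (f : Lf) : (Lspace_repr (Lspace_of f) : T -> R) = f %[ae mu].
Proof. exact: repr_cls. Qed.

Lemma Lspace_ae_inj (u v : L) : 
  (Lspace_repr u : T -> R) = Lspace_repr v %[ae mu] -> u = v.
Proof.
move=> uv.
have : LebesgueSpace.sort u = LebesgueSpace.sort v.
  rewrite -[LHS]reprK -[RHS]reprK; apply/eqP; rewrite eqmodE; exact/asboolP.
case: u v {uv} => [u [[cu]]] [v [[cv]]] /= uv.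
move: cu cv; rewrite uv => cu cv.
by rewrite (Prop_irrelevance cu cv).
Qed.

Lemma Lspace_of_eq (f g : Lf) : (f : T -> R) = g %[ae mu] ->
  Lspace_of f = Lspace_of g.
Proof.
move=> fg; apply: Lspace_ae_inj.
move: (Lspace_ofK f) (Lspace_ofK g) fg.
by apply: filterS3 => x h1 h2 h3 _; rewrite h1// h2// h3.
Qed.

Lemma Lspace_reprK : cancel Lspace_repr Lspace_of.
Proof. by move=> u; apply: Lspace_ae_inj; exact: Lspace_ofK. Qed.

HB.instance Definition _ := gen_eqMixin L.
HB.instance Definition _ := gen_choiceMixin L.

Definition Lspace_add (u v : L) := Lspace_of (Lspace_repr u + Lspace_repr v).
Definition Lspace_opp (u : L) := Lspace_of (- Lspace_repr u).
Definition Lspace_scale (a : R) (u : L) := Lspace_of (a *: Lspace_repr u).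

Let ofD (f g : Lf) : Lspace_add (Lspace_of f) (Lspace_of g) = Lspace_of (f + g).
Proof.
apply: Lspace_of_eq; move: (Lspace_ofK f) (Lspace_ofK g).
by apply: filterS2 => x h1 h2 _; exact: (congr2 +%R (h1 I) (h2 I)).
Qed.

Let ofN (f : Lf) : Lspace_opp (Lspace_of f) = Lspace_of (- f).
Proof.
apply: Lspace_of_eq; have := Lspace_ofK f.
by apply: filterS => x h1 _; exact: (congr1 -%R (h1 I)).
Qed.

Let ofZ a (f : Lf) : Lspace_scale a (Lspace_of f) = Lspace_of (a *: f).
Proof.
apply: Lspace_of_eq; have := Lspace_ofK f.
by apply: filterS => x h1 _; exact: (congr1 ( *%R a) (h1 I)).
Qed.

Let ind (P : L -> Prop) : (forall f, P (Lspace_of f)) -> forall u, P u.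
Proof. by move=> h u; rewrite -(Lspace_reprK u). Qed.

Let addA : associative Lspace_add.
Proof. by do 3!elim/ind => ?; rewrite !ofD addrA. Qed.
Let addC : commutative Lspace_add.
Proof. by do 2!elim/ind => ?; rewrite !ofD addrC. Qed.
Let add0 : left_id (Lspace_of 0) Lspace_add.
Proof. by elim/ind => ?; rewrite !ofD add0r. Qed.
Let addN : left_inverse (Lspace_of 0) Lspace_opp Lspace_add.
Proof. by elim/ind => ?; rewrite ofN ofD addNr. Qed.

HB.instance Definition _ := GRing.isZmodule.Build L addA addC add0 addN.

Let addE (u v : L) : u + v = Lspace_add u v. Proof. by []. Qed.

Let scaleA a b v : Lspace_scale a (Lspace_scale b v) = Lspace_scale (a * b) v.
Proof. by elim/ind: v => ?; rewrite !ofZ scalerA. Qed.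
Let scale1 : left_id 1 Lspace_scale.
Proof. by elim/ind => ?; rewrite !ofZ scale1r. Qed.
Let scaleDr : right_distributive Lspace_scale +%R.
Proof.
move=> a; elim/ind => f; elim/ind => g.
by rewrite addE !(ofD, ofZ) addE ofD scalerDr.
Qed.
Let scaleDl v : {morph Lspace_scale^~ v : a b / a + b}.
Proof. by elim/ind: v => f a b; rewrite /= addE !ofZ ofD scalerDl. Qed.

HB.instance Definition _ := GRing.Zmodule_isLmodule.Build R L
  scaleA scale1 scaleDr scaleDl.

Definition Lspace_norm (u : L) : R := fine ('N[mu]_p[EFin \o Lspace_repr u])%E.

Let norm_of (f : Lf) : Lspace_norm (Lspace_of f) = fine ('N[mu]_p[EFin \o f])%E.
Proof.
congr fine; apply: ae_eq_Lnorm; [exact: measurable_funPT|exact: measurable_funPT|].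
exact: Lspace_ofK.
Qed.

Let normD u v : Lspace_norm (u + v) <= Lspace_norm u + Lspace_norm v.
Proof.
elim/ind : u v => f; elim/ind => g.
by rewrite [_ + _]ofD !norm_of; exact: ler_LnormD.
Qed.

Let normZ a u : Lspace_norm (a *: u) = `|a| * Lspace_norm u.
Proof.
elim/ind : u => f; rewrite [_ *: _]ofZ !norm_of.
by apply: EFin_inj; rewrite EFinM !finite_norm_fine LnormZ.
Qed.

Let norm_eq0 u : Lspace_norm u = 0 -> u = 0.
Proof.
elim/ind : u => f; rewrite norm_of => /fine_Lnormr_eq0 f0.
exact: Lspace_of_eq.
Qed.

HB.instance Definition _ := Lmodule_isNormed.Build R L normD normZ norm_eq0.

(* The class of f if f is in L^p, and 0 otherwise. *)
Definition Lspace_class (f : T -> R) : L := Lspace_of (insubd (0 : Lf) f).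

End Lspace_normed.

Section locally_convex.
Context {R : realType}.

(* A locally convex space is presented as a linear subspace of an ambient
   vector space V with a family of seminorms; lc_norm is only meaningful on
   lc_set. *)
Record lcspace (V : lmodType R) := LCSpace {
  lc_set : set V ;
  lc_index : Type ;
  lc_norm : lc_index -> V -> R }.

Definition lc_elt (V : lmodType R) (E : lcspace V) : Type :=
  set_type (lc_set E).

HB.instance Definition _ (V : lmodType R) (E : lcspace V) :=
  Choice.on (lc_elt E).

(* The topology generated by the seminorms: the balls of all seminorms around all
   points form a subbase. *)
Definition lc_ball (V : lmodType R) (E : lcspace V) (i : lc_index E)
    (f : lc_elt E) (e : R) : set (lc_elt E) :=
  [set g | lc_norm i (\val g - \val f) < e].

HB.instance Definition _ (V : lmodType R) (E : lcspace V) :=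
  isSubBaseTopological.Build (lc_elt E)
    [set U : set (lc_elt E) | exists i f e, U = lc_ball (i : lc_index E) f e] id.

Definition lc_cap (V : lmodType R) (E F : lcspace V) : lcspace V :=
  LCSpace (lc_set E `&` lc_set F)
    (fun i : lc_index E + lc_index F =>
      match i with inl j => lc_norm j | inr j => lc_norm j end).

Definition lc_of_normed (V : normedModType R) : lcspace V :=
  LCSpace [set: V] (fun (_ : unit) (v : V) => `|v|).

(* The sum and the scaling of E are those of V; lc_linear also states that E is
   closed under them. *)
Definition lc_linear (V V' : lmodType R) (E : lcspace V) (E' : lcspace V')
    (G : lc_elt E -> lc_elt E') :=
  forall (c : R) (u v : lc_elt E), exists2 w : lc_elt E,
    \val w = c *: \val u + \val v & \val (G w) = c *: \val (G u) + \val (G v).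

Definition lc_cvg_to (V : lmodType R) (E : lcspace V) (F : set_system V)
    (v : V) :=
  lc_set E v /\ forall i : lc_index E, lc_norm i (u - v) @[u --> F] --> (0 : R).

Definition is_lc_derive (V : lmodType R) (E : lcspace V) (h : R -> V) (t : R)
    (v : V) :=
  lc_cvg_to E ((fun s => s^-1 *: (h (t + s) - h t)) @ 0^') v.

Definition lc_derive (V : lmodType R) (E : lcspace V) (h : R -> V) (t : R) : V :=
  xget 0 [set v | is_lc_derive E h t v].

Definition lc_deriven (V : lmodType R) (E : lcspace V) (j : nat) (h : R -> V) :=
  iter j (lc_derive E) h.

Definition lc_smooth (V : lmodType R) (E : lcspace V) (U : set R) (h : R -> V) :=
  (forall t, U t -> lc_set E (h t)) /\
  (forall j t, U t -> exists v, is_lc_derive E (lc_deriven E j h) t v).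

(* C([0, +oo), E).  A function on [0, +oo) is encoded by its extension by 0 to
   the negative half-line. *)
Definition lc_C0 (V : lmodType R) (E : lcspace V) : lcspace (R -> V) :=
  LCSpace
    [set h : R -> V | (forall t, t < 0 -> h t = 0) /\
       (forall t, 0 <= t ->
          lc_set E (h t) /\ lc_cvg_to E (h @ within `[0, +oo[ (nbhs t)) (h t))]
    (fun (ib : lc_index E * nat) (h : R -> V) =>
       sup [set lc_norm ib.1 (h t) | t in `[0, ib.2.+1%:R]]).

End locally_convex.

Section vector_integral.
Context {R : realType} {V : normedModType R}.

(* Riemann integral over [a, b] (a <= b): the sums over the tagged partitions
   a = x 0 <= xi 0 <= x 1 <= xi 1 <= ... <= x m = b converge to v when the mesh
   tends to 0. *)
Definition is_riemann_integral (f : R -> V) (a b : R) (v : V) :=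
  forall e : R, 0 < e -> exists2 d : R, 0 < d &
    forall (m : nat) (x xi : nat -> R), x 0%N = a -> x m = b ->
      (forall k, (k < m)%N -> x k <= xi k <= x k.+1 /\ x k.+1 - x k < d) ->
      `|\sum_(k < m) (x k.+1 - x k) *: f (xi k) - v| < e.

End vector_integral.

Section test_functions.
Context {R : realType} {n : nat}.

Definition pderiv (i : 'I_n) (phi : 'rV[R]_n -> R) : 'rV[R]_n -> R :=
  'D_(delta_mx 0 i) phi.

Definition mderiv (l : 'I_n -> nat) (phi : 'rV[R]_n -> R) : 'rV[R]_n -> R :=
  foldr (fun i psi => iter (l i) (pderiv i) psi) phi (enum 'I_n).

Definition smooth (phi : 'rV[R]_n -> R) :=
  forall s : seq 'I_n, continuous (foldr pderiv phi s) /\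
    forall i x, derivable (foldr pderiv phi s) x (delta_mx 0 i).

Definition test_function (phi : 'rV[R]_n -> R) :=
  smooth phi /\ compact (closure [set x | phi x != 0]).

End test_functions.

Section sobolev.
Context {R : realType} (n : nat) (q : R) (q1 : (1 <= q%:E)%E).

Definition Lq := LspaceType (lebesgue_rV n) q1.
HB.instance Definition _ := NormedModule.on Lq.

Definition morder (l : 'I_n -> nat) : nat := (\sum_i l i)%N.

Definition is_weak_deriv (l : 'I_n -> nat) (f g : Lq) :=
  forall phi : 'rV[R]_n -> R, test_function phi ->
    \int[lebesgue_rV n]_x (Lspace_repr f x * mderiv l phi x) =
    (-1) ^+ morder l * \int[lebesgue_rV n]_x (Lspace_repr g x * phi x).

Definition weak_deriv (l : 'I_n -> nat) (f : Lq) : Lq :=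
  xget 0 [set g | is_weak_deriv l f g].

Definition sobolev (k : nat) : set Lq :=
  [set f | forall l, (morder l <= k)%N -> exists g, is_weak_deriv l f g].

Definition sobolev_oo : lcspace Lq :=
  LCSpace (\bigcap_k sobolev k)
    (fun (l : 'I_n -> nat) (f : Lq) => `|weak_deriv l f|).

(* C^oo(R_+, W^{q,oo}): no condition on the values outside R_+, so that this is
   only used in intersections with some lc_C0. *)
(* The seminorms sup_(t in K) |d_t^j d_x^l h(t)|_q, where d_t is the derivative of
   W^{q,oo}-valued functions. *)
Definition Cinfty_sobolev_oo : lcspace (R -> Lq) :=
  LCSpace [set h : R -> Lq | lc_smooth sobolev_oo `]0, +oo[ h]
    (fun (jlK : nat * ('I_n -> nat) *
                {K : set R | compact K /\ K `<=` `]0, +oo[}) (h : R -> Lq) =>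
      let: (j, l, K) := jlK in
      sup [set `|lc_deriven sobolev_oo j (fun s => weak_deriv l (h s)) t|
          | t in sval K]).

Definition source_space : lcspace (R -> Lq) :=
  lc_cap Cinfty_sobolev_oo (lc_C0 sobolev_oo).

Definition solution_space : lcspace (R -> Lq) :=
  lc_cap Cinfty_sobolev_oo (lc_C0 (lc_of_normed Lq)).

End sobolev.

Section heat_operators.
Context {R : realType} {n : nat} (a : R -> 'M[R]_n).

Definition primitive_mx (t : R) : 'M[R]_n :=
  \matrix_(i, j) \int[lebesgue_measure]_(s in `[0, t]) a s i j.

Definition heat_kernel (s t : R) (x : 'rV[R]_n) : R :=
  let B := primitive_mx t - primitive_mx s in
  (Num.sqrt ((4 * pi) ^+ n * \det B))^-1 *
  expR (- 4^-1 * (x *m (invmx B *m x^T)) 0 0).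

Definition convolution (k v : 'rV[R]_n -> R) (x : 'rV[R]_n) : R :=
  \int[lebesgue_rV n]_y (k (x - y) * v y).

(* For s <= t; the convolution is of class L^q by Young's inequality. *)
Definition heat_op (q : R) (q1 : (1 <= q%:E)%E) (s t : R) (v : Lq n q1) : Lq n q1 :=
  if s < t then Lspace_class (lebesgue_rV n) q1 (convolution (heat_kernel s t) (Lspace_repr v))
  else v.

End heat_operators.

(* Main.v *)
Require Import Defs.
From HB Require Import structures.
From mathcomp Require Import all_boot all_order all_algebra.
From mathcomp Require Import all_classical all_reals all_analysis.
From mathcomp Require Import measurable_realfun ess_sup_inf.
From mathcomp Require Import ring lra.
Set Implicit Arguments.
Unset Strict Implicit.
Unset Printing Implicit Defensive.
Import Order.TTheory GRing.Theory Num.Theory numFieldNormedType.Exports.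
Local Open Scope classical_set_scope.
Local Open Scope ring_scope.

(** * Lebesgue measure on row vectors *)

Lemma measurable_reflection (R : realType) (c : R) :
  measurable_fun setT ((fun x => c - x) : measurableTypeR R -> measurableTypeR R).
Proof. exact: measurable_funB. Qed.

Lemma lebesgue_measure_reflection (R : realType) (c : R) (A : set (measurableTypeR R)) :
  measurable A ->
  pushforward lebesgue_measure ((fun x => c - x) : measurableTypeR R -> measurableTypeR R) A
  = lebesgue_measure A.
Proof.
move=> mA; apply/esym.
pose nu := pushforward (@lebesgue_measure R) (fun x : measurableTypeR R => c - x : measurableTypeR R).
have mf := measurable_reflection c.
have := @lebesgue_measure_unique R (measure_function_pushforward__canonical__measure_function_Measure lebesgue_measure mf).
apply => // _ [[a b]] _ <-.
rewrite /= /pushforward /= lebesgue_measure_itv/=.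
rewrite (_ : _ @^-1` _ = `[c - b, c - a[%classic); last first.
  apply/seteqP; split => x /=; rewrite !in_itv/=; lra.
rewrite lebesgue_measure_itv/= !lte_fin ltrD2l ltrN2; case: ifP => // _.
by congr EFin; lra.
Qed.

Lemma ge0_integral_reflection1 (R : realType) (c : R) (f : measurableTypeR R -> \bar R) :
  measurable_fun setT f -> (forall x, 0 <= f x)%E ->
  (\int[lebesgue_measure]_x f (c - x)%R = \int[lebesgue_measure]_x f x)%E.
Proof.
move=> mf f0.
have mr := measurable_reflection c.
pose nu := measure_function_pushforward__canonical__measure_function_Measure
  (@lebesgue_measure R) mr.
transitivity (\int[nu]_x f x)%E.
  by rewrite (ge0_integral_pushforward mr lebesgue_measure measurableT mf).
apply: eq_measure_integral => A mA _; exact: lebesgue_measure_reflection.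
Qed.

Section rV_integral.
Context {R : realType}.
Local Notation vol n := (@lebesgue_rV R n).

Lemma ge0_integral_rVS n (f : 'rV[R]_n.+1 -> \bar R) :
  measurable_fun setT f -> (forall x, 0 <= f x)%E ->
  (\int[vol n.+1]_x f x =
   \int[lebesgue_measure]_x \int[vol n]_y f (rV_cons (x, y)))%E.
Proof.
move=> mf f0 /=; rewrite /lebesgue_rV_step.
rewrite (@ge0_integral_pushforward _ _ _ _ R (@rV_cons R n) (@measurable_rV_cons R n)
   (lebesgue_measure \x vol n)%E setT f measurableT mf)//.
rewrite preimage_setT.
rewrite (fubini_tonelli1 (f \o (@rV_cons R n)))//.
  by apply: measurableT_comp => //; exact: measurable_rV_cons.
by move=> ?; exact: f0.
Qed.

Lemma measurable_rV_sub n :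
  measurable_fun setT (fun xy : 'rV[R]_n * 'rV[R]_n => xy.1 - xy.2 : 'rV[R]_n).
Proof.
apply: measurable_fun_rVP => i.
under eq_fun do rewrite !mxE.
by apply: measurable_funB;
  apply: (measurableT_comp (@measurable_coor _ R n i)).
Qed.

Lemma measurable_rV_add n :
  measurable_fun setT (fun xy : 'rV[R]_n * 'rV[R]_n => xy.1 + xy.2 : 'rV[R]_n).
Proof.
apply: measurable_fun_rVP => i.
under eq_fun do rewrite !mxE.
by apply: measurable_funD;
  apply: (measurableT_comp (@measurable_coor _ R n i)).
Qed.

Lemma measurable_rV_reflection n (c : 'rV[R]_n) :
  measurable_fun setT (fun x : 'rV[R]_n => c - x : 'rV[R]_n).
Proof.
apply: measurable_fun_rVP => i.
under eq_fun do rewrite !mxE.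
by apply: measurable_funB => //; exact: measurable_coor.
Qed.

Lemma measurable_rV_translation n (c : 'rV[R]_n) :
  measurable_fun setT (fun x : 'rV[R]_n => x + c : 'rV[R]_n).
Proof.
apply: measurable_fun_rVP => i.
under eq_fun do rewrite !mxE.
by apply: measurable_funD => //; exact: measurable_coor.
Qed.

Lemma ge0_integral_reflection n (c : 'rV[R]_n) (f : 'rV[R]_n -> \bar R) :
  measurable_fun setT f -> (forall x, 0 <= f x)%E ->
  (\int[vol n]_x f (c - x)%R = \int[vol n]_x f x)%E.
Proof.
elim: n => [|n IH] in c f *.
  by move=> mf f0; apply: eq_integral => x _; rewrite [(c - x)%R]thinmx0 [x]thinmx0.
move=> mf f0.
rewrite [RHS]ge0_integral_rVS// ge0_integral_rVS//; last first.
  by apply: measurableT_comp => //; exact: measurable_rV_reflection.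
have mc x : measurable_fun setT (fun y : 'rV[R]_n => f (rV_cons (x, y))).
  apply: (measurableT_comp mf); apply: (measurableT_comp (@measurable_rV_cons R n)) => //.
pose g x : \bar R := (\int[vol n]_y f (rV_cons (x, y)))%E.
rewrite -(@ge0_integral_reflection1 R (c 0 0) g); last 2 first.
- apply: (@measurable_fun_fubini_tonelli_F _ _ _ _ R (vol n) (fun z => f (rV_cons z))).
    by apply: measurableT_comp => //; exact: measurable_rV_cons.
  by move=> z; exact: f0.
- by move=> x; exact: integral_ge0.
apply: eq_integral => x _ /=.
rewrite /g -(IH (\row_i c 0 (lift ord0 i)) (fun y => f (rV_cons (c 0 0 - x, y))))//.
apply: eq_integral => y _; congr f; apply/rowP => i; rewrite /rV_cons !mxE.
by case: unliftP => [j|] -> /=; rewrite ?mxE.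
Qed.

Lemma ge0_integral_translation n (c : 'rV[R]_n) (f : 'rV[R]_n -> \bar R) :
  measurable_fun setT f -> (forall x, 0 <= f x)%E ->
  (\int[vol n]_x f (x + c)%R = \int[vol n]_x f x)%E.
Proof.
move=> mf f0; rewrite -[RHS](ge0_integral_reflection c)//.
rewrite -[RHS](ge0_integral_reflection 0); last by move=> ?.
  by apply: eq_integral => x _; congr f; rewrite sub0r opprK addrC.
by apply: measurableT_comp => //; exact: measurable_rV_reflection.
Qed.

Lemma integral_translation n (c : 'rV[R]_n) (f : 'rV[R]_n -> R) :
  measurable_fun setT f ->
  \int[vol n]_x f (x + c) = \int[vol n]_x f x.
Proof.
move=> mf; rewrite /Rintegral; congr fine.
rewrite [LHS]integralE [RHS]integralE.
congr (_ - _)%E.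
- rewrite -[RHS](ge0_integral_translation c); last by move=> ?; exact: funepos_ge0.
    by apply: eq_integral => x _; rewrite ?funeposE ?funenegE.
  exact/measurable_funepos/measurable_EFinP.
- rewrite -[RHS](ge0_integral_translation c); last by move=> ?; exact: funeneg_ge0.
    by apply: eq_integral => x _; rewrite ?funeposE ?funenegE.
  exact/measurable_funeneg/measurable_EFinP.
Qed.

Lemma open_measurable_rV n (U : set 'rV[R]_n) : open U -> measurable U.
Proof.
move=> oU.
pose box (p : 'rV[rat]_n * rat) : set 'rV[R]_n :=
  [set x : 'rV[R]_n | forall i, `|ratr (p.1 0 i) - x 0 i| < ratr p.2].
have mbox p : measurable (box p).
  rewrite (_ : box p = \bigcap_(i in [set: 'I_n])
     ((fun x : 'rV[R]_n => x 0 i) @^-1` [set y | `|ratr (p.1 0 i) - y| < ratr p.2])); last first.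
    by apply/seteqP; split => x /= h i; [move=> _; exact: h|exact: h].
  apply: fin_bigcap_measurable => // i _.
  rewrite -[X in measurable X]setTI; apply: measurable_coor => //.
  rewrite (_ : [set _ | _] = ball (ratr (p.1 0 i) : R) (ratr p.2 : R)) //.
  exact: measurable_ball.
pose I := {p : 'rV[rat]_n * rat | `[< box p `<=` U >]}.
rewrite (_ : U = \bigcup_(i : I) box (val i)); last first.
  apply/seteqP; split => [x Ux|x [i _ bx]]; last first.
    by move: bx; apply: (asboolP _ (valP i)).
  have [e /= e0 be] := (nbhs_ballP _ _).1 (open_nbhs_nbhs (conj oU Ux)).
  have e2 : 0 < e / 2 by lra.
  have [r] := rat_in_itvoo e2.
  rewrite in_itv/= => /andP[r0 re].
  have /choice[p hp] : forall i : 'I_n, exists p : rat, `|ratr p - x 0 i| < ratr r.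
    move=> i; have [p] := @rat_in_itvoo R (x 0 i) (x 0 i + ratr r) ltac:(lra).
    rewrite in_itv/= => /andP[p0 p1]; exists p; rewrite gtr0_norm; lra.
  pose z : 'rV[rat]_n * rat := (\row_i p i, r).
  have hz : box z `<=` U.
    move=> y hy; apply: be; split => // i j; rewrite !ord1 /ball/=.
    have := hy j; have := hp j; rewrite /= mxE !ltr_norml; lra.
  exists (exist _ z (asboolT hz)) => // i; rewrite /= mxE; exact: hp.
by apply: countable_bigcupT_measurable => //; exact: countableP.
Qed.

Lemma continuous_measurable_rV n (f : 'rV[R]_n -> R) :
  continuous f -> measurable_fun setT f.
Proof.
move=> cf; apply: (measurability _ (RGenOpens.measurableE R)).
move=> _ [_ [a [b ->] <-]]; rewrite setTI; apply: open_measurable_rV.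
by move/continuousP : cf; apply; exact: interval_open.
Qed.

End rV_integral.

(** * Continuity of real functions *)

Section continuity.
Context {R : realType} {T : topologicalType}.
Implicit Types f g : T -> R.

Lemma cont_cst (c : R) : continuous (fun _ : T => c).
Proof. by move=> x; exact: cvg_cst. Qed.

Lemma contD f g : continuous f -> continuous g -> continuous (fun x => f x + g x).
Proof. by move=> cf cg x; apply: cvgD; [exact: cf|exact: cg]. Qed.

Lemma contB f g : continuous f -> continuous g -> continuous (fun x => f x - g x).
Proof. by move=> cf cg x; apply: cvgB; [exact: cf|exact: cg]. Qed.

Lemma contM f g : continuous f -> continuous g -> continuous (fun x => f x * g x).
Proof. by move=> cf cg x; apply: cvgM; [exact: cf|exact: cg]. Qed.

Lemma cont_comp (U : topologicalType) (h : R -> U) f :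
  continuous h -> continuous f -> continuous (fun x => h (f x)).
Proof. by move=> ch cf x; apply: continuous_comp; [exact: cf|exact: ch]. Qed.

Lemma cont_sum (I : Type) (r : seq I) (f : I -> T -> R) :
  (forall i, continuous (f i)) -> continuous (fun x => \sum_(i <- r) f i x).
Proof.
move=> cf; elim: r => [|i r IH].
  by under eq_fun do rewrite big_nil; exact: cont_cst.
by under eq_fun do rewrite big_cons; exact: contD.
Qed.

End continuity.

(** * Gaussian integrals *)

Section posdef.
Context {R : realType}.
Local Notation vol n := (@lebesgue_rV R n).

Definition qform n (M : 'M[R]_n) (x : 'rV[R]_n) : R := (x *m (M *m x^T)) 0 0.

Definition posdef n (M : 'M[R]_n) : Prop :=
  M^T = M /\ forall x : 'rV[R]_n, x != 0 -> 0 < qform M x.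

Lemma qformE n (M : 'M[R]_n) x :
  qform M x = \sum_i \sum_j M i j * (x 0 i * x 0 j).
Proof.
rewrite /qform mxE; apply: eq_bigr => i _; rewrite mxE mulr_sumr.
by apply: eq_bigr => j _; rewrite !mxE; ring.
Qed.

Lemma continuous_coord n (i : 'I_n) : continuous (fun x : 'rV[R]_n => x 0 i).
Proof. exact: coord_continuous. Qed.

Lemma continuous_qform n (M : 'M[R]_n) : continuous (qform M).
Proof.
rewrite (_ : qform M = fun x => \sum_i \sum_j M i j * (x 0 i * x 0 j)); last first.
  by apply/funext => x; exact: qformE.
apply: (@cont_sum R 'rV[R]_n) => i; apply: (@cont_sum R 'rV[R]_n) => j.
by apply: (@contM R 'rV[R]_n); [exact: cont_cst|apply: (@contM R 'rV[R]_n); exact: continuous_coord].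
Qed.

Lemma qform_ge0 n (M : 'M[R]_n) x : posdef M -> 0 <= qform M x.
Proof.
move=> [_ M0]; have [->|/M0/ltW//] := eqVneq x 0.
by rewrite /qform mul0mx mxE.
Qed.

(* Cauchy-Schwarz for the bilinear form of M. *)
Lemma qform_CS n (M : 'M[R]_n) (x y : 'rV[R]_n) : posdef M ->
  ((x *m (M *m y^T)) 0 0) ^+ 2 <= qform M x * qform M y.
Proof.
move=> Mp; have [->|y0] := eqVneq y 0.
  by rewrite /qform trmx0 !mulmx0 !mxE expr0n mulr0.
have qy := Mp.2 y y0; set b := (x *m (M *m y^T)) 0 0.
have sb : (y *m (M *m x^T)) 0 0 = b.
  transitivity ((y *m (M *m x^T))^T 0 0); first by rewrite [RHS]mxE.
  by rewrite !trmx_mul trmxK Mp.1 -mulmxA.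
have := qform_ge0 (x - (b / qform M y) *: y) Mp.
have -> : qform M (x - (b / qform M y) *: y) =
    qform M x - (b / qform M y) * b *+ 2 + (b / qform M y) ^+ 2 * qform M y.
  set k := b / qform M y; rewrite {1}/qform.
  have -> : (x - k *: y) *m (M *m (x - k *: y)^T) = x *m (M *m x^T)
     - k *: (x *m (M *m y^T)) - (k *: (y *m (M *m x^T)) - (k * k) *: (y *m (M *m y^T))).
    have -> : (x - k *: y)^T = x^T - k *: y^T by rewrite raddfB/= linearZ.
    by rewrite mulmxBr mulmxBl !mulmxBr -!scalemxAr -!scalemxAl ?scalerA.
  have e (A B C D : 'M[R]_1) : (A - k *: B - (k *: C - (k * k) *: D)) 0 0 =
     A 0 0 - k * B 0 0 - (k * C 0 0 - k * k * D 0 0) by rewrite !mxE.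
  by rewrite e sb -/b -!/(qform _ _); ring.
move=> h; have := mulr_ge0 h (ltW qy).
rewrite (_ : (_ + _) * qform M y = qform M x * qform M y - b ^+ 2); first lra.
by field; lra.
Qed.

Lemma posdefD n (A B : 'M[R]_n) : posdef A -> posdef B -> posdef (A + B).
Proof.
move=> [sA pA] [sB pB]; split=> [|x x0]; first by rewrite linearD/= sA sB.
by rewrite /qform mulmxDl mulmxDr mxE addr_gt0//; [exact: pA|exact: pB].
Qed.

Lemma posdefZ n c (A : 'M[R]_n) : 0 < c -> posdef A -> posdef (c *: A).
Proof.
move=> c0 [sA pA]; split=> [|x x0]; first by rewrite linearZ/= sA.
by rewrite /qform -scalemxAl -scalemxAr mxE mulr_gt0//; exact: pA.
Qed.

Lemma posdef_unit n (A : 'M[R]_n) : posdef A -> A \in unitmx.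
Proof.
move=> [sA pA]; rewrite -row_free_unit; apply/row_freeP.
apply/row_freeP; rewrite -kermx_eq0; apply/negPn/negP => /rowV0Pn[x].
rewrite sub_kermx => /eqP xA x0; have := pA x x0.
by rewrite /qform mulmxA xA mul0mx mxE ltxx.
Qed.

Lemma posdef_inv n (A : 'M[R]_n) : posdef A -> posdef (invmx A).
Proof.
move=> Ap; have uA := posdef_unit Ap; split; first by rewrite trmx_inv Ap.1.
move=> x x0; have := Ap.2 (x *m invmx A).
have -> : qform A (x *m invmx A) = qform (invmx A) x.
  by rewrite /qform trmx_mul trmx_inv Ap.1 (mulmxA A) mulmxV// mul1mx -mulmxA.
apply; apply: contraNneq x0 => h; apply/eqP.
by rewrite -[x]mulmx1 -(mulVmx uA) mulmxA h mul0mx.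
Qed.

Lemma measurable_shifted_square (c m b : R) :
  measurable_fun setT (fun t : R => c * (m * (t + b) ^+ 2)).
Proof.
apply: continuous_measurable_fun; apply: contM; first exact: cont_cst.
apply: contM; first exact: cont_cst.
under eq_fun do rewrite expr2.
by apply: contM; (apply: contD; [move=> ?; exact: cvg_id|exact: cont_cst]).
Qed.

Lemma integral_gauss1 (m b : R) : 0 < m ->
  (\int[lebesgue_measure]_t (expR (- 4^-1 * (m * (t + b) ^+ 2)))%:E =
   (Num.sqrt (4 * pi / m))%:E)%E.
Proof.
move=> m0; pose s : R := Num.sqrt (2 / m).
have s2 : s ^+ 2 = 2 / m by rewrite sqr_sqrtr// divr_ge0// ltW.
have s0 : s != 0 by rewrite gt_eqF// sqrtr_gt0 divr_gt0.
have := @integral_normal_pdf R (- b) s.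
have E t : normal_pdf (- b) s t =
    (Num.sqrt (4 * pi / m))^-1 * expR (- 4^-1 * (m * (t + b) ^+ 2)).
  rewrite normal_pdfE// /normal_peak /normal_fun s2.
  congr (_ ^-1 * expR _); first by congr Num.sqrt; rewrite -mulr_natr; field; lra.
  by rewrite opprK; field; lra.
under eq_integral do rewrite E EFinM.
have c0 : 0 < Num.sqrt (4 * pi / m) by rewrite sqrtr_gt0 divr_gt0// mulr_gt0// pi_gt0.
rewrite ge0_integralZl//; last first.
  apply/measurable_EFinP; apply: measurableT_comp => //.
  exact: measurable_shifted_square.
move: c0; set c := Num.sqrt _ => c0 h; rewrite -[LHS]mul1e.
have k : (c%:E * c^-1%:E)%E = 1%E :> \bar R by rewrite -EFinM divff// gt_eqF.
by rewrite -k -muleA h mule1.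
Qed.

Lemma rV_consE n t (y : 'rV[R]_n) :
  rV_cons (t, y) = row_mx (t%:M : 'M[R]_1) y :> 'rV[R]_(1 + n).
Proof.
apply/rowP => i; rewrite mxE; case: (unliftP ord0 i) => [j|] -> /=.
  rewrite (_ : lift ord0 j = rshift 1 j); first by rewrite row_mxEr.
  exact: val_inj.
transitivity (row_mx (t%:M : 'M[R]_1) y 0 (lshift n ord0)).
  by rewrite row_mxEl mxE mulr1n.
by congr (row_mx _ _ _ _); exact: val_inj.
Qed.

(* Completing the square in the first coordinate; S is the Schur complement. *)
Lemma posdef_schur n (M : 'M[R]_n.+1) : posdef M ->
  exists m (c : 'cV[R]_n) (S : 'M[R]_n),
  [/\ 0 < m, posdef S, \det M = m * \det S &
   forall t y, qform M (rV_cons (t, y)) = m * (t + (y *m c) 0 0) ^+ 2 + qform S y].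
Proof.
move=> Mp; pose M' : 'M[R]_(1 + n) := M.
pose m := M 0 0; pose r := ursubmx M'; pose c := m^-1 *: r^T.
have m0 : 0 < m.
  have := Mp.2 (delta_mx 0 0); rewrite (_ : qform _ _ = m).
    by apply; apply/eqP => /matrixP/(_ 0 0)/eqP; rewrite !mxE/= oner_eq0.
  by rewrite /qform trmx_delta -colE -rowE !mxE.
pose S := drsubmx M' - m *: (c *m c^T).
pose L : 'M[R]_(1 + n) := block_mx 1%:M 0 c 1%:M.
pose D : 'M[R]_(1 + n) := block_mx m%:M 0 0 S.
have ME : M' = L *m D *m L^T.
  rewrite /L /D tr_block_mx !mulmx_block !trmx0 !trmx1 !(mul1mx, mulmx1, mul0mx, mulmx0, addr0, add0r).
  rewrite -[M']submxK; congr block_mx.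
  - by rewrite [LHS]mx11_scalar; congr (_%:M); rewrite !mxE; congr (M _ _); exact: val_inj.
  - by rewrite mul_scalar_mx /c linearZ/= trmxK scalerA divff ?scale1r// gt_eqF.
  - rewrite mul_mx_scalar /c scalerA divff ?scale1r ?gt_eqF// /r trmx_ursub.
    by congr dlsubmx; rewrite /M' Mp.1.
  - by rewrite mul_mx_scalar -scalemxAl /S addrC subrK.
have qE t y : qform M (rV_cons (t, y)) = m * (t + (y *m c) 0 0) ^+ 2 + qform S y.
  rewrite rV_consE /qform.
  transitivity ((row_mx t%:M y *m (M' *m (row_mx t%:M y)^T)) 0 0); first by [].
  rewrite ME (_ : row_mx t%:M y *m (L *m D *m L^T *m (row_mx t%:M y)^T) =
     (row_mx t%:M y *m L) *m (D *m (row_mx t%:M y *m L)^T)); last first.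
    by rewrite trmx_mul !mulmxA.
  have -> : row_mx t%:M y *m L = row_mx (t + (y *m c) 0 0)%:M y.
    rewrite /L mul_row_block !(mulmx1, mulmx0, add0r); congr row_mx.
    by rewrite raddfD/= -mx11_scalar.
  rewrite tr_row_mx /D mul_block_col !mul0mx addr0 add0r mul_row_col mxE; congr (_ + _).
  by rewrite tr_scalar_mx -!scalar_mxM mxE mulr1n expr2; ring.
exists m, c, S; split => //.
- split => [|y y0].
    rewrite /S linearB/= linearZ/= trmx_mul trmxK; congr (_ - _).
    by rewrite trmx_drsub; congr drsubmx; rewrite /M' Mp.1.
  have := Mp.2 (rV_cons (- (y *m c) 0 0, y)); rewrite qE addNr expr0n mulr0 add0r; apply.
  apply: contraNneq y0 => /rowP h; apply/eqP/rowP => j.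
  by have := h (lift ord0 j); rewrite /rV_cons !mxE liftK.
- transitivity (\det M'); first by [].
  rewrite ME !det_mulmx det_tr /L det_lblock /D det_ublock !det1 !mul1r mulr1.
  by rewrite det_scalar1.
Qed.

Lemma measurable_gauss n (M : 'M[R]_n) :
  measurable_fun setT (fun x : 'rV[R]_n => expR (- 4^-1 * qform M x)).
Proof.
apply: continuous_measurable_rV.
apply: (@cont_comp R 'rV[R]_n); first exact: continuous_expR.
by apply: (@contM R 'rV[R]_n); [exact: cont_cst|exact: continuous_qform].
Qed.

Theorem integral_gauss n (M : 'M[R]_n) : posdef M ->
  0 < \det M /\
  (\int[vol n]_x (expR (- 4^-1 * qform M x))%:E =
   (Num.sqrt ((4 * pi) ^+ n / \det M))%:E)%E.
Proof.
elim: n M => [|n IH] M Mp.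
  rewrite det_mx00 expr0 divr1 sqrtr1; split => //.
  rewrite integral_dirac//; last first.
    by apply/measurable_EFinP; exact: measurable_gauss.
  by rewrite diracT mul1e /qform mul0mx mxE mulr0 expR0.
have [m [c [S [m0 Sp dM qE]]]] := posdef_schur Mp.
have [dS iS] := IH _ Sp.
have pi4 : 0 < 4 * pi :> R by rewrite mulr_gt0// pi_gt0.
split; first by rewrite dM mulr_gt0.
have mg : measurable_fun setT (fun z => (expR (- 4^-1 * qform M (@rV_cons R n z)))%:E).
  apply/measurable_EFinP; apply: (measurableT_comp (measurable_gauss M)).
  exact: measurable_rV_cons.
rewrite ge0_integral_rVS//; last first.
  by apply/measurable_EFinP; exact: measurable_gauss.
rewrite (@fubini_tonelli _ _ _ _ R lebesgue_measure (vol n)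
  (fun z => (expR (- 4^-1 * qform M (@rV_cons R n z)))%:E) mg)/=; last by move=> z; rewrite lee_fin expR_ge0.
under eq_integral => y _.
  under eq_integral do rewrite qE mulrDr expRD EFinM.
  rewrite ge0_integralZr//; last first.
    apply/measurable_EFinP; apply: measurableT_comp => //.
    exact: measurable_shifted_square.
  rewrite integral_gauss1//.
  over.
rewrite ge0_integralZl//; last first.
  by apply/measurable_EFinP; exact: measurable_gauss.
rewrite iS -EFinM -sqrtrM ?divr_ge0 ?ltW//; congr ((Num.sqrt _)%:E).
by rewrite dM exprS; field; rewrite !gt_eqF.
Qed.

End posdef.

(** * The spaces L^q *)

Section Lq_theory.
Context {R : realType} {n : nat} {q : R} (q1 : (1 <= q%:E)%E).
Local Notation vol := (@lebesgue_rV R n).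
Local Notation L := (Lq n q1).
Implicit Types (f g : 'rV[R]_n -> R) (u v : L).

Definition Lfn (v : L) : 'rV[R]_n -> R := Lspace_repr v.
Definition Lcls f : L := Lspace_class vol q1 f.

Lemma q_gt0 : 0 < q. Proof. by rewrite (lt_le_trans ltr01). Qed.
Lemma q_neq0 : q != 0. Proof. by rewrite gt_eqF// q_gt0. Qed.
Hint Resolve q_gt0 q_neq0 : core.

Lemma ler_powq (x y : R) : 0 <= x -> 0 <= y -> (x `^ q <= y `^ q) = (x <= y).
Proof.
move=> x0 y0; apply/idP/idP => [|xy]; last first.
  by apply: ge0_ler_powR; rewrite ?nnegrE// ltW.
apply: contraTT; rewrite -!ltNge => yx.
by apply: gt0_ltr_powR; rewrite ?nnegrE.
Qed.

Lemma measurable_Lfn v : measurable_fun setT (Lfn v).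
Proof. exact: measurable_funPT. Qed.

Lemma measurable_powq f : measurable_fun setT f ->
  measurable_fun setT (fun x => (`|f x| `^ q)%:E).
Proof.
move=> mf; apply/measurable_EFinP.
by apply: (@measurableT_comp _ _ _ _ _ _ (@powR R ^~ q)) => //; exact: measurableT_comp.
Qed.

Lemma Lnorm_powq f : ('N[vol]_q%:E[EFin \o f] `^ q = \int[vol]_x (`|f x| `^ q)%:E)%E.
Proof. by rewrite powR_Lnorm//; apply: eq_integral => x _. Qed.

Lemma Lfun_powq f : measurable_fun setT f ->
  (\int[vol]_x (`|f x| `^ q)%:E < +oo)%E -> f \in Lfun vol q%:E.
Proof.
move=> mf fq; rewrite inE; apply/andP; split; rewrite inE//=.
rewrite /finite_norm unlock /Lnorm; apply: poweR_lty.
exact: fq.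
Qed.

Lemma Lfun_measurable f : f \in Lfun vol q%:E -> measurable_fun setT f.
Proof. by rewrite inE => /andP[]; rewrite inE. Qed.

Lemma Lcls_ae f : f \in Lfun vol q%:E -> Lfn (Lcls f) = f %[ae vol].
Proof.
move=> fL; rewrite /Lfn /Lcls /Lspace_class.
have := Lspace_ofK (insubd (0 : LfunType vol q1) f).
by apply: filterS => x h _; rewrite h// /insubd insubT.
Qed.

Lemma Lcls_Lfn v : Lcls (Lfn v) = v.
Proof.
apply: Lspace_ae_inj; apply: Lcls_ae.
exact: LfunP.
Qed.

Lemma Lfn_in v : Lfn v \in Lfun vol q%:E. Proof. exact: LfunP. Qed.

Lemma Lq_eq u v : Lfn u = Lfn v %[ae vol] -> u = v.
Proof. exact: Lspace_ae_inj. Qed.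

Lemma normLqE v : (`|v| `^ q)%:E = (\int[vol]_x (`|Lfn v x| `^ q)%:E)%E.
Proof.
rewrite -Lnorm_powq -poweR_EFin; congr (_ `^ q)%E.
rewrite [`|v|](_ : _ = fine ('N[vol]_q%:E[EFin \o Lfn v])%E)//.
by rewrite finite_norm_fine.
Qed.

Lemma norm_Lcls f : f \in Lfun vol q%:E ->
  (`|Lcls f| `^ q)%:E = (\int[vol]_x (`|f x| `^ q)%:E)%E.
Proof.
move=> fL; rewrite normLqE; apply: ae_eq_integral => //.
- by apply: measurable_powq; exact: measurable_Lfn.
- by apply: measurable_powq; exact: Lfun_measurable.
- by have := Lcls_ae fL; apply: filterS => x h /h ->.
Qed.

Lemma norm_Lcls_le f (C : R) : 0 <= C -> measurable_fun setT f ->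
  (\int[vol]_x (`|f x| `^ q)%:E <= (C `^ q)%:E)%E ->
  f \in Lfun vol q%:E /\ `|Lcls f| <= C.
Proof.
move=> C0 mf fC; have fL : f \in Lfun vol q%:E.
  by apply: Lfun_powq => //; apply: le_lt_trans fC _; rewrite ltry.
split => //; move: fC; rewrite -norm_Lcls// lee_fin.
by rewrite ler_powq.
Qed.

Lemma LfnD u v : Lfn (u + v) = (fun x => Lfn u x + Lfn v x) %[ae vol].
Proof.
have := Lspace_ofK (Lspace_repr u + Lspace_repr v).
by apply: filterS => x h _; rewrite /Lfn [_ + _]/(Lspace_add u v) h.
Qed.

Lemma LfnZ c v : Lfn (c *: v) = (fun x => c * Lfn v x) %[ae vol].
Proof.
have := Lspace_ofK (c *: Lspace_repr v).
by apply: filterS => x h _; rewrite /Lfn [_ *: _]/(Lspace_scale c v) h.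
Qed.

Lemma LfunD f g : f \in Lfun vol q%:E -> g \in Lfun vol q%:E ->
  (fun x => f x + g x) \in Lfun vol q%:E.
Proof. by move=> fL gL; apply: ((Lfun_addr_closed vol q1).2 f g). Qed.

Lemma LfunZ c f : f \in Lfun vol q%:E -> (fun x => c * f x) \in Lfun vol q%:E.
Proof.
move=> fL; have := (Lfun_submod_closed vol q1).2 c f 0 fL (Lfun_submod_closed vol q1).1.
by rewrite addr0.
Qed.

Lemma LclsD f g : f \in Lfun vol q%:E -> g \in Lfun vol q%:E ->
  Lcls (fun x => f x + g x) = Lcls f + Lcls g.
Proof.
move=> fL gL; apply: Lq_eq.
have fg : {ae vol, forall x, Lfn (Lcls f) x = f x /\ Lfn (Lcls g) x = g x}.
  move: (Lcls_ae fL) (Lcls_ae gL).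
  by apply: filterS2 => x h1 h2; split; [exact: h1|exact: h2].
move: fg (Lcls_ae (LfunD fL gL)) (LfnD (Lcls f) (Lcls g)).
by apply: filterS3 => x [h2 h3] h1 h4 xT; rewrite h1// h4//= h2// h3.
Qed.

Lemma LclsZ c f : f \in Lfun vol q%:E -> Lcls (fun x => c * f x) = c *: Lcls f.
Proof.
move=> fL; apply: Lq_eq.
move: (Lcls_ae (LfunZ c fL)) (Lcls_ae fL) (LfnZ c (Lcls f)).
by apply: filterS3 => x h1 h2 h3 xT; rewrite h1// h3//= h2.
Qed.

Lemma LclsB f g : f \in Lfun vol q%:E -> g \in Lfun vol q%:E ->
  Lcls (fun x => f x - g x) = Lcls f - Lcls g.
Proof.
move=> fL gL; rewrite -scaleN1r -LclsZ// -LclsD//; last exact: LfunZ.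
by congr Lcls; apply/funext => x; rewrite mulN1r.
Qed.

Lemma LfunB f g : f \in Lfun vol q%:E -> g \in Lfun vol q%:E ->
  (fun x => f x - g x) \in Lfun vol q%:E.
Proof.
by move=> fL gL; apply: ((Lfun_addr_closed vol q1).2 f (- g)) => //; exact: Lfun_oppr_closed.
Qed.

Lemma Lfun_dominated f g : measurable_fun setT f -> g \in Lfun vol q%:E ->
  (forall x, `|f x| <= g x) -> f \in Lfun vol q%:E.
Proof.
move=> mf gL fg; apply: Lfun_powq => //.
apply: (@le_lt_trans _ _ (\int[vol]_x (`|g x| `^ q)%:E)%E); last first.
  by rewrite -norm_Lcls// ltry.
apply: ge0_le_integral => //; [exact: measurable_powq| |].
  by apply: measurable_powq; exact: Lfun_measurable.
by move=> x _; rewrite lee_fin ler_powq// (le_trans (fg x))// ler_norm.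
Qed.

Lemma Lcls_dominated (f_ : nat -> 'rV[R]_n -> R) f g :
  (forall k, measurable_fun setT (f_ k)) -> measurable_fun setT f ->
  g \in Lfun vol q%:E -> (forall k x, `|f_ k x| <= g x) ->
  (forall x, f_ k x @[k --> \oo] --> f x) ->
  Lcls (f_ k) @[k --> \oo] --> Lcls f.
Proof.
move=> mf_ mf gL fg f_f.
have fgl x : `|f x| <= g x.
  have h : `|f_ k x| @[k --> \oo] --> `|f x| by apply: cvg_norm; exact: f_f.
  by apply: (ler_cvg_to h (cvg_cst (g x))); apply: nearW => k; exact: fg.
have f_L k : f_ k \in Lfun vol q%:E by exact: (Lfun_dominated (mf_ k) gL (fg k)).
have fL : f \in Lfun vol q%:E by exact: Lfun_dominated gL fgl.
have dL k : (fun x => f_ k x - f x) \in Lfun vol q%:E by exact: LfunB.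
pose F k x := (`|f_ k x - f x| `^ q)%:E.
have : (\int[vol]_x F k x)%E @[k --> \oo] --> (\int[vol]_x (cst 0%E x))%E.
  have g2L := LfunZ 2 gL.
  have := @dominated_convergence _ _ _ vol setT measurableT F (cst 0%E)
    (fun x => (`|2 * g x| `^ q)%:E).
  case => //.
  - by move=> k; apply: measurable_powq; exact: measurable_funB.
  - apply: aeW => x _; apply/fine_cvgP; split; first by apply: nearW.
    apply/cvgrPdist_le => e e0 /=.
    near=> k; rewrite sub0r normrN ger0_norm ?powR_ge0//.
    have fk : `|f_ k x - f x| <= Num.min 1 e.
      rewrite distrC; near: k; move/cvgrPdist_le : (f_f x); apply.
      by rewrite lt_min ltr01.
    move: fk; rewrite le_min => /andP[fk1 fke].
    have [->|] := eqVneq `|f_ k x - f x| 0; first by rewrite powR0// ltW.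
    rewrite -normr_gt0 normr_id => d0; apply: le_trans fke.
    by apply: ge1r_powR => //; rewrite d0.
  - apply/integrableP; split; first by apply: measurable_powq; exact: Lfun_measurable.
    rewrite (_ : (fun _ => _) = fun x => (`|2 * g x| `^ q)%:E).
      by rewrite -norm_Lcls// ltry.
    by apply/funext => x /=; rewrite ger0_norm// powR_ge0.
  - apply: aeW => x k _; rewrite /F gee0_abs ?lee_fin ?powR_ge0// ler_powq//.
    rewrite (le_trans (ler_normB _ _))// [leRHS]ger0_norm; last first.
      by rewrite mulr_ge0// (le_trans _ (fg 0%N x)).
    by rewrite mulr2n mulrDl mul1r lerD.
rewrite integral0 => /fine_cvgP[_ /cvgrPdist_lt F0].
apply/cvgrPdist_lt => e e0; have eq0 : 0 < e `^ q by exact: powR_gt0.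
have := F0 _ eq0; apply: filterS => k /=.
rewrite sub0r normrN -norm_Lcls//= ger0_norm ?powR_ge0// LclsB// => h.
by rewrite distrC ltNge -ler_powq ?(ltW e0)// -ltNge.
Unshelve. all: by end_near. Qed.

(** Weights against which every element of L^q can be integrated, uniformly
    with respect to translations. *)
Definition weight (C D : R) (phi : 'rV[R]_n -> R) :=
  [/\ measurable_fun setT phi, forall x, `|phi x| <= C &
     (\int[vol]_x `|phi x|%:E <= D%:E)%E].

Definition Lpair v phi := \int[vol]_x (Lfn v x * phi x).

Lemma weight_ge0 C D phi : weight C D phi -> 0 <= C /\ 0 <= D.
Proof.
move=> [_ hC hD]; split; first exact: le_trans (normr_ge0 _) (hC 0).
by rewrite -lee_fin; apply: le_trans hD; exact: integral_ge0.
Qed.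

Lemma weight_translation C D phi z : weight C D phi -> weight C D (fun x => phi (x + z)).
Proof.
move=> [mphi hC hD]; split.
- by apply: measurableT_comp => //; exact: measurable_rV_translation.
- by move=> x; exact: hC.
- rewrite (ge0_integral_translation z (f := fun x => `|phi x|%:E))//.
  by apply/measurable_EFinP; exact: measurableT_comp.
Qed.

(* |v| <= s (1 + (|v|/s)^q), which makes the mass of |v phi| controlled by
   those of |phi| and |v|^q without passing through the dual exponent. *)
Lemma weight_bound C D phi v s : weight C D phi -> 0 < s -> `|v| <= s ->
  (\int[vol]_x `|Lfn v x * phi x|%:E <= (s * (C + D))%:E)%E.
Proof.
move=> w s0 vs; have [C0 D0] := weight_ge0 w; have [mphi hC hD] := w.
have mv := measurable_Lfn v.
have mabs : measurable_fun setT (fun x => `|phi x|%:E).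
  by apply/measurable_EFinP; exact: measurableT_comp.
have mp := measurable_powq mv.
apply: (@le_trans _ _ (\int[vol]_x (s%:E * `|phi x|%:E + (s * C / s `^ q)%:E * (`|Lfn v x| `^ q)%:E))%E).
  apply: ge0_le_integral => //.
  - by apply/measurable_EFinP; apply: measurableT_comp => //; exact: measurable_funM.
  - by apply: emeasurable_funD; apply: measurable_funeM.
  - move=> x _; rewrite -!EFinM -EFinD lee_fin normrM.
    have key : `|Lfn v x| <= s + s / s `^ q * `|Lfn v x| `^ q.
      have [vx|vx] := leP `|Lfn v x| s.
        by rewrite (le_trans vx)// lerDl mulr_ge0 ?divr_ge0 ?powR_ge0// ltW.
      rewrite (@le_trans _ _ (s / s `^ q * `|Lfn v x| `^ q))//; last by rewrite lerDr ltW.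
      have -> : s / s `^ q * `|Lfn v x| `^ q = s * (`|Lfn v x| / s) `^ q.
        rewrite powRM ?invr_ge0 ?(ltW s0)//.
        have -> : s^-1 `^ q = (s `^ q)^-1.
          by rewrite -(@powR_inv1 _ s (ltW s0)) powRAC powR_inv1 ?powR_ge0.
        by ring.
      rewrite mulrC -ler_pdivrMr//; apply: le1r_powR => //.
      by rewrite ler_pdivlMr// mul1r ltW.
    rewrite (le_trans (ler_wpM2r (normr_ge0 _) key))// mulrDl lerD2l.
    rewrite -!mulrA ler_wpM2l ?(ltW s0)// [leRHS]mulrCA ler_wpM2l ?invr_ge0 ?powR_ge0//.
    by rewrite [leRHS]mulrC ler_wpM2l ?powR_ge0.
rewrite ge0_integralD//; last 4 first.
- by move=> x _; rewrite mule_ge0// lee_fin ltW.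
- exact: measurable_funeM.
- by move=> x _; rewrite mule_ge0// lee_fin ?powR_ge0// divr_ge0 ?powR_ge0// mulr_ge0// ltW.
- exact: measurable_funeM.
rewrite ge0_integralZl//; last by rewrite lee_fin ltW.
rewrite ge0_integralZl//; last by rewrite lee_fin divr_ge0 ?powR_ge0// mulr_ge0// ltW.
rewrite -normLqE mulrDr EFinD addeC leeD//.
  rewrite -EFinM lee_fin mulrAC -mulrA ler_piMr ?mulr_ge0 ?(ltW s0)//.
  by rewrite ler_pdivrMr ?powR_gt0// mul1r ler_powq// ltW.
by rewrite EFinM lee_pmul2l.
Qed.

Lemma weight_integrable C D phi v : weight C D phi ->
  vol.-integrable setT (EFin \o (fun x => Lfn v x * phi x)).
Proof.
move=> w; have [mphi hC hD] := w.
apply/integrableP; split.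
  by apply/measurable_EFinP; apply: measurable_funM => //; exact: measurable_Lfn.
have s0 : 0 < `|v| + 1 by rewrite ltr_wpDl.
apply: le_lt_trans (weight_bound w s0 _) _; first by rewrite lerDl.
by rewrite ltry.
Qed.

Lemma Lpair_le C D phi v s : weight C D phi -> 0 < s -> `|v| <= s ->
  `|Lpair v phi| <= s * (C + D).
Proof.
move=> w s0 vs; have iw := weight_integrable v w.
rewrite -lee_fin /Lpair EFin_normr_Rintegral//.
apply: le_trans (weight_bound w s0 vs).
exact: (le_abse_integral vol measurableT (measurable_int vol iw)).
Qed.

Lemma Lpair_bound C D phi v : weight C D phi -> `|Lpair v phi| <= `|v| * (C + D).
Proof.
move=> w; apply/ler_addgt0Pr => e e0; have [C0 D0] := weight_ge0 w.
have CD : 0 < C + D + 1 by rewrite ltr_wpDl// addr_ge0.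
have s0 : 0 < `|v| + e / (C + D + 1) by rewrite ltr_wpDl// divr_gt0.
apply: (le_trans (Lpair_le w s0 _)); first by rewrite lerDl divr_ge0// ltW.
rewrite mulrDl lerD2l mulrAC ler_pdivrMr// ler_pM2l//; lra.
Qed.

Lemma LpairD C D phi u v : weight C D phi -> Lpair (u + v) phi = Lpair u phi + Lpair v phi.
Proof.
move=> w; have [mphi _ _] := w; rewrite /Lpair -RintegralD//; last 2 first.
- exact: weight_integrable w.
- exact: weight_integrable w.
congr fine; apply: ae_eq_integral => //.
- by apply/measurable_EFinP; apply: measurable_funM => //; exact: measurable_Lfn.
- by apply/measurable_EFinP; apply: measurable_funD; apply: measurable_funM => //; exact: measurable_Lfn.
- by have := LfnD u v; apply: filterS => x h _; rewrite h//= mulrDl.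
Qed.

Lemma LpairZ C D phi c v : weight C D phi -> Lpair (c *: v) phi = c * Lpair v phi.
Proof.
move=> w; have [mphi _ _] := w; rewrite /Lpair -RintegralZl//; last exact: weight_integrable w.
congr fine; apply: ae_eq_integral => //.
- by apply/measurable_EFinP; apply: measurable_funM => //; exact: measurable_Lfn.
- apply/measurable_EFinP; apply: measurable_funM; first exact: measurable_cst.
  by apply: measurable_funM => //; exact: measurable_Lfn.
- by have := LfnZ c v; apply: filterS => x h _; rewrite h//= mulrA.
Qed.

Lemma LpairB C D phi u v : weight C D phi -> Lpair (u - v) phi = Lpair u phi - Lpair v phi.
Proof. by move=> w; rewrite (LpairD _ _ w) -scaleN1r (LpairZ _ _ w) mulN1r. Qed.

Lemma Lpair_Lcls f phi : f \in Lfun vol q%:E -> measurable_fun setT phi ->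
  Lpair (Lcls f) phi = \int[vol]_x (f x * phi x).
Proof.
move=> fL mphi; congr fine; apply: ae_eq_integral => //.
- by apply/measurable_EFinP; apply: measurable_funM => //; exact: measurable_Lfn.
- by apply/measurable_EFinP; apply: measurable_funM => //; exact: Lfun_measurable.
- by have := Lcls_ae fL; apply: filterS => x h _; rewrite h.
Qed.

End Lq_theory.

(** * Convolution on L^q *)

Section hoelder_weighted.
Context d (T : measurableType d) (R : realType) (mu : {measure set T -> \bar R}).

Lemma ge0_le_poweR (r : R) (x y : \bar R) : 0 <= r -> (0 <= x)%E -> (x <= y)%E ->
  (x `^ r <= y `^ r)%E.
Proof.
move=> r0 x0 xy; apply: gt0_ler_poweR => //.
  by rewrite in_itv/= x0 leey.
by rewrite in_itv/= (le_trans x0 xy) leey.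
Qed.

(* Jensen's inequality for the measure h mu. *)
Lemma jensen_powR (q K : R) (h g : T -> R) : 1 <= q -> 0 <= K ->
  measurable_fun setT h -> measurable_fun setT g ->
  (forall x, 0 <= h x) -> (forall x, 0 <= g x) ->
  (\int[mu]_x (h x)%:E <= K%:E)%E ->
  ((\int[mu]_x (h x * g x)%:E) `^ q <=
    (K `^ (q - 1))%:E * \int[mu]_x (h x * g x `^ q)%:E)%E.
Proof.
move=> q1 K0 mh mg h0 g0 hK.
have mpow (f : T -> R) r : measurable_fun setT f -> measurable_fun setT (fun x => f x `^ r).
  by move=> mf; apply: (@measurableT_comp _ _ _ _ _ _ (@powR R ^~ r)).
move: q1; rewrite le_eqVlt => /predU1P[<-|q1].
  rewrite subrr powRr0 mul1e poweRe1; last by apply: integral_ge0 => x _; rewrite lee_fin mulr_ge0.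
  by apply: ge0_le_integral => //;
    [by move=> x _; rewrite lee_fin mulr_ge0
    |by apply/measurable_EFinP; exact: measurable_funM
    |by apply/measurable_EFinP; apply: measurable_funM => //; exact: mpow
    |by move=> x _; rewrite powRr1].
have q0 : 0 < q by lra.
have qn0 : q != 0 by rewrite gt_eqF.
pose q' := q / (q - 1); have q'0 : 0 < q' by rewrite divr_gt0// subr_gt0.
have q'n0 : q' != 0 by rewrite gt_eqF.
have q1n : q - 1 != 0 by rewrite subr_eq0 gt_eqF.
have conj : q'^-1 + q^-1 = 1 by rewrite /q'; field; rewrite qn0 q1n.
pose f1 x := h x `^ q'^-1; pose g1 := (fun x => h x `^ q^-1) \* g.
have := @hoelder _ _ _ mu f1 g1 _ _ (mpow h q'^-1 mh) (measurable_funM (mpow h q^-1 mh) mg) q'0 q0 conj.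
rewrite Lnorm1.
have -> : (\int[mu]_x `|(EFin \o (f1 \* g1)%R) x|)%E =
   (\int[mu]_x (h x * g x)%:E)%E.
  apply: eq_integral => x _ /=; rewrite mulrA -powRD; last by rewrite conj oner_eq0.
  by rewrite conj powRr1// ger0_norm// mulr_ge0.
rewrite unlock /Lnorm.
have -> : (\int[mu]_x (`|(EFin \o f1) x| `^ q'))%E = (\int[mu]_x (h x)%:E)%E.
  apply: eq_integral => x _ /=.
  by rewrite ger0_norm ?powR_ge0// -powRrM mulVf// powRr1.
have -> : (\int[mu]_x (`|(EFin \o g1) x| `^ q))%E = (\int[mu]_x (h x * g x `^ q)%:E)%E.
  apply: eq_integral => x _ /=.
  by rewrite ger0_norm ?mulr_ge0 ?powR_ge0// powRM ?powR_ge0// -powRrM mulVf// powRr1.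
set X := (\int[mu]_x (h x * g x `^ q)%:E)%E => hh.
have X0 : (0 <= X)%E by apply: integral_ge0 => x _; rewrite lee_fin mulr_ge0 ?powR_ge0.
have hq : ((\int[mu]_x (h x * g x)%:E) `^ q <=
    (((\int[mu]_x (h x)%:E) `^ q'^-1 * X `^ q^-1)) `^ q)%E.
  apply: ge0_le_poweR => //; first exact: ltW.
  by apply: integral_ge0 => x _; rewrite lee_fin mulr_ge0.
apply: (le_trans hq); rewrite poweRM ?poweR_ge0// -!poweRrM mulVf// poweRe1//.
apply: lee_wpmul2r => //; rewrite (_ : q'^-1 * q = q - 1); last by rewrite /q'; field; rewrite qn0 q1n.
rewrite -poweR_EFin; apply: ge0_le_poweR => //; first by rewrite subr_ge0 ltW.
by apply: integral_ge0 => x _; rewrite lee_fin.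
Qed.

End hoelder_weighted.

Section convolution.
Context {R : realType} {n : nat} {q : R} (q1 : (1 <= q%:E)%E).
Local Notation vol := (@lebesgue_rV R n).
Local Notation L := (Lq n q1).
Implicit Types (k f g phi : 'rV[R]_n -> R) (u v : L).

Definition L1 (K : R) k := measurable_fun setT k /\ (\int[vol]_x `|k x|%:E <= K%:E)%E.

Lemma L1_ge0 K k : L1 K k -> 0 <= K.
Proof. by move=> [_ kK]; rewrite -lee_fin; apply: le_trans kK; exact: integral_ge0. Qed.

Lemma L1_integrable K k : L1 K k -> vol.-integrable setT (EFin \o k).
Proof.
move=> [mk kK]; apply/integrableP; split; first exact/measurable_EFinP.
by apply: le_lt_trans kK _; rewrite ltry.
Qed.

Lemma measurable_convolution_integrand k f : measurable_fun setT k -> measurable_fun setT f ->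
  measurable_fun setT (fun xy : 'rV[R]_n * 'rV[R]_n => k (xy.1 - xy.2) * f xy.2).
Proof.
move=> mk mf; apply: measurable_funM.
  by apply: measurableT_comp => //; exact: measurable_rV_sub.
by apply: measurableT_comp => //; exact: measurable_snd.
Qed.

Lemma measurable_convolution k f : measurable_fun setT k -> measurable_fun setT f ->
  measurable_fun setT (convolution k f).
Proof.
move=> mk mf; have mkf := measurable_convolution_integrand mk mf.
pose F (xy : 'rV[R]_n * 'rV[R]_n) : \bar R := (k (xy.1 - xy.2) * f xy.2)%:E.
have mF : measurable_fun setT F by exact/measurable_EFinP.
rewrite (_ : convolution k f = fun x => fine (\int[vol]_y F^\+ (x, y) - \int[vol]_y F^\- (x, y))%E).
  apply: measurableT_comp => //.
  apply: emeasurable_funB.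
    by apply: measurable_fun_fubini_tonelli_F => [|z]; [exact: measurable_funepos|exact: funepos_ge0].
  by apply: measurable_fun_fubini_tonelli_F => [|z]; [exact: measurable_funeneg|exact: funeneg_ge0].
apply/funext => x; rewrite /convolution /Rintegral integralE.
by congr (fine (_ - _)); apply: eq_integral => y _; rewrite ?funeposE ?funenegE.
Qed.

Lemma L1_reflection K k x : L1 K k -> (\int[vol]_y `|k (x - y)|%:E <= K%:E)%E.
Proof.
move=> [mk kK]; rewrite (ge0_integral_reflection x (f := fun y => `|k y|%:E))//.
by apply/measurable_EFinP; exact: measurableT_comp.
Qed.

Lemma young_ereal K k v : L1 K k ->
  (\int[vol]_x ((\int[vol]_y (`|k (x - y)| * `|Lfn v y|)%:E) `^ q) <=
    ((K * `|v|) `^ q)%:E)%E.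
Proof.
move=> kL; have [mk kK] := kL; have K0 := L1_ge0 kL.
have mv := measurable_Lfn v.
have q1' : 1 <= q by [].
have mnk : measurable_fun setT (fun x => `|k x|) by exact: measurableT_comp.
have mnv : measurable_fun setT (fun x => `|Lfn v x|) by exact: measurableT_comp.
have mvq : measurable_fun setT (fun x => `|Lfn v x| `^ q).
  by apply: (@measurableT_comp _ _ _ _ _ _ (@powR R ^~ q)).
have mI := measurable_convolution_integrand mnk mnv.
have mIq := measurable_convolution_integrand mnk mvq.
apply: (@le_trans _ _ (\int[vol]_x ((K `^ (q - 1))%:E * \int[vol]_y (`|k (x - y)| * `|Lfn v y| `^ q)%:E))%E).
  apply: ge0_le_integral => //.
  - by move=> x _; exact: poweR_ge0.
  - apply: (@measurableT_comp _ _ _ _ _ _ (fun x => poweR x q)); first exact: measurable_poweR.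
    apply: (@measurable_fun_fubini_tonelli_F _ _ _ _ R vol
       (fun z : 'rV[R]_n * 'rV[R]_n => (`|k (z.1 - z.2)| * `|Lfn v z.2|)%:E)) => //.
    exact/measurable_EFinP.
  - apply: measurable_funeM.
    apply: (@measurable_fun_fubini_tonelli_F _ _ _ _ R vol
       (fun z : 'rV[R]_n * 'rV[R]_n => (`|k (z.1 - z.2)| * `|Lfn v z.2| `^ q)%:E)) => //.
    exact/measurable_EFinP.
  - move=> x _; apply: jensen_powR => //; last exact: (L1_reflection x kL).
    exact: (measurableT_comp mnk (measurable_rV_reflection x)).
have mF : measurable_fun setT (fun x : 'rV[R]_n => (\int[vol]_y (`|k (x - y)| * `|Lfn v y| `^ q)%:E)%E).
  apply: (@measurable_fun_fubini_tonelli_F _ _ _ _ R vol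
       (fun z : 'rV[R]_n * 'rV[R]_n => (`|k (z.1 - z.2)| * `|Lfn v z.2| `^ q)%:E)) => //.
  exact/measurable_EFinP.
have F0 x : (0 <= \int[vol]_y (`|k (x - y)| * `|Lfn v y| `^ q)%:E)%E.
  by apply: integral_ge0 => y _; rewrite lee_fin mulr_ge0 ?powR_ge0.
rewrite ge0_integralZl//.
pose G (z : 'rV[R]_n * 'rV[R]_n) := (`|k (z.1 - z.2)| * `|Lfn v z.2| `^ q)%:E.
have mG : measurable_fun setT G by exact/measurable_EFinP.
have G0 z : (0 <= G z)%E by rewrite lee_fin mulr_ge0 ?powR_ge0.
have -> : (\int[vol]_x \int[vol]_y (`|k (x - y)| * `|Lfn v y| `^ q)%:E)%E =
  (\int[vol]_y \int[vol]_x (`|k (x - y)| * `|Lfn v y| `^ q)%:E)%E.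
  by apply: (@fubini_tonelli _ _ _ _ R vol vol G).
have step : (\int[vol]_y \int[vol]_x (`|k (x - y)| * `|Lfn v y| `^ q)%:E <= K%:E * (`|v| `^ q)%:E)%E.
  rewrite normLqE -ge0_integralZl//; last exact/measurable_EFinP.
  have mGG := @measurable_fun_fubini_tonelli_G _ _ _ _ R vol G mG G0.
  have GG0 y : (0 <= fubini_G vol G y)%E by exact: integral_ge0.
  have mvq' : measurable_fun setT (fun x : 'rV[R]_n => (K%:E * (`|Lfn v x| `^ q)%:E)%E).
    by apply: measurable_funeM; exact/measurable_EFinP.
  apply: (@ge0_le_integral _ _ _ vol setT measurableT (fubini_G vol G)) => //.
  move=> y _; rewrite /fubini_G /G/=; under eq_integral do rewrite EFinM.
  rewrite ge0_integralZr//; last first.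
    by apply/measurable_EFinP; exact: (measurableT_comp mnk (measurable_rV_translation (- y))).
  apply: lee_wpmul2r; first by rewrite lee_fin powR_ge0.
  rewrite (ge0_integral_translation (- y) (f := fun x => `|k x|%:E))//.
  exact/measurable_EFinP.
apply: (le_trans (lee_wpmul2l _ step)); first by rewrite lee_fin powR_ge0.
rewrite muleA -!EFinM lee_fin powRM// ler_wpM2r ?powR_ge0//.
by rewrite mulrC mulr_powRB1// q_gt0.
by rewrite lee_fin powR_ge0.
Qed.

(** Young's inequality. *)
Lemma young K k v : L1 K k ->
  convolution k (Lfn v) \in Lfun vol q%:E /\
  `|Lcls q1 (convolution k (Lfn v))| <= K * `|v|.
Proof.
move=> kL; have K0 := L1_ge0 kL; have mv := measurable_Lfn v.
have mc := measurable_convolution kL.1 mv; have mk := kL.1.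
have mnk : measurable_fun setT (fun x => `|k x|) by exact: measurableT_comp.
have mnv : measurable_fun setT (fun x => `|Lfn v x|) by exact: measurableT_comp.
apply: norm_Lcls_le => //; first by rewrite mulr_ge0.
apply: le_trans (young_ereal v kL); apply: ge0_le_integral => //.
- exact: measurable_powq.
- apply: (@measurableT_comp _ _ _ _ _ _ (fun x => poweR x q)); first exact: measurable_poweR.
  apply: (@measurable_fun_fubini_tonelli_F _ _ _ _ R vol
       (fun z : 'rV[R]_n * 'rV[R]_n => (`|k (z.1 - z.2)| * `|Lfn v z.2|)%:E)) => //.
  by apply/measurable_EFinP; exact: (measurable_convolution_integrand mnk mnv).
move=> x _; rewrite -poweR_EFin; apply: ge0_le_poweR => //; first by rewrite ltW// (q_gt0 q1).
rewrite /convolution /Rintegral.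
set I := (X in fine X).
apply: (@le_trans _ _ `|I|%E); first by case: I => //=; rewrite normr0 leey.
rewrite /I; under [leRHS]eq_integral do rewrite -normrM -abse_EFin.
apply: le_abse_integral => //; apply/measurable_EFinP; apply: measurable_funM => //.
exact: (measurableT_comp kL.1 (measurable_rV_reflection x)).
Qed.

Definition Lconv k v : L := Lcls q1 (convolution k (Lfn v)).

Lemma conv_norm K k v : L1 K k -> `|Lconv k v| <= K * `|v|.
Proof. by move=> kL; exact: (young v kL).2. Qed.

Let conv_pair k phi v (z : 'rV[R]_n * 'rV[R]_n) : \bar R :=
  (k z.1 * (Lfn v z.2 * phi (z.2 + z.1)))%:E.

Let integrable_conv_pair_prod K k C D phi v : L1 K k -> weight C D phi ->
  (vol \x vol)%E.-integrable setT (conv_pair k phi v).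
Proof.
move=> kL w; have [mk kK] := kL; have [mphi hC hD] := w.
have mv := measurable_Lfn v.
have K0 := L1_ge0 kL; have [C0 D0] := weight_ge0 w.
pose F2 := conv_pair k phi v.
have m2 : measurable_fun setT F2.
  apply/measurable_EFinP; apply: measurable_funM.
    by apply: (measurableT_comp mk); exact: measurable_fst.
  apply: measurable_funM; first by apply: (measurableT_comp mv); exact: measurable_snd.
  have msw : measurable_fun setT (fun z : 'rV[R]_n * 'rV[R]_n => z.2 + z.1 : 'rV[R]_n).
    by rewrite (_ : (fun z => _) = fun z => z.1 + z.2);
      [exact: measurable_rV_add|apply/funext => z; rewrite addrC].
  exact: (measurableT_comp mphi msw).
have s0 : 0 < `|v| + 1 by rewrite ltr_wpDl.
have b2 z : (\int[vol]_y `|F2 (z, y)| <= `|k z|%:E * ((`|v| + 1) * (C + D))%:E)%E.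
  have -> : (\int[vol]_y `|F2 (z, y)|)%E =
      (`|k z|%:E * \int[vol]_y `|Lfn v y * phi (y + z)|%:E)%E.
    rewrite -ge0_integralZl//; last first.
      apply/measurable_EFinP; apply: measurableT_comp => //; apply: measurable_funM => //.
      exact: (measurableT_comp mphi (measurable_rV_translation z)).
    by apply: eq_integral => y _; rewrite /F2/= normrM EFinM.
  apply: lee_wpmul2l => //.
  by apply: (weight_bound (weight_translation z w)) => //; rewrite lerDl.
apply/integrable12ltyP => //.
have mnk : measurable_fun setT (fun x => `|k x|%:E).
  by apply/measurable_EFinP; exact: measurableT_comp.
apply: (@le_lt_trans _ _ (\int[vol]_z (`|k z|%:E * ((`|v| + 1) * (C + D))%:E))%E).
  apply: ge0_le_integral => //.
  - by move=> x _; exact: integral_ge0.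
  - apply: (@measurable_fun_fubini_tonelli_F _ _ _ _ R vol (abse \o F2)).
      exact: measurableT_comp.
    by move=> z; exact: abse_ge0.
  - by under eq_fun do rewrite -EFinM; apply/measurable_EFinP; apply: measurable_funM => //; exact: measurableT_comp.
rewrite ge0_integralZr//; last by rewrite lee_fin mulr_ge0 ?addr_ge0.
by apply: (@le_lt_trans _ _ (K%:E * ((`|v| + 1) * (C + D))%:E)%E);
  [rewrite lee_wpmul2r// lee_fin mulr_ge0 ?addr_ge0|rewrite -EFinM ltry].
Qed.

Lemma integrable_conv_pair K k C D phi v : L1 K k -> weight C D phi ->
  vol.-integrable setT (EFin \o (fun z => k z * Lpair v (fun x => phi (x + z)))).
Proof.
move=> kL w; have i2 := integrable_conv_pair_prod v kL w.
have := integrable_fubini_F i2; apply: eq_integrable => // z _.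
symmetry; rewrite /fubini_F /conv_pair/= EFinM /Lpair /Rintegral.
have iw := weight_integrable v (weight_translation z w).
under [RHS]eq_integral do rewrite EFinM.
rewrite integralZl//; congr (_ * _)%E.
by rewrite fineK//; exact: integrable_fin_num iw.
Qed.

Lemma weight_L1 K k C D phi y : L1 K k -> weight C D phi ->
  vol.-integrable setT (EFin \o (fun z => k z * phi (y + z))).
Proof.
move=> kL [mphi hC hD]; have [mk kK] := kL.
have mphiy : measurable_fun setT (fun z : 'rV[R]_n => phi (y + z)).
  rewrite (_ : (fun z => _) = fun z : 'rV[R]_n => phi (z + y)); last by apply/funext => z; rewrite addrC.
  exact: (measurableT_comp mphi (measurable_rV_translation y)).
have C0 : 0 <= C := le_trans (normr_ge0 _) (hC 0).
have := integrableZl measurableT C (L1_integrable kL); apply: le_integrable => //.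
  by apply/measurable_EFinP; exact: measurable_funM.
move=> z _ /=; rewrite lee_fin !normrM mulrC ler_wpM2r// (le_trans (hC _))//.
exact: ler_norm.
Qed.

Let conv_pair_swapE K k C D phi v y : L1 K k -> weight C D phi ->
  (\int[vol]_z conv_pair k phi v (z, y) =
   (Lfn v y * \int[vol]_z (k z * phi (y + z)))%:E)%E.
Proof.
move=> kL w; have iy := weight_L1 y kL w.
rewrite /conv_pair/= EFinM /Rintegral fineK; last exact: integrable_fin_num iy.
rewrite -integralZl//; apply: eq_integral => z _.
by rewrite -EFinM; congr EFin; ring.
Qed.

Lemma integrable_conv_swap K k C D phi v : L1 K k -> weight C D phi ->
  vol.-integrable setT (EFin \o (fun y => Lfn v y * \int[vol]_z (k z * phi (y + z)))).
Proof.
move=> kL w; have i2 := integrable_conv_pair_prod v kL w.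
have m2 : measurable_fun setT (conv_pair k phi v) by exact: measurable_int i2.
have mG : measurable_fun setT (EFin \o (fun y => Lfn v y * \int[vol]_z (k z * phi (y + z)))).
  rewrite (_ : _ \o _ = fubini_G vol (conv_pair k phi v)).
    exact: measurable_fubini_G i2.
  by apply/funext => y; rewrite /fubini_G (conv_pair_swapE _ _ kL w).
apply/integrableP; split => //.
have := (integrable21ltyP vol vol m2).1 i2; apply: le_lt_trans.
apply: ge0_le_integral => //.
- exact: measurableT_comp.
- apply: (@measurable_fun_fubini_tonelli_G _ _ _ _ R vol (abse \o conv_pair k phi v)).
    exact: measurableT_comp.
  by move=> z; exact: abse_ge0.
move=> y _; apply: (@le_trans _ _ `|\int[vol]_z conv_pair k phi v (z, y)|%E).
  by rewrite (conv_pair_swapE _ _ kL w).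
apply: le_abse_integral => //.
exact: (measurableT_comp m2 (measurable_pair2 y)).
Qed.

Lemma Lpair_conv_swap K k C D phi v : L1 K k -> weight C D phi ->
  \int[vol]_z (k z * Lpair v (fun x => phi (x + z))) =
  \int[vol]_y (Lfn v y * \int[vol]_z (k z * phi (y + z))).
Proof.
move=> kL w; have i2 := integrable_conv_pair_prod v kL w; rewrite /Rintegral; apply: (congr1 fine).
transitivity (\int[vol]_z \int[vol]_y conv_pair k phi v (z, y))%E.
  apply: eq_integral => z _; rewrite /conv_pair/= EFinM /Lpair /Rintegral.
  have iw := weight_integrable v (weight_translation z w).
  under [RHS]eq_integral do rewrite EFinM.
  rewrite integralZl//; congr (_ * _)%E.
  by rewrite fineK//; exact: integrable_fin_num iw.
rewrite (Fubini i2); apply: eq_integral => y _.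
exact: (conv_pair_swapE _ _ kL w).
Qed.

(* The dual description of a convolution; since the elements of L^q are
   determined by their integrals against test functions, it replaces all almost
   everywhere manipulations. *)
Lemma Lpair_conv K k C D phi v : L1 K k -> weight C D phi ->
  Lpair (Lconv k v) phi = \int[vol]_z (k z * Lpair v (fun x => phi (x + z))).
Proof.
move=> kL w; have [mk kK] := kL; have [mphi hC hD] := w.
have mv := measurable_Lfn v.
have K0 := L1_ge0 kL; have [C0 D0] := weight_ge0 w.
pose F1 (z : 'rV[R]_n * 'rV[R]_n) : \bar R := (k (z.1 - z.2) * Lfn v z.2 * phi z.1)%:E.
pose F2 := conv_pair k phi v.
have m1 : measurable_fun setT F1.
  apply/measurable_EFinP; apply: measurable_funM.
    exact: measurable_convolution_integrand.
  by apply: (measurableT_comp mphi); exact: measurable_fst.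
have i2 := integrable_conv_pair_prod v kL w.
have m2 : measurable_fun setT F2 by exact: measurable_int i2.
have swap (y : 'rV[R]_n) (g : \bar R -> \bar R) : (forall x, 0 <= g x)%E -> measurable_fun setT g ->
    (\int[vol]_x g (F1 (x, y)) = \int[vol]_x g (F2 (x, y)))%E.
  move=> g0 mg.
  rewrite -(ge0_integral_translation y (f := fun x => g (F1 (x, y))))//; last first.
    apply: (measurableT_comp mg); apply/measurable_EFinP => /=.
    apply: measurable_funM => //; apply: measurable_funM; last exact: measurable_cst.
    exact: (measurableT_comp mk (measurable_rV_translation (- y))).
  apply: eq_integral => x _; congr g; rewrite /F1 /F2/= addrK [x + y]addrC.
  by congr EFin; ring.
have i1 : (vol \x vol)%E.-integrable setT F1.
  apply/integrable21ltyP => //.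
  have e : (\int[vol]_y \int[vol]_x `|F1 (x, y)| = \int[vol]_y \int[vol]_x `|F2 (x, y)|)%E.
    by apply: eq_integral => y _; apply: (swap y abse); [exact: abse_ge0|exact: abse_measurable].
  rewrite e; exact: (integrable21ltyP vol vol m2).1 i2.
have inner y : (\int[vol]_x F1 (x, y) = \int[vol]_x F2 (x, y))%E.
  rewrite integralE [RHS]integralE; congr (_ - _)%E.
    under eq_integral do rewrite funeposE; under [RHS]eq_integral do rewrite funeposE.
    apply: (swap y (fun e => maxe e 0%E)).
      by move=> x; rewrite le_max lexx orbT.
    by apply: measurable_maxe => //.
  under eq_integral do rewrite funenegE; under [RHS]eq_integral do rewrite funenegE.
  apply: (swap y (fun e => maxe (- e) 0)%E).
    by move=> x; rewrite le_max lexx orbT.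
  by apply: measurable_maxe => //; exact: measurableT_comp.
rewrite /Lconv Lpair_Lcls ?(young v kL).1//.
rewrite /Rintegral; congr fine.
have mF1 := measurable_fubini_F i1.
transitivity (\int[vol]_x fubini_F vol F1 x)%E.
  apply: ae_eq_integral => //.
  - apply/measurable_EFinP; apply: measurable_funM => //.
    exact: measurable_convolution.
  have := ae_integrable1 i1; apply: filterS => x h _.
  rewrite /fubini_F /F1/=; under eq_integral do rewrite EFinM.
  have [p0|p0] := eqVneq (phi x) 0.
    by rewrite p0 mulr0; under eq_integral do rewrite mule0; rewrite integral0.
  have ikv : vol.-integrable setT (fun y => (k (x - y) * Lfn v y)%:E).
    have := integrableZl measurableT (phi x)^-1 h.
    apply: eq_integrable => // y _; rewrite /F1/= -EFinM; congr EFin; field.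
    exact: p0.
  rewrite integralZr// EFinM; congr (_ * _)%E.
  by rewrite /convolution fineK//; exact: integrable_fin_num ikv.
transitivity (\int[vol]_y \int[vol]_x F1 (x, y))%E; first exact: (Fubini i1).
transitivity (\int[vol]_y \int[vol]_x F2 (x, y))%E.
  by apply: eq_integral => y _.
rewrite -(Fubini i2); apply: eq_integral => z _.
rewrite /F2 /conv_pair/= EFinM /Lpair.
have iw := weight_integrable v (weight_translation z w).
under eq_integral do rewrite EFinM.
rewrite integralZl//; congr (_ * _)%E.
by rewrite fineK//; exact: integrable_fin_num iw.
Qed.

End convolution.

(** * Completeness of L^q *)

Section completeness.
Context {R : realType} {n : nat} {q : R} (q1 : (1 <= q%:E)%E).
Local Notation vol := (@lebesgue_rV R n).
Local Notation L := (Lq n q1).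

Definition gauss1 (x : 'rV[R]_n) : R := expR (- 4^-1 * qform 1%:M x).

Lemma posdef1 : posdef (1%:M : 'M[R]_n).
Proof.
split=> [|x x0]; first exact: trmx1.
rewrite qformE lt_neqAle; apply/andP; split; last first.
  rewrite sumr_ge0// => i _; rewrite sumr_ge0// => j _; rewrite mxE.
  by case: eqVneq => [->|_]; rewrite ?mul1r ?mul0r// -expr2 sqr_ge0.
apply: contraNneq x0 => h; apply/eqP/rowP => i; rewrite [RHS]mxE.
have hx j : \sum_k (1%:M : 'M[R]_n) j k * (x 0 j * x 0 k) = x 0 j ^+ 2.
  rewrite (bigD1 j)//= mxE eqxx mul1r big1 ?addr0 ?expr2// => k kj.
  by rewrite mxE eq_sym (negbTE kj) mul0r.
move/esym : h; under eq_bigr do rewrite hx.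
move/eqP; rewrite psumr_eq0; last by move=> j _; exact: sqr_ge0.
by move/allP => /(_ i (mem_index_enum _)); rewrite /= sqrf_eq0 => /eqP.
Qed.

Lemma gauss1_weight : exists D, weight 1 D gauss1.
Proof.
exists (Num.sqrt ((4 * pi) ^+ n / \det (1%:M : 'M[R]_n))); split.
- exact: measurable_gauss.
- move=> x; rewrite ger0_norm ?expR_ge0// -expR0 ler_expR mulNr oppr_le0.
  by rewrite mulr_ge0// qform_ge0//; exact: posdef1.
- rewrite -(integral_gauss posdef1).2 le_eqVlt; apply/orP; left; apply/eqP.
  by apply: eq_integral => x _; rewrite ger0_norm// expR_ge0.
Qed.

Lemma cvg_powq (a : nat -> R) (l : R) : a k @[k --> \oo] --> l -> (forall k, 0 <= a k) ->
  a k `^ q @[k --> \oo] --> l `^ q.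
Proof.
move=> al a0.
have l0 : 0 <= l by apply: (cvgr_to_ge al); exact: nearW.
have q0 := q_gt0 q1.
move: l0; rewrite le_eqVlt => /predU1P[l0|l0].
  rewrite -l0 powR0 ?(q_neq0 q1)//; apply/cvgrPdist_le => e e0; near=> k.
  have ak : a k <= Num.min 1 e.
    have : `|l - a k| <= Num.min 1 e.
      by near: k; move/cvgrPdist_le : al; apply; rewrite lt_min ltr01.
    by rewrite -l0 sub0r normrN ger0_norm.
  move: ak; rewrite le_min => /andP[ak1 ake].
  rewrite sub0r normrN ger0_norm ?powR_ge0//.
  have [->|ak0] := eqVneq (a k) 0; first by rewrite powR0 ?(q_neq0 q1)// ltW.
  by apply: le_trans ake; apply: ge1r_powR => //; rewrite lt_neqAle eq_sym ak0 a0.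
have : expR (q * ln (a k)) @[k --> \oo] --> expR (q * ln l).
  apply: continuous_cvg; first exact: continuous_expR.
  apply: cvgM; first exact: cvg_cst.
  by apply: continuous_cvg => //; exact: continuous_ln.
rewrite [X in _ --> X](_ : _ = l `^ q); last by rewrite /powR gt_eqF.
apply: cvg_trans; apply: near_eq_cvg; near=> k.
rewrite /powR gt_eqF//; near: k.
by have := cvgr_gt _ al; apply.
Unshelve. all: by end_near. Qed.

Lemma limn_einf_le_cst (a : nat -> \bar R) c : (forall m, a m <= c)%E -> (limn_einf a <= c)%E.
Proof.
move=> ac; apply: le_trans (limn_einf_sup a) _; rewrite limn_esup_lim.
apply: lime_le; first exact: is_cvg_esups.
apply: nearW => k; apply: ge_ereal_sup => _ [m _ <-]; exact: ac.
Qed.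

Theorem Lq_complete (u : nat -> L) :
  (forall e : R, 0 < e -> exists N, forall i j, (N <= i)%N -> (N <= j)%N -> `|u i - u j| <= e) ->
  exists l : L, u k @[k --> \oo] --> l.
Proof.
move=> ucauchy; pose e (k : nat) : R := 1 / (2 ^ k.+1)%:R.
have e0 k : 0 < e k by rewrite divr_gt0// ltr0n expn_gt0.
have /choice[N hN] : forall k, exists N, forall i j, (N <= i)%N -> (N <= j)%N -> `|u i - u j| <= e k.
  by move=> k; exact: ucauchy.
pose M k := (\max_(i < k.+1) N i)%N.
have NM k m : (k <= m)%N -> (N k <= M m)%N.
  by rewrite -ltnS => km; apply: (@leq_bigmax _ (fun i : 'I_m.+1 => N i) (Ordinal km)).
pose w k := u (M k).
have hw k m : (k <= m)%N -> `|w m - w k| <= e k.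
  by move=> km; apply: hN; apply: NM.
pose d k := Lfn (w k.+1 - w k); pose f k := Lfn (w k).
have [D gw] := gauss1_weight.
have [mg _ _] := gw; have [_ D0] := weight_ge0 gw.
have g0 x : 0 < gauss1 x by rewrite expR_gt0.
have md k : measurable_fun setT (d k) by exact: measurable_Lfn.
pose T k x := `|d k x * gauss1 x|%:E.
have mT k : measurable_fun setT (T k).
  by apply/measurable_EFinP; apply: measurableT_comp => //; exact: measurable_funM.
have T0 k x : (0 <= T k x)%E by rewrite lee_fin normr_ge0.
have Tint : vol.-integrable setT (fun x => \sum_(k <oo) T k x)%E.
  apply/integrableP; split; first exact: ge0_emeasurable_sum.
  apply: (@le_lt_trans _ _ (\int[vol]_x (\sum_(k <oo) T k x))%E).
    rewrite le_eqVlt; apply/orP; left; apply/eqP; apply: eq_integral => x _.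
    by rewrite gee0_abs// nneseries_ge0.
  rewrite integral_nneseries//.
  apply: (@le_lt_trans _ _ (\sum_(k <oo) ((1 + D) / (2 ^ k.+1)%:R)%:E)%E).
    apply: lee_nneseries => [k _ _|k _]; first exact: integral_ge0.
    apply: le_trans (weight_bound gw (e0 k) (hw k k.+1 (leqnSn k))) _.
    by rewrite lee_fin /e mulrC mulrA mulr1.
  by apply: le_lt_trans (epsilon_trick0 _ _) _; rewrite ?ltry// addr_ge0.
have fd : {ae vol, forall x, forall k, f k.+1 x = f k x + d k x}.
  apply: ae_foralln => k.
  have := LfnD (w k.+1 - w k) (w k); rewrite subrK.
  by apply: filterS => x h; rewrite /f h// addrC.
pose F x := fine (limn_esup (fun k => (f k x)%:E)).
have mF : measurable_fun setT F.
  apply: measurableT_comp => //; apply: measurable_fun_limn_esup => k.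
  by apply/measurable_EFinP; exact: measurable_Lfn.
have fF : {ae vol, forall x, f k x @[k --> \oo] --> F x}.
  move: fd (integrable_ae measurableT Tint); apply: filterS2 => x hfd /(_ I) hT.
  suff cf : cvgn (f ^~ x).
    move/cvg_ex : cf => [l fl]; rewrite /F.
    have fl' : (f k x)%:E @[k --> \oo] --> l%:E.
      by apply/fine_cvgP; split; [exact: nearW|exact: fl].
    by rewrite (cvg_limn_einf_sup fl').2.
  pose S := fine (\sum_(k <oo) T k x)%E.
  have cd : cvgn (series (fun k => d k x)).
    apply: normed_cvg; apply: nondecreasing_is_cvgn.
      by apply: nondecreasing_series => k _ _ /=.
    exists (S / gauss1 x) => _ [m _ <-].
    rewrite /= /series/= ler_pdivlMr// mulr_suml -lee_fin /S fineK//.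
    apply: le_trans (nneseries_lim_ge m _); last by [].
    rewrite -sumEFin; apply: lee_sum => k _.
    by rewrite lee_fin normrM (ger0_norm (ltW (g0 x))).
  have fE k : f k x = f 0%N x + series (fun k => d k x) k.
    elim: k => [|k IH]; first by rewrite /series/= big_geq// addr0.
    by rewrite hfd IH -addrA /series/= big_nat_recr.
  rewrite (_ : f ^~ x = fun k => f 0%N x + series (fun k => d k x) k); last exact/funext.
  by apply: is_cvgD => //; exact: is_cvg_cst.
have key k : (\int[vol]_x (`|F x - f k x| `^ q)%:E <= (e k `^ q)%:E)%E.
  pose G m x := (`|f (m + k)%N x - f k x| `^ q)%:E.
  have mG m : measurable_fun setT (G m).
    by apply: measurable_powq; apply: measurable_funB; exact: measurable_Lfn.
  apply: (@le_trans _ _ (\int[vol]_x limn_einf (G ^~ x))%E).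
    rewrite le_eqVlt; apply/orP; left; apply/eqP; apply: ae_eq_integral => //.
    - by apply: measurable_powq; apply: measurable_funB => //; exact: measurable_Lfn.
    - rewrite (_ : (fun x => _) = fun x => (- limn_esup (fun m => - G m x))%E).
        apply: measurableT_comp => //; apply: measurable_fun_limn_esup => m.
        exact: measurableT_comp.
      by apply/funext => x; rewrite (limn_esupN (G ^~ x)) oppeK.
    move: fF; apply: filterS => x hx _; apply/esym.
    apply: (cvg_limn_einf_sup _).1.
    apply/fine_cvgP; split; first exact: nearW.
    rewrite /G/=.
    have c0 : `|f (m + k)%N x - f k x| @[m --> \oo] --> `|F x - f k x|.
      by apply: cvg_norm; apply: cvgB; [by move: hx; rewrite -(cvg_shiftn k)|exact: cvg_cst].
    by apply: cvg_powq.
  apply: le_trans (fatou vol measurableT mG _) _; first by move=> m x _; rewrite lee_fin powR_ge0.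
  apply: limn_einf_le_cst => m.
  have wq : `|w (m + k)%N - w k| `^ q <= e k `^ q by rewrite ler_powq ?(ltW (e0 k))// hw// leq_addl.
  apply: (@le_trans _ _ (`|w (m + k)%N - w k| `^ q)%:E); last by rewrite lee_fin.
  rewrite normLqE le_eqVlt; apply/orP; left; apply/eqP; apply: ae_eq_integral => //.
    by apply: measurable_powq; exact: measurable_Lfn.
  have := LfnD (w (m + k)%N - w k) (w k); rewrite subrK.
  by apply: filterS => x h _; rewrite /G /f h// addrK.
have mfk k : measurable_fun setT (f k) by exact: measurable_Lfn.
have mFf k : measurable_fun setT (fun x => F x - f k x) by exact: measurable_funB.
have fL k := norm_Lcls_le q1 (ltW (e0 k)) (mFf k) (key k).
have FL : F \in Lfun vol q%:E.
  rewrite (_ : F = fun x => (F x - f 0%N x) + f 0%N x); last by apply/funext => x; rewrite subrK.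
  by apply: (LfunD q1 (fL 0%N).1); exact: Lfn_in.
exists (Lcls q1 F); apply/cvgrPdist_le => eps eps0.
have e2 : 0 < eps / 2 by lra.
pose k := Num.bound (eps / 2)^-1.
have hk : e k <= eps / 2.
  have ei : 0 <= (eps / 2)^-1 by rewrite invr_ge0 ltW.
  rewrite /e div1r -[leRHS]invrK lef_pV2 ?posrE ?invr_gt0 ?ltr0n ?expn_gt0//.
  apply: le_trans (ltW (archi_boundP ei)) _; rewrite -/k ler_nat.
  by apply: (leq_trans (ltnW (ltn_expl k (ltnSn 1)))); rewrite leq_exp2l.
exists (N k) => // i /= ki.
rewrite (_ : Lcls q1 F - u i = (Lcls q1 F - w k) + (w k - u i)); last by rewrite addrA subrK.
apply: le_trans (ler_normD _ _) _.
have h1 : `|Lcls q1 F - w k| <= e k.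
  by rewrite -[w k]Lcls_Lfn -LclsB//; [exact: (fL k).2|exact: Lfn_in].
have h2 : `|w k - u i| <= e k by apply: hN => //; exact: NM.
lra.
Qed.

End completeness.

(** * Smooth functions *)

Section directional_derivatives.
Context {R : realType} {V W : normedModType R}.
Implicit Types (f : V -> W).

Lemma is_deriveE f a v d : is_derive a v f d <->
  h^-1 *: (f (h *: v + a) - f a) @[h --> (0 : R)^'] --> d.
Proof.
split => [[df <-]|fd]; first exact: df.
by split; [apply/cvg_ex; exists d|exact/cvg_lim].
Qed.

End directional_derivatives.

Section lines.
Context {R : realType} {V W : normedModType R}.
Implicit Types (f : V -> W).

Lemma is_derive_line f v (df : V -> W) x (s : R) :
  (forall y, is_derive y v f (df y)) ->
  is_derive s 1 (fun s => f (x + s *: v)) (df (x + s *: v)).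
Proof.
move=> hf; apply/is_deriveE; have /is_deriveE := hf (x + s *: v).
apply: cvg_trans; apply: near_eq_cvg; apply: nearW => h.
congr (_ *: (f _ - _)); rewrite [h *: 1]mulr1 scalerDl.
by rewrite addrCA addrA.
Qed.

Lemma is_derive_translation f v (df : V -> W) z :
  (forall y, is_derive y v f (df y)) ->
  forall x, is_derive x v (fun x => f (x + z)) (df (x + z)).
Proof.
move=> hf x; apply/is_deriveE; have /is_deriveE := hf (x + z).
apply: cvg_trans; apply: near_eq_cvg; apply: nearW => h.
by rewrite addrA.
Qed.

Lemma continuous_addr (z : V) : continuous (fun x : V => x + z).
Proof. by move=> x; apply: cvgD; [exact: cvg_id|exact: cvg_cst]. Qed.

End lines.

Section flat_functions.
Context {R : realType}.
Implicit Types (p : {poly R}) (x y : R).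

Definition flat p x : R := if 0 < x then p.[x^-1] * expR (- x^-1) else 0.

Lemma powexp_le (m : nat) y : 0 < y -> y ^+ m * expR (- y) <= m%:R ^+ m.
Proof.
move=> y0; case: m => [|m]; first by rewrite !expr0 mul1r expR_le1; lra.
have m0 : 0 < m.+1%:R :> R by rewrite ltr0n.
rewrite expRN ler_pdivrMr ?expR_gt0//.
rewrite -[X in expR X](@divfK _ m.+1%:R _ y) ?gt_eqF// expRM_natr -exprMn.
apply: lerXn2r; rewrite ?nnegrE ?mulr_ge0 ?expR_ge0 ?(ltW y0)//.
rewrite -ler_pdivrMl//; apply: le_trans (expR_ge1Dx _).
by rewrite mulrC lerDr.
Qed.

Lemma flat_bound p : exists C, forall x, 0 < x -> x <= 1 -> `|flat p x| <= C * x ^+ 2.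
Proof.
pose s := size p.
have [K hK] : exists K, forall y, 0 < y -> y ^+ s.+2 * expR (- y) <= K.
  by exists ((s.+2)%:R ^+ s.+2) => y y0; exact: powexp_le.
exists ((\sum_(i < s) `|p`_i|) * K) => x x0 x1.
have y1 : 1 <= x^-1 by rewrite invf_ge1.
have y0 : 0 < x^-1 by rewrite invr_gt0.
rewrite /flat x0 normrM [`|expR _|]ger0_norm ?expR_ge0//.
have hp : `|p.[x^-1]| <= (\sum_(i < s) `|p`_i|) * x^-1 ^+ s.
  rewrite horner_coef (le_trans (ler_norm_sum _ _ _))// mulr_suml.
  apply: ler_sum => i _; rewrite normrM ler_wpM2l// ger0_norm ?exprn_ge0 ?(ltW y0)//.
  by rewrite ler_weXn2l// ltnW.
apply: (le_trans (ler_wpM2r (expR_ge0 _) hp)).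
rewrite -!mulrA ler_wpM2l ?sumr_ge0//.
have -> : x^-1 ^+ s * expR (- x^-1) = x^-1 ^+ s.+2 * expR (- x^-1) * x ^+ 2.
  rewrite -addn2 exprD; move: (x^-1 ^+ s) (expR _) => a b.
  by field; rewrite gt_eqF.
by rewrite ler_wpM2r ?exprn_ge0 ?(ltW x0)//; exact: hK.
Qed.

Definition dflat p : {poly R} := 'X^2 * (p - p^`()).

Lemma is_derive_flat p x : is_derive x 1 (flat p) (flat (dflat p) x).
Proof.
have [x0|x0|x0] := ltgtP x 0.
- have -> : flat (dflat p) x = 0 by rewrite /flat ltNge ltW.
  apply: (@near_eq_is_derive _ _ _ (cst 0)).
  near=> y; have y0 : y < 0 by near: y; exact: lt_nbhsl.
  by rewrite /flat ltNge ltW.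
- have xn0 : x != 0 by rewrite gt_eqF.
  have -> : flat (dflat p) x = (dflat p).[x^-1] * expR (- x^-1) by rewrite /flat x0.
  apply: (@near_eq_is_derive _ _ _ (fun y => p.[y^-1] * expR (- y^-1))).
    near=> y; have y0 : 0 < y by near: y; exact: lt_nbhsr.
    by rewrite /flat y0.
  have dV : is_derive x 1 (fun y : R => y^-1) (- x ^- 2).
    have := @is_deriveV R (@id R) x 1 1 xn0 (is_derive_id _ _).
    by move=> h; apply: is_derive_eq h _; rewrite /GRing.scale/= mulr1.
  have dp : is_derive x 1 (fun y => p.[y^-1]) (p^`().[x^-1] * (- x ^- 2)).
    exact: (@is_derive1_comp R (horner p) (fun y : R => y^-1) x _ _ (is_derive_poly p _) dV).
  have de : is_derive x 1 (fun y : R => expR (- y^-1)) (expR (- x^-1) * x ^- 2).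
    have := @is_derive1_comp R expR (fun y : R => - y^-1) x _ _ (is_derive_expR _) (is_deriveN dV).
    by rewrite opprK.
  apply: is_derive_eq (is_deriveM dp de) _.
  rewrite /dflat hornerM hornerXn hornerD hornerN.
  rewrite /GRing.scale/= exprVn; ring.
- rewrite x0 [flat (dflat p) 0]/flat ltxx.
  apply/is_deriveE; have [C hC] := flat_bound p.
  rewrite [flat p 0]/flat ltxx.
  apply/cvgrPdist_le => e e0; near=> h.
  rewrite sub0r normrN subr0 addr0 [h *: 1]mulr1 /=.
  have [h0|h0] := ltP 0 h; last first.
    by rewrite /flat ltNge h0/= scaler0 normr0 ltW.
  have h1 : `|h| <= Num.min 1 (e / (`|C| + 1)).
    near: h; apply: dnbhs0_le.
    by rewrite lt_min ltr01 divr_gt0// ltr_wpDl.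
  move: h1; rewrite gtr0_norm// le_min => /andP[h1 h2].
  rewrite normrM ger0_norm ?invr_ge0 ?(ltW h0)// mulrC ler_pdivrMr//.
  apply: (le_trans (hC h h0 h1)).
  rewrite expr2 mulrA ler_wpM2r ?(ltW h0)//.
  move: h2; rewrite ler_pdivlMr ?ltr_wpDl// => /(le_trans _); apply.
  by rewrite mulrC ler_wpM2l ?(ltW h0)// (le_trans (ler_norm C))// lerDl.
Unshelve. all: by end_near. Qed.

Lemma continuous_flat p : continuous (flat p).
Proof.
move=> x; apply: differentiable_continuous; apply/derivable1_diffP.
by have [] := is_derive_flat p x.
Qed.

Lemma flat1_le1 x : 0 <= flat 1 x <= 1.
Proof.
rewrite /flat; case: ifPn => x0; last by rewrite lexx ler01.
by rewrite hornerC mul1r expR_ge0/= expR_le1 oppr_le0 invr_ge0 ltW.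
Qed.

Lemma flat1_cvg x : 0 < x -> flat 1 (k.+1%:R * x) @[k --> \oo] --> (1 : R).
Proof.
move=> x0.
rewrite (_ : (fun k : nat => _) = fun k : nat => expR (- (x^-1 * k.+1%:R^-1))); last first.
  apply/funext => k; rewrite /flat mulr_gt0 ?ltr0n// hornerC mul1r.
  by rewrite invfM mulrC.
rewrite -[X in _ --> X]expR0; apply: continuous_cvg; first exact: continuous_expR.
rewrite -[X in _ --> X]oppr0; apply: cvgN.
have h : x^-1 * (@harmonic R k) @[k --> \oo] --> x^-1 * 0.
  by apply: cvgM; [exact: cvg_cst|exact: cvg_harmonic].
by move: h; rewrite mulr0; exact.
Qed.

End flat_functions.

Section cdiff.
Context {R : realType} {n : nat}.
Implicit Types (f g phi psi : 'rV[R]_n -> R).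
Local Notation e_ i := (delta_mx 0 i : 'rV[R]_n).

Definition has_pderiv i f g := forall x, is_derive x (e_ i) f (g x).

Lemma pderivE i f g : has_pderiv i f g -> pderiv i f = g.
Proof. by move=> fg; apply/funext => x; have [_] := fg x. Qed.

Lemma has_pderivM i f df g dg : has_pderiv i f df -> has_pderiv i g dg ->
  has_pderiv i (fun x => f x * g x) (fun x => df x * g x + f x * dg x).
Proof.
move=> hf hg x; apply: is_derive_eq (is_deriveM (hf x) (hg x)) _.
by rewrite /GRing.scale/= addrC [g x * _]mulrC.
Qed.

Lemma has_pderivD i f df g dg : has_pderiv i f df -> has_pderiv i g dg ->
  has_pderiv i (fun x => f x + g x) (fun x => df x + dg x).
Proof. by move=> hf hg x; exact: is_deriveD. Qed.

Lemma has_pderiv_cst i (c : R) : has_pderiv i (fun _ => c) (fun _ => 0).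
Proof. by move=> x; exact: is_derive_cst. Qed.

Fixpoint cdiff (j : nat) f : Prop := continuous f /\
  if j is j'.+1 then forall i, exists2 g, has_pderiv i f g & cdiff j' g else True.

Lemma cdiffS j f : cdiff j.+1 f -> cdiff j f.
Proof.
elim: j f => [|j IH] f [cf hf]; first by split.
by split => // i; have [g fg /IH cg] := hf i; exists g.
Qed.

Lemma cdiff_cst j c : cdiff j (fun _ => c).
Proof.
elim: j c => [|j IH] c; first by split => //; exact: cont_cst.
by split=> [|i]; [exact: cont_cst|exists (fun _ => 0); [exact: has_pderiv_cst|exact: IH]].
Qed.

Lemma cdiffD j f g : cdiff j f -> cdiff j g -> cdiff j (fun x => f x + g x).
Proof.
elim: j f g => [|j IH] f g [cf hf] [cg hg].
  by split => //; exact: (contD cf cg).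
split=> [|i]; first exact: (contD cf cg).
have [df fdf cdf] := hf i; have [dg gdg cdg] := hg i.
by exists (fun x => df x + dg x); [exact: has_pderivD|exact: IH].
Qed.

Lemma cdiffM j f g : cdiff j f -> cdiff j g -> cdiff j (fun x => f x * g x).
Proof.
elim: j f g => [|j IH] f g [cf hf] [cg hg].
  by split => //; exact: (contM cf cg).
split=> [|i]; first exact: (contM cf cg).
have [df fdf cdf] := hf i; have [dg gdg cdg] := hg i.
exists (fun x => df x * g x + f x * dg x); first exact: has_pderivM.
apply: cdiffD; apply: IH => //; exact: cdiffS.
Qed.

Lemma cdiff_prod j (I : Type) (r : seq I) (F : I -> 'rV[R]_n -> R) :
  (forall i, cdiff j (F i)) -> cdiff j (fun x => \prod_(i <- r) F i x).
Proof.
move=> cF; elim: r => [|i r IH].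
  by under eq_fun do rewrite big_nil; exact: cdiff_cst.
by under eq_fun do rewrite big_cons; exact: cdiffM.
Qed.

Lemma has_pderiv_coord i k (g dg : R -> R) : (forall t : R, is_derive t 1 g (dg t)) ->
  has_pderiv k (fun x => g (x 0 i)) (fun x => (i == k)%:R * dg (x 0 i)).
Proof.
move=> hg x; have [<-|ik] := eqVneq i k; last first.
  rewrite mul0r; apply/is_deriveE; apply: (@cvg_trans _ ((fun _ : R => 0 : R) @ (0 : R)^')); last exact: cvg_cst.
  apply: near_eq_cvg; apply: nearW => h.
  by rewrite !mxE/= (negbTE ik) mulr0 add0r subrr scaler0.
rewrite mul1r; apply/is_deriveE; have /is_deriveE := hg (x 0 i).
apply: cvg_trans; apply: near_eq_cvg; apply: nearW => h.
by rewrite !mxE/= !eqxx mulr1 [h *: 1]mulr1.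
Qed.

Lemma cdiff_flat j i (p : {poly R}) (c d : R) :
  cdiff j (fun x => flat p (c * x 0 i + d)).
Proof.
have cont q : continuous (fun x : 'rV[R]_n => flat q (c * x 0 i + d)).
  apply: (@cont_comp R 'rV[R]_n R (flat q) (fun x => c * x 0 i + d)); first exact: continuous_flat.
  apply: (@contD R 'rV[R]_n); last exact: cont_cst.
  by apply: (@contM R 'rV[R]_n); [exact: cont_cst|exact: continuous_coord].
elim: j p => [|j IH] p; first by split => //; exact: cont.
split=> [|k]; first exact: cont.
exists (fun x => (i == k)%:R * (c * flat (dflat p) (c * x 0 i + d))).
  apply: (@has_pderiv_coord i k (fun t => flat p (c * t + d)) (fun t => c * flat (dflat p) (c * t + d))) => t.
  have dl : is_derive t 1 (fun t : R => c * t + d) c.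
    apply/is_deriveE; apply: (@cvg_trans _ ((fun _ : R => c) @ (0 : R)^')); last exact: cvg_cst.
    apply: near_eq_cvg; near=> h; rewrite [h *: 1]mulr1.
    have h0 : h != 0 by near: h; exact: nbhs_dnbhs_neq.
    by rewrite /GRing.scale/=; field.
  have := @is_derive1_comp R (flat p) (fun t => c * t + d) t _ _ (is_derive_flat p _) dl.
  by rewrite mulrC.
by apply: cdiffM; [exact: cdiff_cst|apply: cdiffM; [exact: cdiff_cst|exact: IH]].
Unshelve. all: by end_near. Qed.

Lemma cdiff_foldr j s f : cdiff (size s + j) f -> cdiff j (foldr pderiv f s).
Proof.
elim: s j f => [//|i s IH] j f; rewrite [size _]/= [foldr _ _ _]/= addSnnS => /IH[_ /(_ i)[g fg cg]].
by rewrite (pderivE fg).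
Qed.

Lemma cdiff_smooth f : (forall j, cdiff j f) -> smooth f.
Proof.
move=> cf s; have [cs hs] := @cdiff_foldr 1 s f (cf _); split => // i x.
by have [g fg _] := hs i; have [] := fg x.
Qed.

Lemma smooth_has_pderiv f i : smooth f -> has_pderiv i f (pderiv i f).
Proof. by move=> /(_ [::])[_ /(_ i)] df x; split. Qed.

Lemma smooth_pderiv f i : smooth f -> smooth (pderiv i f).
Proof. by move=> sf s; rewrite -foldr_rcons; exact: sf. Qed.

Lemma smooth_continuous f : smooth f -> continuous f.
Proof. by move=> /(_ [::])[]. Qed.

Lemma smooth_cdiff f j : smooth f -> cdiff j f.
Proof.
elim: j f => [|j IH] f sf; first by split => //; exact: smooth_continuous.
split=> [|i]; first exact: smooth_continuous.
by exists (pderiv i f); [exact: smooth_has_pderiv|apply: IH; exact: smooth_pderiv].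
Qed.

Lemma pderiv_translation f i (z : 'rV[R]_n) : smooth f ->
  pderiv i (fun x : 'rV[R]_n => f (x + z)) = fun x => pderiv i f (x + z).
Proof.
move=> sf; apply: pderivE => x.
exact: (is_derive_translation z (smooth_has_pderiv i sf) x).
Qed.

Lemma continuous_translation f (z : 'rV[R]_n) : continuous f -> continuous (fun x : 'rV[R]_n => f (x + z)).
Proof.
move=> cf x; apply: (@continuous_comp _ _ _ (fun x : 'rV[R]_n => x + z) f); last exact: cf.
exact: continuous_addr.
Qed.

Lemma foldr_pderiv_translation s f (z : 'rV[R]_n) : smooth f ->
  foldr pderiv (fun x : 'rV[R]_n => f (x + z)) s = fun x => foldr pderiv f s (x + z).
Proof.
move=> sf; elim: s => [|i s IH]; first by [].
have ss : smooth (foldr pderiv f s) by move=> s'; rewrite -foldr_cat; exact: sf.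
by rewrite [LHS]/= IH (pderiv_translation _ _ ss).
Qed.

Lemma smooth_translation f (z : 'rV[R]_n) : smooth f -> smooth (fun x : 'rV[R]_n => f (x + z)).
Proof.
move=> sf s; rewrite foldr_pderiv_translation//; split => [|i x].
  by apply: continuous_translation; case: (sf s).
have [_ dfs] := sf s.
have h y : is_derive y (e_ i) (foldr pderiv f s) ('D_(e_ i) (foldr pderiv f s) y) by split => //; exact: dfs.
by have [] := is_derive_translation z h x.
Qed.

(* The operator of mderiv only depends on the list of its directions. *)
Definition mseq (l : 'I_n -> nat) : seq 'I_n := flatten [seq nseq (l i) i | i <- enum 'I_n].

Lemma mderivE l f : mderiv l f = foldr pderiv f (mseq l).
Proof.
rewrite /mderiv /mseq; elim: (enum _) => [|i s IH] //=.
by rewrite foldr_cat -IH; elim: (l i) => //= k ->.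
Qed.

Lemma smooth_foldr f s : smooth f -> smooth (foldr pderiv f s).
Proof. by move=> sf s'; rewrite -foldr_cat; exact: sf. Qed.

(** Clairaut's theorem: both mixed derivatives are limits of the same second
    difference quotient. *)
Lemma pderivC f i j : smooth f -> pderiv i (pderiv j f) = pderiv j (pderiv i f).
Proof.
move=> sf.
have mvt g k (x : 'rV[R]_n) (h : R) : smooth g -> 0 < h -> exists2 c, 0 < c < h &
    g (x + h *: e_ k) - g x = pderiv k g (x + c *: e_ k) * h.
  move=> sg h0.
  have hd (s : R) : is_derive s 1 (fun s : R => g (x + s *: e_ k)) (pderiv k g (x + s *: e_ k)).
    exact: (@is_derive_line R 'rV[R]_n R g (e_ k) (pderiv k g) x s (smooth_has_pderiv k sg)).
  have [c ch E] := @MVT R (fun s => g (x + s *: e_ k)) (fun s => pderiv k g (x + s *: e_ k)) 0 h h0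
     (fun s _ => hd s) (derivable_within_continuous (fun s _ => @ex_derive _ _ _ _ _ _ _ (hd s))).
  move: E; rewrite scale0r addr0 subr0 => E.
  by exists c => //; move: ch; rewrite in_itv.
have second k l (x : 'rV[R]_n) (h : R) : 0 < h -> exists c d, [/\ 0 < c < h, 0 < d < h &
    f (x + h *: e_ k + h *: e_ l) - f (x + h *: e_ k) - (f (x + h *: e_ l) - f x) =
    pderiv l (pderiv k f) (x + c *: e_ k + d *: e_ l) * h * h].
  move=> h0; pose g y := f (y + h *: e_ l) - f y.
  have sg : smooth g.
    apply: cdiff_smooth => m; apply: cdiffD.
      by apply: smooth_cdiff; exact: smooth_translation.
    rewrite (_ : (fun x => - f x) = fun x => -1 * f x); last by apply/funext => y; rewrite mulN1r.
    by apply: cdiffM; [exact: cdiff_cst|exact: smooth_cdiff].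
  have [c ch E] := mvt g k x h sg h0.
  have gk y : pderiv k g y = pderiv k f (y + h *: e_ l) - pderiv k f y.
    have : has_pderiv k g (fun y => pderiv k f (y + h *: e_ l) - pderiv k f y).
      move=> z; apply: is_deriveB; last exact: smooth_has_pderiv.
      by have := is_derive_translation (h *: e_ l) (smooth_has_pderiv k sf) z.
    by move/pderivE => ->.
  have skf : smooth (pderiv k f) by exact: smooth_pderiv.
  have [d dh E2] := mvt _ l (x + c *: e_ k) h skf h0.
  exists c, d; split => //; rewrite -E2 -gk -E /g.
  by congr (_ - _ - _); rewrite addrAC.
have close k l g (x : 'rV[R]_n) (e : R) : continuous g -> 0 < e -> exists2 r, 0 < r & forall h c d,
    0 < h < r -> 0 < c < h -> 0 < d < h -> `|g x - g (x + c *: e_ k + d *: e_ l)| < e.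
  move=> cg e0; have /cvgrPdist_lt/(_ e e0) := cg x.
  move=> /nbhs_ballP[r /= r0 hr]; exists (r / 2); first by rewrite divr_gt0.
  move=> h c d /andP[h0 h1] /andP[c0 c1] /andP[d0 d1]; apply: hr; split => // i' j'.
  rewrite /ball/= !mxE opprD addrA opprD addrA subrr sub0r.
  have b01 (b : bool) (y : R) : 0 < y -> 0 <= y * b%:R <= y.
    by case: b => y0; rewrite ?mulr1 ?mulr0 ?lexx ltW.
  rewrite -opprD normrN ger0_norm ?addr_ge0 ?mulr_ge0 ?(ltW c0) ?(ltW d0)//.
  have /andP[_ h2] := b01 ((i' == 0) && (j' == k)) c c0.
  have /andP[_ h3] := b01 ((i' == 0) && (j' == l)) d d0.
  lra.
apply/funext => x; apply/eqP; rewrite -subr_eq0 -normr_le0; apply/ler_addgt0Pr => e e0.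
rewrite add0r; have e2 : 0 < e / 2 by lra.
have cij k l : continuous (pderiv k (pderiv l f)).
  by apply/smooth_continuous/smooth_pderiv/smooth_pderiv.
have [r1 r10 h1] := close j i _ x _ (cij i j) e2.
have [r2 r20 h2] := close i j _ x _ (cij j i) e2.
pose h := Num.min r1 r2 / 2.
have h0 : 0 < h by rewrite divr_gt0// lt_min r10.
have [hr1 hr2] : h < r1 /\ h < r2.
  have : Num.min r1 r2 <= r1 by rewrite ge_min lexx.
  have : Num.min r1 r2 <= r2 by rewrite ge_min lexx orbT.
  by rewrite /h in h0 *; lra.
have [c1 [d1 [c1h d1h E1]]] := second j i x h h0.
have [c2 [d2 [c2h d2h E2]]] := second i j x h h0.
have E : pderiv i (pderiv j f) (x + c1 *: e_ j + d1 *: e_ i) =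
    pderiv j (pderiv i f) (x + c2 *: e_ i + d2 *: e_ j).
  have hn : h != 0 by rewrite gt_eqF.
  move: E1 E2; rewrite (addrAC x (h *: e_ j)).
  move: (pderiv i _ _) (pderiv j _ _) (f _) (f _) (f _) (f _) => P1 P2 A B C D E1 E2.
  by apply: (mulIf hn); apply: (mulIf hn); rewrite -E1 -E2; ring.
have := h1 h c1 d1; rewrite h0 hr1 c1h d1h E => /(_ isT isT isT) k1.
have := h2 h c2 d2; rewrite h0 hr2 c2h d2h => /(_ isT isT isT) k2.
move: k1 k2; move: (pderiv i _ x) (pderiv j _ x) (pderiv j _ _) => a b c k1 k2.
rewrite (_ : a - b = (a - c) - (b - c)); last by rewrite opprB addrA subrK.
by apply: (le_trans (ler_normB _ _)); clear -k1 k2; lra.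
Qed.

Lemma pderiv_foldr i s f : smooth f -> pderiv i (foldr pderiv f s) = foldr pderiv (pderiv i f) s.
Proof.
move=> sf; elim: s => [|j s IH]; first by [].
rewrite [foldr _ _ (j :: s)]/= (pderivC _ _ (smooth_foldr s sf)) IH.
by [].
Qed.

Lemma foldr_pderiv_perm s t f : smooth f -> perm_eq s t -> foldr pderiv f s = foldr pderiv f t.
Proof.
move=> sf; elim: s t => [|i s IH] t; first by rewrite perm_sym => /perm_nilP ->.
move=> st; have it : i \in t by rewrite -(perm_mem st) mem_head.
case/splitPr: it st => t1 t2 st.
have {}st : perm_eq s (t1 ++ t2).
  by rewrite -(perm_cons i) (perm_trans st)// -[i :: t2]cat1s perm_catCA.
rewrite [LHS]/= (IH _ st) !foldr_cat (pderiv_foldr i t1 (smooth_foldr t2 sf)).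
by [].
Qed.

Lemma mderivD l m f : smooth f -> mderiv l (mderiv m f) = mderiv (fun i => l i + m i)%N f.
Proof.
move=> sf; rewrite !mderivE -foldr_cat; apply: foldr_pderiv_perm => //.
rewrite /mseq; elim: (enum _) => [|i s IH] //=.
rewrite nseqD -!catA perm_cat2l perm_catCA perm_cat2l.
exact: IH.
Qed.

Definition mono (i : 'I_n) : 'I_n -> nat := fun j => (j == i) : nat.

Lemma mderiv_mono i f : mderiv (mono i) f = pderiv i f.
Proof.
rewrite mderivE /mseq (_ : flatten _ = [:: i])//.
have : i \in enum 'I_n by rewrite mem_enum.
have : uniq (enum 'I_n) by exact: enum_uniq.
elim: (enum _) => [|j s IH]; first by [].
rewrite [uniq _]/= => /andP[js us]; rewrite inE /mono /=.
have [ij _|ij /= /(IH us)//] := eqVneq i j.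
rewrite ij /=; congr cons; elim: s js {us IH} => [|k s IH] //=.
by rewrite inE negb_or => /andP[jk /IH ->]; rewrite eq_sym (negbTE jk).
Qed.

Lemma mderiv0 f : mderiv (fun _ => 0%N) f = f.
Proof. by rewrite /mderiv; elim: (enum _) => //= i s ->. Qed.

Lemma mderiv_translation l f (z : 'rV[R]_n) : smooth f ->
  mderiv l (fun x : 'rV[R]_n => f (x + z)) = fun x => mderiv l f (x + z).
Proof. by move=> sf; rewrite !mderivE foldr_pderiv_translation. Qed.

End cdiff.

(** * Test functions *)

Section test.
Context {R : realType} {n : nat}.
Implicit Types (f g phi psi : 'rV[R]_n -> R).
Local Notation vol := (@lebesgue_rV R n).
Local Notation e_ i := (delta_mx 0 i : 'rV[R]_n).

Definition cube (N : nat) : set 'rV[R]_n := [set x | forall i, `|x 0 i| <= N%:R].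

Definition supp_in N f := forall x, f x != 0 -> cube N x.

Lemma cubeE N : cube N = [set x : 'rV[R]_n | forall i, `[- N%:R, N%:R]%classic (x 0 i)].
Proof.
by apply/seteqP; split => x /= h i; have := h i; rewrite in_itv/= ler_norml.
Qed.

Lemma measurable_cube N : measurable (cube N).
Proof.
rewrite cubeE (_ : [set _ | _] = \bigcap_(i in [set: 'I_n])
   ((fun x : 'rV[R]_n => x 0 i) @^-1` `[- N%:R, N%:R]%classic)); last first.
  by apply/seteqP; split => x /= h i; [move=> _; exact: h|exact: h].
apply: fin_bigcap_measurable => // i _.
by rewrite -[X in measurable X]setTI; apply: measurable_coor.
Qed.

Lemma vol_cube N : (vol (cube N) < +oo)%E.
Proof.
rewrite cubeE (@lebesgue_rV_box R n (fun=> `[- N%:R, N%:R]%classic))//.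
elim: (index_enum _) => [|i s IH]; first by rewrite big_nil ltry.
rewrite big_cons; apply: lte_mul_pinfty => //.
by rewrite lebesgue_measure_itv/=; case: ifP.
Qed.

Lemma compact_cube N : compact (cube N).
Proof.
rewrite cubeE; apply: (@rV_compact R n (fun=> `[- N%:R, N%:R]%classic)) => i.
exact: segment_compact.
Qed.

Lemma cube_le N M : (N <= M)%N -> cube N `<=` cube M.
Proof. by move=> NM x h i; rewrite (le_trans (h i))// ler_nat. Qed.

Lemma coord_le_norm (x : 'rV[R]_n) i : `|x 0 i| <= `|x|.
Proof.
rewrite leNgt; apply/negP => lt.
have : ball (0 : 'rV[R]_n) `|x 0 i| x.
  by rewrite -ball_normE/= sub0r normrN.
case=> _ /(_ 0 i); rewrite /ball/= mxE sub0r normrN.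
by rewrite ltxx.
Qed.

Lemma in_cube (x : 'rV[R]_n) : exists N, cube N x.
Proof.
exists (Num.bound `|x|) => i; apply: le_trans (coord_le_norm x i) _.
exact/ltW/archi_boundP.
Qed.

Lemma test_functionP phi : test_function phi <-> smooth phi /\ exists N, supp_in N phi.
Proof.
split=> [[sp cp]|[sp [N hN]]]; split => //.
  have [M [Mr hM]] := compact_bounded cp.
  exists (Num.bound (`|M| + 1)) => x px i.
  apply: le_trans (coord_le_norm x i) _.
  apply: le_trans (ltW (archi_boundP _)); last by rewrite addr_ge0.
  apply: (hM (`|M| + 1)); first by rewrite (le_lt_trans (ler_norm M))// ltrDl.
  by apply: subset_closure; exact: px.
apply: (@subclosed_compact _ _ (cube N)); [exact: closed_closure|exact: compact_cube|].
have cN : closed (cube N) by apply: compact_closed; [exact: norm_hausdorff|exact: compact_cube].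
rewrite [X in _ `<=` X](closure_id _).1//.
by apply: closure_subset => x; exact: hN.
Qed.

Lemma supp_in_bounded f N : continuous f -> supp_in N f -> exists2 C, 0 <= C & forall x, `|f x| <= C.
Proof.
move=> cf sf.
have cfc : compact (f @` cube N).
  apply: continuous_compact; last exact: compact_cube.
  exact: continuous_subspaceT.
have [M [Mr hM]] := compact_bounded cfc.
exists (`|M| + 1) => [|x]; first by rewrite addr_ge0.
have [->|fx] := eqVneq (f x) 0; first by rewrite normr0 addr_ge0.
apply: (hM (`|M| + 1)); first by rewrite (le_lt_trans (ler_norm M))// ltrDl.
by exists x => //; exact: sf.
Qed.

Definition bms C N f := [/\ measurable_fun setT f, forall x, `|f x| <= C & supp_in N f].

Lemma bms_ge0 C N f : bms C N f -> 0 <= C.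
Proof. by move=> [_ /(_ 0) h _]; exact: le_trans h. Qed.

Lemma bms_weight C N f : bms C N f -> weight C (C * fine (vol (cube N))) f.
Proof.
move=> bf; have C0 := bms_ge0 bf; have [mf fC sf] := bf; split => //.
apply: (@le_trans _ _ (\int[vol]_x (C%:E * (\1_(cube N) x)%:E))%E).
  apply: ge0_le_integral => //.
  - by apply/measurable_EFinP; exact: measurableT_comp.
  - apply: measurable_funeM; apply/measurable_EFinP.
    by apply: measurable_indic; exact: measurable_cube.
  move=> x _; rewrite -EFinM lee_fin indicE.
  have [xN|xN] := boolP (x \in cube N); first by rewrite mulr1.
  rewrite mulr0; have [->|/sf/mem_set] := eqVneq (f x) 0; first by rewrite normr0.
  by rewrite (negbTE xN).
have mi : measurable_fun setT (fun x => (\1_(cube N) x)%:E : \bar R).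
  by apply/measurable_EFinP; apply: measurable_indic; exact: measurable_cube.
rewrite ge0_integralZl//.
rewrite integral_indic//; last exact: measurable_cube.
by rewrite setIT EFinM fineK// ge0_fin_numE// vol_cube.
Qed.

Lemma test_bms phi : test_function phi -> exists C N, bms C N phi.
Proof.
move=> /test_functionP[sp [N sN]]; have cp := smooth_continuous sp.
have [C _ hC] := supp_in_bounded cp sN; exists C, N; split => //.
exact: continuous_measurable_rV.
Qed.

Lemma test_weight phi : test_function phi -> exists C D, weight C D phi.
Proof. by move=> /test_bms[C [N /bms_weight w]]; exists C, (C * fine (vol (cube N))). Qed.

Lemma supp_in_pderiv i f g N : has_pderiv i f g -> supp_in N f -> supp_in N g.
Proof.
move=> fg sf x; apply: contra_neqP => xN.
have /existsNP[k /negP] : ~ forall k, `|x 0 k| <= N%:R by exact: xN.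
rewrite -ltNge => hk.
have [dx <-] := fg x; apply: (@cvg_lim _ (@Rhausdorff R)).
apply: (@cvg_trans _ ((fun _ : R => 0 : R) @ (0 : R)^')); last exact: cvg_cst.
have fx0 (y : 'rV[R]_n) : N%:R < `|y 0 k| -> f y = 0.
  by move=> yN; apply: contraTeq yN => /sf/(_ k); rewrite -leNgt.
apply: near_eq_cvg; near=> h.
rewrite /= (fx0 x hk) fx0 ?subr0 ?scaler0// !mxE.
have hh : `|h| < `|x 0 k| - N%:R by near: h; apply: dnbhs0_lt; rewrite subr_gt0.
set d := h * _; have dh : `|d| <= `|h|.
  by rewrite normrM ler_piMr// ger0_norm ?ler0n// lern1 leq_b1.
by have := lerB_dist (x 0 k) (- d); rewrite opprK normrN [x 0 k + d]addrC; lra.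
Unshelve. all: by end_near. Qed.

Lemma test_pderiv i phi : test_function phi -> test_function (pderiv i phi).
Proof.
move=> /test_functionP[sp [N sN]]; apply/test_functionP; split.
  exact: smooth_pderiv.
by exists N; apply: supp_in_pderiv sN; exact: smooth_has_pderiv.
Qed.

Lemma test_mderiv l phi : test_function phi -> test_function (mderiv l phi).
Proof.
rewrite mderivE; elim: (mseq l) => [//|i s IH] /IH; exact: test_pderiv.
Qed.

Lemma test_translation phi z : test_function phi -> test_function (fun x : 'rV[R]_n => phi (x + z)).
Proof.
move=> /test_functionP[sp [N sN]]; apply/test_functionP; split.
  exact: smooth_translation.
have [M hM] := in_cube z; exists (N + M)%N => x /sN h i.
have := h i; have := hM i; rewrite mxE natrD => h1 h2.
by have := ler_normB (x 0 i + z 0 i) (z 0 i); rewrite addrK; lra.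
Qed.

End test.

(** * Approximation by test functions *)

Section monotone_class.
Context {R : realType} {n : nat}.
Implicit Types (f g phi : 'rV[R]_n -> R) (a b : 'I_n -> R).

Definition obox a b : set 'rV[R]_n := [set x | forall i, a i < x 0 i < b i].

Definition oboxes := [set A | exists a b, A = obox a b].

Lemma oboxI : setI_closed oboxes.
Proof.
move=> _ _ [a [b ->]] [a' [b' ->]].
exists (fun i => Num.max (a i) (a' i)), (fun i => Num.min (b i) (b' i)).
apply/seteqP; split => x /=.
  by move=> [h h'] i; have := h i; have := h' i; rewrite gt_max lt_min => /andP[-> ->] /andP[-> ->].
move=> h; split => i; have := h i; rewrite gt_max lt_min;
  by move=> /andP[/andP[? ?] /andP[? ?]]; apply/andP.
Qed.

Lemma measurable_obox a b : measurable (obox a b).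
Proof.
rewrite (_ : obox a b = \bigcap_(i in [set: 'I_n])
   ((fun x : 'rV[R]_n => x 0 i) @^-1` `]a i, b i[%classic)); last first.
  apply/seteqP; split => x /= h i; first by move=> _ /=; rewrite ?in_itv/=; exact: h.
  by have := h i I; rewrite /= ?in_itv.
apply: fin_bigcap_measurable => // i _.
by rewrite -[X in measurable X]setTI; apply: measurable_coor.
Qed.

Lemma measurable_oboxes : @measurable _ 'rV[R]_n = <<s oboxes >>.
Proof.
apply/seteqP; split; last first.
  apply: smallest_sub; first exact: sigma_algebra_measurable.
  by move=> _ [a [b ->]]; exact: measurable_obox.
apply: smallest_sub; first exact: smallest_sigma_algebra.
move=> B; rewrite -bigcup_seq/= => -[i _ [C mC <-]]; rewrite setTI.
pose H := [set C : set R | <<s oboxes >> ((fun x : 'rV[R]_n => x 0 i) @^-1` C)].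
suff : (@measurable _ (measurableTypeR R)) `<=` H by exact.
rewrite RGenOpens.measurableE; have sG := @smallest_sigma_algebra _ [set: 'rV[R]_n] oboxes.
apply: smallest_sub.
  split => /=; rewrite /H/=.
  - by rewrite preimage_set0; case: sG.
  - by move=> A mA; rewrite setTD preimage_setC -setTD; case: sG => _ + _; exact.
  - by move=> F mF; rewrite preimage_bigcup; case: sG => _ _; exact.
move=> _ [u [v ->]]; rewrite /H/=.
rewrite (_ : _ @^-1` _ = \bigcup_N obox (fun j => if j == i then u else - N%:R)
   (fun j => if j == i then v else N%:R)).
  by case: sG => _ _; apply => N; apply: sub_sigma_algebra; do 2 eexists.
apply/seteqP; split => x /=.
  rewrite in_itv/= => xi; have [N hN] := in_cube x.
  exists N.+1 => // j; case: eqP => [->//|_]; rewrite -ltr_norml.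
  by rewrite (le_lt_trans (hN j))// ltr_nat.
by move=> [N _ /(_ i)]; rewrite eqxx in_itv.
Qed.

Lemma cvg_prod1 (I : Type) (s : seq I) (F : I -> nat -> R) :
  (forall i, F i k @[k --> \oo] --> (1 : R)) -> (\prod_(i <- s) F i k) @[k --> \oo] --> (1 : R).
Proof.
move=> cF; elim: s => [|i s IH].
  rewrite (_ : (fun k : nat => _) = fun=> 1); first exact: cvg_cst.
  by apply/funext => k; rewrite big_nil.
rewrite (_ : (fun k : nat => _) = fun k => F i k * \prod_(i <- s) F i k).
  by have h := cvgM (cF i) IH; move: h; rewrite (mulr1 (1 : R)); exact.
by apply/funext => k; rewrite big_cons.
Qed.

Lemma obox_test a b : exists N (phi_ : nat -> 'rV[R]_n -> R),
  [/\ forall k, test_function (phi_ k), forall k x, `|phi_ k x| <= 1,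
      forall k, supp_in N (phi_ k) &
      forall x, phi_ k x @[k --> \oo] --> (\1_(obox a b) x : R)].
Proof.
pose F (k : nat) i (x : 'rV[R]_n) :=
  flat 1 (k.+1%:R * x 0 i + k.+1%:R * - a i) * flat 1 (- k.+1%:R * x 0 i + k.+1%:R * b i).
pose phi_ k x := \prod_i F k i x.
pose N := (\sum_i (Num.bound `|a i| + Num.bound `|b i|))%N.
have FE k i x : F k i x = flat 1 (k.+1%:R * (x 0 i - a i)) * flat 1 (k.+1%:R * (b i - x 0 i)).
  by rewrite /F; congr (flat 1 _ * flat 1 _); ring.
have F01 k i x : 0 <= F k i x <= 1.
  have /andP[p0 p1] := flat1_le1 (k.+1%:R * x 0 i + k.+1%:R * - a i).
  have /andP[r0 r1] := flat1_le1 (- k.+1%:R * x 0 i + k.+1%:R * b i).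
  by rewrite /F mulr_ge0//= mulr_ile1.
have F0 k i x : F k i x != 0 -> a i < x 0 i < b i.
  rewrite FE /flat; case: ifP; last by rewrite mul0r eqxx.
  case: ifP; last by rewrite mulr0 eqxx.
  by rewrite !pmulr_rgt0 ?ltr0n// !subr_gt0 => -> ->.
have sN k : supp_in N (phi_ k).
  move=> x; rewrite prodf_seq_neq0 => /allP h i.
  have /F0/andP[ai bi] := h i (mem_index_enum _).
  have := archi_boundP (normr_ge0 (a i)); have := archi_boundP (normr_ge0 (b i)).
  set A := Num.bound _; set B := Num.bound _ => hA hB.
  apply: (@le_trans _ _ (B + A)%:R); last first.
    by rewrite ler_nat /N (bigD1 i)//= leq_addr.
  rewrite natrD ler_norml; move: hA hB; rewrite !ltr_norml => /andP[? ?] /andP[? ?].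
  have : 0 <= A%:R :> R by []. have : 0 <= B%:R :> R by [].
  by move=> ? ?; apply/andP; split; lra.
exists N, phi_; split => //.
- move=> k; apply/test_functionP; split; last by exists N.
  apply: cdiff_smooth => j; apply: cdiff_prod => i.
  by apply: cdiffM; exact: cdiff_flat.
- move=> k x; rewrite /phi_; elim/big_ind: _ => [|u v hu hv|i _].
  + by rewrite normr1.
  + by rewrite normrM mulr_ile1.
  + by have /andP[? ?] := F01 k i x; rewrite ger0_norm.
- move=> x; rewrite indicE; have [xb|xb] := boolP (x \in obox a b); last first.
    have /existsNP[i hi] : ~ forall i, a i < x 0 i < b i by move=> h; move/negP: xb; apply; exact/mem_set.
    rewrite (_ : (fun k => _) = fun=> 0); first exact: cvg_cst.
    apply/funext => k; apply/eqP; rewrite prodf_seq_eq0; apply/hasP; exists i; first exact: mem_index_enum.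
    by rewrite /=; apply: contra_notT hi; exact: F0.
  move/set_mem : xb => xb.
  apply: (@cvg_prod1 _ _ (fun i k => F k i x)) => i.
  rewrite (_ : (fun k => _) = fun k : nat => flat 1 (k.+1%:R * (x 0 i - a i)) * flat 1 (k.+1%:R * (b i - x 0 i)));
    last by apply/funext => k; exact: FE.
  have /andP[ai bi] := xb i.
  rewrite -subr_gt0 in ai; rewrite -subr_gt0 in bi.
  have h := cvgM (flat1_cvg ai) (flat1_cvg bi).
  by move: h; rewrite (mulr1 (1 : R)); exact.
Qed.

Variable P : ('rV[R]_n -> R) -> Prop.
Hypothesis Ptest : forall phi, test_function phi -> P phi.
Hypothesis Plin : forall (c : R) f g, (exists C N, bms C N f) -> (exists C N, bms C N g) ->
  P f -> P g -> P (fun x => c * f x + g x).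
Hypothesis Plim : forall C N (f_ : nat -> 'rV[R]_n -> R) f,
  (forall k, bms C N (f_ k)) -> bms C N f ->
  (forall x, f_ k x @[k --> \oo] --> f x) -> (forall k, P (f_ k)) -> P f.

Let oc (N : nat) : set 'rV[R]_n := obox (fun=> - N%:R) (fun=> N%:R).

Let bms_indic E N : measurable E -> bms 1 N (\1_(E `&` oc N) : 'rV[R]_n -> R).
Proof.
move=> mE; split.
- by apply: measurable_indic; apply: measurableI => //; exact: measurable_obox.
- by move=> x; rewrite indicE; case: (x \in _); rewrite ?normr1// normr0.
- move=> x; rewrite indicE; case: (boolP (x \in _)); last by rewrite eqxx.
  move=> /set_mem[_ h] _ i; have /andP[h1 h2] := h i.
  by rewrite ler_norml !ltW.
Qed.

Let P0 : P (fun=> 0).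
Proof.
apply: Ptest; apply/test_functionP; split; last by exists 0%N => x; rewrite eqxx.
by apply: cdiff_smooth => j; exact: cdiff_cst.
Qed.

Let P_obox a b : P (\1_(obox a b) : 'rV[R]_n -> R).
Proof.
have [N [phi_ [tphi phi1 sphi cphi]]] := obox_test a b.
apply: (Plim (C := 1) (N := N) (f_ := phi_)) => //.
- move=> k; split => //; apply: continuous_measurable_rV.
  by have [/smooth_continuous] := tphi k.
- split.
  + by apply: measurable_indic; exact: measurable_obox.
  + by move=> x; rewrite indicE; case: (x \in _); rewrite ?normr1// normr0.
  + move=> x fx; apply: contrapT => xN.
    have : phi_ k x @[k --> \oo] --> (0 : R).
      rewrite (_ : (fun k => _) = fun=> 0); first exact: cvg_cst.
      by apply/funext => k; apply/eqP; apply: contra_notT xN; exact: sphi.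
    move=> h; have := cvg_unique (@Rhausdorff R) (cphi x) h.
    by move=> fx0; rewrite fx0 eqxx in fx.
- by move=> k; exact: Ptest.
Qed.

Let Q (E : set 'rV[R]_n) := forall N, P (\1_(E `&` oc N) : 'rV[R]_n -> R).

Let Q_measurable E : measurable E -> Q E.
Proof.
move=> mE; move: (mE); rewrite {1}measurable_oboxes; move: E mE => E _; move: E.
apply: (dynkin_induction measurable_oboxes oboxI).
- by move=> N; rewrite setTI; exact: P_obox.
- move=> _ [a [b ->]] N.
  have [c [d ->]] : oboxes (obox a b `&` oc N) by apply: oboxI; do 2 eexists.
  exact: P_obox.
- move=> S mS QS N.
  rewrite (_ : \1_ _ = fun x => -1 * \1_(S `&` oc N) x + \1_(setT `&` oc N) x).
    apply: Plin; [by exists 1, N; exact: bms_indic|by exists 1, N; exact: bms_indic|exact: QS|].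
    by rewrite setTI; exact: P_obox.
  apply/funext => x; rewrite !indicE !in_setI in_setC in_setT.
  by case: (x \in S); case: (x \in oc N) => /=; ring.
- move=> F mF tF QF N.
  pose E m := \bigcup_(k < m) F k.
  have mE m : measurable (E m) by apply: bigcup_measurable => k _.
  have QE m : P (\1_(E m `&` oc N) : 'rV[R]_n -> R).
    elim: m => [|m IH].
      rewrite /E bigcup_mkord big_ord0 set0I (_ : \1_ _ = fun=> 0)//.
      by apply/funext => x; rewrite indicE in_set0.
    rewrite (_ : \1_ _ = fun x => 1 * \1_(E m `&` oc N) x + \1_(F m `&` oc N) x).
      apply: Plin; [by exists 1, N; exact: bms_indic|by exists 1, N; exact: bms_indic|exact: IH|].
      exact: QF.
    apply/funext => x; rewrite !indicE !in_setI.
    have -> : (x \in E m.+1) = (x \in E m) || (x \in F m).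
      by rewrite /E !bigcup_mkord big_ord_recr in_setU.
    have : ~~ ((x \in E m) && (x \in F m)).
      apply/negP => /andP[/set_mem[k /= km Fk] /set_mem Fm].
      have e : k = m by apply: tF => //; exists x.
      by move: km; rewrite e ltnn.
    by case: (x \in E m); case: (x \in F m); case: (x \in oc N) => //= _; ring.
  apply: (Plim (C := 1) (N := N) (f_ := fun m => \1_(E m `&` oc N))) => //.
  + by move=> k; exact: bms_indic.
  + by apply: bms_indic; exact: bigcup_measurable.
  move=> x; have [[k _ Fk]|nF] := pselect ((\bigcup_k F k) x).
    apply: (@cvg_trans _ ((fun=> \1_(\bigcup_k F k `&` oc N) x : R) @ \oo)); last exact: cvg_cst.
    apply: near_eq_cvg; exists k.+1 => // m /= km.
    rewrite !indicE !in_setI; congr (_ && _)%:R.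
    by rewrite !mem_set//; [exists k|exists k].
  rewrite (_ : (fun m => _) = fun=> \1_(\bigcup_k F k `&` oc N) x); first exact: cvg_cst.
  apply/funext => m; rewrite !indicE !in_setI; congr (_ && _)%:R.
  by rewrite !memNset//; apply: contra_not nF => -[k _ Fk]; exists k.
Qed.

Let P_sum (I : Type) (s : seq I) (c : I -> R) (E : I -> set 'rV[R]_n) N :
  (forall i, measurable (E i)) ->
  P (fun x => \sum_(i <- s) c i * \1_(E i `&` oc N) x) /\
  exists D M, bms D M (fun x => \sum_(i <- s) c i * \1_(E i `&` oc N) x).
Proof.
move=> mE; elim: s => [|i s [IH [C [M [IH1 IH2 IH3]]]]].
  have -> : (fun x => \sum_(i <- [::]) c i * \1_(E i `&` oc N) x) = fun=> 0.
    by apply/funext => x; rewrite big_nil.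
  split; first exact: P0.
  exists 0, 0%N; split.
  - exact: measurable_cst.
  - by move=> x; rewrite normr0.
  - by move=> x; rewrite eqxx.
have -> : (fun x => \sum_(i <- i :: s) c i * \1_(E i `&` oc N) x) =
    fun x => c i * \1_(E i `&` oc N) x + \sum_(i <- s) c i * \1_(E i `&` oc N) x.
  by apply/funext => x; rewrite big_cons.
have [b1 b2 b3] := bms_indic N (mE i).
split; first by apply: Plin => //; [exists 1, N|exists C, M|exact: Q_measurable].
exists (`|c i| + C), (N + M)%N; split.
- by apply: measurable_funD => //; apply: measurable_funM.
- move=> x; rewrite (le_trans (ler_normD _ _))// lerD// normrM ler_piMr//; exact: b2.
- move=> x; have [b0|/b3 h _] := eqVneq (\1_(E i `&` oc N) x : R) 0.
    by rewrite b0 mulr0 add0r => /IH3; apply: cube_le; rewrite leq_addl.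
  by move: h; apply: cube_le; rewrite leq_addr.
Qed.

Import HBSimple HBNNSimple.

Let P_ge0 C N f : bms C N f -> (forall x, 0 <= f x) -> P f.
Proof.
move=> [mf fC sf] f0.
have mf' : measurable_fun setT (EFin \o f) by exact/measurable_EFinP.
pose s_ := nnsfun_approx measurableT mf'.
have sle k x : s_ k x <= f x.
  rewrite -lee_fin nnsfun_approxE; apply: (@le_approx _ _ _ setT (EFin \o f)) => // y _.
  by rewrite lee_fin.
have s0 k x : 0 <= s_ k x by exact: fun_ge0.
have sb k : bms C N (s_ k).
  split; first exact: measurable_funPT.
    by move=> x; rewrite ger0_norm// (le_trans (sle k x))// (le_trans _ (fC x))// ler_norm.
  move=> x sx; apply: sf; apply: contra_neq sx => fx; apply/eqP.
  by rewrite eq_le s0 andbT -fx sle.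
apply: (Plim (f_ := s_)) => //.
  move=> x; have := @cvg_nnsfun_approx _ _ _ _ measurableT _ mf' (fun x _ => f0 x) x I.
  by move/fine_cvgP => [_].
move=> k.
have [m [c [E [mE sE]]]] : exists (m : nat) (c : 'I_m -> R) (E : 'I_m -> set 'rV[R]_n),
    (forall i, measurable (E i)) /\ forall x, s_ k x = \sum_(i < m) c i * \1_(E i) x.
  eexists; eexists (fun i => _); eexists (fun i => (s_ k) @^-1` [set _]); split; last first.
    by move=> x; rewrite {1}(fimfunEord (s_ k)).
  by move=> i; rewrite -[X in measurable X]setTI; apply: measurable_funPT.
have -> : (s_ k : _ -> R) = (fun x => \sum_(i < m) c i * \1_(E i `&` oc N.+1) x).
  apply/funext => x.
  have [xo|xo] := boolP (x \in oc N.+1).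
    by rewrite sE; apply: eq_bigr => i _; rewrite !indicE in_setI xo andbT.
  rewrite [RHS]big1; last by move=> i _; rewrite indicE in_setI (negbTE xo) andbF mulr0.
  apply/eqP; apply: contraNT xo => sx; apply/mem_set => i /=.
  have [_ _ h] := sb k; rewrite -ltr_norml (le_lt_trans (h x sx i))//.
  by rewrite ltr_nat.
exact: (P_sum _ _ _ mE).1.
Qed.

Theorem monotone_class C N f : bms C N f -> P f.
Proof.
move=> bf; have [mf fC sf] := bf.
pose fp x := Num.max (f x) 0; pose fm x := Num.max (- f x) 0.
have bp : bms C N fp.
  split.
  - exact: measurable_maxr.
  - move=> x; rewrite /fp; have [h|h] := leP (f x) 0; last exact: fC.
    by rewrite normr0 (bms_ge0 bf).
  - move=> x fx; apply: sf; apply: contra_neq fx => fx; rewrite /fp fx maxxx//.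
have bm : bms C N fm.
  split.
  - by apply: measurable_maxr => //; exact: measurableT_comp.
  - move=> x; rewrite /fm; have [h|h] := leP (- f x) 0; last by rewrite normrN; exact: fC.
    by rewrite normr0 (bms_ge0 bf).
  - move=> x fx; apply: sf; apply: contra_neq fx => fx; rewrite /fm fx oppr0 maxxx//.
have -> : f = fun x => -1 * fm x + fp x.
  apply/funext => x; rewrite /fm /fp; have [h|h] := leP (f x) 0.
    by rewrite max_l; [ring|rewrite oppr_ge0].
  by rewrite max_r; [ring|rewrite oppr_le0 ltW].
apply: Plin; [by exists C, N|by exists C, N| |].
  by apply: P_ge0 bm _ => x; rewrite le_max lexx orbT.
by apply: P_ge0 bp _ => x; rewrite le_max lexx orbT.
Qed.

End monotone_class.

(** * Weak derivatives *)

Section weak_derivatives.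
Context {R : realType} {n : nat} {q : R} (q1 : (1 <= q%:E)%E).
Local Notation vol := (@lebesgue_rV R n).
Local Notation L := (Lq n q1).
Implicit Types (f g k phi psi : 'rV[R]_n -> R) (u v w : L) (l m : 'I_n -> nat).
Local Notation e_ i := (delta_mx 0 i : 'rV[R]_n).

Lemma bms_cube C N : 0 <= C -> bms C N (fun x : 'rV[R]_n => C * \1_(cube N) x).
Proof.
move=> C0; split.
- by apply: measurable_funM => //; apply: measurable_indic; exact: measurable_cube.
- move=> x; rewrite indicE; case: (x \in _); rewrite ?mulr1 ?mulr0 ?normr0//.
  by rewrite ger0_norm.
- move=> x; rewrite indicE; case: (boolP (x \in _)) => [/set_mem//|_].
  by rewrite mulr0 eqxx.
Qed.

Lemma bms_le C N f x : bms C N f -> `|f x| <= C * \1_(cube N) x.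
Proof.
move=> [_ fC fs]; rewrite indicE.
have [xN|xN] := boolP (x \in cube N); first by rewrite mulr1.
have [->|/fs/mem_set] := eqVneq (f x) 0; first by rewrite normr0 mulr0.
by rewrite (negbTE xN).
Qed.

Lemma Lpair_lin C D C' D' c f g v : weight C D f -> weight C' D' g ->
  Lpair v (fun x => c * f x + g x) = c * Lpair v f + Lpair v g.
Proof.
move=> wf wg; have fi := weight_integrable v wf; have gi := weight_integrable v wg.
rewrite /Lpair -RintegralZl// -RintegralD//; last first.
  by have := integrableZl measurableT c fi; apply: eq_integrable => // x _.
by apply: eq_Rintegral => x _; ring.
Qed.

Lemma Lpair_dominated C N (f_ : nat -> 'rV[R]_n -> R) f v :
  (forall j, bms C N (f_ j)) -> bms C N f -> (forall x, f_ j x @[j --> \oo] --> f x) ->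
  Lpair v (f_ j) @[j --> \oo] --> Lpair v f.
Proof.
move=> bf_ bf f_f; have C0 := bms_ge0 bf.
have mv := measurable_Lfn v; have [mf _ _] := bf.
have bdom := bms_cube N C0.
have := @dominated_convergence _ _ _ vol setT measurableT
  (fun j x => (Lfn v x * f_ j x)%:E) (fun x => (Lfn v x * f x)%:E)
  (fun x => `|Lfn v x * (C * \1_(cube N) x)|%:E).
case => //.
- by move=> j; apply/measurable_EFinP; apply: measurable_funM => //; have [] := bf_ j.
- by apply/measurable_EFinP; exact: measurable_funM.
- apply: aeW => x _; apply/fine_cvgP; split; first exact: nearW.
  by apply: cvgM; [exact: cvg_cst|exact: f_f].
- by have := integrable_abse (weight_integrable v (bms_weight bdom)); apply: eq_integrable.
- apply: aeW => x j _; rewrite abse_EFin lee_fin normrM [leRHS]normrM ler_wpM2l//.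
  by rewrite [leRHS]ger0_norm ?mulr_ge0//; exact: bms_le.
have fin := integrable_fin_num measurableT (weight_integrable v (bms_weight bf)).
by move=> _ _; rewrite -(fineK fin) => /fine_cvgP[_].
Qed.

(** The du Bois-Reymond lemma. *)
Theorem Lpair_inj v : (forall phi, test_function phi -> Lpair v phi = 0) -> v = 0.
Proof.
move=> hv; have mv := measurable_Lfn v.
have h C N f : bms C N f -> Lpair v f = 0.
  apply: (@monotone_class R n (fun f => Lpair v f = 0)) => //.
  - move=> c g g' [C1 [N1 /bms_weight w1]] [C2 [N2 /bms_weight w2]] h1 h2.
    by rewrite (Lpair_lin c v w1 w2) h1 h2 mulr0 addr0.
  - move=> C1 N1 f_ g b_ b cf h1.
    have := @Lpair_dominated C1 N1 f_ g v b_ b cf.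
    under eq_fun do rewrite h1.
    by move=> hh; rewrite (cvg_unique (@Rhausdorff R) hh (cvg_cst _)).
have hN N : {ae vol, forall x, cube N x -> Lfn v x = 0}.
  pose g x : R := Num.sg (Lfn v x) * \1_(cube N) x.
  have msg : measurable_fun setT (fun x => Num.sg (Lfn v x)).
    rewrite (_ : (fun x => _) = fun x => \1_[set y | 0 < y] (Lfn v x) - \1_[set y | y < 0] (Lfn v x)).
      apply: measurable_funB.
        apply: measurableT_comp => //; apply: measurable_indic.
        by rewrite -[X in measurable X]set_itvoy.
      apply: measurableT_comp => //; apply: measurable_indic.
      by rewrite -[X in measurable X]set_itvNyo.
    apply/funext => x; rewrite !indicE.
    have [y0|y0|y0] := ltgtP (Lfn v x) 0.
    - rewrite ltr0_sg// memNset ?mem_set//=; first by ring.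
      by apply/negP; rewrite -leNgt ltW.
    - rewrite gtr0_sg// mem_set// memNset//=; first by ring.
      by apply/negP; rewrite -leNgt ltW.
    - by rewrite y0 sgr0 !memNset ?subrr//=; apply/negP; rewrite ltxx.
  have bg : bms 1 N g.
    split.
    - by apply: measurable_funM => //; apply: measurable_indic; exact: measurable_cube.
    - move=> x; rewrite normrM normr_sg indicE.
      by case: (_ != _); case: (x \in _); rewrite ?normr1 ?normr0 ?mulr0 ?mul0r ?mulr1.
    - move=> x; rewrite /g indicE; case: (boolP (x \in _)) => [/set_mem//|_].
      by rewrite mulr0 eqxx.
  have g0 := h _ _ _ bg.
  have ig := weight_integrable v (bms_weight bg).
  have gE x : Lfn v x * g x = `|Lfn v x| * \1_(cube N) x by rewrite /g normrEsg; ring.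
  have : (\int[vol]_(x in cube N) `|(Lfn v x)%:E| = 0)%E.
    rewrite integral_mkcond; move: g0; rewrite /Lpair /Rintegral => g0.
    transitivity (\int[vol]_x (Lfn v x * g x)%:E)%E.
      apply: eq_integral => x _; rewrite /patch gE indicE.
      by case: ifP => _; rewrite ?mulr1 ?mulr0.
    rewrite -[LHS]fineK ?g0//; exact: integrable_fin_num ig.
  move/(ae_eq_integral_abs vol (measurable_cube N) _).1 => hh.
  have : ae_eq vol (cube N) (EFin \o Lfn v) (cst 0%E).
    by apply: hh; apply/measurable_EFinP; exact: measurable_funS mv.
  by apply: filterS => x hx /hx[].
apply: Lq_eq.
have : {ae vol, forall x, forall N, cube N x -> Lfn v x = 0} by apply: ae_foralln.
have L0 : Lfn (0 : L) = (fun=> 0) %[ae vol].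
  by have := LfnZ 0 (0 : L); rewrite scale0r; apply: filterS => x hx _; rewrite hx// mul0r.
move: L0; apply: filterS2 => x h1 h2 _.
by have [N xN] := in_cube x; rewrite (h2 N xN) h1.
Qed.

Lemma Lpair_eq u v : (forall phi, test_function phi -> Lpair u phi = Lpair v phi) -> u = v.
Proof.
move=> h; apply/eqP; rewrite -subr_eq0; apply/eqP; apply: Lpair_inj => phi tphi.
by have [C [D w]] := test_weight tphi; rewrite (LpairB u v w) h// subrr.
Qed.

Lemma bms_Lfun C N f : bms C N f -> f \in Lfun vol q%:E.
Proof.
move=> bf; have C0 := bms_ge0 bf; have [mf fC fs] := bf; apply: Lfun_powq => //.
have q0 := q_gt0 q1.
have mi : measurable_fun setT (fun x : 'rV[R]_n => (\1_(cube N) x)%:E : \bar R).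
  by apply/measurable_EFinP; apply: measurable_indic; exact: measurable_cube.
have mci : measurable_fun setT (fun x : 'rV[R]_n => ((C `^ q)%:E * (\1_(cube N) x)%:E)%E : \bar R).
  exact: measurable_funeM.
have mfq := measurable_powq (q := q) mf.
apply: (@le_lt_trans _ _ (\int[vol]_x ((C `^ q)%:E * (\1_(cube N) x)%:E))%E).
  apply: ge0_le_integral => //.
  move=> x _; rewrite -EFinM lee_fin indicE.
  have [xN|xN] := boolP (x \in cube N); first by rewrite mulr1 (ler_powq q1).
  rewrite mulr0; have [->|/fs/mem_set] := eqVneq (f x) 0; last by rewrite (negbTE xN).
  by rewrite normr0 powR0// gt_eqF.
rewrite ge0_integralZl//; last by rewrite lee_fin powR_ge0.
rewrite integral_indic//; last exact: measurable_cube.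
by rewrite setIT lte_mul_pinfty// ?lee_fin ?powR_ge0// vol_cube.
Qed.

(** Test functions are dense in L^q. *)
Theorem test_dense (P : L -> Prop) :
  (forall phi, test_function phi -> P (Lcls q1 phi)) ->
  (forall c u v, P u -> P v -> P (c *: u + v)) ->
  (forall (u_ : nat -> L) u, (forall j, P (u_ j)) -> u_ j @[j --> \oo] --> u -> P u) ->
  forall v, P v.
Proof.
move=> Pt Pl Pc v.
have h C N f : bms C N f -> P (Lcls q1 f).
  apply: (@monotone_class R n (fun f => P (Lcls q1 f))) => //.
  - move=> c g g' [C1 [N1 /bms_Lfun b1]] [C2 [N2 /bms_Lfun b2]] h1 h2.
    by rewrite LclsD ?LclsZ//; [exact: Pl|exact: LfunZ].
  - move=> C1 N1 f_ g b_ b cf h1; apply: (Pc (fun j => Lcls q1 (f_ j)) _ h1).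
    have [mg _ _] := b.
    have bdom := bms_cube N1 (bms_ge0 b).
    have mf_ j : measurable_fun setT (f_ j) by have [] := b_ j.
    exact: (Lcls_dominated mf_ mg (bms_Lfun bdom) (fun j x => bms_le x (b_ j)) cf).
rewrite -(Lcls_Lfn v); have mv := measurable_Lfn v.
pose E (j : nat) := [set x | `|Lfn v x| <= j%:R] `&` cube j.
have mE j : measurable (E j).
  apply: measurableI; last exact: measurable_cube.
  rewrite -[X in measurable X]setTI; apply: measurable_fun_le => //.
  exact: measurableT_comp.
pose v_ (j : nat) x := Lfn v x * \1_(E j) x.
have mv_ j : measurable_fun setT (v_ j) by apply: measurable_funM => //; exact: measurable_indic.
apply: (Pc (fun j => Lcls q1 (v_ j))).
  move=> j; apply: (h j%:R j); split => //.
    move=> x; rewrite /v_ indicE; have [/set_mem[xE _]|xE] := boolP (x \in E j).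
      by rewrite mulr1.
    by rewrite mulr0 normr0.
  move=> x; rewrite /v_ indicE; have [/set_mem[_ xE]//|xE] := boolP (x \in E j).
  by rewrite mulr0 eqxx.
have vL : (fun x => `|Lfn v x|) \in Lfun vol q%:E.
  apply: Lfun_powq; first exact: measurableT_comp.
  under eq_integral do rewrite normr_id.
  by rewrite -normLqE ltry.
apply: (Lcls_dominated mv_ mv vL) => [j x|x].
  rewrite /v_ normrM ler_piMr// indicE; case: (x \in _); rewrite ?normr1 ?normr0//.
apply: (@cvg_trans _ ((fun=> Lfn v x) @ \oo)); last exact: cvg_cst.
have [N xN] := in_cube x.
apply: near_eq_cvg; exists (N + Num.bound `|Lfn v x|)%N => // j /= jN.
rewrite /v_ indicE mem_set ?mulr1//; split.
  rewrite /= (le_trans (ltW (archi_boundP (normr_ge0 _))))// ler_nat.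
  by rewrite (leq_trans _ jN)// leq_addl.
by apply: cube_le xN; rewrite (leq_trans _ jN)// leq_addr.
Qed.

End weak_derivatives.

Section integration_by_parts.
Context {R : realType} {n : nat}.
Local Notation vol := (@lebesgue_rV R n).
Implicit Types (f g phi psi : 'rV[R]_n -> R).
Local Notation e_ i := (delta_mx 0 i : 'rV[R]_n).

(* Mean value theorem along a coordinate direction. *)
Lemma pderiv_MVT i f g x (h : R) : has_pderiv i f g -> 0 < h ->
  exists2 c, 0 < c < h & f (x + h *: e_ i) - f x = g (x + c *: e_ i) * h.
Proof.
move=> fg h0.
have hd (s : R) : is_derive s 1 (fun s : R => f (x + s *: e_ i)) (g (x + s *: e_ i)).
  exact: (@is_derive_line R 'rV[R]_n R f (e_ i) g x s fg).
have [c ch E] := @MVT R (fun s => f (x + s *: e_ i)) (fun s => g (x + s *: e_ i)) 0 h h0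
   (fun s _ => hd s) (derivable_within_continuous (fun s _ => @ex_derive _ _ _ _ _ _ _ (hd s))).
move: E; rewrite scale0r addr0 subr0 => E.
by exists c => //; move: ch; rewrite in_itv.
Qed.

(* The integral of a derivative vanishes, as the limit of the integrals of the
   difference quotients, which vanish by translation invariance. *)
Lemma integral_pderiv0 i f g N : has_pderiv i f g -> continuous f -> continuous g ->
  supp_in N f -> \int[vol]_x g x = 0.
Proof.
move=> fg cf cg sf.
have sg := supp_in_pderiv fg sf.
have [C C0 gC] := supp_in_bounded cg sg.
have [Cf Cf0 fC] := supp_in_bounded cf sf.
have mf := continuous_measurable_rV cf; have mg := continuous_measurable_rV cg.
have wf := bms_weight (And3 mf fC sf).
have fi : vol.-integrable setT (EFin \o f).
  apply/integrableP; split; first exact/measurable_EFinP.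
  by have [_ _ h] := wf; apply: le_lt_trans h _; rewrite ltry.
pose h (k : nat) : R := @harmonic R k.
have h0 k : 0 < h k by rewrite /h /harmonic/= invr_gt0 ltr0n.
pose Q k x := (h k)^-1 * (f (x + h k *: e_ i) - f x).
have mft z : measurable_fun setT (fun x : 'rV[R]_n => f (x + z)).
  exact: (measurableT_comp mf (measurable_rV_translation z)).
have fit z : vol.-integrable setT (EFin \o (fun x : 'rV[R]_n => f (x + z))).
  apply/integrableP; split; first exact/measurable_EFinP.
  by have [_ _ hh] := weight_translation z wf; apply: le_lt_trans hh _; rewrite ltry.
have Q0 k : \int[vol]_x Q k x = 0.
  rewrite /Q RintegralZl//; last first.
    have := integrableB measurableT (fit (h k *: e_ i)) fi.
    by apply: eq_integrable.
  by rewrite RintegralB// (integral_translation (h k *: e_ i) mf) subrr mulr0.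
have bQ k : bms C N.+1 (Q k).
  split.
  - by apply: measurable_funM => //; apply: measurable_funB.
  - move=> x; have [c _ E] := pderiv_MVT x fg (h0 k).
    by rewrite /Q E [X in `|_ * X|]mulrC mulKf ?gt_eqF.
  - move=> x Qx; have [fx|/sf] := eqVneq (f x) 0; last exact: cube_le.
    have : f (x + h k *: e_ i) != 0.
      by apply: contra_neq Qx => fx'; rewrite /Q fx fx' subrr mulr0.
    move=> /sf hx j; have := hx j; rewrite !mxE.
    have : `|h k * ((0 == 0 :> 'I_1) && (j == i))%:R| <= 1.
      rewrite normrM mulr_ile1//.
        by rewrite ger0_norm ?(ltW (h0 k))// /h /harmonic/= invf_le1 ?ltr0n// ler1n.
      by rewrite ger0_norm// (ler_nat R _ 1) leq_b1.
    move=> d1 d2; rewrite -natr1.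
    by have := ler_normB (x 0 j + h k * ((0 == 0 :> 'I_1) && (j == i))%:R) (h k * ((0 == 0 :> 'I_1) && (j == i))%:R); rewrite addrK; lra.
have := @dominated_convergence _ _ _ vol setT measurableT
  (fun k x => (Q k x)%:E) (fun x => (g x)%:E)
  (fun x => (C * \1_(cube N.+1) x)%:E).
have bdom : bms C N.+1 (fun x : 'rV[R]_n => C * \1_(cube N.+1) x) by exact: bms_cube.
case => //.
- by move=> k; apply/measurable_EFinP; have [] := bQ k.
- exact/measurable_EFinP.
- apply: aeW => x _; apply/fine_cvgP; split; first exact: nearW.
  have /is_deriveE := fg x => gx.
  have : h k @[k --> \oo] --> (0 : R)^'.
    move=> A; rewrite /dnbhs => hA.
    have H : \forall k \near \oo, h k != 0 -> A (h k) by exact: cvg_harmonic hA.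
    rewrite nbhs_filterE /fmap/=; apply: filterS H => k hk.
    by apply: hk; rewrite gt_eqF.
  move=> hk; have := cvg_comp _ _ hk gx.
  apply: cvg_trans; apply: near_eq_cvg; apply: nearW => k.
  by rewrite /Q /= [_ + x]addrC.
- have [m1 _ w] := bms_weight bdom; apply/integrableP; split; first exact/measurable_EFinP.
  by apply: le_lt_trans w _; rewrite ltry.
- by apply: aeW => x k _; rewrite abse_EFin lee_fin; exact: bms_le.
move=> gi _.
have fin := integrable_fin_num measurableT gi.
rewrite -(fineK fin) => /fine_cvgP[_] H.
have H' : (fun k : nat => \int[vol]_x Q k x) @ \oo --> \int[vol]_x g x := H.
have e0 : (fun k : nat => \int[vol]_x Q k x) = fun=> 0 by apply/funext => k; exact: Q0.
by rewrite e0 in H'; exact: (cvg_unique (@Rhausdorff R) H' (cvg_cst _)).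
Qed.

Lemma integration_by_parts i f df phi N : has_pderiv i f df -> continuous f -> continuous df ->
  smooth phi -> supp_in N phi ->
  \int[vol]_x (f x * pderiv i phi x) = - \int[vol]_x (df x * phi x).
Proof.
move=> fdf cf cdf sphi suphi.
have cphi := smooth_continuous sphi.
have cdphi := smooth_continuous (smooth_pderiv i sphi).
have hdphi := smooth_has_pderiv i sphi.
have sudphi := supp_in_pderiv hdphi suphi.
have int0 : \int[vol]_x (df x * phi x + f x * pderiv i phi x) = 0.
  apply: (@integral_pderiv0 i (fun x => f x * phi x) _ N).
  - exact: has_pderivM.
  - exact: (@contM R 'rV[R]_n).
  - by apply: (@contD R 'rV[R]_n); exact: (@contM R 'rV[R]_n).
  - by move=> x; rewrite mulf_eq0 negb_or => /andP[_ /suphi].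
have integ (u v : 'rV[R]_n -> R) : continuous u -> continuous v -> supp_in N v ->
    vol.-integrable setT (EFin \o (fun x => u x * v x)).
  move=> cu cv sv.
  have cuv : continuous (fun x => u x * v x) by exact: (@contM R 'rV[R]_n).
  have suv : supp_in N (fun x => u x * v x).
    by move=> x; rewrite mulf_eq0 negb_or => /andP[_ /sv].
  have [C _ hC] := supp_in_bounded cuv suv.
  have [m _ w] := bms_weight (And3 (continuous_measurable_rV cuv) hC suv).
  apply/integrableP; split; first exact/measurable_EFinP.
  by apply: le_lt_trans w _; rewrite ltry.
move: int0; rewrite RintegralD//; [|exact: integ|exact: integ].
by move=> /eqP; rewrite addrC addr_eq0 => /eqP.
Qed.

End integration_by_parts.

Section weak_derivative_algebra.
Context {R : realType} {n : nat} {q : R} (q1 : (1 <= q%:E)%E).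
Local Notation vol := (@lebesgue_rV R n).
Local Notation L := (Lq n q1).
Implicit Types (f g k phi psi : 'rV[R]_n -> R) (u v w : L) (l m : 'I_n -> nat).

Lemma wdE l u v : is_weak_deriv l u v <->
  forall phi, test_function phi -> Lpair u (mderiv l phi) = (-1) ^+ morder l * Lpair v phi.
Proof. by []. Qed.

Lemma sgnK j (x y : R) : x = (-1) ^+ j * y -> y = (-1) ^+ j * x.
Proof. by move=> ->; rewrite mulrA -exprD addnn -mul2n exprM sqrrN expr1n expr1n mul1r. Qed.

Lemma wd_unique l u v w : is_weak_deriv l u v -> is_weak_deriv l u w -> v = w.
Proof.
move=> /wdE uv /wdE uw; apply: Lpair_eq => phi tphi.
by have := uv phi tphi; rewrite (uw phi tphi) => /sgnK ->; rewrite mulrA -exprD addnn -mul2n exprM sqrrN expr1n expr1n mul1r.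
Qed.

Lemma weak_derivE l u v : is_weak_deriv l u v -> weak_deriv l u = v.
Proof.
move=> uv; rewrite /weak_deriv; apply: (wd_unique (l := l) (u := u)) => //.
exact: (xgetI 0 uv).
Qed.

Lemma weak_derivP l u : (exists v, is_weak_deriv l u v) -> is_weak_deriv l u (weak_deriv l u).
Proof. by move=> [v uv]; rewrite (weak_derivE uv). Qed.

Lemma wd_lin l c u v u' v' : is_weak_deriv l u v -> is_weak_deriv l u' v' ->
  is_weak_deriv l (c *: u + u') (c *: v + v').
Proof.
move=> /wdE uv /wdE uv'; apply/wdE => phi tphi.
have [C [D w]] := test_weight tphi; have [C' [D' w']] := test_weight (test_mderiv l tphi).
rewrite (LpairD _ _ w) (LpairD _ _ w') (LpairZ _ _ w) (LpairZ _ _ w') uv// uv'//.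
by ring.
Qed.

Lemma Lpair_cvg C D phi (u_ : nat -> L) u : weight C D phi -> u_ j @[j --> \oo] --> u ->
  Lpair (u_ j) phi @[j --> \oo] --> Lpair u phi.
Proof.
move=> w /cvgrPdist_lt uu; apply/cvgrPdist_lt => e e0.
have [C0 D0] := weight_ge0 w.
have CD : 0 < C + D + 1 by rewrite ltr_wpDl// addr_ge0.
have := uu (e / (C + D + 1)) (divr_gt0 e0 CD); apply: filterS => j hj.
rewrite -(LpairB _ _ w); apply: le_lt_trans (Lpair_bound _ w) _.
apply: (@le_lt_trans _ _ (`|u - u_ j| * (C + D + 1))); first by rewrite ler_wpM2l// lerDl.
by rewrite -ltr_pdivlMr.
Qed.

Lemma wd0 u : is_weak_deriv (fun=> 0%N) u u.
Proof.
by apply/wdE => phi _; rewrite mderiv0 /morder big1// expr0 mul1r.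
Qed.

Lemma morderD l m : morder (fun i => l i + m i)%N = (morder l + morder m)%N.
Proof. by rewrite /morder big_split. Qed.

Lemma morder_mono (i : 'I_n) : morder (mono i) = 1%N.
Proof.
rewrite /morder (bigD1 i)//= /mono eqxx big1 ?addn0// => j ji.
by rewrite (negbTE ji).
Qed.

Lemma wd_comp l m u v w : is_weak_deriv m u v -> is_weak_deriv l v w ->
  is_weak_deriv (fun i => l i + m i)%N u w.
Proof.
move=> /wdE uv /wdE vw; apply/wdE => phi tphi; have [sphi _] := tphi.
rewrite (_ : (fun i => _) = fun i => m i + l i)%N; last by apply/funext => i; rewrite addnC.
rewrite -mderivD// uv; last exact: test_mderiv.
by rewrite vw// morderD exprD mulrA.
Qed.

Lemma wd_decomp l m u v w : is_weak_deriv m u v -> is_weak_deriv (fun i => l i + m i)%N u w ->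
  is_weak_deriv l v w.
Proof.
move=> /wdE uv /wdE uw; apply/wdE => phi tphi; have [sphi _] := tphi.
have [tl _] := test_mderiv l tphi.
have /sgnK -> := uv _ (test_mderiv l tphi).
rewrite mderivD// (_ : (fun i => _) = fun i => l i + m i)%N; last by apply/funext => i; rewrite addnC.
rewrite uw// morderD exprD mulrA [X in X * _]mulrCA -exprD addnn -mul2n exprM sqrrN expr1n.
by rewrite expr1n mulr1.
Qed.

Lemma conv_wd K k l u v : L1 K k -> is_weak_deriv l u v ->
  is_weak_deriv l (Lconv k u) (Lconv k v).
Proof.
move=> kL /wdE uv; apply/wdE => phi tphi; have [sphi _] := tphi.
have [C [D w]] := test_weight tphi; have [C' [D' w']] := test_weight (test_mderiv l tphi).
rewrite (Lpair_conv _ kL w) (Lpair_conv _ kL w').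
have bound z : `|Lpair v (fun x => phi (x + z))| <= `|v| * (C + D).
  exact: (Lpair_bound _ (weight_translation z w)).
rewrite -RintegralZl//; last exact: (integrable_conv_pair _ kL w).
apply: eq_Rintegral => z _.
rewrite -(mderiv_translation l z sphi) uv; last exact: test_translation.
by ring.
Qed.

Lemma conv_pderiv K K' k k' i v : L1 K k -> L1 K' k' -> has_pderiv i k k' ->
  continuous k -> continuous k' ->
  is_weak_deriv (mono i) (Lconv k v) (Lconv k' v).
Proof.
move=> kL kL' kk' ck ck'; apply/wdE => phi tphi; have [sphi _] := tphi.
have [_ [N sN]] := (test_functionP phi).1 tphi.
have [C [D w]] := test_weight tphi; have [C' [D' w']] := test_weight (test_pderiv i tphi).
rewrite mderiv_mono morder_mono expr1 mulN1r.
rewrite (Lpair_conv _ kL w') (Lpair_conv _ kL' w) (Lpair_conv_swap _ kL w') (Lpair_conv_swap _ kL' w).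
rewrite -mulN1r -RintegralZl//; last exact: (integrable_conv_swap _ kL' w).
apply: eq_Rintegral => y _; rewrite mulN1r -mulrN; congr (_ * _).
have ty : test_function (fun z : 'rV[R]_n => phi (z + y)) by exact: test_translation.
have [_ [M sM]] := (test_functionP _).1 ty.
rewrite (_ : (fun z => _) = fun z => k z * pderiv i (fun z : 'rV[R]_n => phi (z + y)) z); last first.
  by apply/funext => z; rewrite pderiv_translation// addrC.
rewrite (integration_by_parts kk' ck ck' (smooth_translation y sphi) sM).
by congr (- _); apply: eq_Rintegral => z _; rewrite addrC.
Qed.

(** Classical derivatives of test functions are weak derivatives. *)
Lemma Lcls_test_wd l phi : test_function phi ->
  is_weak_deriv l (Lcls q1 phi) (Lcls q1 (mderiv l phi)).
Proof.
move=> tphi; have [C [N bphi]] := test_bms tphi.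
have tl := test_mderiv l tphi; have [C' [N' bl]] := test_bms tl.
have [mphi _ _] := bphi; have [ml _ _] := bl.
apply/wdE => psi tpsi.
have [Cp [Np [mpsi _ _]]] := test_bms tpsi.
have [Cq [Nq [mlpsi _ _]]] := test_bms (test_mderiv l tpsi).
rewrite !Lpair_Lcls//; [|exact: (bms_Lfun q1 bl)|exact: (bms_Lfun q1 bphi)].
have -> : morder l = size (mseq l).
  rewrite /morder /mseq size_flatten /shape -map_comp sumnE big_map big_enum/=.
  by apply: eq_bigr => i _; rewrite /= size_nseq.
rewrite !mderivE; move: (mseq l) => s; clear -tphi tpsi.
have [sphi _] := tphi; have [spsi [N sN]] := (test_functionP psi).1 tpsi.
elim: s phi tphi sphi => [|i s IH] phi tphi sphi; first by rewrite /= expr0 mul1r.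
rewrite [foldr _ psi _]/= [size _]/=.
have cphi := smooth_continuous sphi.
have sNs : supp_in N (foldr pderiv psi s).
  elim: s {IH} => [|j s IH]; first exact: sN.
  by apply: supp_in_pderiv IH; apply: smooth_has_pderiv; exact: smooth_foldr.
rewrite (integration_by_parts (smooth_has_pderiv i sphi) cphi
  (smooth_continuous (smooth_pderiv i sphi)) (smooth_foldr s spsi) sNs).
rewrite IH; [|exact: test_pderiv|exact: smooth_pderiv].
rewrite -(pderiv_foldr i s sphi) exprS mulN1r mulNr.
by [].
Qed.

End weak_derivative_algebra.

(** * Gaussian kernels *)

Section gauss_kernel.
Context {R : realType} {n : nat}.
Local Notation vol := (@lebesgue_rV R n).
Implicit Types (B C M P : 'M[R]_n) (x y : 'rV[R]_n).
Local Notation e_ i := (delta_mx 0 i : 'rV[R]_n).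

Definition gauss M x : R := expR (- 4^-1 * qform M x).

Definition gauss_mass M : R := Num.sqrt ((4 * pi) ^+ n / \det M).

Definition gk B x : R := (Num.sqrt ((4 * pi) ^+ n * \det B))^-1 * gauss (invmx B) x.

Lemma gauss_gt0 M x : 0 < gauss M x. Proof. exact: expR_gt0. Qed.

Lemma continuous_gauss M : continuous (gauss M).
Proof.
apply: (@cont_comp R 'rV[R]_n); first exact: continuous_expR.
by apply: (@contM R 'rV[R]_n); [exact: cont_cst|exact: continuous_qform].
Qed.

Lemma continuous_gk B : continuous (gk B).
Proof. by apply: (@contM R 'rV[R]_n); [exact: cont_cst|exact: continuous_gauss]. Qed.

Lemma pi4_gt0 : 0 < (4 * pi) ^+ n :> R.
Proof. by rewrite exprn_gt0// mulr_gt0// pi_gt0. Qed.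

Lemma posdef_det M : posdef M -> 0 < \det M.
Proof. by move=> /integral_gauss[]. Qed.

Lemma qformZ c M x : qform (c *: M) x = c * qform M x.
Proof. by rewrite /qform -scalemxAl -scalemxAr mxE. Qed.

Lemma qformD M P x : qform (M + P) x = qform M x + qform P x.
Proof. by rewrite /qform mulmxDl mulmxDr mxE. Qed.

Lemma invmxZ' c B : c != 0 -> posdef B -> invmx (c *: B) = c^-1 *: invmx B.
Proof.
move=> c0 pB; have uB := posdef_unit pB.
rewrite -[LHS]mulmx1 -(mulmxV uB) -[X in _ *m (X *m _)]scale1r -(mulVf c0) -scalerA.
rewrite -scalemxAl -scalemxAr mulmxA mulVmx ?mul1mx//.
by rewrite unitmxE detZ unitrM unitrX ?unitfE// -unitfE -unitmxE.
Qed.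

Lemma gauss_integral M : posdef M -> (\int[vol]_x (gauss M x)%:E = (gauss_mass M)%:E)%E.
Proof. by move=> /integral_gauss[]. Qed.

Lemma L1_gauss M : posdef M -> L1 (gauss_mass M) (gauss M).
Proof.
move=> pM; split; first exact: (continuous_measurable_rV (@continuous_gauss M)).
by under eq_integral do rewrite ger0_norm ?(ltW (gauss_gt0 _ _))//; rewrite gauss_integral.
Qed.

Lemma gk_gt0 B x : posdef B -> 0 < gk B x.
Proof.
by move=> pB; rewrite mulr_gt0 ?gauss_gt0// invr_gt0 sqrtr_gt0 mulr_gt0 ?pi4_gt0// posdef_det.
Qed.

Lemma L1_scale K c k : L1 K k -> L1 (`|c| * K) (fun x : 'rV[R]_n => c * k x).
Proof.
move=> [mk kK]; split; first exact: measurable_funM.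
under eq_integral do rewrite normrM EFinM.
rewrite ge0_integralZl//; last by apply/measurable_EFinP; exact: measurableT_comp.
by rewrite EFinM lee_wpmul2l.
Qed.

Lemma L1_gk B : posdef B -> L1 1 (gk B).
Proof.
move=> pB; have := L1_scale (Num.sqrt ((4 * pi) ^+ n * \det B))^-1 (L1_gauss (posdef_inv pB)).
congr L1; have dB := posdef_det pB.
rewrite ger0_norm ?invr_ge0 ?sqrtr_ge0// /gauss_mass det_inv invrK mulVf//.
by rewrite gt_eqF// sqrtr_gt0 mulr_gt0 ?pi4_gt0.
Qed.

Lemma gk_integral B : posdef B -> \int[vol]_x gk B x = 1.
Proof.
move=> pB; have pM := posdef_inv pB; have dB := posdef_det pB.
rewrite /gk RintegralZl//; last exact: L1_integrable (L1_gauss pM).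
rewrite /Rintegral gauss_integral//= /gauss_mass det_inv invrK mulVf//.
by rewrite gt_eqF// sqrtr_gt0 mulr_gt0 ?pi4_gt0.
Qed.

Lemma sqr_expR_le (s : R) : 0 <= s -> (1 + s) ^+ 2 * expR (- 4^-1 * s) <= 8 * (8 * 8) * expR (- 8^-1 * s).
Proof.
move=> s0.
have -> : expR (- 4^-1 * s) = expR (8^-1) * expR (- (8^-1 * (1 + s))) * expR (- 8^-1 * s).
  by rewrite -!expRD; congr expR; field.
rewrite !mulrA ler_wpM2r ?expR_ge0//.
have y0 : 0 < 8^-1 * (1 + s) by rewrite mulr_gt0 ?invr_gt0//; lra.
have := powexp_le 2 y0; set E := expR (- _) => h.
have e8 : expR (8^-1 : R) <= 2.
  have : expR (- 8^-1 : R) >= 1 - 8^-1 by have := expR_ge1Dx (- 8^-1 : R).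
  rewrite expRN => h8; have e0 := expR_gt0 (8^-1 : R).
  by rewrite -(invrK (expR _)) -[leRHS]invrK lef_pV2 ?posrE ?invr_gt0//; lra.
have -> : (1 + s) ^+ 2 * expR 8^-1 * E = 64 * expR 8^-1 * ((8^-1 * (1 + s)) ^+ 2 * E) by field.
have e0 := expR_gt0 (8^-1 : R).
have z0 : 0 <= (8^-1 * (1 + s)) ^+ 2 * E by rewrite mulr_ge0 ?expR_ge0// sqr_ge0.
have := ler_pM (ltW e0) z0 e8 h; lra.
Qed.

Definition gauss_cst M : R := 8 * (8 * 8) * gauss_mass (2^-1 *: M).

(** A quadratic polynomial in the exponent is absorbed at the cost of a wider
   Gaussian. *)
Lemma gauss_dominated M (c : R) (f : 'rV[R]_n -> R) : posdef M -> measurable_fun setT f ->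
  (forall x, `|f x| <= c * ((1 + qform M x) ^+ 2 * gauss M x)) -> L1 (c * gauss_cst M) f.
Proof.
move=> pM; have pM2 : posdef (2^-1 *: M) by apply: posdefZ.
rewrite /gauss_cst; pose w : R := 8 * (8 * 8); have w0 : 0 <= w by rewrite /w !mulr_ge0.
rewrite -/w; move=> mf hf; split => //.
have c0 : 0 <= c.
  have := le_trans (normr_ge0 _) (hf 0).
  by rewrite pmulr_lge0// mulr_gt0 ?gauss_gt0// exprn_gt0// ltr_wpDr// qform_ge0.
have [mg gK] := L1_scale (c * w) (L1_gauss pM2).
apply: le_trans (_ : _ <= \int[vol]_x `|c * w * gauss (2^-1 *: M) x|%:E)%E _.
  apply: ge0_le_integral => //.
  - by apply/measurable_EFinP; exact: measurableT_comp.
  - by apply/measurable_EFinP; exact: measurableT_comp.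
  move=> x _; rewrite lee_fin (le_trans (hf x))// (le_trans _ (ler_norm _))//.
  rewrite -mulrA ler_wpM2l// /gauss qformZ mulrA.
  rewrite (_ : - 4^-1 * 2^-1 = - 8^-1 :> R); last by field.
  exact/sqr_expR_le/qform_ge0.
by apply: le_trans gK _; rewrite lee_fin ger0_norm ?mulr_ge0// mulrA.
Qed.

Lemma has_pderiv_comp i (f df : 'rV[R]_n -> R) (g dg : R -> R) : has_pderiv i f df ->
  (forall t : R, is_derive t 1 g (dg t)) -> has_pderiv i (fun x => g (f x)) (fun x => dg (f x) * df x).
Proof.
move=> hf hg x; pose p (s : R) := f (s *: e_ i + x).
have hp : is_derive (0 : R) 1 p (df x).
  apply/is_deriveE; have /is_deriveE := hf x; apply: cvg_trans; apply: near_eq_cvg; apply: nearW => h.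
  by rewrite /p addr0 [h *: 1]mulr1 scale0r add0r.
have hgp : is_derive (p 0) 1 g (dg (p 0)) by exact: hg.
have H : is_derive (0 : R) 1 (g \o p) (dg (f x) * df x).
  by apply: is_derive_eq (is_derive1_comp hgp hp) _; rewrite /p scale0r add0r /GRing.scale/=; ring.
have /is_deriveE := H; move=> {}H; apply/is_deriveE; move: H; rewrite /p.
apply: cvg_trans; apply: near_eq_cvg; apply: nearW => h /=.
by rewrite addr0 [h *: 1]mulr1 scale0r add0r.
Qed.

Lemma mulmx_delta i M x : (x *m (M *m (e_ i)^T)) 0 0 = (x *m M) 0 i.
Proof.
rewrite mulmxA mxE (bigD1 i)//= big1 ?addr0 => [|j ji]; first by rewrite !mxE !eqxx mulr1.
by rewrite !mxE (negbTE ji) andbF mulr0.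
Qed.

Lemma qform_delta i M : qform M (e_ i) = M i i.
Proof. by rewrite /qform mulmx_delta -rowE mxE. Qed.

Lemma has_pderiv_qform i M : M^T = M -> has_pderiv i (qform M) (fun x => 2 * (x *m M) 0 i).
Proof.
move=> sM x; apply/is_deriveE.
apply: (@cvg_trans _ ((fun h : R => 2 * (x *m M) 0 i + h * M i i) @ (0 : R)^')); last first.
  have L : 2 * (x *m M) 0 i + h * M i i @[h --> (0 : R)^'] --> 2 * (x *m M) 0 i + 0 * M i i.
    apply: cvgD; first exact: cvg_cst.
    by apply: cvgMl; apply: cvg_within_filter; exact: cvg_id.
  by rewrite mul0r addr0 in L.
apply: near_eq_cvg; near=> h.
have h0 : h != 0 by near: h; exact: nbhs_dnbhs_neq.
have E2 : (e_ i *m (M *m x^T)) 0 0 = (x *m M) 0 i.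
  rewrite -mulmx_delta; transitivity ((e_ i *m (M *m x^T))^T 0 0); first by rewrite [RHS]mxE.
  by rewrite !trmx_mul trmxK sM -mulmxA.
have E3 : (e_ i *m (M *m (e_ i)^T)) 0 0 = M i i := qform_delta i M.
have -> : qform M (h *: e_ i + x) = h * (h * M i i) + h * (x *m M) 0 i + (h * (x *m M) 0 i + qform M x).
  rewrite /qform linearD/= linearZ/= mulmxDl !mulmxDr -!scalemxAl -!scalemxAr.
  by rewrite -E3 -{1}E2 -mulmx_delta !mxE.
rewrite /GRing.scale/=; field.
exact: h0.
Unshelve. all: by end_near.
Qed.

Lemma has_pderiv_gauss i M : M^T = M ->
  has_pderiv i (gauss M) (fun x => - 2^-1 * (x *m M) 0 i * gauss M x).
Proof.
move=> sM.
have h (t : R) : is_derive t 1 (fun t => expR (- 4^-1 * t)) (expR (- 4^-1 * t) * - 4^-1).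
  have e : is_derive (- 4^-1 * t) 1 expR (expR (- 4^-1 * t)) by exact: is_derive_expR.
  have l : is_derive t 1 (fun t : R => - 4^-1 * t) (- 4^-1 : R).
    by apply: is_derive_eq; rewrite /GRing.scale/= mulr1.
  exact: (is_derive1_comp e l).
move=> x; have := has_pderiv_comp (has_pderiv_qform i sM) h x.
by congr is_derive; rewrite /gauss; field.
Qed.

Lemma continuous_mulmx_coord i M : continuous (fun x : 'rV[R]_n => (x *m M) 0 i).
Proof.
rewrite (_ : (fun x => _) = fun x : 'rV[R]_n => \sum_j x 0 j * M j i); last first.
  by apply/funext => x; rewrite mxE.
apply: (@cont_sum R 'rV[R]_n) => j.
by apply: (@contM R 'rV[R]_n); [exact: continuous_coord|exact: cont_cst].
Qed.

Lemma mulmx_coord_le i M x : posdef M -> `|(x *m M) 0 i| <= Num.sqrt (M i i) * (1 + qform M x).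
Proof.
move=> pM; have := @qform_CS R n M x (e_ i) pM.
rewrite mulmx_delta qform_delta => h; have q0 := qform_ge0 x pM.
have Mi0 : 0 <= M i i by rewrite -qform_delta qform_ge0.
have m0 : 0 <= Num.sqrt (M i i) * (1 + qform M x) by rewrite mulr_ge0 ?sqrtr_ge0//; lra.
rewrite -(@ler_pXn2r _ 2) ?nnegrE// real_normK ?num_real// (le_trans h)//.
rewrite exprMn sqr_sqrtr// mulrC ler_wpM2l//; nra.
Qed.

Lemma L1_pderiv_gk i B : posdef B -> exists K k,
  [/\ L1 K k, continuous k & has_pderiv i (gk B) k].
Proof.
move=> pB; have pM := posdef_inv pB.
set M := invmx B; set c := (Num.sqrt ((4 * pi) ^+ n * \det B))^-1.
have c0 : 0 <= c by rewrite invr_ge0 sqrtr_ge0.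
pose k x := c * (- 2^-1 * (x *m M) 0 i * gauss M x).
have ck : continuous k.
  apply: (@contM R 'rV[R]_n); first exact: cont_cst.
  apply: (@contM R 'rV[R]_n); last exact: continuous_gauss.
  apply: (@contM R 'rV[R]_n); [exact: cont_cst|exact: continuous_mulmx_coord].
exists (c * Num.sqrt (M i i) * gauss_cst M), k; split => //.
  apply: gauss_dominated => //; first exact: continuous_measurable_rV.
  move=> x; rewrite /k !normrM (ger0_norm c0) (gtr0_norm (gauss_gt0 _ _)) normrN.
  rewrite (gtr0_norm (_ : 0 < 2^-1))// -!mulrA ler_wpM2l//.
  have q0 := qform_ge0 x pM; have g0 := gauss_gt0 M x.
  rewrite !mulrA ler_wpM2r ?(ltW g0)//.
  have := mulmx_coord_le i x pM; rewrite -/M => h.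
  have s0 := sqrtr_ge0 (M i i).
  have : `|(x *m M) 0 i| <= Num.sqrt (M i i) * (1 + qform M x) ^+ 2.
    apply: le_trans h _; rewrite ler_wpM2l// expr2 ler_peMr//; lra.
  have := normr_ge0 ((x *m M) 0 i); lra.
move=> x; have := has_pderivM (has_pderiv_cst i c) (has_pderiv_gauss i pM.1) x.
by congr is_derive; rewrite mul0r add0r.
Qed.

End gauss_kernel.

(** * The Gaussian semigroup *)

Section semigroup.
Context {R : realType} {n : nat} {q : R} {q1 : (1 <= q%:E)%E}.
Local Notation vol := (@lebesgue_rV R n).
Local Notation L := (Lq n q1).
Implicit Types (k f g phi : 'rV[R]_n -> R) (u v w : L) (B M N P : 'M[R]_n).
Local Notation e_ i := (delta_mx 0 i : 'rV[R]_n).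

Lemma Lconv_lin K k c u v : L1 K k -> Lconv k (c *: u + v) = c *: Lconv k u + Lconv k v.
Proof.
move=> kL; apply: Lpair_eq => phi tphi; have [C [D w]] := test_weight tphi.
rewrite (LpairD _ _ w) (LpairZ _ _ w) !(Lpair_conv _ kL w).
have iu := integrable_conv_pair u kL w; have iv := integrable_conv_pair v kL w.
rewrite -RintegralZl// -RintegralD//; last exact: integrableZl iu.
apply: eq_Rintegral => z _; have wz := weight_translation z w.
by rewrite (LpairD _ _ wz) (LpairZ _ _ wz); ring.
Qed.

Lemma Lconv0 K k : L1 K k -> Lconv k (0 : L) = 0.
Proof.
by move=> kL; have := Lconv_lin (-1) (0 : L) 0 kL; rewrite scaler0 addr0 scaleN1r addNr.
Qed.

Lemma LconvD K k u v : L1 K k -> Lconv k (u + v) = Lconv k u + Lconv k v.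
Proof. by move=> kL; have := Lconv_lin 1 u v kL; rewrite !scale1r. Qed.

Lemma LconvZ K k c u : L1 K k -> Lconv k (c *: u) = c *: Lconv k u.
Proof. by move=> kL; have := Lconv_lin c u 0 kL; rewrite (Lconv0 kL) !addr0. Qed.

Lemma Lconv_sum K k (I : Type) (r : seq I) (F : I -> L) : L1 K k ->
  Lconv k (\sum_(i <- r) F i) = \sum_(i <- r) Lconv k (F i).
Proof.
move=> kL; elim: r => [|i r IH]; first by rewrite !big_nil (Lconv0 kL).
by rewrite !big_cons (LconvD _ _ kL) IH.
Qed.

Lemma Lconv_klin K K' k k' c v : L1 K k -> L1 K' k' ->
  L1 (`|c| * K + K') (fun x => c * k x + k' x) /\
  Lconv (fun x => c * k x + k' x) v = c *: Lconv k v + Lconv k' v.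
Proof.
move=> kL kL'; have [mk kK] := L1_scale c kL; have [mk' kK'] := kL'.
have sL : L1 (`|c| * K + K') (fun x => c * k x + k' x).
  split; first exact: measurable_funD.
  rewrite EFinD; apply: (@le_trans _ _ (\int[vol]_x (`|c * k x|%:E + `|k' x|%:E))%E).
    apply: ge0_le_integral => //.
    - by apply/measurable_EFinP; apply: measurableT_comp => //; exact: measurable_funD.
    - by apply: emeasurable_funD; apply/measurable_EFinP; exact: measurableT_comp.
    by move=> x _; rewrite -EFinD lee_fin ler_normD.
  rewrite ge0_integralD//; [exact: leeD| |].
  - by apply/measurable_EFinP; exact: measurableT_comp.
  - by apply/measurable_EFinP; exact: measurableT_comp.
split => //; apply: Lpair_eq => phi tphi; have [C [D w]] := test_weight tphi.
rewrite (LpairD _ _ w) (LpairZ _ _ w) (Lpair_conv _ kL w) (Lpair_conv _ kL' w) (Lpair_conv _ sL w).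
have iu := integrable_conv_pair v kL w; have iv := integrable_conv_pair v kL' w.
rewrite -RintegralZl// -RintegralD//; last exact: integrableZl iu.
by apply: eq_Rintegral => z _; ring.
Qed.

Lemma measurable_Lpair_translation C D phi v : weight C D phi ->
  measurable_fun setT (fun z => Lpair v (fun x => phi (x + z))).
Proof.
move=> w; have gL := L1_gauss (@posdef1 R n).
have := measurable_int _ (integrable_conv_pair v gL w) => /measurable_EFinP mi.
rewrite (_ : (fun z => _) = fun z : 'rV[R]_n => expR (4^-1 * qform 1%:M z) *
  (gauss 1%:M z * Lpair v (fun x => phi (x + z)))); last first.
  by apply/funext => z; rewrite /gauss mulrA -expRD mulNr subrr expR0 mul1r.
apply: measurable_funM => //; apply: continuous_measurable_rV.
apply: (@cont_comp R 'rV[R]_n); first exact: continuous_expR.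
by apply: (@contM R 'rV[R]_n); [exact: cont_cst|exact: continuous_qform].
Qed.

Lemma Lconv_comp K K' K'' k k' k'' v : L1 K k -> L1 K' k' -> L1 K'' k'' ->
  (forall u : 'rV[R]_n, \int[vol]_z (k z * k' (u - z)) = k'' u) ->
  Lconv k (Lconv k' v) = Lconv k'' v.
Proof.
move=> kL kL' kL'' E; apply: Lpair_eq => phi tphi; have [C [D w]] := test_weight tphi.
rewrite (Lpair_conv _ kL w) (Lpair_conv _ kL'' w).
pose m z := Lpair v (fun x => phi (x + z)).
have mm : measurable_fun setT m by exact: measurable_Lpair_translation w.
have [C0 D0] := weight_ge0 w.
pose Cm := `|v| * (C + D).
have Cm0 : 0 <= Cm by rewrite mulr_ge0// addr_ge0.
have mC z : `|m z| <= Cm by exact: Lpair_bound (weight_translation z w).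
have [mk kK] := kL; have [mk' kK'] := kL'.
have mk'z z : measurable_fun setT (fun u : 'rV[R]_n => k' (u - z)).
  exact: (measurableT_comp mk' (measurable_rV_translation (- z))).
have mk'u (u : 'rV[R]_n) : measurable_fun setT (fun z : 'rV[R]_n => k' (u - z)).
  exact: (measurableT_comp mk' (measurable_rV_reflection u)).
have inner z : Lpair (Lconv k' v) (fun x => phi (x + z)) = \int[vol]_u (k' (u - z) * m u).
  have wz := weight_translation z w.
  rewrite (Lpair_conv _ kL' wz) -(integral_translation z (f := fun u : 'rV[R]_n => k' (u - z) * m u)).
    apply: eq_Rintegral => x _; rewrite addrK; congr (_ * Lpair v _).
    by apply/funext => y; rewrite addrA.
  exact: measurable_funM.
pose F (zu : 'rV[R]_n * 'rV[R]_n) : \bar R := (k zu.1 * (k' (zu.2 - zu.1) * m zu.2))%:E.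
have mF : measurable_fun setT F.
  apply/measurable_EFinP; apply: measurable_funM.
    by apply: (measurableT_comp mk); exact: measurable_fst.
  apply: measurable_funM; last by apply: (measurableT_comp mm); exact: measurable_snd.
  have msw : measurable_fun setT (fun z : 'rV[R]_n * 'rV[R]_n => z.2 - z.1 : 'rV[R]_n).
    apply: measurable_fun_rVP => i; under eq_fun do rewrite !mxE.
    apply: measurable_funB.
      exact: (measurableT_comp (measurable_coor i) measurable_snd).
    exact: (measurableT_comp (measurable_coor i) measurable_fst).
  exact: (measurableT_comp mk' msw).
have K'0 := L1_ge0 kL'; have K0 := L1_ge0 kL.
have int1 z : (\int[vol]_u `|k' (u - z) * m u|%:E <= (K' * Cm)%:E)%E.
  apply: (@le_trans _ _ (\int[vol]_u (`|k' (u - z)|%:E * Cm%:E))%E).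
    apply: ge0_le_integral => //.
    - by apply/measurable_EFinP; apply: measurableT_comp => //; exact: measurable_funM.
    - apply: emeasurable_funM => //; apply/measurable_EFinP; exact: measurableT_comp.
    by move=> u _; rewrite -EFinM lee_fin normrM ler_wpM2l.
  rewrite ge0_integralZr//; last by apply/measurable_EFinP; exact: measurableT_comp.
  rewrite [(K' * Cm)%:E]EFinM lee_wpmul2r// (ge0_integral_translation (- z) (f := fun u : 'rV[R]_n => `|k' u|%:E))//.
  by apply/measurable_EFinP; exact: measurableT_comp.
have iz z : vol.-integrable setT (fun u : 'rV[R]_n => (k' (u - z) * m u)%:E).
  apply/integrableP; split; first by apply/measurable_EFinP; exact: measurable_funM.
  by apply: le_lt_trans (int1 z) _; rewrite ltry.
have iF : (vol \x vol)%E.-integrable setT F.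
  apply/integrable12ltyP => //.
  apply: (@le_lt_trans _ _ (\int[vol]_z (`|k z|%:E * (K' * Cm)%:E))%E).
    apply: ge0_le_integral => //.
    - by move=> z _; exact: integral_ge0.
    - apply: (@measurable_fun_fubini_tonelli_F _ _ _ _ R vol (abse \o F)).
        exact: measurableT_comp.
      by move=> z; exact: abse_ge0.
    - by apply: emeasurable_funM => //; apply/measurable_EFinP; exact: measurableT_comp.
    move=> z _; rewrite /F/=; under eq_integral do rewrite normrM EFinM.
    rewrite ge0_integralZl//; first exact: lee_wpmul2l.
    by apply/measurable_EFinP; apply: measurableT_comp => //; exact: measurable_funM.
  rewrite ge0_integralZr//; last by rewrite lee_fin mulr_ge0.
    by apply: (@le_lt_trans _ _ (K%:E * (K' * Cm)%:E)%E);
      [rewrite lee_wpmul2r// lee_fin mulr_ge0|rewrite -EFinM ltry].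
  by apply/measurable_EFinP; exact: measurableT_comp.
rewrite /Rintegral; apply: (congr1 fine).
transitivity (\int[vol]_z \int[vol]_u F (z, u))%E.
  apply: eq_integral => z _; rewrite inner /F/= EFinM /Rintegral fineK; last exact: integrable_fin_num (iz z).
  by rewrite -integralZl//; apply: eq_integral => u _; rewrite -EFinM.
rewrite (Fubini iF).
have := ae_integrable2 iF => ae2.
apply: ae_eq_integral => //.
- by have := measurable_fubini_G iF.
- have [mk'' _] := kL''; apply/measurable_EFinP; exact: measurable_funM.
apply: filterS ae2 => u iFu _; rewrite /F/= -/(m u) -E.
have [m0|m0] := eqVneq (m u) 0.
  by rewrite m0 mulr0; under eq_integral do rewrite !mulr0; rewrite integral0.
under eq_integral do rewrite mulrA EFinM.
have ikk : vol.-integrable setT (fun z => (k z * k' (u - z))%:E).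
  have := integrableZl measurableT (m u)^-1 iFu.
  by apply: eq_integrable => // z _; rewrite /F/= -EFinM; congr EFin; field.
rewrite integralZr// EFinM; congr (_ * _)%E.
by rewrite /Rintegral fineK//; exact: integrable_fin_num ikk.
Qed.

(* Completing the square. *)
Lemma gauss_square M N (x y : 'rV[R]_n) : posdef M -> posdef N ->
  gauss M y * gauss N (x - y) =
  gauss (N - N *m invmx (M + N) *m N) x * gauss (M + N) (y - x *m N *m invmx (M + N)).
Proof.
move=> pM pN; have pP := posdefD pM pN; set P := M + N.
have uP : P \in unitmx by exact: posdef_unit.
rewrite /gauss -!expRD -!mulrDr; congr (expR (_ * _)).
have sym (A : 'M[R]_n) (a b : 'rV[R]_n) : A^T = A -> (a *m (A *m b^T)) 0 0 = (b *m (A *m a^T)) 0 0.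
  move=> sA; transitivity ((a *m (A *m b^T))^T 0 0); first by rewrite [RHS]mxE.
  by rewrite !trmx_mul trmxK sA -mulmxA.
have qB (A : 'M[R]_n) (a b : 'rV[R]_n) : A^T = A ->
    qform A (a - b) = qform A a - 2 * (a *m (A *m b^T)) 0 0 + qform A b.
  move=> sA; rewrite /qform linearB/= mulmxBl !mulmxBr.
  have e (X Y Z W : 'M[R]_1) : (X - Y - (Z - W)) 0 0 = X 0 0 - Y 0 0 - (Z 0 0 - W 0 0) by rewrite !mxE.
  by rewrite e (sym A b a)//; ring.
set c := x *m N *m invmx P.
rewrite (qB N _ _ pN.1) (qB P _ _ pP.1).
have cP : c *m P = x *m N by rewrite /c -mulmxA mulVmx// mulmx1.
rewrite (sym P y c pP.1) (mulmxA c) cP -(mulmxA x).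
have -> : qform P c = qform (N *m invmx P *m N) x.
  rewrite /qform (mulmxA c) cP /c trmx_mul trmx_inv pP.1 trmx_mul pN.1.
  by rewrite !mulmxA.
have -> : qform (N - N *m invmx P *m N) x = qform N x - qform (N *m invmx P *m N) x.
  by rewrite /qform mulmxBl mulmxBr !mxE.
by rewrite /P qformD; ring.
Qed.

Lemma gk_convolution B (C : 'M[R]_n) (x : 'rV[R]_n) : posdef B -> posdef C ->
  \int[vol]_y (gk B y * gk C (x - y)) = gk (B + C) x.
Proof.
move=> pB pC; have pM := posdef_inv pB; have pN := posdef_inv pC; have pBC := posdefD pB pC.
have uB := posdef_unit pB; have uC := posdef_unit pC; have uBC := posdef_unit pBC.
have pP := posdefD pM pN; set M := invmx B in pM pP *; set N := invmx C in pN pP *.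
have uP := posdef_unit pP.
have BPC : B *m (M + N) *m C = B + C.
  by rewrite mulmxDr mulmxDl /M /N mulmxV// mul1mx -mulmxA mulVmx// mulmx1 addrC.
have inv : N - N *m invmx (M + N) *m N = invmx (B + C).
  have -> : N - N *m invmx (M + N) *m N = N *m invmx (M + N) *m M.
    transitivity (N *m invmx (M + N) *m ((M + N) - N)); last by rewrite addrK.
    by rewrite mulmxBr -(mulmxA N (invmx _) (M + N)) mulVmx ?mulmx1.
  have e : (B + C) *m (N *m invmx (M + N) *m M) = 1%:M.
    rewrite -BPC !mulmxA -(mulmxA _ C N) /N mulmxV// mulmx1 -(mulmxA B) mulmxV// mulmx1.
    by rewrite /M mulmxV.
  by rewrite -[LHS]mul1mx -(mulVmx uBC) -mulmxA e mulmx1.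
have dB := posdef_det pB; have dC := posdef_det pC; have dP := posdef_det pP; have dBC := posdef_det pBC.
have dE : \det (B + C) = \det B * \det (M + N) * \det C by rewrite -BPC !det_mulmx.
set cB := (Num.sqrt ((4 * pi) ^+ n * \det B))^-1; set cC := (Num.sqrt ((4 * pi) ^+ n * \det C))^-1.
rewrite (@eq_Rintegral _ _ _ _ _ (fun y : 'rV[R]_n => cB * cC * gauss (invmx (B + C)) x *
    gauss (M + N) (y + - (x *m N *m invmx (M + N))))); last first.
  move=> y _; rewrite /gk -/M -/N -/cB -/cC -inv.
  by have := gauss_square x y pM pN => h; rewrite -mulrA -h; ring.
have mg : measurable_fun setT (gauss (M + N)) by exact: (continuous_measurable_rV (@continuous_gauss R n _)).
have [_ iP] := integrableP _ _ _ (L1_integrable (L1_gauss pP)).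
rewrite RintegralZl//; last first.
  apply/integrableP; split.
    by apply/measurable_EFinP; exact: (measurableT_comp mg (measurable_rV_translation _)).
  rewrite (ge0_integral_translation _ (f := fun y => `|(gauss (M + N) y)%:E|%E))//.
  by apply: measurableT_comp => //; exact/measurable_EFinP.
rewrite (integral_translation _ mg) /Rintegral gauss_integral//= /gk mulrAC; congr (_ * _); rewrite /cB /cC /gauss_mass dE.
have p4 := @pi4_gt0 R n; set p := (4 * pi) ^+ n in p4 *.
apply: (@mulIf _ (Num.sqrt (p * (\det B * \det (M + N) * \det C)))).
  by rewrite gt_eqF// sqrtr_gt0 !mulr_gt0.
rewrite mulVf; last by rewrite gt_eqF// sqrtr_gt0 !mulr_gt0.
have -> : Num.sqrt (p * (\det B * \det (M + N) * \det C)) =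
    Num.sqrt (p * \det B) * Num.sqrt (p * \det C) * Num.sqrt (\det (M + N) / p).
  rewrite -!sqrtrM ?mulr_ge0 ?(ltW p4) ?(ltW dB) ?(ltW dC)//; congr Num.sqrt; field.
  by rewrite gt_eqF.
rewrite -[p / _]invf_div sqrtrV ?divr_ge0 ?ltW//.
have sB : Num.sqrt (p * \det B) != 0 by rewrite gt_eqF// sqrtr_gt0 mulr_gt0.
have sC : Num.sqrt (p * \det C) != 0 by rewrite gt_eqF// sqrtr_gt0 mulr_gt0.
have sP : Num.sqrt (\det (M + N) / p) != 0 by rewrite gt_eqF// sqrtr_gt0 divr_gt0.
move: sB sC sP; set sB := Num.sqrt _; set sC := Num.sqrt _; set sP := Num.sqrt _ => b0 c0 d0.
by field; rewrite b0 c0 d0.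
Qed.

Definition heat B v : L := Lconv (gk B) v.

Lemma heat_norm B v : posdef B -> `|heat B v| <= `|v|.
Proof. by move=> pB; rewrite -[leRHS]mul1r; exact: conv_norm (L1_gk pB). Qed.

Lemma heat_comp B (C : 'M[R]_n) v : posdef B -> posdef C -> heat B (heat C v) = heat (B + C) v.
Proof.
move=> pB pC; apply: (Lconv_comp _ (L1_gk pB) (L1_gk pC) (L1_gk (posdefD pB pC))).
by move=> u; exact: gk_convolution.
Qed.

Lemma heat_lin B c u v : posdef B -> heat B (c *: u + v) = c *: heat B u + heat B v.
Proof. by move=> pB; exact: Lconv_lin (L1_gk pB). Qed.

Lemma heat_wd B l u v : posdef B -> is_weak_deriv l u v -> is_weak_deriv l (heat B u) (heat B v).
Proof. by move=> pB; exact: conv_wd (L1_gk pB). Qed.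

Lemma morder_eq0 (l : 'I_n -> nat) : morder l = 0%N -> l = fun=> 0%N.
Proof.
move=> /eqP; rewrite /morder sum_nat_eq0 => /forallP h.
by apply/funext => i; apply/eqP; exact: (implyP (h i)).
Qed.

Lemma morder_split (l : 'I_n -> nat) j : morder l = j.+1 ->
  exists i (l' : 'I_n -> nat), l = (fun p => l' p + mono i p)%N /\ morder l' = j.
Proof.
move=> lj; have [i li] : exists i, (0 < l i)%N.
  apply/existsP; apply: contraPT lj => /existsPn h.
  by rewrite /morder big1// => k _; have := h k; rewrite -eqn0Ngt => /eqP.
exists i, (fun p => l p - mono i p)%N.
have e : l = (fun p => (l p - mono i p) + mono i p)%N.
  apply/funext => k; rewrite subnK// /mono; by case: eqVneq => [->|]//.
by split => //; have := lj; rewrite {1}e morderD morder_mono addn1 => -[].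
Qed.

(** The Gaussian kernel smoothes: split it into several, each of which absorbs one
   derivative. *)
Lemma heat_smoothing l B : posdef B -> exists2 C, 0 <= C & forall v, exists2 w,
  is_weak_deriv l (heat B v) w & `|w| <= C * `|v|.
Proof.
move: {2}(morder l) (erefl (morder l)) => j; elim: j l B => [|j IH] l B lj pB.
  exists 1 => // v; exists (heat B v); last by rewrite mul1r heat_norm.
  by rewrite (morder_eq0 lj); exact: wd0.
have [i [l' [-> l'j]]] := morder_split lj.
have pB2 : posdef (2^-1 *: B) by apply: posdefZ.
have [C C0 hC] := IH l' _ l'j pB2.
have [K [k [kL ck hk]]] := L1_pderiv_gk i pB2.
have K0 := L1_ge0 kL.
exists (C * K); first exact: mulr_ge0.
move=> v; have [w hw wle] := hC (Lconv k v).
exists w; last by rewrite (le_trans wle)// -mulrA ler_wpM2l// (conv_norm _ kL).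
have -> : heat B v = heat (2^-1 *: B) (heat (2^-1 *: B) v).
  have h2 : 2^-1 + 2^-1 = 1 :> R by field.
  by rewrite (heat_comp v pB2 pB2) -scalerDl h2 scale1r.
apply: wd_comp hw; apply: heat_wd => //.
exact: conv_pderiv (L1_gk pB2) kL hk (@continuous_gk R n _) ck.
Qed.

End semigroup.

(** * Identities in vector spaces *)

Section linear_expressions.
Context {R : realType} {V : lmodType R}.

(** Linear expressions over a list of vectors, so that an identity of vectors
   reduces to identities between the coefficients. *)
Inductive lexp := LVar of nat | LZero | LAdd of lexp & lexp | LOpp of lexp
  | LScale of R & lexp.

Fixpoint leval (s : seq V) e : V :=
  match e with
  | LVar i => s`_i | LZero => 0 | LAdd e1 e2 => leval s e1 + leval s e2
  | LOpp e1 => - leval s e1 | LScale c e1 => c *: leval s e1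
  end.

Fixpoint lcoef (i : nat) e : R :=
  match e with
  | LVar j => if i == j then 1 else 0 | LZero => 0
  | LAdd e1 e2 => lcoef i e1 + lcoef i e2
  | LOpp e1 => - lcoef i e1 | LScale c e1 => c * lcoef i e1
  end.

Lemma levalE s e : leval s e = \sum_(i < size s) lcoef i e *: s`_i.
Proof.
elim: e => [j||e1 IH1 e2 IH2|e1 IH1|c e1 IH1] /=.
- have [js|js] := ltnP j (size s); last first.
    rewrite nth_default// big1// => i _; rewrite ifF ?scale0r//.
    by apply: contra_leqF js => /eqP <-.
  rewrite (bigD1 (Ordinal js))//= eqxx scale1r big1 ?addr0// => i /negbTE ij.
  by rewrite ifF ?scale0r//; apply/negbTE; apply: contraFneq ij => ij; apply/eqP/val_inj.
- by rewrite big1// => i _; rewrite scale0r.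
- by rewrite IH1 IH2 -big_split/=; apply: eq_bigr => i _; rewrite scalerDl.
- by rewrite IH1 -sumrN; apply: eq_bigr => i _; rewrite scaleNr.
- by rewrite IH1 scaler_sumr; apply: eq_bigr => i _; rewrite scalerA.
Qed.

Fixpoint lcoef_eq (k : nat) e1 e2 : Prop :=
  if k is k'.+1 then lcoef k' e1 = lcoef k' e2 /\ lcoef_eq k' e1 e2 else True.

Lemma leval_eq s e1 e2 : lcoef_eq (size s) e1 e2 -> leval s e1 = leval s e2.
Proof.
move=> h; rewrite !levalE; apply: eq_bigr => i _; congr (_ *: _).
elim: (size s) i h => [[]//|k IH] i [h1 h2].
have [ik|ik] := ltnP i k; first exact: (IH (Ordinal ik)).
by rewrite (_ : (i : nat) = k)//; apply/eqP; rewrite eqn_leq ik -ltnS ltn_ord.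
Qed.

End linear_expressions.

Ltac lmem x s := match s with
  | nil => constr:(false) | (x :: _)%SEQ => constr:(true) | (_ :: ?s')%SEQ => lmem x s' end.
Ltac lindex x s := match s with
  | (x :: _)%SEQ => constr:(0%N) | (_ :: ?s')%SEQ => let i := lindex x s' in constr:(i.+1) end.
Ltac lvars t s := match t with
  | @Algebra.add _ ?a ?b => let s' := lvars a s in lvars b s'
  | @Algebra.opp _ ?a => lvars a s
  | @GRing.scale _ _ _ ?a => lvars a s
  | @Algebra.zero _ => s
  | _ => let b := lmem t s in match b with true => s | false => constr:((t :: s)%SEQ) end end.
Ltac lreify R t s := match t with
  | @Algebra.add _ ?a ?b => let x := lreify R a s in let y := lreify R b s in constr:(@LAdd R x y)
  | @Algebra.opp _ ?a => let x := lreify R a s in constr:(@LOpp R x)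
  | @GRing.scale _ _ ?c ?a => let x := lreify R a s in constr:(@LScale R c x)
  | @Algebra.zero _ => constr:(@LZero R)
  | _ => let i := lindex t s in constr:(@LVar R i) end.

(** Proves an identity in an R-module, leaving identities between coefficients when
   [ring] does not prove them. *)
Ltac lmod R := match goal with |- @eq ?V ?a ?b =>
  let s0 := constr:(@nil V) in
  let s1 := lvars a s0 in let s := lvars b s1 in
  let x := lreify R a s in let y := lreify R b s in
  transitivity (leval s x); [reflexivity|];
  transitivity (leval s y); [|reflexivity];
  apply: leval_eq; cbn [size lcoef_eq lcoef eqn eq_op]; rewrite /=; do ?split; try ring end.

(** * Primitives and Riemann integrals of vector-valued functions *)

Section primitive.
Context {R : realType} {V : normedModType R}.
Implicit Types (a b c e x y : R) (f g P : R -> V).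

Lemma segment_uniform a b (Q : R -> R -> Prop) :
  (forall c, a <= c <= b -> exists2 d, 0 < d & forall x y, a <= x <= b -> a <= y <= b ->
     `|x - c| < d -> `|y - c| < d -> Q x y) ->
  exists2 d, 0 < d & forall x y, a <= x <= b -> a <= y <= b -> `|y - x| < d -> Q x y.
Proof.
move=> loc.
have /compact_near_coveringP cov := @segment_compact R a b.
have := cov _ (0 : R)^'+ (fun d x => a <= x <= b -> forall y, a <= y <= b -> `|y - x| < d -> Q x y) _.
case.
  move=> c; rewrite /= in_itv/= => hc; have [d d0 hd] := loc c hc.
  have d2 : 0 < d / 2 by rewrite divr_gt0.
  exists (ball c (d / 2), [set s : R | s < d / 2]).
    by split; [exact: nbhsx_ballx|exact: nbhs_right_lt].
  move=> [x s] [/= cx sd] xab y yab yx; apply: hd => //.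
    by rewrite distrC; apply: lt_le_trans cx _; lra.
  have {}cx : `|c - x| < d / 2 by exact: cx.
  have h := ler_distD x y c; rewrite [`|x - c|]distrC in h.
  by apply: le_lt_trans h _; have := splitr d; lra.
move=> d /= d0 hd; exists (d / 2); first by rewrite divr_gt0.
move=> x y xab yab yx.
have dd : `|0 - d / 2| < d by rewrite sub0r normrN gtr0_norm ?divr_gt0//; have := splitr d; lra.
have := hd _ dd; rewrite divr_gt0// => /(_ isT x); apply => //=; by rewrite in_itv.
Qed.

Lemma lipschitz_global a b M g : a <= b -> 0 <= M ->
  (exists2 d, 0 < d & forall x y, a <= x -> x <= y -> y <= b -> y - x < d ->
     `|g y - g x| <= M * (y - x)) ->
  `|g b - g a| <= M * (b - a).
Proof.
move=> ab M0 [d d0 hd].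
pose N := (Num.bound ((b - a) / d)).+1; pose h := (b - a) / N%:R.
have N0 : 0 < N%:R :> R by rewrite ltr0n.
have h0 : 0 <= h by rewrite divr_ge0 ?subr_ge0// ltW.
have hN : N%:R * h = b - a by rewrite /h mulrCA divff ?mulr1// gt_eqF.
have hlt : h < d.
  rewrite ltr_pdivrMr// mulrC -ltr_pdivrMr//.
  have : 0 <= (b - a) / d by rewrite divr_ge0 ?subr_ge0// ltW.
  by move=> /archi_boundP => k; apply: lt_le_trans k _; rewrite ler_nat.
suff H k : (k <= N)%N -> `|g (a + k%:R * h) - g a| <= M * (k%:R * h).
  by have := H N (leqnn _); rewrite hN; have -> : a + (b - a) = b by ring.
elim: k => [|k IH] kN; first by rewrite mul0r addr0 subrr normr0 mulr0.
have k1 : k.+1%:R * h = k%:R * h + h by rewrite -natr1 mulrDl mul1r.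
have kh : k.+1%:R * h <= b - a by rewrite -hN ler_wpM2r// ler_nat.
have kh0 : 0 <= k%:R * h by rewrite mulr_ge0.
have s := hd (a + k%:R * h) (a + k.+1%:R * h).
have e1 : a + k.+1%:R * h - (a + k%:R * h) = h by rewrite k1; ring.
rewrite e1 in s.
have := s; rewrite k1 lerDl kh0; have := IH (ltnW kN).
rewrite (_ : g (a + (k%:R * h + h)) - g a = (g (a + (k%:R * h + h)) - g (a + k%:R * h)) + (g (a + k%:R * h) - g a)); last by lmod R.
move=> i1 i2.
have := i2 isT; rewrite lerD2l lerDl h0 => /(_ isT); rewrite -lerBrDl -k1 kh => /(_ isT hlt).
rewrite k1 => i3; apply: le_trans (ler_normD _ _) _; rewrite mulrDr; lra.
Qed.

Lemma lipschitz_eps a b M g : a <= b -> 0 <= M ->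
  (forall e, 0 < e -> exists2 d, 0 < d & forall x y, a <= x -> x <= y -> y <= b -> y - x < d ->
     `|g y - g x| <= (M + e) * (y - x)) ->
  `|g b - g a| <= M * (b - a).
Proof.
move=> ab M0 h; apply/ler_addgt0Pr => e e0.
have s0 : 0 < b - a + 1 by rewrite ltr_wpDl// subr_ge0.
have := @lipschitz_global a b (M + e / (b - a + 1)) g ab _ (h _ (divr_gt0 e0 s0)).
rewrite addr_ge0 ?(ltW (divr_gt0 e0 s0))// => /(_ isT) H; apply: le_trans H _.
rewrite mulrDl lerD2l mulrAC ler_pdivrMr// ler_wpM2l ?(ltW e0)//; lra.
Qed.

(** [prim f P a b]: P is a primitive of f over [a, b], with difference quotients
   converging uniformly, and tagged at an arbitrary intermediate point. *)
Definition prim f P a b := forall e, 0 < e -> exists2 d, 0 < d &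
  forall x xi y, a <= x -> x <= xi -> xi <= y -> y <= b -> y - x < d ->
    `|P y - P x - (y - x) *: f xi| <= e * (y - x).

Lemma prim_local f P a b :
  (forall e, 0 < e -> forall c, a <= c <= b -> exists2 d, 0 < d &
    forall x xi y, a <= x -> x <= xi -> xi <= y -> y <= b -> `|x - c| < d -> `|y - c| < d ->
    `|P y - P x - (y - x) *: f xi| <= e * (y - x)) -> prim f P a b.
Proof.
move=> loc e e0.
have := @segment_uniform a b (fun x y => forall xi, x <= xi -> xi <= y ->
  `|P y - P x - (y - x) *: f xi| <= e * (y - x)).
case.
  move=> c cab; have [d d0 hd] := loc e e0 c cab; exists d => //.
  by move=> x y /andP[ax xb] /andP[ay yb] xc yc xi x1 x2; apply: hd.
move=> d d0 hd; exists d => // x xi y ax x1 x2 yb yx.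
have xy := le_trans x1 x2.
by apply: hd; rewrite ?ax ?yb ?(le_trans ax xy) ?(le_trans xy yb) ?ger0_norm ?subr_ge0.
Qed.

Lemma prim_sub f P a b a' b' : prim f P a b -> a <= a' -> b' <= b -> prim f P a' b'.
Proof.
move=> h aa bb e e0; have [d d0 hd] := h e e0; exists d => // x xi y ax x1 x2 yb yx.
by apply: hd => //; [exact: le_trans ax|exact: le_trans yb _].
Qed.

Lemma prim_ext f g P a b : prim f P a b -> (forall x, a <= x <= b -> f x = g x) -> prim g P a b.
Proof.
move=> h fg e e0; have [d d0 hd] := h e e0; exists d => // x xi y ax x1 x2 yb yx.
by rewrite -fg ?(le_trans ax x1) ?(le_trans x2 yb)//; exact: hd.
Qed.

Lemma prim_cst (v : V) a b : prim (fun=> v) (fun x => x *: v) a b.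
Proof.
move=> e e0; exists 1 => // x xi y _ x1 x2 _ _.
by rewrite -scalerBl subrr normr0 mulr_ge0 ?(ltW e0)// subr_ge0 (le_trans x1).
Qed.

Lemma prim_lin k f g P Q a b : prim f P a b -> prim g Q a b ->
  prim (fun x => k *: f x + g x) (fun x => k *: P x + Q x) a b.
Proof.
move=> hf hg e e0.
have k1 : 0 < `|k| + 1 by rewrite ltr_wpDl.
have e1 : 0 < e / 2 / (`|k| + 1) by rewrite !divr_gt0.
have e2 : 0 < e / 2 by rewrite divr_gt0.
have [d1 d10 h1] := hf _ e1; have [d2 d20 h2] := hg _ e2.
exists (Num.min d1 d2); first by rewrite lt_min d10.
move=> x xi y ax x1 x2 yb; rewrite lt_min => /andP[y1 y2].
have H1 := h1 x xi y ax x1 x2 yb y1; have H2 := h2 x xi y ax x1 x2 yb y2.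
rewrite (_ : _ - _ = k *: (P y - P x - (y - x) *: f xi) + (Q y - Q x - (y - x) *: g xi)); last first.
  by lmod R.
apply: le_trans (ler_normD _ _) _; rewrite normrZ.
have yx : 0 <= y - x by rewrite subr_ge0 (le_trans x1).
have : `|k| * `|P y - P x - (y - x) *: f xi| <= e / 2 * (y - x).
  apply: le_trans (_ : _ <= (`|k| + 1) * (e / 2 / (`|k| + 1) * (y - x))) _.
    by apply: ler_pM => //; lra.
  by rewrite le_eqVlt; apply/orP; left; apply/eqP; field; rewrite gt_eqF.
have := splitr e; nra.
Qed.

Lemma prim_le f P a b M : a <= b -> 0 <= M -> prim f P a b ->
  (forall x, a <= x <= b -> `|f x| <= M) -> `|P b - P a| <= M * (b - a).
Proof.
move=> ab M0 h fM; apply: lipschitz_eps => // e e0; have [d d0 hd] := h e e0; exists d => // x y ax xy yb yx.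
have := hd x x y ax (lexx _) xy yb yx => H.
rewrite -[P y - P x](subrK ((y - x) *: f x)) mulrDl addrC.
have y0 : 0 <= y - x by rewrite subr_ge0.
apply: le_trans (ler_normD _ _) _; apply: lerD => //.
by rewrite normrZ ger0_norm// mulrC ler_wpM2r// fM// ax (le_trans xy).
Qed.

(** Over an interval on which f is close to v, the integral of f is close to that of v. *)
Lemma prim_near f P a b M v : a <= b -> 0 <= M -> prim f P a b ->
  (forall x, a <= x <= b -> `|f x - v| <= M) -> `|P b - P a - (b - a) *: v| <= M * (b - a).
Proof.
move=> ab M0 h fM.
have := prim_lin (-1) (prim_cst v a b) h => h'.
have := prim_le ab M0 h' => /=.
have -> : -1 *: (b *: v) + P b - (-1 *: (a *: v) + P a) = P b - P a - (b - a) *: v.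
  by lmod R.
by apply => x xab; rewrite scaleN1r addrC fM.
Qed.

Lemma prim_unique f P Q a b : a <= b -> prim f P a b -> prim f Q a b -> P b - P a = Q b - Q a.
Proof.
move=> ab hP hQ; apply/eqP; rewrite -subr_eq0 -normr_le0.
have := prim_le ab (lexx 0) (prim_lin (-1) hQ hP) => /=.
rewrite mul0r !scaleN1r => H.
rewrite (_ : _ - _ = - Q b + P b - (- Q a + P a)); last first.
  by lmod R.
by apply: H => x _; rewrite scaleN1r addNr normr0.
Qed.

Lemma prim_riemann f P a b : a <= b -> prim f P a b -> is_riemann_integral f a b (P b - P a).
Proof.
move=> ab h e e0.
have s0 : 0 < b - a + 1 by rewrite ltr_wpDl// subr_ge0.
have [d d0 hd] := h _ (divr_gt0 e0 s0); exists d => // m x xi x0 xm hx.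
have mono k : (k <= m)%N -> x (m - k)%N <= b.
  elim: k => [|k IH] km; first by rewrite subn0 xm.
  have /hx[/andP[u v] _] : (m - k.+1 < m)%N by rewrite ltn_subrL (leq_ltn_trans _ km).
  by apply: le_trans (le_trans u v) _; rewrite subnSK// IH// ltnW.
have xb k : (k <= m)%N -> x k <= b.
  by move=> km; rewrite -(subKn km); apply: mono; exact: leq_subr.
pose S k := \sum_(i < k) (x i.+1 - x i) *: f (xi i).
have H k : (k <= m)%N -> a <= x k /\
    `|S k - (P (x k) - P a)| <= e / (b - a + 1) * (x k - a).
  elim: k => [|k IH] km; first by rewrite x0 lexx /S big_ord0 !subrr normr0 mulr0.
  have [ax IHk] := IH (ltnW km); have [/andP[u v] w] := hx k km.
  split; first exact: le_trans ax (le_trans u v).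
  have SS : S k.+1 = S k + (x k.+1 - x k) *: f (xi k) by rewrite /S big_ord_recr.
  have D := hd _ _ _ ax u v (xb _ km) w.
  rewrite (_ : _ - _ = S k - (P (x k) - P a)
      - (P (x k.+1) - P (x k) - (x k.+1 - x k) *: f (xi k))); last first.
    by rewrite SS; lmod R.

  apply: le_trans (ler_normB _ _) _.
  rewrite (_ : x k.+1 - a = (x k - a) + (x k.+1 - x k)); last by ring.
  by rewrite mulrDr lerD.
have [_] := H m (leqnn _); rewrite xm => Hm; apply: le_lt_trans Hm _.
by rewrite mulrAC ltr_pdivrMr// ltr_pM2l//; lra.
Qed.

Lemma norm_lim_le (u : nat -> V) l (C : R) N : u k @[k --> \oo] --> l ->
  (forall k, (N <= k)%N -> `|u k| <= C) -> `|l| <= C.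
Proof.
move=> ul uC; apply: (cvgr_to_le (cvg_norm ul)).
by exists N => // k /= Nk; exact: uC.
Qed.

Let cut (p s t y : R) := Num.min y t - Num.min y s.

Let cut_mono p s t x y : s <= t -> x <= y -> cut p s t x <= cut p s t y.
Proof.
move=> st xy; rewrite /cut /Num.min.
by do ![case: ifP => /=]; move=> *; lra.
Qed.

Let cut_pos p s t x y : s <= t -> x <= y -> cut p s t x != cut p s t y -> s < y /\ x < t.
Proof.
move=> st xy; rewrite /cut => h; split; rewrite ltNge; apply: contra_neqN h => h.
  rewrite (min_idPl h) (min_idPl (le_trans xy h)).
  by rewrite (min_idPl (le_trans h st)) (min_idPl (le_trans xy (le_trans h st))) !subrr.
by rewrite (min_idPr h) (min_idPr (le_trans h xy)) (min_idPr (le_trans st h)) (min_idPr (le_trans st (le_trans h xy))).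
Qed.

Hypothesis V_complete : forall u : nat -> V,
  (forall e : R, 0 < e -> exists N, forall i j, (N <= i)%N -> (N <= j)%N -> `|u i - u j| <= e) ->
  exists l : V, u k @[k --> \oo] --> l.

(** Existence of primitives, as uniform limits of piecewise affine functions. *)
Theorem prim_exists f a b : a <= b ->
  (forall e, 0 < e -> forall c, a <= c <= b -> exists2 d, 0 < d & forall x, a <= x <= b ->
    `|x - c| < d -> `|f x - f c| <= e) ->
  exists2 P, P a = 0 & prim f P a b.
Proof.
move=> ab fc.
have fu e : 0 < e -> exists2 d, 0 < d & forall x y, a <= x <= b -> a <= y <= b -> `|y - x| < d ->
    `|f x - f y| <= e.
  move=> e0; apply: segment_uniform => c cab; have e2 : 0 < e / 2 by rewrite divr_gt0.
  have [d d0 hd] := fc _ e2 c cab; exists d => // x y xab yab xc yc.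
  have := hd x xab xc; have := hd y yab yc.
  have := ler_distD (f c) (f x) (f y); rewrite [`|f c - f y|]distrC; have := splitr e; lra.
pose h (N : nat) := (b - a) / N.+1%:R.
pose p N (i : nat) := a + i%:R * h N.
have h0 N : 0 <= h N by rewrite divr_ge0 ?subr_ge0.
have pm N i : p N i <= p N i.+1.
  by rewrite /p lerD2l -natr1 mulrDl mul1r lerDl.
have p0 N : p N 0%N = a by rewrite /p mul0r addr0.
have pN N : p N N.+1 = b by rewrite /p /h mulrCA divff ?mulr1 ?pnatr_eq0// addrC subrK.
have pab N i : (i <= N.+1)%N -> a <= p N i <= b.
  move=> iN; rewrite /p lerDl mulr_ge0//= -[leRHS](pN N) /p lerD2l ler_wpM2r// ler_nat//.
pose F N x := \sum_(i < N.+1) cut 0 (p N i) (p N i.+1) x *: f (p N i).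
have sumcut N x : a <= x <= b -> \sum_(i < N.+1) cut 0 (p N i) (p N i.+1) x = x - a.
  move=> /andP[ax xb]; rewrite /cut -(big_mkord xpredT (fun i => Num.min x (p N i.+1) - Num.min x (p N i))).
  by rewrite telescope_sumr// pN p0 (min_idPl xb) (min_idPr ax).
have FP e : 0 < e -> exists2 d, 0 < d & forall N, h N < d ->
    forall x xi y, a <= x -> x <= xi -> xi <= y -> y <= b -> y - x < d ->
    `|F N y - F N x - (y - x) *: f xi| <= e * (y - x).
  move=> e0; have [d d0 hd] := fu e e0; exists (d / 2); first by rewrite divr_gt0.
  move=> N hN x xi y ax x1 x2 yb yx.
  have xy := le_trans x1 x2.
  have e1 : y - x = \sum_(i < N.+1) (cut 0 (p N i) (p N i.+1) y - cut 0 (p N i) (p N i.+1) x).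
    rewrite sumrB !sumcut; last 2 first.
    - by rewrite ax (le_trans xy).
    - by rewrite yb (le_trans ax).
    by ring.
  rewrite {1}e1 scaler_suml /F -sumrB -sumrB.
  apply: le_trans (ler_norm_sum _ _ _) _; rewrite [in leRHS]e1 mulr_sumr.
  apply: ler_sum => i _; rewrite -scalerBl -scalerBr normrZ.
  have c0 : 0 <= cut 0 (p N i) (p N i.+1) y - cut 0 (p N i) (p N i.+1) x by rewrite subr_ge0 cut_mono.
  rewrite ger0_norm// mulrC.
  have [->|cne] := eqVneq (cut 0 (p N i) (p N i.+1) x) (cut 0 (p N i) (p N i.+1) y).
    by rewrite subrr !mulr0.
  have [u v] := cut_pos (pm N i) xy cne.
  rewrite ler_wpM2r//; apply: hd.
  - by apply: pab; rewrite ltnW.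
  - by rewrite (le_trans ax x1) (le_trans x2 yb).
  have e2 : p N i.+1 = p N i + h N by rewrite /p -natr1 mulrDl mul1r addrA.
  rewrite e2 in v; have := splitr d => sd.
  by rewrite ltr_norml; apply/andP; split; lra.
have Fa N : F N a = 0.
  rewrite /F big1// => i _; have /andP[q1 _] := pab N i (ltnW (ltn_ord i)).
  have /andP[q2 _] := pab N i.+1 (ltn_ord i).
  by rewrite /cut (min_idPl q1) (min_idPl q2) subrr scale0r.
have hlim d : 0 < d -> exists N, forall k, (N <= k)%N -> h k < d.
  move=> d0; exists (Num.bound ((b - a) / d)) => k Nk.
  rewrite /h ltr_pdivrMr ?ltr0n// mulrC -ltr_pdivrMr//.
  have : 0 <= (b - a) / d by rewrite divr_ge0 ?subr_ge0// ltW.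
  by move=> /archi_boundP => A; apply: lt_le_trans A _; rewrite ler_nat leqW.
have Fc x : a <= x <= b -> exists l : V, F k x @[k --> \oo] --> l.
  move=> /andP[ax xb]; apply: (V_complete (u := fun k => F k x)) => e e0.
  have s0 : 0 < b - a + 1 by rewrite ltr_wpDl// subr_ge0.
  have e1 : 0 < e / 2 / (b - a + 1) by rewrite !divr_gt0.
  have [d d0 hd] := FP _ e1; have [N hN] := hlim d d0.
  exists N => i j Ni Nj.
  have := @lipschitz_global a x (e / (b - a + 1)) (fun x => F i x - F j x) ax.
  rewrite !Fa !subr0 => H; apply: le_trans (H _ _) _.
  - by rewrite divr_ge0 ?(ltW e0) ?(ltW s0).
  - exists d => // y z ay yz zx zy.
    have zb := le_trans zx xb.
    have A := hd i (hN i Ni) y y z ay (lexx _) yz zb zy; have B := hd j (hN j Nj) y y z ay (lexx _) yz zb zy.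
    have -> : F i z - F j z - (F i y - F j y) = (F i z - F i y - (z - y) *: f y) - (F j z - F j y - (z - y) *: f y).
      by lmod R.
    apply: le_trans (ler_normB _ _) _; apply: le_trans (lerD A B) _.
    by rewrite -mulrDl -mulrDl -splitr.
  rewrite mulrAC ler_pdivrMr// ler_wpM2l ?(ltW e0)//; lra.
have /choice[P hP] : forall x, exists l : V, a <= x <= b -> F k x @[k --> \oo] --> l.
  move=> x; have [/Fc[l hl]|_] := boolP (a <= x <= b); first by exists l.
  by exists 0.
exists P.
  have := hP a; rewrite lexx ab => /(_ isT) Pa.
  apply: (cvg_unique (@norm_hausdorff R V) Pa).
  by rewrite (_ : (fun k => F k a) = fun=> 0); [exact: cvg_cst|apply/funext => k; exact: Fa].
move=> e e0; have [d d0 hd] := FP e e0; have [N hN] := hlim d d0; exists d => // x xi y ax x1 x2 yb yx.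
have xy := le_trans x1 x2.
have Px : F k x @[k --> \oo] --> P x by apply: hP; rewrite ax (le_trans xy).
have Py : F k y @[k --> \oo] --> P y by apply: hP; rewrite yb (le_trans ax).
apply: (@norm_lim_le (fun k => F k y - F k x - (y - x) *: f xi) _ _ N).
  by apply: cvgB; [exact: cvgB|exact: cvg_cst].
by move=> k Nk; apply: hd => //; exact: hN.
Qed.

End primitive.

Section linear_image.
Context {R : realType} {V W : normedModType R}.

Lemma prim_linear (T : V -> W) (C : R) f (P : R -> V) a b : 0 <= C ->
  (forall (c : R) u v, T (c *: u + v) = c *: T u + T v) -> (forall v, `|T v| <= C * `|v|) ->
  prim f P a b -> prim (fun x => T (f x)) (fun x => T (P x)) a b.
Proof.
move=> C0 Tl TC h e e0.
have C1 : 0 < C + 1 by rewrite ltr_wpDl.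
have [d d0 hd] := h _ (divr_gt0 e0 C1); exists d => // x xi y ax x1 x2 yb yx.
have TB u v c : T (u - v - c *: f xi) = T u - T v - c *: T (f xi).
  have -> : u - v - c *: f xi = (- c) *: f xi + (-1 *: v + u) by rewrite scaleNr scaleN1r addrC [- v + u]addrC.
  by rewrite !Tl scaleNr scaleN1r addrC [- T v + _]addrC.
rewrite -TB; apply: le_trans (TC _) _.
have y0 : 0 <= y - x by rewrite subr_ge0 (le_trans x1).
apply: le_trans (_ : _ <= (C + 1) * (e / (C + 1) * (y - x))) _.
  apply: ler_pM => //; first lra.
  exact: hd.
by rewrite mulrA mulrCA divff ?mulr1// gt_eqF.
Qed.

End linear_image.

(** * The initial value of the Gaussian semigroup *)

Section initial_value.
Context {R : realType} {n : nat} {q : R} {q1 : (1 <= q%:E)%E}.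
Local Notation vol := (@lebesgue_rV R n).
Local Notation L := (Lq n q1).
Implicit Types (phi : 'rV[R]_n -> R) (u v w : L) (A B N : 'M[R]_n).
Local Notation e_ i := (delta_mx 0 i : 'rV[R]_n).

Lemma gk_moment A i : posdef A ->
  L1 (Num.sqrt (A i i) * (8 * (8 * 8) * Num.sqrt (2 ^+ n))) (fun z : 'rV[R]_n => `|z 0 i| * gk A z).
Proof.
move=> pA; have uA := posdef_unit pA; have pN := posdef_inv pA; set N := invmx A in pN *.
have dA := posdef_det pA.
pose cA := (Num.sqrt ((4 * pi) ^+ n * \det A))^-1.
have p4 := @pi4_gt0 R n.
have cA0 : 0 < cA by rewrite invr_gt0 sqrtr_gt0 mulr_gt0.
have Aii : 0 <= A i i by rewrite -qform_delta qform_ge0.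
have -> : Num.sqrt (A i i) * (8 * (8 * 8) * Num.sqrt (2 ^+ n)) =
    (Num.sqrt (A i i) * cA) * gauss_cst N.
  have -> : Num.sqrt (2 ^+ n) = cA * gauss_mass (2^-1 *: N).
    rewrite /gauss_mass detZ det_inv /cA.
    rewrite (_ : _ / _ = 2 ^+ n * ((4 * pi) ^+ n * \det A)); last first.
      by rewrite exprVn; field; rewrite gt_eqF//= expf_neq0.
    by rewrite [Num.sqrt (2 ^+ n * _)]sqrtrM ?exprn_ge0// mulrCA mulVf ?mulr1// gt_eqF// sqrtr_gt0 mulr_gt0.
  by rewrite /gauss_cst; ring.
have cz : continuous (fun z : 'rV[R]_n => `|z 0 i| * gk A z).
  apply: (@contM R 'rV[R]_n); last exact: continuous_gk.
  apply: (@cont_comp R 'rV[R]_n); last exact: continuous_coord.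
  exact: norm_continuous.
apply: gauss_dominated => //; first exact: (continuous_measurable_rV cz).
move=> z; rewrite normrM normr_id (gtr0_norm (gk_gt0 _ pA)) /gk -/N -/cA.
have q0 := qform_ge0 z pN; have g0 := gauss_gt0 N z.
have cs := @qform_CS R n N z (e_ i *m A) pN.
have e1 : (z *m (N *m (e_ i *m A)^T)) 0 0 = z 0 i.
  rewrite trmx_mul pA.1 mulmxA mulmxA -(mulmxA z) mulVmx// mulmx1 mxE (bigD1 i)//= big1 ?addr0.
    by rewrite !mxE !eqxx mulr1.
  by move=> j ji; rewrite !mxE (negbTE ji) andbF mulr0.
have e2 : qform N (e_ i *m A) = A i i.
  by rewrite /qform trmx_mul pA.1 (mulmxA N) mulVmx// mul1mx -mulmxA mulmx_delta -rowE mxE.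
rewrite e1 e2 in cs.
have s0 := sqrtr_ge0 (A i i).
have zi : `|z 0 i| <= Num.sqrt (A i i) * (1 + qform N z).
  have m0 : 0 <= Num.sqrt (A i i) * (1 + qform N z) by rewrite mulr_ge0//; lra.
  rewrite -(@ler_pXn2r _ 2) ?nnegrE// real_normK ?num_real// (le_trans cs)//.
  rewrite exprMn sqr_sqrtr// mulrC ler_wpM2l//; nra.
have zi2 : `|z 0 i| <= Num.sqrt (A i i) * (1 + qform N z) ^+ 2.
  apply: le_trans zi _; rewrite ler_wpM2l// expr2 ler_peMr//; lra.
rewrite [leRHS](_ : _ = Num.sqrt (A i i) * (1 + qform N z) ^+ 2 * (cA * gauss N z)); last by ring.
by rewrite ler_wpM2r// mulr_ge0// ltW.
Qed.

Let shift v phi (z : 'rV[R]_n) := Lpair v (fun x => phi (x + z)).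

Lemma Lpair_lipschitz1 v phi : test_function phi -> exists2 C, 0 <= C & forall i (z : 'rV[R]_n) t,
  `|shift v phi (z + t *: e_ i) - shift v phi z| <= C * `|t|.
Proof.
move=> tphi; have [sphi [M sM]] := (test_functionP phi).1 tphi.
have cphi := smooth_continuous sphi.
have bound i : exists2 C, 0 <= C & forall x, `|pderiv i phi x| <= C.
  have hd := smooth_has_pderiv i sphi.
  exact: supp_in_bounded (smooth_continuous (smooth_pderiv i sphi)) (supp_in_pderiv hd sM).
have [C1 C10 hC1] : exists2 C, 0 <= C & forall i x, `|pderiv i phi x| <= C.
  have /choice[f hf] : forall i, exists C, 0 <= C /\ forall x, `|pderiv i phi x| <= C.
    by move=> i; have [C ? ?] := bound i; exists C.
  exists (\sum_i f i); first by apply: sumr_ge0 => i _; have [] := hf i.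
  move=> i x; have [_ h] := hf i; apply: le_trans (h x) _.
  by rewrite (bigD1 i)//= lerDl sumr_ge0// => j _; have [] := hf j.
have [C [D w]] := test_weight tphi; have [C0 D0] := weight_ge0 w.
pose V := fine (vol (@cube R n M.+1)).
have V0 : 0 <= V by apply: fine_ge0; exact: measure_ge0.
pose K := `|v| * (C1 + C1 * V) + 2 * (`|v| * (C + D)).
have K1 : 0 <= `|v| * (C1 + C1 * V) by rewrite !(mulr_ge0, addr_ge0).
have K2 : 0 <= `|v| * (C + D) by rewrite !(mulr_ge0, addr_ge0).
have K0 : 0 <= K by rewrite addr_ge0// mulr_ge0.
have pos i (z : 'rV[R]_n) t : 0 < t -> `|shift v phi (z + t *: e_ i) - shift v phi z| <= K * t.
  move=> t0; have wz := weight_translation z w; have wzt := weight_translation (z + t *: e_ i) w.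
  have [t1|t1] := lerP t 1; last first.
    have h1 := Lpair_bound v wz; have h2 := Lpair_bound v wzt.
    apply: le_trans (ler_normB _ _) _; apply: le_trans (lerD h2 h1) _.
    apply: (@le_trans _ _ K); first by rewrite /K; clear -K1; lra.
    by rewrite ler_peMr// ltW.
  have b : bms (C1 * t) M.+1 (fun x : 'rV[R]_n => phi (x + t *: e_ i) - phi x).
    have mphi := continuous_measurable_rV cphi.
    split.
    - apply: measurable_funB => //.
      exact: (measurableT_comp mphi (measurable_rV_translation (t *: e_ i))).
    - move=> x; have [c _ ->] := pderiv_MVT x (smooth_has_pderiv i sphi) t0.
      by rewrite normrM (gtr0_norm t0) ler_wpM2r// ltW.
    move=> x hx; have [fx|/sM] := eqVneq (phi x) 0; last exact: cube_le.
    have : phi (x + t *: e_ i) != 0 by apply: contra_neq hx => ->; rewrite fx subrr.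
    move=> /sM hxt j; have := hxt j; rewrite !mxE.
    have : `|t * ((0 == 0 :> 'I_1) && (j == i))%:R| <= 1.
      rewrite normrM mulr_ile1//; first by rewrite gtr0_norm.
      by rewrite ger0_norm// (ler_nat R _ 1) leq_b1.
    move=> d1 d2; rewrite -natr1.
    by have := ler_normB (x 0 j + t * ((0 == 0 :> 'I_1) && (j == i))%:R) (t * ((0 == 0 :> 'I_1) && (j == i))%:R); rewrite addrK; lra.
  have wb := weight_translation z (bms_weight b).
  rewrite (_ : shift _ _ _ - _ = Lpair v (fun x => phi (x + z + t *: e_ i) - phi (x + z))); last first.
    have := @Lpair_lin R n q q1 C D C D (-1) _ _ v wz wzt; rewrite mulN1r => H.
    rewrite [LHS]addrC /shift -H; congr (Lpair v _); apply/funext => x.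
    by rewrite mulN1r [RHS]addrC addrA.
  apply: le_trans (Lpair_bound v wb) _.
  rewrite -/V mulrAC -mulrDl mulrA ler_wpM2r ?(ltW t0)// lerDl mulr_ge0//.
exists K => // i z t; have [t0|t0|->] := ltgtP t 0; last first.
- by rewrite scale0r addr0 subrr normr0 mulr0.
- by rewrite (gtr0_norm t0) pos.
have := pos i (z + t *: e_ i) (- t); rewrite oppr_gt0 => /(_ t0).
by rewrite scaleNr addrK distrC (ltr0_norm t0).
Qed.

Lemma Lpair_lipschitz v phi : test_function phi -> exists2 C, 0 <= C & forall z : 'rV[R]_n,
  `|shift v phi z - shift v phi 0| <= C * \sum_i `|z 0 i|.
Proof.
move=> tphi; have [C C0 hC] := Lpair_lipschitz1 v tphi; exists C => // z.
suff H (r : seq 'I_n) : `|shift v phi (\sum_(i <- r) z 0 i *: e_ i) - shift v phi 0| <= C * \sum_(i <- r) `|z 0 i|.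
  by rewrite {1}(row_sum_delta z); exact: H.
elim: r => [|i r IH]; first by rewrite !big_nil subrr normr0 mulr0.
rewrite !big_cons mulrDr; set y := \sum_(j <- r) _ in IH *.
rewrite (_ : shift v phi (z 0 i *: e_ i + y) - shift v phi 0 =
  (shift v phi (y + z 0 i *: e_ i) - shift v phi y) + (shift v phi y - shift v phi 0)); last first.
  by rewrite [y + _]addrC; ring.
by apply: le_trans (ler_normD _ _) _; exact: lerD.
Qed.

(** The pairing of G_A v with a test function is an average of the pairings of v with
   its translates, so that its distance to the pairing of v is controlled by the first
   moments of the kernel. *)
Lemma heat_initial v phi : test_function phi -> exists2 C, 0 <= C & forall A, posdef A ->
  `|Lpair (heat A v) phi - Lpair v phi| <= C * \sum_i Num.sqrt (A i i).
Proof.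
move=> tphi; have [C C0 hC] := Lpair_lipschitz v tphi; have [C1 [D1 w]] := test_weight tphi.
pose K : R := 8 * (8 * 8) * Num.sqrt (2 ^+ n).
have K0 : 0 <= K by rewrite mulr_ge0 ?sqrtr_ge0// !mulr_ge0.
exists (C * K); first exact: mulr_ge0.
move=> A pA; have gL := L1_gk pA; rewrite (Lpair_conv _ gL w).
have s0 : Lpair v phi = shift v phi 0 by rewrite /shift; congr Lpair; apply/funext => x; rewrite addr0.
have ig := integrable_conv_pair v gL w.
have iA := L1_integrable gL.
have -> : Lpair v phi = \int[vol]_z (gk A z * shift v phi 0).
  by rewrite RintegralZr// gk_integral// mul1r.
have i0 : vol.-integrable setT (EFin \o (fun z => gk A z * shift v phi 0)).
  by have := integrableZr measurableT (shift v phi 0) iA; apply: eq_integrable.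
rewrite -RintegralB//.
have im i := L1_integrable (gk_moment i pA).
pose G i (z : 'rV[R]_n) : R := C * (`|z 0 i| * gk A z).
have iG i : vol.-integrable setT (EFin \o G i).
  by have := integrableZl measurableT C (im i); apply: eq_integrable.
have Rsum (r : seq 'I_n) : vol.-integrable setT (EFin \o (fun z : 'rV[R]_n => \sum_(i <- r) G i z)) /\
    \int[vol]_z (\sum_(i <- r) G i z) = \sum_(i <- r) \int[vol]_z G i z.
  elim: r => [|i r [IHi IHe]].
    split; first by apply: eq_integrable (integrable0 _ _) => // z _; rewrite /= big_nil.
    rewrite big_nil /Rintegral (eq_integral (fun=> 0%E)) ?integral0// => z _.
    by rewrite big_nil.
  have e : (fun z => \sum_(j <- i :: r) G j z) = (fun z => G i z + \sum_(j <- r) G j z).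
    by apply/funext => z; rewrite big_cons.
  rewrite e; split; last by rewrite RintegralD// IHe big_cons.
  by have := integrableD measurableT (iG i) IHi; apply: eq_integrable.
have [isum esum] := Rsum (index_enum 'I_n).
have iB : vol.-integrable setT (EFin \o (fun z => gk A z * shift v phi z - gk A z * shift v phi 0)).
  by have := integrableB measurableT ig i0; apply: eq_integrable.
apply: le_trans (le_normr_Rintegral measurableT iB) _.
apply: (@le_trans _ _ (\int[vol]_z (\sum_i G i z))).
  apply: le_Rintegral => //; first exact: integrable_norm iB.
  move=> z _; rewrite -mulrBr normrM (gtr0_norm (gk_gt0 z pA)).
  have -> : \sum_i G i z = gk A z * (C * \sum_i `|z 0 i|).
    by rewrite /G -mulr_sumr -mulr_suml; ring.
  apply: ler_wpM2l; first exact/ltW/gk_gt0.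
  exact: hC.
rewrite esum -mulrA mulr_sumr mulr_sumr; apply: ler_sum => i _.
rewrite /G RintegralZl// ler_wpM2l//.
have [mm mK] := gk_moment i pA.
rewrite -lee_fin /Rintegral fineK; last exact: integrable_fin_num (im i).
rewrite [X in (_ <= X%:E)%E]mulrC; apply: le_trans mK.
by rewrite le_eqVlt; apply/orP; left; apply/eqP; apply: eq_integral => z _; rewrite normrM normr_id (gtr0_norm (gk_gt0 _ pA)).
Qed.

End initial_value.

(** * The generator of the Gaussian semigroup *)

Section ksum.
Context {R : realType} {n : nat} {q : R} {q1 : (1 <= q%:E)%E}.
Local Notation L := (Lq n q1).

Lemma Lconv_ksum (I : Type) (r : seq I) (c : I -> R) (k : I -> 'rV[R]_n -> R) (v : L) :
  (forall i, exists K, L1 K (k i)) ->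
  (exists K, L1 K (fun x => \sum_(i <- r) c i * k i x)) /\
  Lconv (fun x => \sum_(i <- r) c i * k i x) v = \sum_(i <- r) c i *: Lconv (k i) v.
Proof.
move=> kL; elim: r => [|i r [[K rL] IH]].
  have zL : L1 0 (fun x : 'rV[R]_n => 0 * gauss 1%:M x).
    by have := L1_scale 0 (L1_gauss (@posdef1 R n)); rewrite normr0 mul0r.
  have z0 : (fun x : 'rV[R]_n => \sum_(i <- [::]) c i * k i x) = (fun x : 'rV[R]_n => 0 * gauss 1%:M x).
    by apply/funext => x; rewrite big_nil mul0r.
  rewrite z0 big_nil; split; first by exists 0.
  by apply/eqP; rewrite -normr_le0 (le_trans (conv_norm _ zL))// mul0r.
have [Ki kiL] := kL i.
have e : (fun x : 'rV[R]_n => \sum_(j <- i :: r) c j * k j x) =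
    (fun x => c i * k i x + \sum_(j <- r) c j * k j x).
  by apply/funext => x; rewrite big_cons.
have [sL sE] := Lconv_klin (c i) v kiL rL.
by rewrite e sE big_cons IH; split => //; eexists; exact: sL.
Qed.

End ksum.

Lemma is_derive_inv (R : realType) (t : R) : 0 < t ->
  is_derive t 1 (fun t : R => t^-1) (- (t^-1) ^+ 2).
Proof.
move=> t0; have t1 : t != 0 by rewrite gt_eqF.
have h := @is_deriveV R (fun t : R => t) t 1 1 t1 (is_derive_id _ _).
by apply: is_derive_eq h _; rewrite /GRing.scale/= mulr1 exprVn.
Qed.

Section kernel_time.
Context {R : realType} {n : nat}.
Variable (B : 'M[R]_n).
Hypothesis pB : posdef B.
Let M := invmx B.
Let Q (x : 'rV[R]_n) := qform M x.
Let c0 : R := (Num.sqrt ((4 * pi) ^+ n * \det B))^-1.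

(* Time dependence of the kernel gk (t *: B): it is [ktime (Q x) t]. *)
Let g (r t : R) : R := - (n%:R / 2) * ln t - 4^-1 * r * t^-1.
Let dg (r t : R) : R := - (n%:R / 2) * t^-1 + 4^-1 * r * (t^-1) ^+ 2.
Let ddg (r t : R) : R := n%:R / 2 * (t^-1) ^+ 2 - 2^-1 * r * (t^-1) ^+ 3.
Let ktime (r t : R) : R := c0 * expR (g r t).
Let dktime (r t : R) : R := dg r t * ktime r t.
Let ddktime (r t : R) : R := (ddg r t + dg r t ^+ 2) * ktime r t.

Let pM : posdef M. Proof. exact: posdef_inv. Qed.
Let Q_ge0 x : 0 <= Q x. Proof. exact: qform_ge0. Qed.

Let c0_gt0 : 0 < c0.
Proof. by rewrite invr_gt0 sqrtr_gt0 mulr_gt0 ?pi4_gt0// posdef_det. Qed.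

Let gk_ktime (t : R) x : 0 < t -> gk (t *: B) x = ktime (Q x) t.
Proof.
move=> t0; rewrite /gk /ktime /gauss invmxZ' ?gt_eqF// qformZ detZ -/M -/(Q x).
rewrite /g expRD mulrA; congr (_ * _); last by congr expR; ring.
have t0n : 0 <= t ^+ n by rewrite exprn_ge0// ltW.
rewrite (mulrCA _ (t ^+ n)) sqrtrM// invfM mulrC /c0; congr (_ * _).
have -> : Num.sqrt (t ^+ n) = expR (n%:R / 2 * ln t).
  have e0 := expR_ge0 (n%:R / 2 * ln t).
  rewrite -[RHS](ger0_norm e0) -sqrtr_sqr; congr Num.sqrt.
  rewrite expr2 -expRD (_ : _ + _ = n%:R * ln t); last by field.
  by rewrite expRM_natl lnK.
by rewrite -expRN mulNr.
Qed.

Let is_derive_g (r t : R) : 0 < t -> is_derive t 1 (g r) (dg r t).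
Proof.
move=> t0; have t1 : t != 0 by rewrite gt_eqF.
have h1 : is_derive t 1 (@ln R) (t^-1) by exact: is_derive1_ln.
have h2 := is_derive_inv t0.
have h3 := is_deriveZ (- (n%:R / 2)) h1; have h4 := is_deriveZ (- (4^-1 * r)) h2.
have h5 := is_deriveD h3 h4.
rewrite (_ : g r = (- (n%:R / 2) \*: @ln R + (- (4^-1 * r)) \*: (fun t : R => t^-1))); last first.
  by apply/funext => s; rewrite /g mulNr [in RHS]/GRing.add /= /GRing.scale/=; ring.
by apply: is_derive_eq h5 _; rewrite /dg /GRing.scale/=; ring.
Qed.

Let is_derive_dg (r t : R) : 0 < t -> is_derive t 1 (dg r) (ddg r t).
Proof.
move=> t0; have t1 : t != 0 by rewrite gt_eqF.
have h2 := is_derive_inv t0.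
have h3 : is_derive t 1 (fun t : R => t^-1 * t^-1) _ := is_deriveM h2 h2.
have h4 : is_derive t 1 (fun t : R => - (n%:R / 2) * t^-1 + 4^-1 * r * (t^-1 * t^-1)) _ :=
  is_deriveD (is_deriveZ (- (n%:R / 2)) h2) (is_deriveZ (4^-1 * r) h3).
rewrite (_ : dg r = fun t : R => - (n%:R / 2) * t^-1 + 4^-1 * r * (t^-1 * t^-1)); last first.
  by apply/funext => s; rewrite /dg expr2.
by apply: is_derive_eq h4 _; rewrite /ddg /GRing.scale/=; field.
Qed.

Let is_derive_ktime (r t : R) : 0 < t -> is_derive t 1 (ktime r) (dktime r t).
Proof.
move=> t0; have hg := is_derive_g r t0.
have he : is_derive (g r t) 1 expR (expR (g r t)) by exact: is_derive_expR.
have h := is_deriveZ c0 (is_derive1_comp he hg).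
by apply: is_derive_eq h _; rewrite /dktime /ktime /GRing.scale/=; ring.
Qed.

Let is_derive_dktime (r t : R) : 0 < t -> is_derive t 1 (dktime r) (ddktime r t).
Proof.
move=> t0; have h := is_deriveM (is_derive_dg r t0) (is_derive_ktime r t0).
by apply: is_derive_eq h _; rewrite /ddktime /dktime /GRing.scale/=; ring.
Qed.

Let MVTpos (F dF : R -> R) (x y : R) : 0 < x -> x < y ->
  (forall t : R, 0 < t -> is_derive t 1 F (dF t)) ->
  exists2 z, x < z < y & F y - F x = dF z * (y - x).
Proof.
move=> x0 xy hF.
have h1 t : t \in `]x, y[ -> is_derive t 1 F (dF t).
  by rewrite in_itv/= => /andP[xt _]; apply: hF; exact: lt_trans xt.
have h2 t : t \in `[x, y] -> derivable F t 1.
  rewrite in_itv/= => /andP[xt _]; have h := hF t (lt_le_trans x0 xt).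
  exact: ex_derive.
have [z zxy E] := @MVT R F dF x y xy h1 (derivable_within_continuous h2).
by exists z => //; move: zxy; rewrite in_itv.
Qed.

Let ddktime_bound s : 0 < s -> s <= 1 -> exists2 C, 0 <= C & forall x t, s <= t -> t <= 1 ->
  `|ddktime (Q x) t| <= C * ((1 + Q x) ^+ 2 * gauss M x).
Proof.
move=> s0 s1; set i := s^-1.
have i1 : 1 <= i by rewrite invf_ge1.
have i0 : 0 < i by rewrite invr_gt0.
pose a := (n%:R + 1 : R).
have n0 : 0 <= n%:R :> R by [].
exists ((a * i ^+ 3 + (a * i ^+ 2) ^+ 2) * (c0 * expR (n%:R / 2 * ln i))).
  by rewrite mulr_ge0 ?addr_ge0 ?mulr_ge0 ?exprn_ge0 ?sqr_ge0 ?expR_ge0 ?(ltW c0_gt0) ?(ltW i0)// /a addr_ge0.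
move=> x t st t1; have t0 := lt_le_trans s0 st.
have q0 := Q_ge0 x; set r := Q x in q0 *.
set u := t^-1; have u0 : 0 < u by rewrite invr_gt0.
have u1 : 1 <= u by rewrite invf_ge1.
have ui : u <= i by rewrite lef_pV2.
have u2 : u ^+ 2 <= i ^+ 2 by rewrite lerXn2r// nnegrE ltW.
have u3 : u ^+ 3 <= i ^+ 3 by rewrite lerXn2r// nnegrE ltW.
have uu2 : u <= u ^+ 2 by rewrite expr2 ler_peMr// ltW.
have uu3 : u ^+ 2 <= u ^+ 3 by rewrite [leRHS]exprS ler_peMl// sqr_ge0.
have up2 : 0 <= u ^+ 2 by exact: sqr_ge0.
have up3 : 0 <= u ^+ 3 by rewrite exprn_ge0// ltW.
have d1 : `|dg r t| <= a * i ^+ 2 * (1 + r).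
  have : `|dg r t| <= n%:R * u ^+ 2 + r * u ^+ 2.
    rewrite /dg -/u; apply: le_trans (ler_normD _ _) _; rewrite !normrM normrN.
    rewrite !ger0_norm ?(ltW u0)//; nra.
  have : n%:R * u ^+ 2 + r * u ^+ 2 <= n%:R * i ^+ 2 + r * i ^+ 2 by rewrite lerD// ler_wpM2l.
  have i20 : 0 <= i ^+ 2 by exact: sqr_ge0.
  have := mulr_ge0 (mulr_ge0 n0 i20) q0; rewrite /a.
  move: (i ^+ 2) (u ^+ 2) i20 => I U i20; move: (`|_|) => X; nra.
have d2 : `|ddg r t| <= a * i ^+ 3 * (1 + r).
  have : `|ddg r t| <= n%:R * u ^+ 3 + r * u ^+ 3.
    rewrite /ddg -/u; apply: le_trans (ler_normB _ _) _; rewrite !normrM.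
    rewrite !ger0_norm//; nra.
  have : n%:R * u ^+ 3 + r * u ^+ 3 <= n%:R * i ^+ 3 + r * i ^+ 3 by rewrite lerD// ler_wpM2l.
  have i30 : 0 <= i ^+ 3 by rewrite exprn_ge0// ltW.
  have := mulr_ge0 (mulr_ge0 n0 i30) q0; rewrite /a.
  move: (i ^+ 3) (u ^+ 3) i30 => I U i30; move: (`|_|) => X; nra.
have kb : ktime r t <= c0 * expR (n%:R / 2 * ln i) * gauss M x.
  rewrite /ktime -mulrA ler_wpM2l ?(ltW c0_gt0)// /gauss -expRD ler_expR /g -/(Q x) -/r -/u.
  have : - ln t <= ln i by rewrite -lnV ?posrE// ler_ln ?posrE.
  have : r <= r * u by rewrite ler_peMr.
  nra.
rewrite /ddktime normrM (ger0_norm (_ : 0 <= ktime r t)); last by rewrite mulr_ge0 ?(ltW c0_gt0)// expR_ge0.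
rewrite [leRHS](_ : _ = (a * i ^+ 3 + (a * i ^+ 2) ^+ 2) * (1 + r) ^+ 2 * (c0 * expR (n%:R / 2 * ln i) * gauss M x)); last by ring.
apply: ler_pM => //; first by rewrite mulr_ge0 ?(ltW c0_gt0)// expR_ge0.
apply: le_trans (ler_normD _ _) _; rewrite normrX mulrDl; apply: lerD.
  apply: le_trans d2 _; rewrite ler_wpM2l ?mulr_ge0 ?exprn_ge0 ?(ltW i0)//; first by rewrite /a addr_ge0.
  by rewrite expr2 ler_peMr//; lra.
rewrite -exprMn lerXn2r// nnegrE// !mulr_ge0 ?sqr_ge0//; first by rewrite /a addr_ge0.
all: by lra.
Qed.

Definition gk_dt t (x : 'rV[R]_n) : R := dktime (Q x) t.

(** Second order Taylor estimate of the kernel in L^1, locally uniform in time. *)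
Lemma gk_taylor s : 0 < s -> s <= 1 -> exists2 C, 0 <= C & forall x xi y,
  s <= x -> x <= xi -> xi <= y -> y <= 1 ->
  L1 ((y - x) ^+ 2 * C) (fun z => gk (y *: B) z - gk (x *: B) z - (y - x) * gk_dt xi z).
Proof.
move=> s0 s1; have [C C0 hC] := ddktime_bound s0 s1.
exists (C * gauss_cst M); first by rewrite mulr_ge0// /gauss_cst !mulr_ge0 ?sqrtr_ge0.
move=> x xi y sx xxi xiy y1.
have x0 := lt_le_trans s0 sx; have xi0 := lt_le_trans x0 xxi; have y0 := lt_le_trans xi0 xiy.
have cQ : continuous Q by exact: continuous_qform.
have ckt (t : R) : continuous (fun z => ktime (Q z) t).
  apply: (@contM R 'rV[R]_n); first exact: cont_cst.
  apply: (@cont_comp R 'rV[R]_n); first exact: continuous_expR.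
  apply: (@contB R 'rV[R]_n); first exact: cont_cst.
  apply: (@contM R 'rV[R]_n); last exact: cont_cst.
  by apply: (@contM R 'rV[R]_n); first exact: cont_cst.
have cdg (t : R) : continuous (fun z => dg (Q z) t).
  apply: (@contD R 'rV[R]_n); first exact: cont_cst.
  apply: (@contM R 'rV[R]_n); last exact: cont_cst.
  by apply: (@contM R 'rV[R]_n); first exact: cont_cst.
have cF : continuous (fun z => gk (y *: B) z - gk (x *: B) z - (y - x) * gk_dt xi z).
  apply: (@contB R 'rV[R]_n); first by apply: (@contB R 'rV[R]_n); exact: continuous_gk.
  apply: (@contM R 'rV[R]_n); first exact: cont_cst.
  by apply: (@contM R 'rV[R]_n).
rewrite mulrA; apply: gauss_dominated => //; first exact: (continuous_measurable_rV cF).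
move=> z; rewrite !gk_ktime// /gk_dt; set r := Q z.
have [xy|xy] := eqVneq x y.
  rewrite xy !subrr mul0r subr0 normr0 expr0n !mul0r//.
have {}xy : x < y by rewrite lt_neqAle xy (le_trans xxi).
have yx0 : 0 < y - x by rewrite subr_gt0.
have [w /andP[w1 w2] E] := MVTpos x0 xy (fun t t0 => is_derive_ktime r t0).
rewrite E [dktime r w * _]mulrC -mulrBr normrM (gtr0_norm yx0) [(y - x) ^+ 2]expr2 -(mulrA _ C) -(mulrA (y - x) (y - x)).
rewrite ler_wpM2l ?(ltW yx0)// -/(Q z) -/r.
have D u u' : x <= u -> u < u' -> u' <= y -> `|dktime r u' - dktime r u| <= (y - x) * (C * ((1 + r) ^+ 2 * gauss M z)).
  move=> xu uu uy; have u0 := lt_le_trans x0 xu.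
  have [p /andP[p1 p2] ->] := MVTpos u0 uu (fun t t0 => is_derive_dktime r t0).
  rewrite normrM mulrC; apply: ler_pM => //; first by rewrite gtr0_norm ?subr_gt0//; lra.
  by apply: hC; lra.
have [wx|xw|<-] := ltgtP w xi.
- by rewrite distrC; apply: D => //; lra.
- by apply: D => //; lra.
rewrite subrr normr0; apply: mulr_ge0; first exact: ltW.
by apply: mulr_ge0 => //; apply: mulr_ge0; [exact: sqr_ge0|exact/ltW/gauss_gt0].
Qed.

(** The heat equation of the kernel: its time derivative is a combination of its second
   space derivatives. *)
Lemma gk_heat_equation t : 0 < t -> exists dk : 'I_n -> 'rV[R]_n -> R, exists ddk : 'I_n -> 'I_n -> 'rV[R]_n -> R,
  [/\ forall j, (exists K, L1 K (dk j)) /\ continuous (dk j) /\ has_pderiv j (gk (t *: B)) (dk j),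
      forall i j, (exists K, L1 K (ddk i j)) /\ continuous (ddk i j) /\ has_pderiv i (dk j) (ddk i j) &
      gk_dt t = fun x => \sum_i \sum_j B i j * ddk i j x].
Proof.
move=> t0; have pA : posdef (t *: B) by exact: posdefZ.
set A := t *: B in pA *; have pN := posdef_inv pA; set N := invmx A in pN *.
pose c := (Num.sqrt ((4 * pi) ^+ n * \det A))^-1.
have cc : 0 <= c by rewrite invr_ge0 sqrtr_ge0.
pose y j (x : 'rV[R]_n) := (x *m N) 0 j.
pose dk j (x : 'rV[R]_n) := - 2^-1 * (y j x * gk A x).
pose ddk i j (x : 'rV[R]_n) := - 2^-1 * (N i j * gk A x + y j x * dk i x).
have cy j : continuous (y j) by exact: continuous_mulmx_coord.
have cgk : continuous (gk A) by exact: continuous_gk.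
have cdk j : continuous (dk j).
  by apply: (@contM R 'rV[R]_n); [exact: cont_cst|exact: (@contM R 'rV[R]_n)].
have cddk i j : continuous (ddk i j).
  apply: (@contM R 'rV[R]_n); first exact: cont_cst.
  apply: (@contD R 'rV[R]_n); last exact: (@contM R 'rV[R]_n).
  by apply: (@contM R 'rV[R]_n) => //; exact: cont_cst.
have yb j x : `|y j x| <= Num.sqrt (N j j) * (1 + qform N x) by exact: mulmx_coord_le.
have gkE x : gk A x = c * gauss N x by [].
have Q0 x : 0 <= qform N x by exact: qform_ge0.
have sq j : 0 <= Num.sqrt (N j j) by exact: sqrtr_ge0.
have dkL j : exists K, L1 K (dk j).
  exists (Num.sqrt (N j j) * c * gauss_cst N); apply: gauss_dominated => //.
    exact: (continuous_measurable_rV (cdk j)).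
  move=> x; have h2 : 0 < 2^-1 :> R by [].
  rewrite /dk gkE !normrM normrN (gtr0_norm h2) (ger0_norm cc) (gtr0_norm (gauss_gt0 _ _)).
  have h := yb j x; have q0 := Q0 x; have s0 := sq j; have y0 := normr_ge0 (y j x).
  rewrite [leRHS](_ : _ = Num.sqrt (N j j) * (1 + qform N x) ^+ 2 * (c * gauss N x)); last by ring.
  rewrite mulrA ler_wpM2r ?mulr_ge0 ?(ltW (gauss_gt0 _ _))//.
  have : Num.sqrt (N j j) * (1 + qform N x) <= Num.sqrt (N j j) * (1 + qform N x) ^+ 2.
    rewrite ler_wpM2l// expr2 ler_peMr//; lra.
  by lra.
have ddkL i j : exists K, L1 K (ddk i j).
  exists ((`|N i j| + Num.sqrt (N j j) * Num.sqrt (N i i)) * c * gauss_cst N); apply: gauss_dominated => //.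
    exact: (continuous_measurable_rV (cddk i j)).
  move=> x; rewrite /ddk /dk gkE.
  rewrite (_ : _ * _ = (- 2^-1 * N i j + 4^-1 * (y j x * y i x)) * (c * gauss N x)); last by field.
  rewrite normrM [`|c * _|]ger0_norm ?mulr_ge0 ?(ltW (gauss_gt0 _ _))//.
  rewrite [leRHS](_ : _ = (`|N i j| + Num.sqrt (N j j) * Num.sqrt (N i i)) * (1 + qform N x) ^+ 2 * (c * gauss N x)); last by ring.
  rewrite ler_wpM2r ?mulr_ge0 ?(ltW (gauss_gt0 _ _))//.
  apply: le_trans (ler_normD _ _) _; have h2 : 0 < 2^-1 :> R by [].
  have h4 : 0 < 4^-1 :> R by [].
  rewrite !normrM normrN (gtr0_norm h2) (gtr0_norm h4) mulrDl.
  have q0 := Q0 x; have hh := ler_pM (normr_ge0 _) (normr_ge0 _) (yb j x) (yb i x).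
  have p0 : 0 <= `|y j x| * `|y i x| by rewrite mulr_ge0.
  have : Num.sqrt (N j j) * (1 + qform N x) * (Num.sqrt (N i i) * (1 + qform N x)) =
    Num.sqrt (N j j) * Num.sqrt (N i i) * (1 + qform N x) ^+ 2 by ring.
  move: hh => /[swap] -> hh.
  have n0 := normr_ge0 (N i j).
  have : `|N i j| <= `|N i j| * (1 + qform N x) ^+ 2.
    rewrite ler_peMr// expr2 -[leLHS]mulr1 ler_pM//; lra.
  by lra.
have hgk j : has_pderiv j (gk A) (dk j).
  move=> x; have := has_pderivM (has_pderiv_cst j c) (has_pderiv_gauss j pN.1) x.
  by congr is_derive; rewrite mul0r add0r /dk gkE /y; ring.
have hy i j : has_pderiv i (y j) (fun=> N i j).
  move=> x; apply/is_deriveE; apply: (@cvg_trans _ ((fun _ : R => N i j) @ (0 : R)^')); last exact: cvg_cst.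
  apply: near_eq_cvg; near=> h; have h0 : h != 0 by near: h; exact: nbhs_dnbhs_neq.
  rewrite /y mulmxDl -scalemxAl -rowE !mxE addrK /GRing.scale/= mulrA mulVf ?mul1r//.
exists dk, ddk; split => // [i j|].
  split; [exact: ddkL|split; [exact: cddk|]] => x.
  have := has_pderivM (has_pderiv_cst i (- 2^-1)) (has_pderivM (hy i j) (hgk i)) x.
  by congr is_derive; rewrite mul0r add0r.
apply/funext => x; rewrite /gk_dt /dktime -gk_ktime// -/A.
have NE : N = t^-1 *: M by rewrite /N invmxZ' ?gt_eqF.
have uB : B \in unitmx by exact: posdef_unit.
have s1 : \sum_i \sum_j B i j * N i j = n%:R * t^-1.
  rewrite (eq_bigr (fun=> t^-1)); first by rewrite sumr_const card_ord mulr_natl.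
  move=> i _; transitivity ((B *m N^T) i i); first by rewrite mxE; apply: eq_bigr => j _; rewrite mxE.
  by rewrite pN.1 NE -scalemxAr mulmxV// !mxE eqxx mulr1.
have s2 : \sum_i \sum_j B i j * (y j x * y i x) = Q x * t^-1 ^+ 2.
  transitivity (qform B (x *m N)).
    by rewrite qformE; apply: eq_bigr => i _; apply: eq_bigr => j _; rewrite /y [X in _ = _ * X]mulrC.
  rewrite NE -scalemxAr /qform linearZ/= -!scalemxAr -scalemxAl scalerA mxE.
  rewrite trmx_mul pM.1 !mulmxA -(mulmxA x M B) mulVmx// mulmx1 /Q /qform mulmxA.
  by rewrite mulrC expr2.
transitivity ((- 2^-1 * (\sum_i \sum_j B i j * N i j) + 4^-1 * (\sum_i \sum_j B i j * (y j x * y i x))) * gk A x).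
  by rewrite s1 s2 /dg; field; rewrite gt_eqF.
rewrite !mulr_sumr -big_split/= mulr_suml; apply: eq_bigr => i _.
rewrite !mulr_sumr -big_split/= mulr_suml; apply: eq_bigr => j _.
by rewrite /ddk /dk; field.
Unshelve. all: by end_near.
Qed.

End kernel_time.

Section generator.
Context {R : realType} {n : nat} {q : R} {q1 : (1 <= q%:E)%E}.
Local Notation L := (Lq n q1).
Local Notation wd := (@weak_deriv R n q q1).
Implicit Types (u v w : L) (l m : 'I_n -> nat) (B C : 'M[R]_n).

Definition inS v := forall l, exists g, is_weak_deriv l v g.

Lemma inSP v : lc_set (sobolev_oo n q1) v <-> inS v.
Proof.
split => [h l|h k _ l _]; last exact: h.
exact: (h (morder l) I l (leqnn _)).
Qed.

Lemma wdP l v : inS v -> is_weak_deriv l v (wd l v).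
Proof. by move=> vS; exact: weak_derivP. Qed.

Lemma inS_wd m v : inS v -> inS (wd m v).
Proof.
by move=> vS l; eexists; apply: wd_decomp (wdP m vS) (wdP _ vS).
Qed.

Lemma wd_add l m v : inS v -> wd l (wd m v) = wd (fun i => l i + m i)%N v.
Proof. by move=> vS; apply: weak_derivE; exact: wd_decomp (wdP m vS) (wdP _ vS). Qed.

Lemma wd_comm l m v : inS v -> wd l (wd m v) = wd m (wd l v).
Proof.
by move=> vS; rewrite !wd_add//; congr (wd _ v); apply/funext => i; rewrite addnC.
Qed.

Lemma inS_lin c u v : inS u -> inS v -> inS (c *: u + v).
Proof. by move=> uS vS l; eexists; apply: wd_lin; exact: wdP. Qed.

Lemma wd_linE l c u v : inS u -> inS v -> wd l (c *: u + v) = c *: wd l u + wd l v.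
Proof. by move=> uS vS; apply: weak_derivE; apply: wd_lin; exact: wdP. Qed.

Lemma inS0 : inS 0.
Proof.
move=> l; exists 0; apply/wdE => phi tphi.
have [C [D w]] := test_weight tphi; have [C' [D' w']] := test_weight (test_mderiv l tphi).
by rewrite -(scale0r (0 : L)) (LpairZ _ _ w) (LpairZ _ _ w') !mul0r mulr0.
Qed.

Lemma wd_id v : wd (fun=> 0%N) v = v.
Proof. by apply: weak_derivE; exact: wd0. Qed.

Lemma inSZ c v : inS v -> inS (c *: v).
Proof. by move=> vS; rewrite -[_ *: _]addr0; apply: inS_lin => //; exact: inS0. Qed.

Lemma inSD u v : inS u -> inS v -> inS (u + v).
Proof. by move=> uS vS; rewrite -[u]scale1r; exact: inS_lin. Qed.

Lemma wdD l u v : inS u -> inS v -> wd l (u + v) = wd l u + wd l v.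
Proof. by move=> uS vS; have := wd_linE l 1 uS vS; rewrite !scale1r. Qed.

Lemma wd_zero l : wd l 0 = 0.
Proof. by have := wd_linE l (-1) inS0 inS0; rewrite scaler0 addr0 scaleN1r addNr. Qed.

Lemma wdZ l c v : inS v -> wd l (c *: v) = c *: wd l v.
Proof. by move=> vS; have := wd_linE l c vS inS0; rewrite !addr0 wd_zero addr0. Qed.

Lemma wdB l u v : inS u -> inS v -> wd l (u - v) = wd l u - wd l v.
Proof.
move=> uS vS; have -> : u - v = -1 *: v + u by rewrite scaleN1r addrC.
by rewrite wd_linE// scaleN1r addrC.
Qed.

Lemma inSB u v : inS u -> inS v -> inS (u - v).
Proof. by move=> uS vS; rewrite -scaleN1r; apply: inSD => //; exact: inSZ. Qed.

Lemma inS_sum (I : Type) (r : seq I) (F : I -> L) : (forall i, inS (F i)) -> inS (\sum_(i <- r) F i).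
Proof.
move=> FS; elim: r => [|i r IH]; first by rewrite big_nil; exact: inS0.
by rewrite big_cons; exact: inSD.
Qed.

Lemma wd_sum l (I : Type) (r : seq I) (F : I -> L) : (forall i, inS (F i)) ->
  wd l (\sum_(i <- r) F i) = \sum_(i <- r) wd l (F i).
Proof.
move=> FS; elim: r => [|i r IH]; first by rewrite !big_nil wd_zero.
by rewrite !big_cons wdD ?IH//; exact: inS_sum.
Qed.

Lemma inS_heat B v : posdef B -> inS v -> inS (heat B v).
Proof. by move=> pB vS l; eexists; apply: heat_wd => //; exact: wdP. Qed.

Lemma wd_heat l B v : posdef B -> inS v -> wd l (heat B v) = heat B (wd l v).
Proof. by move=> pB vS; apply: weak_derivE; apply: heat_wd => //; exact: wdP. Qed.

Lemma inS_heat_smoothing B v : posdef B -> inS (heat B v).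
Proof. by move=> pB l; have [C _ /(_ v)[w hw _]] := heat_smoothing (q1 := q1) l pB; exists w. Qed.

Definition dij (i j : 'I_n) : 'I_n -> nat := fun k => (mono i k + mono j k)%N.

Definition Lop B v : L := \sum_i \sum_j B i j *: wd (dij i j) v.

Lemma inS_Lop B v : inS v -> inS (Lop B v).
Proof.
by move=> vS; apply: inS_sum => i; apply: inS_sum => j; apply: inSZ; exact: inS_wd.
Qed.

Lemma wd_Lop l B v : inS v -> wd l (Lop B v) = Lop B (wd l v).
Proof.
move=> vS; have h i j : inS (B i j *: wd (dij i j) v) by apply: inSZ; exact: inS_wd.
rewrite wd_sum; last by move=> i; apply: inS_sum => j; exact: h.
apply: eq_bigr => i _; rewrite wd_sum//; apply: eq_bigr => j _.
by rewrite wdZ; [rewrite wd_comm|exact: inS_wd].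
Qed.

Lemma LopD B u v : inS u -> inS v -> Lop B (u + v) = Lop B u + Lop B v.
Proof.
move=> uS vS; rewrite /Lop -big_split; apply: eq_bigr => i _; rewrite -big_split.
by apply: eq_bigr => j _; rewrite wdD// scalerDr.
Qed.

Lemma Lop_mxZ c B v : Lop (c *: B) v = c *: Lop B v.
Proof.
rewrite /Lop scaler_sumr; apply: eq_bigr => i _; rewrite scaler_sumr.
by apply: eq_bigr => j _; rewrite mxE scalerA.
Qed.

Lemma Lop_mxB B C v : Lop (B - C) v = Lop B v - Lop C v.
Proof.
rewrite /Lop -sumrB; apply: eq_bigr => i _; rewrite -sumrB.
by apply: eq_bigr => j _; rewrite !mxE scalerBl.
Qed.

Definition D2norm v : R := \sum_i \sum_j `|wd (dij i j) v|.

Lemma D2norm_ge0 v : 0 <= D2norm v.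
Proof. by apply: sumr_ge0 => i _; apply: sumr_ge0. Qed.

Lemma Lop_norm B v d : 0 <= d -> (forall i j, `|B i j| <= d) -> `|Lop B v| <= d * D2norm v.
Proof.
move=> d0 Bd; apply: le_trans (ler_norm_sum _ _ _) _; rewrite mulr_sumr; apply: ler_sum => i _.
apply: le_trans (ler_norm_sum _ _ _) _; rewrite mulr_sumr; apply: ler_sum => j _.
by rewrite normrZ ler_wpM2r.
Qed.

Lemma gk_dt_conv B t v : posdef B -> 0 < t -> inS v ->
  (exists K, L1 K (gk_dt B t)) /\ Lconv (gk_dt B t) v = heat (t *: B) (Lop B v).
Proof.
move=> pB t0 vS; have pA : posdef (t *: B) by exact: posdefZ.
have [dk [ddk [hdk hddk ->]]] := gk_heat_equation pB t0.
have inner i := Lconv_ksum (index_enum 'I_n) (fun j => B i j) v (fun j => (hddk i j).1).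
have e : (fun x => \sum_i \sum_j B i j * ddk i j x) = (fun x => \sum_i 1 * \sum_j B i j * ddk i j x).
  by apply/funext => x; apply: eq_bigr => i _; rewrite mul1r.
have [sL sE] := Lconv_ksum (index_enum 'I_n) (fun=> 1) v (fun i => (inner i).1).
rewrite e; split => //; rewrite sE /Lop /heat (Lconv_sum _ _ (L1_gk pA)); apply: eq_bigr => i _.
rewrite scale1r (inner i).2 (Lconv_sum _ _ (L1_gk pA)); apply: eq_bigr => j _.
rewrite (LconvZ _ _ (L1_gk pA)); congr (_ *: _).
have [[K1 L11] [c1 p1]] := hdk j; have [[K2 L12] [c2 p2]] := hddk i j.
have w1 := conv_pderiv v (L1_gk pA) L11 p1 (@continuous_gk R n _) c1.
have w2 := conv_pderiv v L11 L12 p2 c1 c2.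
apply: (wd_unique (wd_comp w1 w2)).
exact: heat_wd pA (wdP _ vS).
Qed.

(** G_{tB} v has time derivative G_{tB} (L_B v), uniformly away from t = 0. *)
Lemma heat_prim B v s : posdef B -> inS v -> 0 < s -> s <= 1 ->
  prim (fun t => heat (t *: B) (Lop B v)) (fun t => heat (t *: B) v) s 1.
Proof.
move=> pB vS s0 s1 e e0; have [C C0 hC] := gk_taylor pB s0 s1.
have K0 : 0 < C * `|v| + 1 by rewrite ltr_wpDl// mulr_ge0.
exists (e / (C * `|v| + 1)); first by rewrite divr_gt0.
move=> x xi y sx x1 x2 y1 yx.
have x0 := lt_le_trans s0 sx; have xi0 := lt_le_trans x0 x1; have y0 := lt_le_trans xi0 x2.
have FL := hC x xi y sx x1 x2 y1.
have [[K gL] <-] := gk_dt_conv pB xi0 vS.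
have Lx := L1_gk (posdefZ x0 pB); have Ly := L1_gk (posdefZ y0 pB).
have [k1 E1] := Lconv_klin (-1) v Lx Ly.
have [k2 E2] := Lconv_klin (- (y - x)) v gL k1.
rewrite (_ : _ - _ = Lconv (fun z => gk (y *: B) z - gk (x *: B) z - (y - x) * gk_dt B xi z) v); last first.
  have Fe : (fun z : 'rV[R]_n => gk (y *: B) z - gk (x *: B) z - (y - x) * gk_dt B xi z) =
      (fun z => - (y - x) * gk_dt B xi z + (-1 * gk (x *: B) z + gk (y *: B) z)).
    by apply/funext => z; ring.
  rewrite Fe E2 E1 /heat; set a1 := Lconv (gk (y *: B)) v; set a2 := Lconv (gk (x *: B)) v.
  by set a3 := Lconv (gk_dt B xi) v; lmod R.
apply: le_trans (conv_norm v FL) _.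
have y0' : 0 <= y - x by rewrite subr_ge0 (le_trans x1).
rewrite expr2 -!mulrA mulrCA [leRHS]mulrC ler_wpM2l//.
move: yx; rewrite ltr_pdivlMr// => h; have : 0 <= (y - x) * (C * `|v|) by rewrite !mulr_ge0.
by rewrite mulrDr mulr1 in h; lra.
Qed.

Let seq1 (k : nat) : R := (k.+1%:R)^-1.

Let seq1_gt0 k : 0 < seq1 k. Proof. by rewrite invr_gt0 ltr0n. Qed.
Let seq1_le1 k : seq1 k <= 1. Proof. by rewrite invf_le1 ?ltr0n// ler1n. Qed.

Let seq1_lim : seq1 k @[k --> \oo] --> (0 : R).
Proof. exact: cvg_harmonic. Qed.

Lemma heat_lim B v : posdef B -> inS v -> heat (seq1 k *: B) v @[k --> \oo] --> v.
Proof.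
move=> pB vS; pose w := Lop B v; pose f t := heat (t *: B) v.
have lip s t : 0 < s -> s <= t -> t <= 1 -> `|f t - f s| <= `|w| * (t - s).
  move=> s0 st t1; apply: (prim_le st (normr_ge0 _) (prim_sub (heat_prim pB vS s0 (le_trans st t1)) (lexx _) t1)).
  by move=> x /andP[sx _]; apply: heat_norm; apply: posdefZ => //; exact: lt_le_trans sx.
have [l hl] : exists l : L, f (seq1 k) @[k --> \oo] --> l.
  apply: (Lq_complete (u := fun k => f (seq1 k))) => e e0.
  have W0 : 0 < `|w| + 1 by rewrite ltr_wpDl.
  have := seq1_lim => /cvgrPdist_lt /(_ _ (divr_gt0 e0 W0))[N _ hN]; exists N => i j Ni Nj.
  have close i' : (N <= i')%N -> seq1 i' < e / (`|w| + 1).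
    by move=> /hN; rewrite /= sub0r normrN gtr0_norm.
  wlog ij : i j Ni Nj / seq1 j <= seq1 i.
    move=> H; have [ji|/ltW ij] := lerP (seq1 j) (seq1 i); first exact: H.
    by rewrite distrC; exact: H.
  apply: le_trans (lip _ _ (seq1_gt0 j) ij (seq1_le1 i)) _.
  have := close i Ni; rewrite ltr_pdivlMr// => h; have := seq1_gt0 j; have := normr_ge0 w; nra.
suff lv : l = v by rewrite lv in hl.
symmetry.
apply: Lpair_eq => phi tphi; have [C0 [D0 w0]] := test_weight tphi.
have L1' := Lpair_cvg w0 hl.
have [C C0' hC] := heat_initial v tphi.
pose S := \sum_i Num.sqrt (B i i).
have S0 : 0 <= S by apply: sumr_ge0 => i _; exact: sqrtr_ge0.
apply: (cvg_unique (@Rhausdorff R) _ L1').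
have z : Num.sqrt (seq1 k) @[k --> \oo] --> (0 : R).
  rewrite -[X in _ --> X]sqrtr0.
  exact: (continuous_cvg _ (@sqrt_continuous R 0) seq1_lim).
apply/cvgrPdist_le => e e0.
have CS0 : 0 < C * S + 1 by rewrite ltr_wpDl// mulr_ge0.
have := z => /cvgrPdist_le /(_ _ (divr_gt0 e0 CS0)); apply: filterS => k /=.
rewrite sub0r normrN ger0_norm ?sqrtr_ge0// ler_pdivlMr// => h.
rewrite distrC; apply: le_trans (hC _ (posdefZ (seq1_gt0 k) pB)) _.
have -> : \sum_i Num.sqrt ((seq1 k *: B) i i) = Num.sqrt (seq1 k) * S.
  by rewrite mulr_sumr; apply: eq_bigr => i _; rewrite mxE sqrtrM// ltW.
have := sqrtr_ge0 (seq1 k); nra.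
Qed.

Lemma heat_sub_le B v : posdef B -> inS v -> `|heat B v - v| <= `|Lop B v|.
Proof.
move=> pB vS; have hl := heat_lim pB vS.
apply: (@norm_lim_le R L (fun k => heat B v - heat (seq1 k *: B) v) _ _ 0%N).
  by apply: cvgB => //; exact: cvg_cst.
move=> k _; rewrite -{1}[B]scale1r; have s0 := seq1_gt0 k.
have p : prim (fun t => heat (t *: B) (Lop B v)) (fun t => heat (t *: B) v) (seq1 k) 1.
  exact: heat_prim.
apply: le_trans (prim_le (seq1_le1 k) (normr_ge0 (Lop B v)) p _) _.
  by move=> x /andP[sx _]; apply: heat_norm; apply: posdefZ => //; exact: lt_le_trans sx.
by rewrite ler_piMr//; lra.
Qed.

Lemma heat_taylor B v : posdef B -> inS v -> `|heat B v - v - Lop B v| <= `|Lop B (Lop B v)|.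
Proof.
move=> pB vS; have hl := heat_lim pB vS; have wS := inS_Lop B vS.
apply: (@norm_lim_le R L (fun k => heat B v - heat (seq1 k *: B) v - (1 - seq1 k) *: Lop B v) _ _ 0%N).
  apply: cvgB; first by apply: cvgB => //; exact: cvg_cst.
  rewrite -[X in _ --> X]scale1r; apply: cvgZr_tmp; rewrite -[X in _ --> X]subr0.
  by apply: cvgB; [exact: cvg_cst|exact: seq1_lim].
move=> k _; rewrite -{1}[B]scale1r; have s0 := seq1_gt0 k.
have p : prim (fun t => heat (t *: B) (Lop B v)) (fun t => heat (t *: B) v) (seq1 k) 1.
  exact: heat_prim.
apply: le_trans (prim_near (seq1_le1 k) (normr_ge0 (Lop B (Lop B v))) p _) _.
  move=> x /andP[sx x1]; have x0 := lt_le_trans s0 sx.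
  apply: le_trans (heat_sub_le (posdefZ x0 pB) wS) _.
  by rewrite Lop_mxZ normrZ gtr0_norm// ler_piMl.
by rewrite ler_piMr//; lra.
Qed.

(** Strong continuity at 0: by contractivity it suffices to treat test functions. *)
Lemma heat_continuous v e : 0 < e -> exists2 d, 0 < d & forall B, posdef B ->
  (forall i j, `|B i j| <= d) -> `|heat B v - v| <= e.
Proof.
move: v e; apply: test_dense => [phi tphi|c u v uP vP|u_ u uP uu] e e0.
- have vS : inS (Lcls q1 phi) by move=> l; eexists; exact: Lcls_test_wd.
  set v := Lcls q1 phi in vS *; have D0 := D2norm_ge0 v.
  have D1 : 0 < D2norm v + 1 by lra.
  exists (e / (D2norm v + 1)); first by rewrite divr_gt0.
  move=> B pB hB; apply: le_trans (heat_sub_le pB vS) _.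
  apply: le_trans (Lop_norm _ _ hB) _; first by rewrite divr_ge0// ltW.
  by rewrite mulrAC ler_pdivrMr// ler_wpM2l ?(ltW e0)//; lra.
- have c0 : 0 < `|c| + 1 by rewrite ltr_wpDl.
  have e1 : 0 < e / 2 / (`|c| + 1) by rewrite !divr_gt0.
  have e2 : 0 < e / 2 by rewrite divr_gt0.
  have [d1 d10 h1] := uP _ e1; have [d2 d20 h2] := vP _ e2.
  exists (Num.min d1 d2); first by rewrite lt_min d10.
  move=> B pB hB.
  have b1 : `|heat B u - u| <= e / 2 / (`|c| + 1).
    by apply: h1 => // i j; have := hB i j; rewrite le_min => /andP[].
  have b2 : `|heat B v - v| <= e / 2.
    by apply: h2 => // i j; have := hB i j; rewrite le_min => /andP[].
  rewrite heat_lin// (_ : _ - _ = c *: (heat B u - u) + (heat B v - v)); last by lmod R.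
  apply: le_trans (ler_normD _ _) _; rewrite normrZ [leRHS]splitr; apply: lerD => //.
  move: b1; rewrite ler_pdivlMr// => h; have := normr_ge0 (heat B u - u); nra.
have e3 : 0 < e / 3 by rewrite divr_gt0.
have := uu => /cvgrPdist_le /(_ _ e3)[N _ hN]; have {hN}hN := hN N (leqnn N).
have [d d0 hd] := uP N _ e3; exists d => // B pB hB; have {hd}hd := hd B pB hB.
rewrite (_ : heat B u - u = heat B (u - u_ N) + (heat B (u_ N) - u_ N) - (u - u_ N)); last first.
  have -> : u - u_ N = -1 *: u_ N + u by lmod R.
  by rewrite heat_lin//; lmod R.
have h := heat_norm (u - u_ N) pB; rewrite /= in hN.
apply: le_trans (ler_normB _ _) _; apply: le_trans (lerD (ler_normD _ _) (lexx _)) _.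
by move: (`|heat B (u - u_ N)|) (`|u - u_ N|) h hN hd => a b; lra.
Qed.

End generator.

(** * The evolution operators *)

Section scalar_primitive.
Context {R : realType}.
Local Notation mu := (@lebesgue_measure R).

Lemma within_cvg_eps (f : R -> R) c : {within `[0, +oo[, continuous f} -> 0 <= c ->
  forall e, 0 < e -> exists2 d, 0 < d & forall x, 0 <= x -> `|x - c| < d -> `|f x - f c| <= e.
Proof.
move=> /subspace_continuousP cf c0 e e0.
have h0 : (`[0, +oo[%classic : set R) c by rewrite /= in_itv/= c0.
have /cvgrPdist_le /(_ _ e0) := cf c h0.
rewrite near_withinE => -[d /= d0 hd]; exists d => // x x0 xc.
rewrite distrC; apply: hd => /=; first by rewrite distrC.
by rewrite in_itv/= x0.
Qed.

Lemma integral_prim (f : R -> R) b : {within `[0, +oo[, continuous f} ->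
  prim (f : R -> R^o) (fun t => \int[mu]_(s in `[0, t]) f s : R^o) 0 b.
Proof.
move=> cf; apply: prim_local => e e0 c /andP[c0 cb].
have e2 : 0 < e / 2 by rewrite divr_gt0.
have [d d0 hd] := within_cvg_eps cf c0 e2; exists d => // x xi y x0 x1 x2 yb xc yc.
have xy := le_trans x1 x2; have y0 := le_trans x0 xy.
have int u : 0 <= u -> mu.-integrable `[0, u] (EFin \o f).
  move=> u0; apply: continuous_compact_integrable; first exact: segment_compact.
  by apply: continuous_subspaceW cf => z /=; rewrite !in_itv/= => /andP[->].
have -> : \int[mu]_(s in `[0, y]) f s - \int[mu]_(s in `[0, x]) f s = \int[mu]_(s in `]x, y]) f s.
  by apply: Rintegral_itvB; [exact: int|rewrite bnd_simp|rewrite bnd_simp].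
have ixy : mu.-integrable `]x, y] (EFin \o f).
  apply: integrableS (int y y0) => //.
  by move=> z /=; rewrite !in_itv/= => /andP[xz ->]; rewrite andbT (le_trans x0)// ltW.
have mE : fine (mu `]x, y]) = y - x.
  rewrite lebesgue_measure_itv/= lte_fin; case: ltP => h //=.
  by have -> : x = y; [apply/eqP; rewrite eq_le xy h|rewrite subrr].
have muoo : (mu `]x, y] < +oo)%E.
  by rewrite lebesgue_measure_itv/=; case: ifP => _; rewrite ?ltry// -EFinB ltry.
have ic (r : R) : mu.-integrable `]x, y] (EFin \o cst r).
  apply/integrableP; split; first by apply/measurable_EFinP.
  by rewrite (eq_integral (cst `|r|%:E))// integral_cst// lte_mul_pinfty.
have -> : (y - x) *: (f xi : R^o) = \int[mu]_(s in `]x, y]) f xi.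
  by rewrite Rintegral_cst// mE mulrC.
rewrite -RintegralB//; last exact: ic.
have iB : mu.-integrable `]x, y] (EFin \o (fun s => f s - f xi)).
  have h := integrableB _ ixy (ic (f xi)).
  by apply: eq_integrable (h _).
apply: le_trans (le_normr_Rintegral _ iB) _ => //.
rewrite -mE -Rintegral_cst//; apply: le_Rintegral => //.
- exact: integrable_norm iB.
- exact: ic.
move=> z /=; rewrite in_itv/= => /andP[xz zy].
have z0 : 0 <= z by rewrite (le_trans x0)// ltW.
have xi0 : 0 <= xi := le_trans x0 x1.
have near u : x <= u -> u <= y -> `|u - c| < d.
  by move: xc yc; rewrite !ltr_norml => /andP[a1 a2] /andP[a3 a4] u1 u2; apply/andP; split; lra.
have h1 := hd z z0 (near z (ltW xz) zy); have h2 := hd xi xi0 (near xi x1 x2).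
have := ler_distD (f c) (f z) (f xi); rewrite [`|f c - f xi|]distrC; have := splitr e; lra.
Qed.

End scalar_primitive.

Section evolution.
Context {R : realType} {n : nat} (a : R -> 'M[R]_n).
Hypothesis a_continuous : {within `[0, +oo[, continuous a}.
Hypothesis a_sym : forall t : R, 0 <= t -> (a t)^T = a t.
Hypothesis a_posdef : forall t : R, 0 <= t ->
  forall x : 'rV[R]_n, x != 0 -> 0 < (x *m (a t *m x^T)) 0 0.
Local Notation A := (primitive_mx a).

Lemma a_entry_continuous i j : {within `[0, +oo[, continuous (fun s => a s i j)}.
Proof.
move: a_continuous => /subspace_continuousP ca; apply/subspace_continuousP => x hx.
have cij : {for a x, continuous (fun M : 'M[R]_n => M i j)} by exact: coord_continuous.
exact: (cvg_comp _ _ (ca x hx) cij).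
Qed.

Lemma prim_A i j b : prim (fun s => a s i j : R^o) (fun t => A t i j : R^o) 0 b.
Proof.
have := integral_prim b (a_entry_continuous (i := i) (j := j)).
by congr prim; apply/funext => t; rewrite mxE.
Qed.

Lemma A_near t0 e : 0 <= t0 -> 0 < e -> exists2 d, 0 < d & forall s t, 0 <= s -> s <= t ->
  `|s - t0| < d -> `|t - t0| < d ->
  forall i j, `|(A t - A s) i j - (t - s) * a t0 i j| <= e * (t - s).
Proof.
move=> t00 e0.
have /choice[f hf] : forall ij : 'I_n * 'I_n, exists d, 0 < d /\
    forall x, 0 <= x -> `|x - t0| < d -> `|a x ij.1 ij.2 - a t0 ij.1 ij.2| <= e.
  by move=> [i j]; have [d d0 hd] := within_cvg_eps (a_entry_continuous (i := i) (j := j)) t00 e0; exists d.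
pose d := \big[Order.min/1]_ij f ij.
have d0 : 0 < d.
  by rewrite /d; elim/big_ind: _ => // [x y x0 y0|ij _]; [rewrite lt_min x0|have [] := hf ij].
exists d => // s t s0 st sd td i j.
have := prim_sub (prim_A i j t) s0 (lexx t) => p.
have := prim_near (v := a t0 i j) st (ltW e0) p.
rewrite !mxE => H; apply: H => x /andP[sx xt].
have [_ h] := hf (i, j); apply: h; first exact: le_trans sx.
apply: lt_le_trans (_ : d <= f (i, j)); last exact: bigmin_le_cond.
by move: sd td; rewrite !ltr_norml => /andP[? ?] /andP[? ?]; apply/andP; split; lra.
Qed.

Lemma A_posdef s t : 0 <= s -> s < t -> posdef (A t - A s).
Proof.
move=> s0 st; have t0 : 0 <= t by rewrite (le_trans s0)// ltW.
have symA u : 0 <= u -> (A u)^T = A u.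
  move=> u0; apply/matrixP => i j; rewrite !mxE; apply: eq_Rintegral => r.
  by rewrite inE/= in_itv/= => /andP[r0 _]; rewrite -(a_sym r0) mxE a_sym.
split => [|x x0]; first by rewrite linearB/= !symA.
pose phi (r : R) : R^o := qform (a r) x.
pose F (r : R) : R^o := qform (A r) x.
have phiE r : phi r = \sum_(i <- index_enum 'I_n) \sum_(j <- index_enum 'I_n) (x 0 i * x 0 j) *: (a r i j : R^o).
  by rewrite /phi qformE; apply: eq_bigr => i _; apply: eq_bigr => j _; rewrite mulrC.
have FE r : F r = \sum_(i <- index_enum 'I_n) \sum_(j <- index_enum 'I_n) (x 0 i * x 0 j) *: (A r i j : R^o).
  by rewrite /F qformE; apply: eq_bigr => i _; apply: eq_bigr => j _; rewrite mulrC.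
have psum (I : Type) (r : seq I) (f G : I -> R -> R^o) : (forall i, prim (f i) (G i) 0 t) ->
    prim (fun u => \sum_(i <- r) f i u) (fun u => \sum_(i <- r) G i u) 0 t.
  move=> h; elim: r => [|i r IH].
    have := prim_cst (0 : R^o) 0 t => p e e0; have [d d0 hd] := p e e0; exists d => // y xi z ? ? ? ? ?.
    by have := hd y xi z; rewrite !scaler0 !big_nil scaler0; apply.
  have := prim_lin 1 (h i) IH; congr prim; apply/funext => u; by rewrite big_cons scale1r.
have pphi : prim phi F 0 t.
  rewrite (funext phiE) (funext FE).
  apply: (psum 'I_n) => i; apply: (psum 'I_n) => j.
  have := prim_lin (x 0 i * x 0 j) (prim_A i j t) (prim_cst (0 : R^o) 0 t).
  by congr prim; apply/funext => u; rewrite ?scaler0 addr0.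
have cphi0 : {within `[0, +oo[, continuous (phi : R -> R)}.
  rewrite (_ : phi = fun r => \sum_(i <- index_enum 'I_n) \sum_(j <- index_enum 'I_n) x 0 i * x 0 j * a r i j); last first.
    by apply/funext => r; rewrite phiE.
  apply: (@cont_sum R (subspace (`[0, +oo[%classic : set R))) => i; apply: (@cont_sum R (subspace (`[0, +oo[%classic : set R))) => j.
  by apply: (@contM R (subspace (`[0, +oo[%classic : set R))); [exact: cont_cst|exact: a_entry_continuous].
have cphi : {within `[s, t], continuous (phi : R -> R)}.
  apply: continuous_subspaceW cphi0 => z /=.
  by rewrite !in_itv/= andbT => /andP[/(le_trans s0)].
have [c cst' hc] := EVT_min (ltW st) cphi.
have [c' cst'' hc'] := EVT_max (ltW st) cphi.
have m0 : 0 < phi c.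
  by apply: a_posdef => //; move: cst'; rewrite in_itv/= => /andP[/(le_trans s0)].
have mM : phi c <= phi c' by exact: hc.
have := prim_near (v := phi c') (M := phi c' - phi c) (ltW st) _ (prim_sub pphi s0 (lexx t)).
rewrite subr_ge0 mM => /(_ isT) H.
have {H} : `|F t - F s - (t - s) * phi c'| <= (phi c' - phi c) * (t - s).
  apply: H => u ust; have h1 := hc u; have h2 := hc' u.
  rewrite in_itv/= in h1; rewrite in_itv/= in h2.
  by rewrite distrC ger0_norm ?subr_ge0 ?h2// lerB// h1.
have -> : qform (A t - A s) x = F t - F s.
  by have := qformD (A t - A s) (A s) x; rewrite subrK /F => ->; rewrite addrK.
rewrite ler_norml => /andP[h _].
have ts : 0 < t - s by rewrite subr_gt0.
have := mulr_gt0 m0 ts; nra.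
Qed.

Context {q : R} {q1 : (1 <= q%:E)%E}.
Local Notation L := (Lq n q1).
Local Notation wd := (@weak_deriv R n q q1).
Local Notation W s t := (@heat_op R n a q q1 s t).
Implicit Types (u v w : L).

Lemma WE s t v : s < t -> W s t v = heat (A t - A s) v.
Proof. by move=> st; rewrite /heat_op st. Qed.

Lemma Wid t v : W t t v = v.
Proof. by rewrite /heat_op ltxx. Qed.

Lemma W_norm s t v : 0 <= s -> s <= t -> `|W s t v| <= `|v|.
Proof.
move=> s0; rewrite le_eqVlt => /predU1P[->|st]; first by rewrite Wid.
by rewrite WE//; apply: heat_norm; exact: A_posdef.
Qed.

Lemma W_lin s t c u v : 0 <= s -> s <= t -> W s t (c *: u + v) = c *: W s t u + W s t v.
Proof.
move=> s0; rewrite le_eqVlt => /predU1P[->|st]; first by rewrite !Wid.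
by rewrite !WE//; apply: heat_lin; exact: A_posdef.
Qed.

Lemma WB s t u v : 0 <= s -> s <= t -> W s t (u - v) = W s t u - W s t v.
Proof.
move=> s0 st; have -> : u - v = -1 *: v + u by rewrite scaleN1r addrC.
by rewrite W_lin// scaleN1r addrC.
Qed.

Lemma W_comp r s t v : 0 <= r -> r <= s -> s <= t -> W s t (W r s v) = W r t v.
Proof.
move=> r0 rs st; have s0 := le_trans r0 rs.
move: rs st; rewrite le_eqVlt => /predU1P[->|rs]; first by rewrite Wid.
rewrite le_eqVlt => /predU1P[<-|st]; first by rewrite Wid.
rewrite !WE//; last exact: lt_trans st.
rewrite heat_comp; [|exact: A_posdef|exact: A_posdef].
by rewrite addrA subrK.
Qed.

Lemma inS_W s t v : 0 <= s -> s <= t -> inS v -> inS (W s t v).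
Proof.
move=> s0; rewrite le_eqVlt => /predU1P[->|st]; first by rewrite Wid.
by move=> vS; rewrite WE//; apply: inS_heat => //; exact: A_posdef.
Qed.

Lemma wd_W l s t v : 0 <= s -> s <= t -> inS v -> wd l (W s t v) = W s t (wd l v).
Proof.
move=> s0; rewrite le_eqVlt => /predU1P[->|st]; first by rewrite !Wid.
by move=> vS; rewrite !WE//; apply: wd_heat => //; exact: A_posdef.
Qed.

Let amax t0 : R := \sum_i \sum_j `|a t0 i j|.
Let amax_ge0 t0 : 0 <= amax t0.
Proof. by apply: sumr_ge0 => i _; apply: sumr_ge0. Qed.
Lemma a_le_amax t0 i j : `|a t0 i j| <= \sum_i \sum_j `|a t0 i j|.
Proof.
rewrite (bigD1 i)//= (bigD1 j)//= -addrA lerDl addr_ge0//; last first.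
  by apply: sumr_ge0 => k _; apply: sumr_ge0.
by apply: sumr_ge0.
Qed.

Lemma A_lip t0 : 0 <= t0 -> exists2 d, 0 < d & forall s t, 0 <= s -> s <= t ->
  `|s - t0| < d -> `|t - t0| < d -> forall i j, `|(A t - A s) i j| <= (amax t0 + 1) * (t - s).
Proof.
move=> t00; have [d d0 hd] := A_near t00 ltr01; exists d => // s t s0 st sd td i j.
have h := hd s t s0 st sd td i j.
have ts : 0 <= t - s by rewrite subr_ge0.
rewrite -[X in `|X|](subrK ((t - s) * a t0 i j)); apply: le_trans (ler_normD _ _) _.
rewrite [leRHS]mulrDl [leRHS]addrC; apply: lerD => //.
by rewrite normrM (ger0_norm ts) mulrC ler_wpM2r//; exact: a_le_amax.
Qed.

Lemma W_cont t0 v e : 0 <= t0 -> 0 < e -> exists2 d, 0 < d & forall s t, 0 <= s -> s <= t ->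
  `|s - t0| < d -> `|t - t0| < d -> `|W s t v - v| <= e.
Proof.
move=> t00 e0; have [d d0 hd] := A_lip t00; have [b b0 hb] := heat_continuous v e0.
have k0 : 0 < 2 * (amax t0 + 1) by have := amax_ge0 t0; lra.
exists (Num.min d (b / (2 * (amax t0 + 1)))); first by rewrite lt_min d0 divr_gt0.
move=> s t s0; rewrite le_eqVlt => /predU1P[->|st].
  by move=> _ _; rewrite Wid subrr normr0 ltW.
rewrite !lt_min => /andP[s1 s2] /andP[t1 t2]; rewrite WE//; apply: hb; first exact: A_posdef.
move=> i j; apply: le_trans (hd s t s0 (ltW st) s1 t1 i j) _.
move: s2 t2; rewrite !ltr_pdivlMr// => s2 t2.
have := ler_distD t0 t s; rewrite (gtr0_norm (_ : 0 < t - s)) ?subr_gt0// [`|t0 - s|]distrC => h.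
have := amax_ge0 t0; nra.
Qed.

Definition D4norm v : R := \sum_i \sum_j D2norm (wd (dij i j) v).

Lemma D4norm_ge0 v : 0 <= D4norm v.
Proof. by apply: sumr_ge0 => i _; apply: sumr_ge0 => j _; exact: D2norm_ge0. Qed.

Lemma D2norm_Lop (B : 'M[R]_n) v d : 0 <= d -> (forall i j, `|B i j| <= d) -> inS v ->
  D2norm (Lop B v) <= d * D4norm v.
Proof.
move=> d0 Bd vS; rewrite /D2norm /D4norm mulr_sumr; apply: ler_sum => i _.
rewrite mulr_sumr; apply: ler_sum => j _; rewrite wd_Lop//.
exact: Lop_norm.
Qed.

(** First order expansion of the evolution, with a remainder controlled by derivatives of
   order at most 4. *)
Lemma W_taylor t0 e : 0 <= t0 -> 0 < e -> exists2 d, 0 < d & forall s t v, 0 <= s -> s <= t ->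
  `|s - t0| < d -> `|t - t0| < d -> inS v ->
  `|W s t v - v - (t - s) *: Lop (a t0) v| <= e * (D2norm v + D4norm v) * (t - s).
Proof.
move=> t00 e0; have [d1 d10 h1] := A_near t00 e0; have [d2 d20 h2] := A_lip t00.
have am := amax_ge0 t0; set m := amax t0 + 1 in h2; have m0 : 0 < m by rewrite /m; lra.
have d30 : 0 < e / (2 * m ^+ 2) by rewrite divr_gt0// mulr_gt0// exprn_gt0.
exists (Num.min d1 (Num.min d2 (e / (2 * m ^+ 2)))); first by rewrite !lt_min d10 d20.
move=> s t v s0; rewrite le_eqVlt => /predU1P[->|st].
  by move=> _ _ _; rewrite Wid !subrr scale0r subrr normr0 mulr0.
rewrite !lt_min => /and3P[s1 s2 s3] /and3P[t1 t2 t3] vS; rewrite WE//.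
have pB := A_posdef s0 st; set B := A t - A s in pB *.
have ts : 0 < t - s by rewrite subr_gt0.
have Bb := h2 s t s0 (ltW st) s2 t2; rewrite -/B in Bb.
have Ba := h1 s t s0 (ltW st) s1 t1; rewrite -/B in Ba.
have D2 := D2norm_ge0 v; have D4 := D4norm_ge0 v.
rewrite (_ : _ - _ = (heat B v - v - Lop B v) + Lop (B - (t - s) *: a t0) v); last first.
  by rewrite (Lop_mxB B ((t - s) *: a t0) v) (Lop_mxZ (t - s) (a t0) v); lmod R.
apply: le_trans (ler_normD _ _) _.
have b1 : `|heat B v - v - Lop B v| <= e * D4norm v * (t - s).
  apply: le_trans (heat_taylor pB vS) _.
  have mts : 0 <= m * (t - s) by rewrite mulr_ge0// ltW.
  apply: le_trans (Lop_norm _ mts Bb) _.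
  apply: (@le_trans _ _ (m * (t - s) * (m * (t - s) * D4norm v))).
    by rewrite ler_wpM2l//; exact: D2norm_Lop.
  rewrite (_ : _ * _ = m ^+ 2 * (t - s) * (D4norm v * (t - s))); last by ring.
  rewrite -(mulrA e) ler_wpM2r ?mulr_ge0 ?(ltW ts)//.
  have := ler_distD t0 t s; rewrite (gtr0_norm ts) [`|t0 - s|]distrC => h.
  move: s3 t3; rewrite !ltr_pdivlMr ?mulr_gt0 ?exprn_gt0// => s3 t3.
  have m2 : 0 <= m ^+ 2 by exact: sqr_ge0.
  nra.
have b2 : `|Lop (B - (t - s) *: a t0) v| <= e * D2norm v * (t - s).
  rewrite mulrAC; apply: Lop_norm; first by rewrite mulr_ge0 ?(ltW e0) ?(ltW ts).
  by move=> i j; have := Ba i j; rewrite !mxE.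
by move: b1 b2; nra.
Qed.

End evolution.

(** * Differentiation in the Sobolev scale *)

(* From here on weak derivatives and evolution operators are used through their
   properties only; unfolding them makes unification diverge. *)
#[local] Opaque weak_deriv heat_op Lspace_norm Lspace_add Lspace_opp Lspace_scale.

Lemma frac_le (R : realType) (c U e s : R) : 0 <= c -> 0 <= U -> c <= e / (U + 1) * s -> c * U <= e * s.
Proof.
move=> c0 U0; have U1 : 0 < U + 1 by rewrite ltr_wpDl.
by rewrite mulrAC ler_pdivlMr//; lra.
Qed.

Section differentiation.
Context {R : realType} {n : nat} {q : R} {q1 : (1 <= q%:E)%E}.
Local Notation L := (Lq n q1).
Local Notation wd := (@weak_deriv R n q q1).
Local Notation S := (sobolev_oo n q1).
Implicit Types (u w : R -> L) (l m : 'I_n -> nat).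

(** On functions from R_+ to the intersection of the Sobolev spaces: [hasD u u'] says that
   u' is the derivative of u. *)
Definition hasD u u' := forall t, 0 < t -> forall l e, 0 < e -> exists2 d, 0 < d &
  forall s, 0 < s -> `|s - t| < d -> `|wd l (u s - u t - (s - t) *: u' t)| <= e * `|s - t|.

Definition Sval u := forall t, 0 < t -> inS (u t).

Lemma hasD_lc_derive u u' : Sval u -> Sval u' -> hasD u u' ->
  forall t, 0 < t -> is_lc_derive S u t (u' t).
Proof.
move=> uS uS' h t t0; split; first by apply/inSP; exact: uS'.
move=> l; apply/cvgrPdist_le => e e0; have [d d0 hd] := h t t0 l e e0.
rewrite !near_simpl; near=> s => /=.
have s0 : s != 0 by near: s; exact: nbhs_dnbhs_neq.
have sd : `|s| < Num.min d t.
  near: s; apply: nbhs_dnbhs; exists (Num.min d t); first by rewrite /= lt_min d0.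
  by move=> z /=; rewrite sub0r normrN.
move: sd; rewrite lt_min => /andP[sd st].
have ts0 : 0 < t + s by move: st; rewrite ltr_norml => /andP[? _]; lra.
have := hd (t + s) ts0; rewrite (_ : t + s - t = s); last by ring.
move=> /(_ sd) H; rewrite sub0r normrN normr_id.
have -> : s^-1 *: (u (t + s) - u t) - u' t = s^-1 *: (u (t + s) - u t - s *: u' t).
  by lmod R; field.
rewrite wdZ; last first.
  by apply: inSB; [apply: inSB; exact: uS|apply: inSZ; exact: uS'].
by rewrite normrZ normfV mulrC ler_pdivrMr// normr_gt0.
Unshelve. all: by end_near.
Qed.

Lemma lc_derive_eps u t v : is_lc_derive S u t v -> inS v /\ forall l e, 0 < e ->
  exists2 d, 0 < d & forall s, s != 0 -> `|s| < d ->
    `|wd l (s^-1 *: (u (t + s) - u t) - v)| <= e.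
Proof.
move=> [vS h]; split; first exact/inSP.
move=> l e e0; have /cvgrPdist_le /(_ e e0)[d /= d0 hd] := h l; exists d; first exact: d0.
move=> s s0 sd; have sd' : ball_ Num.norm 0 d s by rewrite /ball_/= sub0r normrN.
by have := hd s sd' s0; rewrite sub0r normrN normr_id.
Qed.

Lemma lc_derive_hasD u u' : Sval u -> Sval u' ->
  (forall t, 0 < t -> is_lc_derive S u t (u' t)) -> hasD u u'.
Proof.
move=> uS uS' h t t0 l e e0; have [_ /(_ l e e0)[d d0 hd]] := lc_derive_eps (h t t0).
exists d; first exact: d0.
move=> s s0 sd; have [->|st] := eqVneq s t.
  by rewrite !subrr scale0r subrr wd_zero !normr0 mulr0.
have st0 : s - t != 0 by rewrite subr_eq0.
have := hd (s - t) st0 sd; rewrite (_ : t + (s - t) = s); last by ring.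
have -> : (s - t)^-1 *: (u s - u t) - u' t = (s - t)^-1 *: (u s - u t - (s - t) *: u' t).
  by lmod R; field.
rewrite wdZ; last first.
  by apply: inSB; [apply: inSB; exact: uS|apply: inSZ; exact: uS'].
by rewrite normrZ normfV mulrC ler_pdivrMr// normr_gt0.
Qed.

Lemma lc_derive_unique u t v v' : is_lc_derive S u t v -> is_lc_derive S u t v' -> v = v'.
Proof.
move=> /lc_derive_eps[_ h] /lc_derive_eps[_ h'].
apply/eqP; rewrite -subr_eq0 -normr_le0; apply/ler_addgt0Pr => e e0; rewrite add0r.
have e2 : 0 < e / 2 by rewrite divr_gt0.
have [d d0 hd] := h (fun=> 0%N) _ e2; have [d' d'0 hd'] := h' (fun=> 0%N) _ e2.
pose s := Num.min d d' / 2.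
have s0 : 0 < s by rewrite divr_gt0// lt_min d0.
have sm : s < Num.min d d' by rewrite ltr_pdivrMr// mulr_natr mulr2n ltrDl lt_min d0.
have s1 : s != 0 by rewrite gt_eqF.
have : `|s| < d /\ `|s| < d' by rewrite gtr0_norm//; move: sm; rewrite lt_min => /andP[].
move=> [sd sd']; have := hd s s1 sd; have := hd' s s1 sd'; rewrite !wd_id.
set D := s^-1 *: _ => b b'; rewrite (_ : v - v' = (D - v') - (D - v)); last by lmod R.
by apply: le_trans (ler_normB _ _) _; rewrite [leRHS]splitr; apply: lerD.
Qed.

Lemma lc_deriveE u t v : is_lc_derive S u t v -> lc_derive S u t = v.
Proof. by move=> h; apply: (lc_derive_unique _ h); exact: (xgetI 0 h). Qed.

Lemma hasD_ext u w u' w' : (forall t, 0 < t -> u t = w t) -> (forall t, 0 < t -> u' t = w' t) ->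
  hasD u u' -> hasD w w'.
Proof.
move=> uw uw' h t t0 l e e0; have [d d0 hd] := h t t0 l e e0; exists d; first exact: d0.
by move=> s s0 sd; rewrite -(uw s s0) -(uw t t0) -(uw' t t0); exact: hd.
Qed.

Lemma Sval_ext u w : (forall t, 0 < t -> u t = w t) -> Sval u -> Sval w.
Proof. by move=> uw uS t t0; rewrite -uw//; exact: uS. Qed.

Lemma lc_deriven_tower u (U : nat -> R -> L) k : (forall t, 0 < t -> U 0%N t = u t) ->
  (forall i, (i <= k)%N -> Sval (U i)) -> (forall i, (i < k)%N -> hasD (U i) (U i.+1)) ->
  forall i, (i <= k)%N -> forall t, 0 < t -> lc_deriven S i u t = U i t.
Proof.
move=> U0 US UD; elim=> [|i IH] ik t t0; first by rewrite U0.
rewrite /lc_deriven iterS; apply: lc_deriveE; apply: hasD_lc_derive t t0.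
- by apply: Sval_ext (US i (ltnW ik)) => t t0; rewrite -IH// ltnW.
- exact: US.
apply: hasD_ext (UD i ik) => // t t0; by rewrite -IH// ltnW.
Qed.

Lemma hasD_lin c u w u' w' : Sval u -> Sval w -> Sval u' -> Sval w' -> hasD u u' -> hasD w w' ->
  hasD (fun t => c *: u t + w t) (fun t => c *: u' t + w' t).
Proof.
move=> uS wS uS' wS' hu hw t t0 l e e0.
have c1 : 0 < `|c| + 1 by rewrite ltr_wpDl.
have e1 : 0 < e / 2 / (`|c| + 1) by rewrite !divr_gt0.
have e2 : 0 < e / 2 by rewrite divr_gt0.
have [d1 d10 h1] := hu t t0 l _ e1; have [d2 d20 h2] := hw t t0 l _ e2.
exists (Num.min d1 d2); first by rewrite lt_min d10.
move=> s s0; rewrite lt_min => /andP[s1 s2]; have H1 := h1 s s0 s1; have H2 := h2 s s0 s2.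
set X := u s - _ - _ in H1; set Y := w s - _ - _ in H2.
have XS : inS X by apply: inSB; [apply: inSB; exact: uS|apply: inSZ; exact: uS'].
have YS : inS Y by apply: inSB; [apply: inSB; exact: wS|apply: inSZ; exact: wS'].
rewrite (_ : _ - _ = c *: X + Y); last by rewrite /X /Y; lmod R.
rewrite wd_linE//; apply: le_trans (ler_normD _ _) _; rewrite normrZ.
rewrite {1}(splitr e) mulrDl; apply: lerD => //.
by rewrite mulrC; apply: frac_le H1; exact: normr_ge0.
Qed.

Lemma hasD_wd m u u' : Sval u -> Sval u' -> hasD u u' -> hasD (fun t => wd m (u t)) (fun t => wd m (u' t)).
Proof.
move=> uS uS' h t t0 l e e0; have [d d0 hd] := h t t0 (fun i => l i + m i)%N e e0; exists d => // s s0 sd.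
have XS : inS (u s - u t - (s - t) *: u' t).
  by apply: inSB; [apply: inSB; exact: uS|apply: inSZ; exact: uS'].
have := hd s s0 sd; rewrite -(wd_add l m XS) (wdB m (inSB (uS s s0) (uS t t0)) (inSZ _ (uS' t t0))).
by rewrite (wdB m (uS s s0) (uS t t0)) (wdZ m _ (uS' t t0)).
Qed.

Lemma hasD_lipschitz u u' : Sval u -> Sval u' -> hasD u u' -> forall t, 0 < t -> forall l,
  exists2 d, 0 < d & forall s, 0 < s -> `|s - t| < d -> `|wd l (u s - u t)| <= (`|wd l (u' t)| + 1) * `|s - t|.
Proof.
move=> uS uS' h t t0 l; have [d d0 hd] := h t t0 l 1 ltr01; exists d => // s s0 sd.
rewrite -(subrK ((s - t) *: u' t) (u s - u t)) wdD; last 2 first.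
- by apply: inSB; [apply: inSB; exact: uS|apply: inSZ; exact: uS'].
- by apply: inSZ; exact: uS'.
apply: le_trans (ler_normD _ _) _; rewrite mulrDl addrC lerD//; last exact: hd.
by rewrite wdZ ?normrZ 1?mulrC//; exact: uS'.
Qed.

Lemma hasD_scale (b b' : R -> R) u u' : Sval u -> Sval u' ->
  (forall t : R, 0 < t -> is_derive t 1 b (b' t)) -> hasD u u' ->
  hasD (fun t => b t *: u t) (fun t => b' t *: u t + b t *: u' t).
Proof.
move=> uS uS' hb hu t t0 l e e0.
pose U := `|wd l (u t)|; pose U' := `|wd l (u' t)| + 1; pose B := `|b t|; pose B' := `|b' t| + 1.
have U0 : 0 <= U by exact: normr_ge0.
have B0 : 0 <= B by exact: normr_ge0.
have U'0 : 0 < U' by rewrite ltr_wpDl. have B'0 : 0 < B' by rewrite ltr_wpDl.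
have U1 : 0 < U + 1 by apply: ltr_wpDl; [exact: U0|exact: ltr01].
have B1 : 0 < B + 1 by apply: ltr_wpDl; [exact: B0|exact: ltr01].
have e30 : 0 < e / 3 by apply: divr_gt0.
have e1 := divr_gt0 e30 U1; have e2 := divr_gt0 e30 B1.
have e3 := divr_gt0 e30 (mulr_gt0 B'0 U'0).
have bd e' : 0 < e' -> exists2 d, 0 < d & forall s, `|s - t| < d -> `|b s - b t - (s - t) * b' t| <= e' * `|s - t|.
  move=> e'0; have /is_deriveE := hb t t0 => /cvgrPdist_le /(_ e' e'0).
  move=> [d /= d0 hd]; exists d => // s sd.
  have [->|st] := eqVneq s t; first by rewrite !subrr mul0r subrr normr0 mulr0.
  have st0 : s - t != 0 by rewrite subr_eq0.
  have := hd (s - t); rewrite /= sub0r normrN => /(_ sd st0).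
  rewrite [(s - t) *: 1]mulr1 subrK => H.
  rewrite (_ : _ - _ = - ((s - t) * (b' t - (s - t)^-1 * (b s - b t)))); last by field.
  by rewrite normrN normrM mulrC ler_wpM2r.
have [d1 d10 h1] := bd _ e1; have [d2 d20 h2] := hu t t0 l _ e2.
have [d3 d30 h3] := hasD_lipschitz uS uS' hu t0 l; have [d4 d40 h4] := bd 1 ltr01.
exists (Num.min (Num.min d1 d2) (Num.min (Num.min d3 d4) (e / 3 / (B' * U')))).
  by rewrite !lt_min d10 d20 d30 d40.
move=> s s0; rewrite !lt_min => /andP[/andP[s1 s2] /andP[/andP[s3 s4] s5]].
have H1 := h1 s s1; have H2 := h2 s s0 s2; have H3 := h3 s s0 s3; have H4 := h4 s s4.
set X := u s - u t - _ in H2; set Y := u s - u t in H3.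
have XS : inS X by apply: inSB; [apply: inSB; exact: uS|apply: inSZ; exact: uS'].
have YS : inS Y by apply: inSB; exact: uS.
set c1 := b s - b t - _ in H1; set c3 := b s - b t.
rewrite (_ : _ - _ = c1 *: u t + (b t *: X + c3 *: Y)); last first.
  by rewrite /X /Y /c1 /c3; lmod R.
have uSt : inS (u t) by exact: uS.
rewrite wdD ?wdZ//; [|exact: inSZ|by apply: inSD; exact: inSZ].
rewrite wdD ?wdZ//; [|exact: inSZ|exact: inSZ].
have sn := normr_ge0 (s - t).
have C3 : `|c3| <= B' * `|s - t|.
  rewrite /c3 -(subrK ((s - t) * b' t) (b s - b t)); apply: le_trans (ler_normD _ _) _.
  by rewrite /B' [leRHS]mulrDl [leRHS]addrC; apply: lerD => //; rewrite normrM mulrC.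
apply: le_trans (ler_normD _ _) _; rewrite normrZ.
apply: le_trans (lerD (lexx _) (ler_normD _ _)) _; rewrite !normrZ.
have P1 : `|c1| * U <= e / 3 * `|s - t| by apply: frac_le H1; [exact: normr_ge0|exact: U0].
have P2 : B * `|wd l X| <= e / 3 * `|s - t|.
  by rewrite mulrC; apply: frac_le H2; [exact: normr_ge0|exact: B0].
have P3 : `|c3| * `|wd l Y| <= e / 3 * `|s - t|.
  apply: le_trans (ler_pM (normr_ge0 _) (normr_ge0 _) C3 H3) _.
  rewrite mulrACA mulrA ler_wpM2r//.
  by move: s5; rewrite ltr_pdivlMr ?mulr_gt0// mulrC => /ltW.
rewrite -/U -/B (_ : e = e / 3 + (e / 3 + e / 3)); last by field.
rewrite !mulrDl; apply: lerD; first exact: P1.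
by apply: lerD; [exact: P2|exact: P3].
Qed.

End differentiation.

(** * Mild solutions are differentiable *)

Section mild.
Context {R : realType} {n : nat} (a : R -> 'M[R]_n).
Hypothesis a_continuous : {within `[0, +oo[, continuous a}.
Hypothesis a_sym : forall t : R, 0 <= t -> (a t)^T = a t.
Hypothesis a_posdef : forall t : R, 0 <= t ->
  forall x : 'rV[R]_n, x != 0 -> 0 < (x *m (a t *m x^T)) 0 0.
Context {q : R} {q1 : (1 <= q%:E)%E}.
Local Notation L := (Lq n q1).
Local Notation wd := (@weak_deriv R n q q1).
Local Notation W s t := (@heat_op R n a q q1 s t).

Lemma sum_bounded (I : Type) (r : seq I) (X : Type) (P : X -> Prop) (F : I -> X -> R) :
  (forall i, exists2 M, 0 <= M & forall x, P x -> F i x <= M) ->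
  exists2 M, 0 <= M & forall x, P x -> \sum_(i <- r) F i x <= M.
Proof.
move=> h; elim: r => [|i r [M M0 IH]]; first by exists 0 => // x _; rewrite big_nil.
have [N N0 hN] := h i; exists (N + M); first exact: addr_ge0.
by move=> x Px; rewrite big_cons lerD ?hN ?IH.
Qed.

Definition locally_bounded (u : R -> L) := forall l c, 0 < c -> exists2 d, 0 < d &
  exists2 M, 0 <= M & forall t, 0 < t -> `|t - c| < d -> `|wd l (u t)| <= M.

Lemma locally_bounded_D (u : R -> L) l c : Sval u -> locally_bounded u -> 0 < c ->
  exists2 d, 0 < d & exists2 M, 0 <= M & forall t, 0 < t -> `|t - c| < d ->
    D2norm (wd l (u t)) <= M /\ D4norm (wd l (u t)) <= M.
Proof.
move=> uS lb c0.
have /choice[f hf] : forall ijkl : ('I_n * 'I_n) * ('I_n * 'I_n), exists dM : R * R,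
    [/\ 0 < dM.1, 0 <= dM.2 & forall t, 0 < t -> `|t - c| < dM.1 ->
      `|wd (dij ijkl.1.1 ijkl.1.2) (wd l (u t))| <= dM.2 /\
      `|wd (dij ijkl.1.1 ijkl.1.2) (wd (dij ijkl.2.1 ijkl.2.2) (wd l (u t)))| <= dM.2].
  move=> [[i j] [k p]] /=.
  have [d1 d10 [M1 M10 h1]] := lb (fun x => dij i j x + l x)%N c c0.
  have [d2 d20 [M2 M20 h2]] := lb (fun x => dij i j x + (dij k p x + l x))%N c c0.
  exists (Num.min d1 d2, Num.max M1 M2); split => /=; first by rewrite lt_min d10.
    by rewrite le_max M10.
  move=> t t0; rewrite lt_min => /andP[t1 t2]; have uSt := uS t t0.
  rewrite (wd_add (dij k p) l uSt) (wd_add _ (fun x => dij k p x + l x)%N uSt) (wd_add _ l uSt).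
  by split; rewrite le_max; apply/orP; [left; exact: h1|right; exact: h2].
pose d := \big[Order.min/1]_i (f i).1.
have d0 : 0 < d.
  by rewrite /d; elim/big_ind: _ => // [x y x0 y0|i _]; [rewrite lt_min x0|have [] := hf i].
have dle i : d <= (f i).1 by exact: bigmin_le_cond.
pose P t := 0 < t /\ `|t - c| < d.
have bd i j k p : exists2 M, 0 <= M & forall t, P t ->
    `|wd (dij i j) (wd (dij k p) (wd l (u t)))| <= M.
  have [_ M0 h] := hf ((i, j), (k, p)); exists (f ((i, j), (k, p))).2 => // t [t0 tc].
  exact: (h t t0 (lt_le_trans tc (dle _))).2.
have bd2 i j : exists2 M, 0 <= M & forall t, P t -> `|wd (dij i j) (wd l (u t))| <= M.
  have [_ M0 h] := hf ((i, j), (i, j)); exists (f ((i, j), (i, j))).2 => // t [t0 tc].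
  exact: (h t t0 (lt_le_trans tc (dle _))).1.
have [M2 M20 H2] := sum_bounded (index_enum 'I_n) (fun i => sum_bounded (index_enum 'I_n) (fun j => bd2 i j)).
have [M4 M40 H4] := sum_bounded (index_enum 'I_n) (fun k => sum_bounded (index_enum 'I_n) (fun p =>
  sum_bounded (index_enum 'I_n) (fun i => sum_bounded (index_enum 'I_n) (fun j => bd i j k p)))).
exists d => //; exists (M2 + M4); first exact: addr_ge0.
move=> t t0 tc; have Pt : P t by [].
by split; [apply: le_trans (H2 t Pt) _; rewrite lerDl|apply: le_trans (H4 t Pt) _; rewrite lerDr].
Qed.

Definition mild (u h : R -> L) := forall l t0 e, 0 < t0 -> 0 < e -> exists2 d, 0 < d &
  forall s t, 0 < s -> s <= t -> `|s - t0| < d -> `|t - t0| < d ->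
    `|wd l (u t - W s t (u s) - (t - s) *: h t0)| <= e * (t - s).

Lemma mild_hasD (u h : R -> L) : Sval u -> Sval h -> locally_bounded u -> mild u h ->
  hasD u (fun t => Lop (a t) (u t) + h t).
Proof.
move=> uS hS lb um t0 t00 l e e0.
pose k := \sum_i \sum_j `|a t0 i j|.
have k0 : 0 <= k by apply: sumr_ge0 => i _; apply: sumr_ge0.
have [d1 d10 [M M0 hM]] := locally_bounded_D l uS lb t00.
have [d2 d20 h2] := W_taylor (q1 := q1) a_continuous a_sym a_posdef (ltW t00) ltr01.
have M1 : 0 < 2 * M + 1 by lra.
have e1 : 0 < e / 3 / (2 * M + 1) by rewrite !divr_gt0.
have [d3 d30 h3] := W_taylor (q1 := q1) a_continuous a_sym a_posdef (ltW t00) e1.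
have e3 : 0 < e / 3 by rewrite divr_gt0.
have [d4 d40 h4] := um l t0 _ t00 e3.
have lip (l' : 'I_n -> nat) : exists2 d, 0 < d & exists2 C, 0 <= C & forall s t, 0 < s -> s <= t ->
    `|s - t0| < d -> `|t - t0| < d -> `|wd l' (u t - u s)| <= C * (t - s).
  have [b1 b10 [N N0 hN]] := locally_bounded_D l' uS lb t00.
  have [b4 b40 hb4] := um l' t0 1 t00 ltr01.
  exists (Num.min (Num.min b1 d2) b4); first by rewrite !lt_min b10 d20.
  exists (k * N + 2 * N + `|wd l' (h t0)| + 1); first by rewrite !addr_ge0 ?mulr_ge0.
  move=> s t s0 st; rewrite !lt_min => /andP[/andP[s1 s2] s4] /andP[/andP[t1 t2] t4].
  have ts : 0 <= t - s by rewrite subr_ge0.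
  have t_0 := lt_le_trans s0 st; have usS := uS s s0; have utS := uS t t_0; have htS := hS t0 t00.
  have WS := inS_W a_continuous a_sym a_posdef (ltW s0) st usS.
  have B4 := hb4 s t s0 st s4 t4.
  have B2 := h2 s t (wd l' (u s)) (ltW s0) st s2 t2 (inS_wd l' usS).
  have [D2 D4] := hN s s0 s1.
  have LB := Lop_norm (wd l' (u s)) k0 (a_le_amax a t0).
  rewrite (_ : u t - u s = (u t - W s t (u s) - (t - s) *: h t0) + ((t - s) *: h t0 + (W s t (u s) - u s))); last by lmod R.
  have I1 : inS (u t - W s t (u s) - (t - s) *: h t0) by apply: inSB; [exact: inSB|exact: inSZ].
  have I2 : inS ((t - s) *: h t0) by exact: inSZ.
  have I3 : inS (W s t (u s) - u s) by exact: inSB.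
  rewrite (wdD _ I1 (inSD I2 I3)) (wdD _ I2 I3).
  rewrite (wdZ _ _ htS) (wdB _ WS usS) (wd_W a_continuous a_sym a_posdef _ (ltW s0) st usS).
  set v := wd l' (u s) in B2 LB D2 D4 *.
  have B5 : `|W s t v - v| <= (k * N + 2 * N) * (t - s).
    rewrite -(subrK ((t - s) *: Lop (a t0) v) (W s t v - v)); apply: le_trans (ler_normD _ _) _.
    rewrite normrZ ger0_norm//.
    have D20 := D2norm_ge0 v; have D40 := D4norm_ge0 v.
    have : k * D2norm v <= k * N by rewrite ler_wpM2l.
    have := ler_wpM2l ts LB; nra.
  apply: le_trans (ler_normD _ _) _; apply: le_trans (lerD (lexx _) (ler_normD _ _)) _.
  by rewrite normrZ ger0_norm//; nra.
have [d5 d50 [C C0 hC]] : exists2 d, 0 < d & exists2 C, 0 <= C & forall s t, 0 < s -> s <= t ->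
    `|s - t0| < d -> `|t - t0| < d -> D2norm (wd l (u t - u s)) <= C * (t - s).
  have /choice[f hf] : forall ij : 'I_n * 'I_n, exists dC : R * R, [/\ 0 < dC.1, 0 <= dC.2 &
      forall s t, 0 < s -> s <= t -> `|s - t0| < dC.1 -> `|t - t0| < dC.1 ->
       `|wd (dij ij.1 ij.2) (wd l (u t - u s))| <= dC.2 * (t - s)].
    move=> [i j]; have [d d0 [C C0 hC]] := lip (fun x => dij i j x + l x)%N.
    exists (d, C); split => //= s t s0 st sd td; rewrite wd_add; first exact: hC.
    by apply: inSB; apply: uS => //; exact: lt_le_trans st.
  exists (\big[Order.min/1]_i (f i).1).
    by elim/big_ind: _ => // [x y x0 y0|i _]; [rewrite lt_min x0|have [] := hf i].
  exists (\sum_i \sum_j (f (i, j)).2).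
    by apply: sumr_ge0 => i _; apply: sumr_ge0 => j _; have [] := hf (i, j).
  move=> s t s0 st sd td; rewrite /D2norm mulr_suml; apply: ler_sum => i _.
  rewrite mulr_suml; apply: ler_sum => j _; have [_ _ h'] := hf (i, j).
  by apply: h' => //; [apply: lt_le_trans sd _|apply: lt_le_trans td _]; exact: bigmin_le_cond.
have e5 : 0 < e / 3 / (k * C + 1) by rewrite !divr_gt0// ltr_wpDl// mulr_ge0.
exists (Num.min (Num.min d1 d3) (Num.min (Num.min d4 d5) (e / 3 / (k * C + 1)))).
  by rewrite !lt_min d10 d30 d40 d50.
have main s t : 0 < s -> s <= t -> (s = t0 \/ t = t0) ->
    `|s - t0| < Num.min (Num.min d1 d3) (Num.min (Num.min d4 d5) (e / 3 / (k * C + 1))) ->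
    `|t - t0| < Num.min (Num.min d1 d3) (Num.min (Num.min d4 d5) (e / 3 / (k * C + 1))) ->
    `|wd l (u t - u s - (t - s) *: (Lop (a t0) (u t0) + h t0))| <= e * (t - s).
  move=> s0 st ste; rewrite !lt_min => /andP[/andP[s1 s3] /andP[/andP[s4 s5] s6]].
  move=> /andP[/andP[t1 t3] /andP[/andP[t4 t5] t6]].
  have ts : 0 <= t - s by rewrite subr_ge0.
  have t_0 := lt_le_trans s0 st; have usS := uS s s0; have utS := uS t t_0; have htS := hS t0 t00.
  have ut0S := uS t0 t00.
  have WS := inS_W a_continuous a_sym a_posdef (ltW s0) st usS.
  have LS := inS_Lop (a t0) usS; have LS0 := inS_Lop (a t0) (inSB usS ut0S).
  rewrite (_ : _ - _ = (u t - W s t (u s) - (t - s) *: h t0) +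
     ((W s t (u s) - u s - (t - s) *: Lop (a t0) (u s)) + (t - s) *: Lop (a t0) (u s - u t0))); last first.
    rewrite (_ : u s - u t0 = u s + (-1) *: u t0); last by lmod R.
    rewrite LopD//; last exact: inSZ.
    have -> : Lop (a t0) (-1 *: u t0) = -1 *: Lop (a t0) (u t0).
      rewrite /Lop scaler_sumr; apply: eq_bigr => i _; rewrite scaler_sumr; apply: eq_bigr => j _.
      by rewrite wdZ// !scalerA mulrC.
    by lmod R.
  have I1 : inS (u t - W s t (u s) - (t - s) *: h t0) by apply: inSB; [exact: inSB|exact: inSZ].
  have I2 : inS (W s t (u s) - u s - (t - s) *: Lop (a t0) (u s)) by apply: inSB; [exact: inSB|exact: inSZ].
  have I3 : inS ((t - s) *: Lop (a t0) (u s - u t0)) by exact: inSZ.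
  rewrite (wdD _ I1 (inSD I2 I3)) (wdD _ I2 I3).
  apply: le_trans (ler_normD _ _) _; apply: le_trans (lerD (lexx _) (ler_normD _ _)) _.
  rewrite (_ : e = e / 3 + (e / 3 + e / 3)); last by field.
  rewrite mulrDl (mulrDl (e / 3)); apply: lerD; first exact: h4.
  apply: lerD.
    rewrite (wdB _ (inSB WS usS) (inSZ _ LS)) (wdB _ WS usS) (wdZ _ _ LS) (wd_Lop _ _ usS).
    rewrite (wd_W a_continuous a_sym a_posdef _ (ltW s0) st usS).
    apply: le_trans (h3 s t _ (ltW s0) st s3 t3 (inS_wd l usS)) _.
    rewrite ler_wpM2r// mulrAC ler_pdivrMr// ler_wpM2l ?(ltW e3)//.
    by have [] := hM s s0 s1; lra.
  rewrite (wdZ _ _ LS0) normrZ ger0_norm// mulrC ler_wpM2r// (wd_Lop _ _ (inSB usS ut0S)).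
  apply: le_trans (Lop_norm _ k0 (a_le_amax a t0)) _.
  have D : D2norm (wd l (u s - u t0)) <= C * (e / 3 / (k * C + 1)).
    case: ste => [->|te].
      have := hC t0 t0 t00 (lexx _); rewrite !subrr normr0 mulr0 => /(_ d50 d50) H.
      by apply: le_trans H _; rewrite mulr_ge0// ltW.
    have D2 : D2norm (wd l (u s - u t0)) = D2norm (wd l (u t0 - u s)).
      apply: eq_bigr => i _; apply: eq_bigr => j _.
      by rewrite -(opprB (u t0) (u s)) -scaleN1r wdZ ?wdZ ?scaleN1r ?normrN//; [apply: inS_wd|]; exact: inSB.
    have st0 : s <= t0 by rewrite -te.
    have := hC s t0 s0 st0 s5; rewrite subrr normr0 => /(_ d50) H; rewrite D2.
    apply: le_trans H _; apply: (ler_wpM2l C0).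
    have ts0 : 0 <= t0 - s by rewrite subr_ge0.
    by have := ltW s6; rewrite distrC (ger0_norm ts0).
  have kC : 0 < k * C + 1 by rewrite ltr_wpDl// mulr_ge0.
  apply: le_trans (ler_wpM2l k0 D) _; clear -e5 kC.
  have E : e / 3 = e / 3 / (k * C + 1) * (k * C + 1) by rewrite divfK// gt_eqF.
  by rewrite [leRHS]E; move: (e / 3 / (k * C + 1)) e5 => x x0; lra.
move=> s s0 sd; have dpos : 0 < Num.min (Num.min d1 d3) (Num.min (Num.min d4 d5) (e / 3 / (k * C + 1))).
  by rewrite !lt_min d10 d30 d40 d50.
have [st|ts] := leP s t0; last first.
  rewrite (gtr0_norm (_ : 0 < s - t0)) ?subr_gt0//.
  by apply: main (ltW ts) _ _ sd => //; [left|rewrite subrr normr0].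
have XS : inS (u t0 - u s - (t0 - s) *: (Lop (a t0) (u t0) + h t0)).
  apply: inSB; first by apply: inSB; exact: uS.
  by apply: inSZ; apply: inSD; [apply: inS_Lop; exact: uS|exact: hS].
rewrite (_ : u s - u t0 - (s - t0) *: (Lop (a t0) (u t0) + h t0) =
   -1 *: (u t0 - u s - (t0 - s) *: (Lop (a t0) (u t0) + h t0))); last by lmod R.
rewrite (wdZ _ _ XS) scaleN1r normrN distrC ger0_norm ?subr_ge0//.
by apply: main => //; [right|rewrite subrr normr0].
Qed.

End mild.

(** * Families of smooth functions with bounds *)

Section families.
Context {R : realType} {n : nat} {q : R} {q1 : (1 <= q%:E)%E}.
Local Notation L := (Lq n q1).
Local Notation wd := (@weak_deriv R n q q1).
Local Notation S := (sobolev_oo n q1).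

Lemma compact_pos_segment (K : set R) : compact K -> K `<=` `]0, +oo[ ->
  exists2 ab : R * R, 0 < ab.1 & forall t, K t -> ab.1 <= t <= ab.2.
Proof.
move=> cK K0; have [->|/set0P K1] := eqVneq K set0; first by exists (1, 1) => // t [].
have ci : {within K, continuous (fun x : R => x)} by apply: continuous_subspaceT => x; exact: cvg_id.
have [c cK1 hc] := compact_EVT_min K1 cK ci; have [d dK1 hd] := compact_EVT_max K1 cK ci.
exists (c, d) => /=.
  by rewrite inE in cK1; have := K0 c cK1; rewrite /= in_itv/= andbT.
by move=> t Kt; rewrite hc ?hd// inE.
Qed.

Lemma within_bounded (f : R -> R) (al be : R) : {within `[al, be], continuous f} ->
  exists2 M, 0 <= M & forall t, al <= t <= be -> `|f t| <= M.
Proof.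
move=> cf; have [ab|ba] := leP al be; last first.
  by exists 0 => // t /andP[h1 h2]; have := le_trans h1 h2; rewrite leNgt ba.
have [c _ hc] := EVT_max ab cf; have [d _ hd] := EVT_min ab cf.
exists (`|f c| + `|f d|); first exact: addr_ge0.
move=> t tab; have h1 := hc t; have h2 := hd t; rewrite in_itv/= in h1; rewrite in_itv/= in h2.
have {h1} := h1 tab; have {h2} := h2 tab.
have := ler_norm (f c); have := ler_norm (- f d); rewrite normrN.
have := normr_ge0 (f c); have := normr_ge0 (f d).
move: (`|f c|) (`|f d|) => x y *; rewrite ler_norml; apply/andP; split; lra.
Qed.

Lemma hasD_bounded (u u' : R -> L) : Sval u -> Sval u' -> hasD u u' -> forall l (al be : R), 0 < al ->
  exists2 M, 0 <= M & forall t, al <= t <= be -> `|wd l (u t)| <= M.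
Proof.
move=> uS uS' h l al be al0.
have c : {within `[al, be], continuous (fun t => `|wd l (u t)|)}.
  apply: continuous_in_subspaceT => t; rewrite inE/= in_itv/= => /andP[at1 _].
  have t0 := lt_le_trans al0 at1; have [d d0 hd] := hasD_lipschitz uS uS' h t0 l.
  pose C := `|wd l (u' t)| + 1; have C0 : 0 < C by apply: ltr_wpDl; [exact: normr_ge0|exact: ltr01].
  apply/cvgrPdist_le => e e0.
  exists (Num.min (Num.min d t) (e / C)); first by rewrite /= !lt_min d0 t0 divr_gt0.
  move=> s /=; rewrite !lt_min => /andP[/andP[s1 s2] s3].
  have s0 : 0 < s by move: s2; rewrite ltr_norml => /andP[_ s2]; lra.
  rewrite distrC in s1; have H := hd s s0 s1.
  have E : wd l (u s - u t) = wd l (u s) - wd l (u t) by apply: wdB; exact: uS.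
  rewrite E in H; rewrite distrC; apply: le_trans (ler_dist_dist _ _) _; apply: le_trans H _.
  by move: s3; rewrite ltr_pdivlMr// distrC mulrC => /ltW.
have [M M0 hM] := within_bounded c; exists M => // t tab.
by have := hM t tab; rewrite normr_id.
Qed.

Lemma smooth_tower (h : R -> L) : lc_smooth S `]0, +oo[ h ->
  (forall i, Sval (lc_deriven S i h)) /\ (forall i, hasD (lc_deriven S i h) (lc_deriven S i.+1 h)).
Proof.
move=> [hS hD].
have D i t : 0 < t -> is_lc_derive S (lc_deriven S i h) t (lc_deriven S i.+1 h t).
  move=> t0; have [|v hv] := hD i t; first by rewrite /= in_itv/= t0.
  by rewrite /lc_deriven iterS (lc_deriveE hv).
have SV i : Sval (lc_deriven S i h).
  case: i => [|i] t t0; last by have [/inSP] := D i t t0.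
  by apply/inSP; apply: hS; rewrite /= in_itv/= t0.
by split => // i; apply: lc_derive_hasD => //; exact: D.
Qed.

Lemma smooth_wd (h : R -> L) l : lc_smooth S `]0, +oo[ h ->
  forall i t, 0 < t -> lc_deriven S i (fun s => wd l (h s)) t = wd l (lc_deriven S i h t).
Proof.
move=> /smooth_tower[SV D] i t t0.
apply: (@lc_deriven_tower R n q q1 _ (fun i t => wd l (lc_deriven S i h t)) i) => //.
- by move=> j _ s s0; apply: inS_wd; exact: SV.
- by move=> j _; apply: hasD_wd.
Qed.

Lemma smooth_lin (c : R) (h g : R -> L) : lc_smooth S `]0, +oo[ h -> lc_smooth S `]0, +oo[ g ->
  lc_smooth S `]0, +oo[ (c *: h + g) /\
  forall i t, 0 < t -> lc_deriven S i (c *: h + g) t = c *: lc_deriven S i h t + lc_deriven S i g t.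
Proof.
move=> /smooth_tower[SVh Dh] /smooth_tower[SVg Dg].
pose U i t := c *: lc_deriven S i h t + lc_deriven S i g t.
have US i : Sval (U i) by move=> t t0; apply: inS_lin; [exact: SVh|exact: SVg].
have UD i : hasD (U i) (U i.+1) by apply: hasD_lin.
have E i t : 0 < t -> lc_deriven S i (c *: h + g) t = U i t.
  by apply: (@lc_deriven_tower R n q q1 _ U i).
split => //; split.
  by move=> t; rewrite /= in_itv/= andbT => t0; apply/inSP; exact: (US 0%N).
move=> i t; rewrite /= in_itv/= andbT => t0; exists (U i.+1 t).
apply: (@hasD_lc_derive R n q q1 (lc_deriven S i (c *: h + g)) (U i.+1)) => //.
- by apply: Sval_ext (US i) => s s0; rewrite E.
- by apply: hasD_ext (UD i) => // s s0; rewrite E.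
Qed.

Context {X : Type} (P : (X -> R) -> Prop).
Hypothesis P_ge0 : forall p x, P p -> 0 <= p x.
Hypothesis P_0 : P (fun=> 0).
Hypothesis P_add : forall p p', P p -> P p' -> P (fun x => p x + p' x).
Hypothesis P_scale : forall c p, 0 <= c -> P p -> P (fun x => c * p x).
Implicit Types (u w : X -> R -> L).

Definition bnd u := (forall x, Sval (u x)) /\ forall l (al be : R), 0 < al ->
  exists2 p, P p & forall x t, al <= t <= be -> `|wd l (u x t)| <= p x.

(** Families of functions differentiable j times on R_+, all derivatives being bounded on
   compact sets by functionals of the class P. *)
Fixpoint Cl j u : Prop := bnd u /\
  if j is j'.+1 then exists u', (forall x, hasD (u x) (u' x)) /\ Cl j' u' else True.

Lemma Cl_bnd j u : Cl j u -> bnd u. Proof. by case: j => [|j] []. Qed.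

Lemma Cl_S j u : Cl j.+1 u -> Cl j u.
Proof.
elim: j u => [|j IH] u; first by move=> [].
by move=> [bu [u' [D h]]]; split => //; exists u'; split => //; exact: IH.
Qed.

Lemma bnd_add u w : bnd u -> bnd w -> bnd (fun x t => u x t + w x t).
Proof.
move=> [uS ub] [wS wb]; split; first by move=> x t t0; apply: inSD; [exact: uS|exact: wS].
move=> l al be al0; have [p Pp hp] := ub l al be al0; have [p' Pp' hp'] := wb l al be al0.
exists (fun x => p x + p' x); first exact: P_add.
move=> x t tab; have t0 : 0 < t by have /andP[h _] := tab; exact: lt_le_trans h.
have E : wd l (u x t + w x t) = wd l (u x t) + wd l (w x t) by apply: wdD; [exact: uS|exact: wS].
rewrite E; apply: le_trans (ler_normD _ _) _; apply: lerD; [exact: hp|exact: hp'].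
Qed.

Lemma bnd_wd m u : bnd u -> bnd (fun x t => wd m (u x t)).
Proof.
move=> [uS ub]; split; first by move=> x t t0; apply: inS_wd; exact: uS.
move=> l al be al0; have [p Pp hp] := ub (fun i => l i + m i)%N al be al0; exists p => // x t tab.
have t0 : 0 < t by have /andP[h _] := tab; exact: lt_le_trans h.
have E := wd_add l m (uS x t t0); rewrite E; exact: hp.
Qed.

Lemma bnd_scale (b : R -> R) u : bnd u ->
  (forall al be : R, 0 < al -> exists2 M, 0 <= M & forall t, al <= t <= be -> `|b t| <= M) ->
  bnd (fun x t => b t *: u x t).
Proof.
move=> [uS ub] hb; split; first by move=> x t t0; apply: inSZ; exact: uS.
move=> l al be al0; have [p Pp hp] := ub l al be al0; have [M M0 hM] := hb al be al0.
exists (fun x => M * p x); first exact: P_scale.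
move=> x t tab; have t0 : 0 < t by have /andP[h _] := tab; exact: lt_le_trans h.
have E := wdZ l (b t) (uS x t t0); rewrite E normrZ.
by apply: ler_pM; [exact: normr_ge0|exact: normr_ge0|exact: hM|exact: hp].
Qed.

Lemma bnd_zero : bnd (fun _ _ => 0).
Proof.
split; first by move=> x t _; exact: inS0.
move=> l al be al0; exists (fun=> 0) => // x t _.
by rewrite (wd_zero l) normr0.
Qed.

Lemma Cl_zero j : Cl j (fun _ _ => 0).
Proof.
elim: j => [|j IH]; split; [exact: bnd_zero|exact: I|exact: bnd_zero|].
exists (fun _ _ => 0); split => // x t t0 l e e0; exists 1 => // s _ _.
have -> : 0 - 0 - (s - t) *: 0 = 0 :> L by rewrite scaler0 !subrr.
by rewrite (wd_zero l) normr0 mulr_ge0// ltW.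
Qed.

Lemma Cl_add j u w : Cl j u -> Cl j w -> Cl j (fun x t => u x t + w x t).
Proof.
elim: j u w => [|j IH] u w [bu hu] [bw hw]; split; [exact: bnd_add|exact: I|exact: bnd_add|].
have [u' [Du hu']] := hu; have [w' [Dw hw']] := hw.
exists (fun x t => u' x t + w' x t); split; last exact: IH.
move=> x; have := hasD_lin 1 (bu.1 x) (bw.1 x) ((Cl_bnd hu').1 x) ((Cl_bnd hw').1 x) (Du x) (Dw x).
by apply: hasD_ext => t _; rewrite scale1r.
Qed.

Lemma Cl_sum j (I : Type) (r : seq I) (u : I -> X -> R -> L) : (forall i, Cl j (u i)) ->
  Cl j (fun x t => \sum_(i <- r) u i x t).
Proof.
move=> h; elim: r => [|i r IH].
  rewrite (_ : (fun x t => _) = fun _ _ => 0); first exact: Cl_zero.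
  by apply/funext => x; apply/funext => t; rewrite big_nil.
rewrite (_ : (fun x t => _) = fun x t => u i x t + \sum_(j <- r) u j x t); first exact: Cl_add.
by apply/funext => x; apply/funext => t; rewrite big_cons.
Qed.

Lemma Cl_wd j m u : Cl j u -> Cl j (fun x t => wd m (u x t)).
Proof.
elim: j u => [|j IH] u [bu hu]; split; [exact: bnd_wd|exact: I|exact: bnd_wd|].
have [u' [Du hu']] := hu; exists (fun x t => wd m (u' x t)); split; last exact: IH.
by move=> x; apply: hasD_wd (Du x); [exact: bu.1|exact: (Cl_bnd hu').1].
Qed.

Definition tower (bs : nat -> R -> R) := forall k (t : R), 0 < t -> is_derive t 1 (bs k) (bs k.+1 t).

Lemma tower_bounded bs k : tower bs -> forall al be : R, 0 < al ->
  exists2 M, 0 <= M & forall t, al <= t <= be -> `|bs k t| <= M.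
Proof.
move=> tb al be al0; apply: within_bounded; apply: derivable_within_continuous => t.
rewrite in_itv/= => /andP[at1 _]; have h := tb k t (lt_le_trans al0 at1).
exact: ex_derive.
Qed.

Lemma Cl_scale j bs k u : tower bs -> Cl j u -> Cl j (fun x t => bs k t *: u x t).
Proof.
move=> tb; elim: j k u => [|j IH] k u hju.
  have [bu _] := hju; split; last exact: I.
  by apply: (bnd_scale bu) => al be; exact: tower_bounded.
have [bu [u' [Du hu']]] := hju; split; first by apply: (bnd_scale bu) => al be; exact: tower_bounded.
exists (fun x t => bs k.+1 t *: u x t + bs k t *: u' x t); split.
  by move=> x; apply: hasD_scale (Du x); [exact: bu.1|exact: (Cl_bnd hu').1|exact: tb].
by apply: Cl_add; apply: IH => //; exact: Cl_S.
Qed.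

Lemma Cl_Lop j (a : nat -> R -> 'M[R]_n) u : (forall i k, tower (fun p t => a p t i k)) ->
  Cl j u -> Cl j (fun x t => Lop (a 0%N t) (u x t)).
Proof.
move=> ta hu; apply: Cl_sum => i; apply: Cl_sum => k.
exact: (Cl_scale 0%N (ta i k) (Cl_wd _ hu)).
Qed.

(** Bootstrap: a solution of u' = L_a u + h is as smooth as h. *)
Lemma Cl_equation (a : nat -> R -> 'M[R]_n) u h : (forall i k, tower (fun p t => a p t i k)) ->
  bnd u -> (forall j, Cl j h) -> (forall x, hasD (u x) (fun t => Lop (a 0%N t) (u x t) + h x t)) ->
  forall j, Cl j u.
Proof.
move=> ta bu hh D; elim=> [|j IH]; first by [].
split => //; exists (fun x t => Lop (a 0%N t) (u x t) + h x t); split => //.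
by apply: Cl_add => //; exact: Cl_Lop.
Qed.

Lemma Cl_tower j u : Cl j u -> exists U : nat -> X -> R -> L,
  [/\ U 0%N = u, forall i, (i <= j)%N -> bnd (U i) &
      forall i x, (i < j)%N -> hasD (U i x) (U i.+1 x)].
Proof.
elim: j u => [|j IH] u; first by move=> [bu _]; exists (fun=> u); split => // -[].
move=> [bu [u' [D /IH[U [U0 Ub UD]]]]].
exists (fun i => if i is i'.+1 then U i' else u); split; first by [].
  by case=> [_|i]; [exact: bu|exact: Ub].
by case=> [|i] x ij; [rewrite U0; exact: D|exact: UD].
Qed.

Lemma Cl_smooth u : (forall j, Cl j u) -> forall x, lc_smooth S `]0, +oo[ (u x).
Proof.
move=> hu x; split; first by move=> t; rewrite /= in_itv/= andbT => t0; apply/inSP; exact: (Cl_bnd (hu 0%N)).1.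
move=> j t; rewrite /= in_itv/= andbT => t0.
have [U [U0 Ub UD]] := Cl_tower (hu j.+1).
have E : forall i, (i <= j.+1)%N -> forall t, 0 < t -> lc_deriven S i (u x) t = U i x t.
  apply: (@lc_deriven_tower R n q q1 _ (fun i => U i x) j.+1).
  - by move=> s _; rewrite U0.
  - by move=> i ij; exact: (Ub i ij).1.
  - by move=> i ij; exact: UD.
exists (U j.+1 x t).
apply: (@hasD_lc_derive R n q q1 (lc_deriven S j (u x)) (U j.+1 x)) => //.
- by apply: Sval_ext ((Ub j (leqnSn j)).1 x) => s s0; rewrite E.
- exact: (Ub j.+1 (leqnn _)).1.
- by apply: hasD_ext (UD j x (ltnSn j)) => // s s0; rewrite E.
Qed.

Lemma Cl_seminorm u : (forall j, Cl j u) -> forall j l (al be : R), 0 < al ->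
  exists2 p, P p & forall x t, al <= t <= be -> `|lc_deriven S j (fun s => wd l (u x s)) t| <= p x.
Proof.
move=> hu j l al be al0; have [U [U0 Ub UD]] := Cl_tower (Cl_wd l (hu j)).
have [_ bj] := Ub j (leqnn j); have [p Pp hp] := bj (fun=> 0%N) al be al0.
exists p => // x t tab; have t0 : 0 < t by have /andP[h _] := tab; exact: lt_le_trans h.
have E : lc_deriven S j (fun s => wd l (u x s)) t = U j x t.
  apply: (@lc_deriven_tower R n q q1 _ (fun i => U i x) j) => //.
  - by move=> s _; rewrite U0.
  - by move=> i ij; exact: (Ub i ij).1.
  - by move=> i ij; exact: UD.
by have := hp x t tab; rewrite wd_id E.
Qed.

Lemma Cl_of_smooth u : (forall x, lc_smooth S `]0, +oo[ (u x)) ->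
  (forall j l (al be : R), 0 < al -> exists2 p, P p & forall x t, al <= t <= be ->
     `|lc_deriven S j (fun s => wd l (u x s)) t| <= p x) -> forall j, Cl j u.
Proof.
move=> us ub j.
suff H k : Cl j (fun x => lc_deriven S k (u x)) by exact: (H 0%N).
have B i : bnd (fun x => lc_deriven S i (u x)).
  split; first by move=> x; exact: (smooth_tower (us x)).1.
  move=> l al be al0; have [p Pp hp] := ub i l al be al0; exists p => // x t tab.
  have t0 : 0 < t by have /andP[h _] := tab; exact: lt_le_trans h.
  by have := hp x t tab; rewrite (smooth_wd l (us x) i t0).
elim: j k => [|j IH] k; split; try exact: B; first by [].
exists (fun x => lc_deriven S k.+1 (u x)); split; last exact: IH.
by move=> x; exact: (smooth_tower (us x)).2.
Qed.

End families.

(** * Continuity in locally convex spaces *)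

Section lc_topology.
Context {R : realType} {V : lmodType R} (E : lcspace V).

Lemma lc_ball_open (i : lc_index E) f e : open (lc_ball i f e : set (lc_elt E)).
Proof.
exists [set lc_ball i f e]; last by rewrite bigcup_set1.
move=> _ ->; by apply: finI_from1; exists i, f, e.
Qed.

Lemma lc_nbhs_sub (x : lc_elt E) (A : set (lc_elt E)) : nbhs x A ->
  exists r : seq (lc_index E * lc_elt E * R), (forall p, List.In p r -> lc_ball p.1.1 p.1.2 p.2 x) /\
   forall y, (forall p, List.In p r -> lc_ball p.1.1 p.1.2 p.2 y) -> A y.
Proof.
rewrite nbhsE/= => -[B [[D' sD' <-] [U D'U Ux]] BA].
have [F sF FE] := sD' U D'U; rewrite -FE in Ux.
have gen (s : seq _) : {subset s <= finmap.enum_fset F} ->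
    exists r : seq (lc_index E * lc_elt E * R), forall y : lc_elt E,
    (forall p, List.In p r -> lc_ball p.1.1 p.1.2 p.2 y) <->
    (forall i, i \in s -> isSubBaseTopological.b i y).
  elim: s => [|W s IH] sW; first by exists [::] => y; split.
  have [r hr] := IH (fun i si => sW i (mem_behead (s := W :: s) si)).
  have WF : W \in finmap.enum_fset F by apply: sW; rewrite inE eqxx.
  have := sF W WF; rewrite inE => -[i [f [e EW]]].
  exists ((i, f, e) :: r) => y; split.
    move=> h j; rewrite inE => /predU1P[->|js].
      by rewrite /isSubBaseTopological.b/= EW; apply: (h (i, f, e)); left.
    by apply: (hr y).1 j js => p pr; apply: h; right.
  move=> h p [<-|pr].
    by have := h W; rewrite inE eqxx /isSubBaseTopological.b/= EW; apply.
  by apply: (hr y).2 p pr => j js; apply: h; rewrite inE js orbT.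
have [r hr] := gen _ (fun _ h => h); exists r; split; first by apply: (hr x).2 => i iF; exact: Ux.
move=> y /(hr y).1 Uy; apply: BA; exists U; first exact: D'U.
have Uy' : (U : set (lc_elt E)) y by rewrite -FE => i iF; exact: Uy.
exact: Uy'.
Qed.

Lemma lc_continuous (T : topologicalType) (G : T -> lc_elt E) :
  (forall (i : lc_index E) (f g k : lc_elt E),
     lc_norm i (\val f - \val k) <= lc_norm i (\val f - \val g) + lc_norm i (\val g - \val k)) ->
  (forall x (i : lc_index E) e, 0 < e -> \forall y \near x, lc_norm i (\val (G y) - \val (G x)) < e) ->
  continuous G.
Proof.
move=> tri hG x A /lc_nbhs_sub[r [rx rA]].
have : forall s : seq (lc_index E * lc_elt E * R), (forall p, List.In p s -> List.In p r) ->
    \forall y \near x, forall p, List.In p s -> lc_ball p.1.1 p.1.2 p.2 (G y).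
  elim=> [|p s IH] sr; first by apply: nearW => y p [].
  have h1 : \forall y \near x, forall p, List.In p s -> lc_ball p.1.1 p.1.2 p.2 (G y).
    by apply: IH => p' p's; apply: sr; right.
  have := rx p (sr p (or_introl erefl)); rewrite /lc_ball/= -subr_gt0 => e0.
  have := hG x p.1.1 _ e0; apply: filterS2 h1 => y h1 h2 p' [<-|]; last exact: h1.
  by apply: le_lt_trans (tri _ _ (G x) _) _; rewrite -ltrBrDr.
by move=> /(_ r (fun _ h => h)); apply: filterS => y hy; exact: rA.
Qed.

Lemma lc_near (r : seq (lc_index E)) (x : lc_elt E) e : 0 < e ->
  (forall i : lc_index E, lc_norm i (\val x - \val x) <= 0) ->
  \forall y \near x, forall i, List.In i r -> lc_norm i (\val y - \val x) < e.
Proof.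
move=> e0 h; elim: r => [|i r IH]; first by apply: (@filterE _ (nbhs x)) => y i [].
have hi : nbhs x (lc_ball i x e).
  apply: open_nbhs_nbhs; split; first exact: lc_ball_open.
  by rewrite /lc_ball/=; exact: le_lt_trans (h i) e0.
by apply: filterS2 hi IH => y h1 h2 j [<-|jr]; [exact: h1|exact: h2].
Qed.

Lemma sup_ge0 (A : set R) : (forall x, A x -> 0 <= x) -> 0 <= sup A.
Proof.
move=> A0; have [[[x Ax] ub]|hs] := pselect (has_sup A); last by rewrite sup_out.
by apply: le_trans (A0 x Ax) _; exact: ub_le_sup.
Qed.

Lemma sup_nneg_le (A : set R) M : 0 <= M -> (forall x, A x -> x <= M) -> sup A <= M.
Proof.
move=> M0 h; have [[A0 ub]|hs] := pselect (has_sup A); last by rewrite sup_out.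
exact: ge_sup.
Qed.

Lemma le_supP (A : set R) M x : (forall x, A x -> x <= M) -> A x -> x <= sup A.
Proof. by move=> h Ax; apply: ub_le_sup => //; exists M. Qed.

End lc_topology.

(** * The Duhamel integral *)

Section duhamel.
Context {R : realType} {n : nat} (a : R -> 'M[R]_n).
Hypothesis a_continuous : {within `[0, +oo[, continuous a}.
Hypothesis a_sym : forall t : R, 0 <= t -> (a t)^T = a t.
Hypothesis a_posdef : forall t : R, 0 <= t ->
  forall x : 'rV[R]_n, x != 0 -> 0 < (x *m (a t *m x^T)) 0 0.
Context {q : R} {q1 : (1 <= q%:E)%E}.
Local Notation L := (Lq n q1).
Local Notation wd := (@weak_deriv R n q q1).
Local Notation W s t := (@heat_op R n a q q1 s t).
Implicit Types (h g : R -> L) (l : 'I_n -> nat).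

(* The functions of C([0, +oo), W^{q,oo}). *)
Definition C0S h := (forall t, 0 <= t -> inS (h t)) /\
  forall t l e, 0 <= t -> 0 < e -> exists2 d, 0 < d & forall s, 0 <= s -> `|s - t| < d ->
    `|wd l (h s) - wd l (h t)| <= e.

Lemma C0S_bounded h l b : C0S h -> exists2 M, 0 <= M & forall t, 0 <= t <= b -> `|wd l (h t)| <= M.
Proof.
move=> [hS hC].
have c : {within `[0, b], continuous (fun t => `|wd l (h t)|)}.
  apply/subspace_continuousP => t; rewrite /= in_itv/= => /andP[t0 tb].
  apply/cvgrPdist_le => e e0; have [d d0 hd] := hC t l e t0 e0.
  rewrite near_withinE; exists d => // s /= st; rewrite in_itv/= => /andP[s0 sb].
  rewrite distrC; apply: le_trans (ler_dist_dist _ _) _; apply: hd => //.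
  by rewrite distrC.
have [M M0 hM] := within_bounded c; exists M => // t tab.
by have := hM t tab; rewrite normr_id.
Qed.

Lemma C0S_lin c h g : C0S h -> C0S g -> C0S (fun t => c *: h t + g t).
Proof.
move=> [hS hC] [gS gC]; split; first by move=> t t0; apply: inS_lin; [exact: hS|exact: gS].
move=> t l e t0 e0; have c1 : 0 < `|c| + 1 by apply: ltr_wpDl; [exact: normr_ge0|exact: ltr01].
have e2 : 0 < e / 2 by rewrite divr_gt0.
have [d1 d10 h1] := hC t l _ t0 (divr_gt0 e2 c1); have [d2 d20 h2] := gC t l _ t0 e2.
exists (Num.min d1 d2); first by rewrite lt_min d10.
move=> s s0; rewrite lt_min => /andP[s1 s2].
have E r (r0 : 0 <= r) := wd_linE l c (hS r r0) (gS r r0).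
rewrite (E s s0) (E t t0).
have H1 := h1 s s0 s1; have H2 := h2 s s0 s2.
rewrite (_ : _ - _ = c *: (wd l (h s) - wd l (h t)) + (wd l (g s) - wd l (g t))); last by lmod R.
apply: le_trans (ler_normD _ _) _; rewrite normrZ [leRHS]splitr; apply: lerD; last exact: H2.
have F := frac_le (normr_ge0 (wd l (h s) - wd l (h t))) (normr_ge0 c) (e := e / 2) (s := 1).
by rewrite !mulr1 in F; rewrite mulrC; apply: F; exact: H1.
Qed.

Definition dprim h l t : R -> L :=
  xget (fun=> 0) [set F : R -> L | F 0 = 0 /\ prim (fun s => W s t (wd l (h s))) F 0 t].

Lemma dprimP h l t : C0S h -> 0 <= t ->
  dprim h l t 0 = 0 /\ prim (fun s => W s t (wd l (h s))) (dprim h l t) 0 t.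
Proof.
move=> [hS hC] t0.
suff [F F0 pF] : exists2 F : R -> L, F 0 = 0 & prim (fun s => W s t (wd l (h s))) F 0 t.
  exact: (@xgetPex _ (fun=> 0) [set F : R -> L | F 0 = 0 /\ prim (fun s => W s t (wd l (h s))) F 0 t] (ex_intro _ F (conj F0 pF))).
apply: prim_exists => //; first exact: Lq_complete.
move=> e e0 c /andP[c0 ct]; have e2 : 0 < e / 2 by rewrite divr_gt0.
have [d1 d10 h1] := hC c l _ c0 e2.
have [d2 d20 h2] := W_cont (q1 := q1) a_continuous a_sym a_posdef (wd l (h c)) c0 e2.
exists (Num.min d1 d2); first by rewrite lt_min d10.
move=> x /andP[x0 xt]; rewrite lt_min => /andP[xc1 xc2].
set v := wd l (h c) in h1 h2 *.
rewrite (_ : _ - _ = W x t (wd l (h x) - v) + (W x t v - W c t v)); last first.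
  have := WB a_continuous a_sym a_posdef (wd l (h x)) v x0 xt => ->; lmod R.
apply: le_trans (ler_normD _ _) _; rewrite [leRHS]splitr; apply: lerD.
  apply: le_trans (W_norm a_continuous a_sym a_posdef _ x0 xt) _; exact: h1.
have cc : `|c - c| < d2 by rewrite subrr normr0.
have [xc|cx] := leP x c.
  rewrite -(W_comp a_continuous a_sym a_posdef v x0 xc ct).
  rewrite -(WB a_continuous a_sym a_posdef _ _ c0 ct).
  apply: le_trans (W_norm a_continuous a_sym a_posdef _ c0 ct) _; exact: h2.
rewrite -(W_comp a_continuous a_sym a_posdef v c0 (ltW cx) xt).
rewrite -(WB a_continuous a_sym a_posdef _ _ x0 xt).
apply: le_trans (W_norm a_continuous a_sym a_posdef _ x0 xt) _; rewrite distrC.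
exact: h2 (ltW cx) cc xc2.
Qed.

Lemma dprim_wd h l s t : C0S h -> 0 <= s -> s <= t ->
  is_weak_deriv l (dprim h (fun=> 0%N) t s) (dprim h l t s).
Proof.
move=> hh s0 st; have t0 := le_trans s0 st; have [hS hC] := hh.
have [z0 p0] := dprimP (fun=> 0%N) hh t0; have [zl pl] := dprimP l hh t0.
apply/wdE => phi tphi.
have [C [D w]] := test_weight tphi; have [C' [D' w']] := test_weight (test_mderiv l tphi).
have [C0 D0] := weight_ge0 w; have [C'0 D'0] := weight_ge0 w'.
pose T1 (v : L) : R^o := Lpair v (mderiv l phi).
pose T2 (v : L) : R^o := (-1) ^+ morder l * Lpair v phi.
have T1l (c : R) u v : T1 (c *: u + v) = c *: T1 u + T1 v by rewrite /T1 (LpairD _ _ w') (LpairZ _ _ w').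
have T2l (c : R) u v : T2 (c *: u + v) = c *: T2 u + T2 v.
  by rewrite /T2 (LpairD _ _ w) (LpairZ _ _ w) /GRing.scale/=; ring.
have T1b v : `|T1 v| <= (C' + D') * `|v| by rewrite mulrC; exact: Lpair_bound.
have T2b v : `|T2 v| <= (C + D) * `|v|.
  by rewrite /T2 normrM normrX normrN normr1 expr1n mul1r mulrC; exact: Lpair_bound.
have q1' := prim_linear (addr_ge0 C'0 D'0) T1l T1b (prim_sub p0 (lexx 0) st).
have q2' := prim_linear (addr_ge0 C0 D0) T2l T2b (prim_sub pl (lexx 0) st).
have q3 : prim (fun x => T1 (W x t (wd (fun=> 0%N) (h x)))) (fun x => T2 (dprim h l t x)) 0 s.
  apply: prim_ext q2' _ => x /andP[x0 xs]; have xt := le_trans xs st.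
  have hx := hS x x0; have := wdP l (inS_W a_continuous a_sym a_posdef x0 xt hx).
  rewrite (wd_W a_continuous a_sym a_posdef l x0 xt hx) => /wdE /(_ phi tphi) E.
  by rewrite /T1 wd_id E.
have := prim_unique s0 q1' q3; rewrite z0 zl.
have T10 : T1 0 = 0 by have := T1l (-1) 0 0; rewrite scaler0 addr0 scaleN1r addNr.
have T20 : T2 0 = 0 by have := T2l (-1) 0 0; rewrite scaler0 addr0 scaleN1r addNr.
by rewrite T10 T20 !subr0.
Qed.

Lemma inS_dprim h s t : C0S h -> 0 <= s -> s <= t -> inS (dprim h (fun=> 0%N) t s).
Proof. by move=> hh s0 st l; eexists; exact: dprim_wd. Qed.

Lemma wd_dprim h l s t : C0S h -> 0 <= s -> s <= t ->
  wd l (dprim h (fun=> 0%N) t s) = dprim h l t s.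
Proof. by move=> hh s0 st; apply: weak_derivE; exact: dprim_wd. Qed.

(** Both sides are primitives of the same function. *)
Lemma dprim_W h l s t : C0S h -> 0 <= s -> s <= t -> W s t (dprim h l s s) = dprim h l t s.
Proof.
move=> hh s0 st; have t0 := le_trans s0 st.
have [zs ps] := dprimP l hh s0; have [zt pt] := dprimP l hh t0.
have Wl (c : R) (u v : L) : W s t (c *: u + v) = c *: W s t u + W s t v by exact: W_lin.
have Wb (v : L) : `|W s t v| <= 1 * `|v| by rewrite mul1r; exact: W_norm.
have p1 := prim_linear ler01 Wl Wb ps.
have p2 : prim (fun x => W x t (wd l (h x))) (fun x => W s t (dprim h l s x)) 0 s.
  by apply: prim_ext p1 _ => x /andP[x0 xs]; exact: W_comp.
have := prim_unique s0 p2 (prim_sub pt (lexx 0) st); rewrite zs zt.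
have -> : W s t 0 = 0 by have := Wl (-1) 0 0; rewrite scaler0 addr0 scaleN1r addNr.
by rewrite !subr0.
Qed.

Lemma dprim_le h l t M : C0S h -> 0 <= t -> 0 <= M -> (forall s, 0 <= s <= t -> `|wd l (h s)| <= M) ->
  `|dprim h l t t| <= M * t.
Proof.
move=> hh t0 M0 hM; have [z p] := dprimP l hh t0.
have := prim_le t0 M0 p; rewrite z !subr0; apply => s /andP[s0 st].
by apply: le_trans (W_norm a_continuous a_sym a_posdef _ s0 st) _; apply: hM; rewrite s0.
Qed.

Definition duhamel h t : L := if 0 <= t then dprim h (fun=> 0%N) t t else 0.

Lemma duhamelE h t : 0 <= t -> duhamel h t = dprim h (fun=> 0%N) t t.
Proof. by rewrite /duhamel => ->. Qed.

Lemma inS_duhamel h t : C0S h -> 0 <= t -> inS (duhamel h t).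
Proof. by move=> hh t0; rewrite duhamelE//; exact: inS_dprim. Qed.

Lemma wd_duhamel h l t : C0S h -> 0 <= t -> wd l (duhamel h t) = dprim h l t t.
Proof. by move=> hh t0; rewrite duhamelE//; exact: wd_dprim. Qed.

Lemma duhamel_riemann h t : C0S h -> 0 <= t ->
  is_riemann_integral (fun s => W s t (h s)) 0 t (duhamel h t).
Proof.
move=> hh t0; have [z p] := dprimP (fun=> 0%N) hh t0.
have r := prim_riemann t0 p; rewrite z subr0 in r.
rewrite (duhamelE h t0).
have E : (fun s => W s t (h s)) = (fun s => W s t (wd (fun=> 0%N) (h s))).
  by apply/funext => s; rewrite wd_id.
by rewrite E; exact: r.
Qed.

Lemma duhamel_lin c h g t : C0S h -> C0S g ->
  duhamel (fun s => c *: h s + g s) t = c *: duhamel h t + duhamel g t.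
Proof.
move=> hh hg; have [t0|t0] := boolP (0 <= t); last first.
  have z f : duhamel f t = 0 by rewrite /duhamel (negbTE t0).
  by rewrite !z scaler0 addr0.
rewrite !(duhamelE _ t0).
have [z1 p1] := dprimP (fun=> 0%N) hh t0; have [z2 p2] := dprimP (fun=> 0%N) hg t0.
have [z3 p3] := dprimP (fun=> 0%N) (C0S_lin c hh hg) t0.
have p4 := prim_lin c p1 p2.
have p5 : prim (fun s => c *: W s t (wd (fun=> 0%N) (h s)) + W s t (wd (fun=> 0%N) (g s)))
    (dprim (fun s => c *: h s + g s) (fun=> 0%N) t) 0 t.
  apply: prim_ext p3 _ => x /andP[x0 xt]; rewrite !wd_id.
  exact: W_lin.
have := prim_unique t0 p5 p4; rewrite /= z1 z2 z3 scaler0 addr0 !subr0.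
exact.
Qed.

Lemma duhamel_mild h : C0S h -> mild a (duhamel h) h.
Proof.
move=> hh l t0 e t00 e0; have [hS hC] := hh; have e2 : 0 < e / 2 by rewrite divr_gt0.
have [d1 d10 h1] := hC t0 l _ (ltW t00) e2.
have [d2 d20 h2] := W_cont (q1 := q1) a_continuous a_sym a_posdef (wd l (h t0)) (ltW t00) e2.
exists (Num.min d1 d2); first by rewrite lt_min d10.
move=> s t s0 st; rewrite !lt_min => /andP[s1 s2] /andP[t1 t2].
have t_0 := lt_le_trans s0 st; have htS := hS t0 (ltW t00).
have uS := inS_duhamel hh (ltW s0); have utS := inS_duhamel hh (ltW t_0).
have WS := inS_W a_continuous a_sym a_posdef (ltW s0) st uS.
rewrite (wdB _ (inSB utS WS) (inSZ _ htS)) (wdB _ utS WS) (wdZ _ _ htS).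
rewrite (wd_W a_continuous a_sym a_posdef l (ltW s0) st uS).
rewrite (wd_duhamel l hh (ltW s0)) (wd_duhamel l hh (ltW t_0)) (dprim_W l hh (ltW s0) st).
have [z p] := dprimP l hh (ltW t_0).
apply: (prim_near st (ltW e0) (prim_sub p (ltW s0) (lexx t))) => x /andP[sx xt].
have x0 := le_trans (ltW s0) sx.
have near d : `|s - t0| < d -> `|t - t0| < d -> `|x - t0| < d.
  by rewrite !ltr_norml => /andP[? ?] /andP[? ?]; apply/andP; split; lra.
set v := wd l (h t0) in h1 h2 *.
rewrite (_ : _ - _ = W x t (wd l (h x) - v) + (W x t v - v)); last first.
  by rewrite (WB a_continuous a_sym a_posdef _ _ x0 xt); lmod R.
apply: le_trans (ler_normD _ _) _; rewrite [leRHS]splitr; apply: lerD.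
  apply: le_trans (W_norm a_continuous a_sym a_posdef _ x0 xt) _; apply: h1 => //.
  exact: near.
by apply: h2 => //; exact: near.
Qed.

Lemma duhamel_locally_bounded h : C0S h -> locally_bounded (duhamel h).
Proof.
move=> hh l c c0; have [M M0 hM] := C0S_bounded l (c + 1) hh.
exists 1 => //; exists (M * (c + 1)); first by rewrite mulr_ge0// addr_ge0// ltW.
move=> t t0; rewrite ltr_norml => /andP[t1 t2].
rewrite (wd_duhamel l hh (ltW t0)); apply: le_trans (dprim_le hh (ltW t0) M0 _) _.
  by move=> s /andP[s0 st]; apply: hM; rewrite s0/=; lra.
by apply: ler_wpM2l => //; lra.
Qed.

Lemma duhamel_hasD h : C0S h -> hasD (duhamel h) (fun t => Lop (a t) (duhamel h t) + h t).
Proof.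
move=> hh; apply: (mild_hasD a_continuous a_sym a_posdef).
- by move=> t t0; apply: inS_duhamel => //; exact: ltW.
- by move=> t t0; apply: hh.1; exact: ltW.
- exact: duhamel_locally_bounded.
- exact: duhamel_mild.
Qed.

End duhamel.

(** * The homogeneous solution *)

Section homogeneous.
Context {R : realType} {n : nat} (a : R -> 'M[R]_n).
Hypothesis a_continuous : {within `[0, +oo[, continuous a}.
Hypothesis a_sym : forall t : R, 0 <= t -> (a t)^T = a t.
Hypothesis a_posdef : forall t : R, 0 <= t ->
  forall x : 'rV[R]_n, x != 0 -> 0 < (x *m (a t *m x^T)) 0 0.
Context {q : R} {q1 : (1 <= q%:E)%E}.
Local Notation L := (Lq n q1).
Local Notation wd := (@weak_deriv R n q q1).
Local Notation W s t := (@heat_op R n a q q1 s t).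

Lemma inS_W0 t (v : L) : 0 < t -> inS (W 0 t v).
Proof.
move=> t0; rewrite WE//; apply: inS_heat_smoothing.
by apply: (A_posdef a_continuous a_sym a_posdef).
Qed.

Lemma W0_bounded l (al : R) : 0 < al -> exists2 C, 0 <= C & forall t (v : L), al <= t ->
  `|wd l (W 0 t v)| <= C * `|v|.
Proof.
move=> al0; have pA := A_posdef a_continuous a_sym a_posdef (lexx 0) al0.
have [C C0 hC] := heat_smoothing (q1 := q1) l pA; exists C => // t v alt.
rewrite -(W_comp a_continuous a_sym a_posdef v (lexx 0) (ltW al0) alt).
rewrite (wd_W a_continuous a_sym a_posdef l (ltW al0) alt (inS_W0 v al0)).
apply: le_trans (W_norm a_continuous a_sym a_posdef _ (ltW al0) alt) _.
have [w ww wb] := hC v; rewrite WE//.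
by rewrite (weak_derivE ww).
Qed.

Lemma W0_hasD (v : L) : hasD (fun t => W 0 t v) (fun t => Lop (a t) (W 0 t v) + 0).
Proof.
apply: (mild_hasD (h := fun=> 0) a_continuous a_sym a_posdef).
- by move=> t t0; exact: inS_W0.
- by move=> t _; exact: inS0.
- move=> l c c0; have c2 : 0 < c / 2 by rewrite divr_gt0.
  have [C C0 hC] := W0_bounded l c2; exists (c / 2) => //; exists (C * `|v|).
    by apply: mulr_ge0 => //; exact: normr_ge0.
  move=> t t0; rewrite ltr_norml => /andP[t1 t2]; apply: hC.
  by have := splitr c; lra.
move=> l t0 e t00 e0; exists 1 => // s t s0 st _ _.
rewrite (W_comp a_continuous a_sym a_posdef v (lexx 0) (ltW s0) st) subrr scaler0 subr0 (wd_zero l) normr0.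
by apply: mulr_ge0; [exact: ltW|rewrite subr_ge0].
Qed.

End homogeneous.

#[local] Opaque lc_deriven.

(** * The solution spaces *)

Section dominated_functionals.
Context {R : realType} {X I : Type} (N : I -> X -> R).
Hypothesis N_ge0 : forall i x, 0 <= N i x.

(* The functionals dominated by a finite sum of the N i. *)
Definition dominated (p : X -> R) := (forall x, 0 <= p x) /\
  exists2 C, 0 <= C & exists r : seq I, forall x, p x <= C * \sum_(i <- r) N i x.

Lemma dominated_ge0 p x : dominated p -> 0 <= p x. Proof. by move=> []. Qed.

Lemma dominated_0 : dominated (fun=> 0).
Proof. by split => //; exists 0 => //; exists [::] => x; rewrite mul0r. Qed.

Lemma dominated_add p p' : dominated p -> dominated p' -> dominated (fun x => p x + p' x).
Proof.
move=> [p0 [C C0 [r hr]]] [p0' [C' C0' [r' hr']]]; split; first by move=> x; rewrite addr_ge0.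
exists (C + C'); first exact: addr_ge0.
exists (r ++ r') => x; rewrite big_cat/=.
have s0 (s : seq I) : 0 <= \sum_(i <- s) N i x by exact: sumr_ge0.
have := hr x; have := hr' x; have := s0 r; have := s0 r'; nra.
Qed.

Lemma dominated_scale c p : 0 <= c -> dominated p -> dominated (fun x => c * p x).
Proof.
move=> c0 [p0 [C C0 [r hr]]]; split; first by move=> x; rewrite mulr_ge0.
exists (c * C); first exact: mulr_ge0.
by exists r => x; rewrite -mulrA ler_wpM2l.
Qed.

Lemma dominated_N i : dominated (N i).
Proof. by split => //; exists 1 => //; exists [:: i] => x; rewrite mul1r big_seq1. Qed.

Lemma sum_small (r : seq I) x d : (forall i, List.In i r -> N i x < d) ->
  \sum_(i <- r) N i x <= (size r)%:R * d.
Proof.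
elim: r => [|i r IH] h; first by rewrite big_nil mul0r.
rewrite big_cons [size _]/= -natr1 mulrDl mul1r addrC; apply: lerD.
  by apply: IH => j jr; apply: h; right.
by apply/ltW/h; left.
Qed.

Lemma dominated_small p e : dominated p -> 0 < e -> exists (r : seq I), exists2 d, 0 < d &
  forall x, (forall i, List.In i r -> N i x < d) -> p x < e.
Proof.
move=> [p0 [C C0 [r hr]]] e0; exists r; pose k := C * (size r)%:R.
have k0 : 0 <= k by rewrite mulr_ge0.
have k1 : 0 < k + 1 by rewrite ltr_wpDl.
exists (e / (k + 1)); first by rewrite divr_gt0.
move=> x hx; apply: le_lt_trans (hr x) _.
apply: le_lt_trans (ler_wpM2l C0 (sum_small hx)) _.
have -> : C * ((size r)%:R * (e / (k + 1))) = e * (k / (k + 1)) by rewrite /k; ring.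
rewrite gtr_pMr// ltr_pdivrMr// mul1r; lra.
Qed.

End dominated_functionals.

Section spaces.
Context {R : realType} {n : nat} {q : R} {q1 : (1 <= q%:E)%E}.
Local Notation L := (Lq n q1).
Local Notation wd := (@weak_deriv R n q q1).
Local Notation S := (sobolev_oo n q1).
Implicit Types (f g h : R -> L).

Lemma C0SP h : lc_set (lc_C0 S) h <-> (forall t, t < 0 -> h t = 0) /\ C0S h.
Proof.
split=> [[h0 hC]|[h0 [hS hC]]]; split => //.
  have hS t : 0 <= t -> inS (h t) by move=> t0; apply/inSP; exact: (hC t t0).1.
  split => // t l e t0 e0; have [_ [_ /(_ l)]] := hC t t0.
  move=> /cvgrPdist_le /(_ e e0) H.
  have {H} : \forall s \near within `[0, +oo[ (nbhs t), `|0 - lc_norm (l : lc_index S) (h s - h t)| <= e by exact: H.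
  rewrite near_withinE => -[d /= d0 hd]; exists d => // s s0 sd.
  have := hd s; rewrite /= distrC in_itv/= s0 => /(_ sd isT).
  rewrite sub0r normrN normr_id.
  by have := wdB l (hS s s0) (hS t t0) => ->.
move=> t t0; split; first by apply/inSP; exact: hS.
split; first by apply/inSP; exact: hS.
move=> l; apply/cvgrPdist_le => e e0; have [d d0 hd] := hC t l e t0 e0.
suff : \forall s \near within `[0, +oo[ (nbhs t), `|0 - lc_norm (l : lc_index S) (h s - h t)| <= e by [].
rewrite near_withinE; exists d => // s /= st; rewrite in_itv/= andbT => s0.
rewrite sub0r normrN normr_id.
have := wdB l (hS s s0) (hS t t0) => ->; apply: hd => //; by rewrite distrC.
Qed.

Lemma C0LP h : (forall t, t < 0 -> h t = 0) ->
  (forall t e, 0 <= t -> 0 < e -> exists2 d, 0 < d & forall s, 0 <= s -> `|s - t| < d -> `|h s - h t| <= e) ->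
  lc_set (lc_C0 (lc_of_normed L)) h.
Proof.
move=> h0 hC; split => // t t0; split => //; split => // i.
apply/cvgrPdist_le => e e0; have [d d0 hd] := hC t e t0 e0.
suff : \forall s \near within `[0, +oo[ (nbhs t), `|0 - `|h s - h t| | <= e by [].
rewrite near_withinE; exists d => // s /= st; rewrite in_itv/= andbT => s0.
rewrite sub0r normrN normr_id; apply: hd => //; by rewrite distrC.
Qed.

Lemma solution_mem h : (forall t, t < 0 -> h t = 0) -> lc_smooth S `]0, +oo[ h ->
  (forall e, 0 < e -> exists2 d, 0 < d & forall s, 0 <= s -> s < d -> `|h s - h 0| <= e) ->
  lc_set (solution_space n q1) h.
Proof.
move=> h0 hs hc; split => //; apply: C0LP => // t e t0 e0.
move: t0; rewrite le_eqVlt => /predU1P[<-|t0].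
  have [d d0 hd] := hc e e0; exists d => // s s0; rewrite subr0 ger0_norm//; exact: hd.
have [SV D] := smooth_tower hs.
have [d d0 hd] := hasD_lipschitz (SV 0%N) (SV 1%N) (D 0%N) t0 (fun=> 0%N).
pose C := `|wd (fun=> 0%N) (lc_deriven S 1 h t)| + 1.
have C0 : 0 < C by apply: ltr_wpDl; [exact: normr_ge0|exact: ltr01].
exists (Num.min (Num.min d t) (e / C)); first by rewrite !lt_min d0 t0 divr_gt0.
move=> s _; rewrite !lt_min => /andP[/andP[s1 s2] s3].
have s0 : 0 < s by move: s2; rewrite ltr_norml => /andP[s2 _]; lra.
have := hd s s0 s1; rewrite wd_id => H; apply: le_trans H _.
by move: s3; rewrite ltr_pdivlMr// mulrC => /ltW.
Qed.

Lemma smooth_sub f g : lc_smooth S `]0, +oo[ f -> lc_smooth S `]0, +oo[ g ->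
  lc_smooth S `]0, +oo[ (f - g) /\ forall j l t, 0 < t ->
    lc_deriven S j (fun s => wd l ((f - g) s)) t =
    lc_deriven S j (fun s => wd l (f s)) t - lc_deriven S j (fun s => wd l (g s)) t.
Proof.
move=> fs gs; have [fgs E] := smooth_lin (-1) gs fs.
have e : -1 *: g + f = f - g by rewrite scaleN1r addrC.
rewrite e in fgs E; split => // j l t t0.
have SVf := (smooth_tower fs).1 j t t0; have SVg := (smooth_tower gs).1 j t t0.
rewrite (smooth_wd l fgs j t0) (smooth_wd l fs j t0) (smooth_wd l gs j t0) (E j t t0).
have F : -1 *: lc_deriven S j g t + lc_deriven S j f t = lc_deriven S j f t - lc_deriven S j g t.
  by rewrite scaleN1r addrC.
by rewrite F; exact: wdB.
Qed.

Lemma smooth_bounded f j l (K : set R) : lc_smooth S `]0, +oo[ f -> compact K -> K `<=` `]0, +oo[ ->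
  exists2 M, 0 <= M & forall t, K t -> `|lc_deriven S j (fun s => wd l (f s)) t| <= M.
Proof.
move=> fs cK K0; have [[al be] /= al0 hK] := compact_pos_segment cK K0.
have [SV D] := smooth_tower fs.
have [M M0 hM] := hasD_bounded (SV j) (SV j.+1) (D j) l be al0; exists M => // t Kt.
have tab := hK t Kt; have t0 : 0 < t by have /andP[h _] := tab; exact: lt_le_trans h.
by rewrite (smooth_wd l fs j t0); exact: hM.
Qed.

Lemma sup_triangle (T : Type) (A : set T) (F G H : T -> R) : (forall t, A t -> F t <= G t + H t) ->
  (forall t, 0 <= G t) -> (forall t, 0 <= H t) ->
  (exists M, forall t, A t -> G t <= M) -> (exists M, forall t, A t -> H t <= M) ->
  sup [set F t | t in A] <= sup [set G t | t in A] + sup [set H t | t in A].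
Proof.
move=> FGH G0 H0 [M hM] [M' hM']; apply: sup_nneg_le.
  by apply: addr_ge0; apply: sup_ge0 => _ [t _ <-].
move=> _ [t At <-]; apply: le_trans (FGH t At) _; apply: lerD.
  by apply: (le_supP (M := M)); [move=> _ [s As <-]; exact: hM|exists t].
by apply: (le_supP (M := M')); [move=> _ [s As <-]; exact: hM'|exists t].
Qed.

Lemma C0L_bounded h (b : R) : lc_set (lc_C0 (lc_of_normed L)) h ->
  exists M, forall t, t \in `[0, b] -> `|h t| <= M.
Proof.
move=> [_ hC].
have c : {within `[0, b], continuous (fun t => `|h t|)}.
  apply/subspace_continuousP => t; rewrite /= in_itv/= => /andP[t0 tb].
  apply/cvgrPdist_le => e e0; have [_ [_ /(_ tt) /cvgrPdist_le /(_ e e0) H]] := hC t t0.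
  have {H} : \forall s \near within `[0, +oo[ (nbhs t), `|0 - `|h s - h t| | <= e by exact: H.
  rewrite !near_withinE => -[d /= d0 hd]; exists d => // s /= st; rewrite in_itv/= => /andP[s0 sb].
  have := hd s st; rewrite in_itv/= s0 => /(_ isT); rewrite sub0r normrN normr_id => H.
  by rewrite distrC; apply: le_trans (ler_dist_dist _ _) _.
have [M M0 hM] := within_bounded c; exists M => // t; rewrite in_itv/= => tab.
by have := hM t tab; rewrite normr_id.
Qed.

Lemma solution_triangle (i : lc_index (solution_space n q1)) (f g k : lc_elt (solution_space n q1)) :
  lc_norm i (\val f - \val k) <= lc_norm i (\val f - \val g) + lc_norm i (\val g - \val k).
Proof.
have [fs fC] := set_mem (valP f); have [gs gC] := set_mem (valP g); have [ks kC] := set_mem (valP k).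
move: (\val f) (\val g) (\val k) fs fC gs gC ks kC => {}f {}g {}k fs fC gs gC ks kC.
case: i => [[[j l] [K [cK K0]]]|[[] b]] /=.
  have [fgs Efg] := smooth_sub fs gs; have [gks Egk] := smooth_sub gs ks; have [fks Efk] := smooth_sub fs ks.
  apply: sup_triangle.
  - move=> t Kt; have t0 : 0 < t by have := K0 t Kt; rewrite /= in_itv/= andbT.
    have mid (x y z : L) : x - y = (x - z) + (z - y) by lmod R.
    have E := etrans (Efk j l t t0) (etrans (mid _ _ _) (esym (congr2 +%R (Efg j l t t0) (Egk j l t t0)))).
    rewrite (congr1 Num.norm E).
    exact: ler_normD.
  - by move=> t; exact: normr_ge0.
  - by move=> t; exact: normr_ge0.
  - by have [M _ hM] := smooth_bounded j l fgs cK K0; exists M.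
  - by have [M _ hM] := smooth_bounded j l gks cK K0; exists M.
have [Mf hf] := C0L_bounded b.+1%:R fC; have [Mg hg] := C0L_bounded b.+1%:R gC.
have [Mk hk] := C0L_bounded b.+1%:R kC.
apply: sup_triangle.
- move=> t _; rewrite (_ : (f - k) t = (f - g) t + (g - k) t); first exact: ler_normD.
  by change (f t - k t = (f t - g t) + (g t - k t)); lmod R.
- by move=> t; exact: normr_ge0.
- by move=> t; exact: normr_ge0.
- exists (Mf + Mg) => t tb; apply: le_trans (ler_normB _ _) _; apply: lerD; [exact: hf|exact: hg].
- exists (Mg + Mk) => t tb; apply: le_trans (ler_normB _ _) _; apply: lerD; [exact: hg|exact: hk].
Qed.

Lemma source_norm_ge0 (i : lc_index (source_space n q1)) h : 0 <= lc_norm i h.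
Proof. by case: i => [[[j l] K]|[l b]]; apply: sup_ge0 => _ [t _ <-]; exact: normr_ge0. Qed.

Lemma source_norm0 (i : lc_index (source_space n q1)) (x : lc_elt (source_space n q1)) :
  lc_norm i (\val x - \val x) <= 0.
Proof.
have [xs _] := set_mem (valP x); move: (\val x) xs => {}x xs.
case: i => [[[j l] [K [cK K0]]]|[l b]] /=; apply: sup_nneg_le => // _ [t Kt <-].
  have t0 : 0 < t by have := K0 t Kt; rewrite /= in_itv/= andbT.
  by rewrite ((smooth_sub xs xs).2 j l t t0) subrr normr0.
by change (`|wd l (x t - x t)| <= 0); rewrite subrr (wd_zero l) normr0.
Qed.

Lemma source_sub (x y : lc_elt (source_space n q1)) : lc_set (source_space n q1) (\val y - \val x).
Proof.
have [xs xC] := set_mem (valP x); have [ys yC] := set_mem (valP y).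
move: (\val x) (\val y) xs xC ys yC => {}x {}y xs xC ys yC.
split; first exact: (smooth_sub ys xs).1.
have [x0 xS] := (C0SP x).1 xC; have [y0 yS] := (C0SP y).1 yC.
apply/C0SP; split; first by move=> t t0; change (y t - x t = 0); rewrite x0// y0// subrr.
have -> : y - x = (fun t => -1 *: x t + y t); last exact: C0S_lin.
by apply/funext => t; rewrite scaleN1r addrC.
Qed.

Lemma source_lin (c : R) (x y : lc_elt (source_space n q1)) :
  lc_set (source_space n q1) (c *: \val x + \val y).
Proof.
have [xs xC] := set_mem (valP x); have [ys yC] := set_mem (valP y).
move: (\val x) (\val y) xs xC ys yC => {}x {}y xs xC ys yC.
split; first exact: (smooth_lin c xs ys).1.
have [x0 xS] := (C0SP x).1 xC; have [y0 yS] := (C0SP y).1 yC.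
apply/C0SP; split; last exact: C0S_lin.
by move=> t t0; change (c *: x t + y t = 0); rewrite x0// y0// scaler0 addr0.
Qed.

(** The C^oo seminorms of the identity of the source space are dominated by its own
   seminorms. *)
Lemma source_Cl j : Cl (dominated (fun (i : lc_index (source_space n q1)) (x : lc_elt (source_space n q1)) => lc_norm i (\val x)))
  j (fun x => \val x).
Proof.
have N0 (i : lc_index (source_space n q1)) (x : lc_elt (source_space n q1)) : 0 <= lc_norm i (\val x) by exact: source_norm_ge0.
apply: Cl_of_smooth.
  by move=> x; have [xs _] := set_mem (valP x).
move=> {}j l al be al0.
have cK : compact `[al, be] by exact: segment_compact.
have K0 : `[al, be]%classic `<=` `]0, +oo[%classic.
  by move=> t /=; rewrite !in_itv/= andbT => /andP[h _]; exact: lt_le_trans h.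
pose i : lc_index (source_space n q1) := inl (j, l, exist _ _ (conj cK K0)).
exists (fun x => lc_norm i (\val x)); first exact: (dominated_N N0 i).
move=> x t tab; have [xs _] := set_mem (valP x).
have [M _ hM] := smooth_bounded j l xs cK K0.
apply: (le_supP (M := M)); first by move=> _ [s Ks <-]; exact: hM.
by exists t => //=; rewrite in_itv.
Qed.

(** A family which is a C^oo family for the dominated functionals maps into the smooth
   functions continuously. *)
Lemma Cl_norm (X : Type) (P : (X -> R) -> Prop) (u : X -> R -> L) :
  (forall p x, P p -> 0 <= p x) -> (forall j, Cl P j u) ->
  forall i : lc_index (Cinfty_sobolev_oo n q1), exists2 p, P p & forall x, lc_norm i (u x) <= p x.
Proof.
move=> P0 hu [[j l] [K [cK K0]]]; have [[al be] /= al0 hK] := compact_pos_segment cK K0.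
have [p Pp hp] := Cl_seminorm hu j l be al0; exists p => // x.
apply: sup_nneg_le; first exact: P0.
by move=> _ [t Kt <-]; apply: hp; exact: hK.
Qed.

End spaces.

(** * The solution maps *)

Section coefficients.
Context {R : realType} {n : nat} (a : R -> 'M[R]_n).
Hypothesis a_smooth : forall (j : nat) (t : R), 0 < t -> derivable (derive1n j a) t 1.

Lemma a_tower i k : tower (fun p t => derive1n p a t i k).
Proof.
move=> p t t0.
have D : is_derive t 1 (derive1n p a) (derive1n p.+1 a t).
  by rewrite derive1nS derive1E; apply: derivableP; exact: a_smooth.
apply/is_deriveE; have /is_deriveE h := D.
have cik : {for derive1n p.+1 a t, continuous (fun M : 'M[R]_n => M i k)} by exact: coord_continuous.
have := cvg_comp _ _ h cik.
by apply: cvg_trans; apply: near_eq_cvg; apply: nearW => s /=; rewrite !mxE.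
Qed.

End coefficients.

Section maps.
Context {R : realType} {n : nat} (a : R -> 'M[R]_n).
Hypothesis a_smooth : forall (j : nat) (t : R), 0 < t -> derivable (derive1n j a) t 1.
Hypothesis a_continuous : {within `[0, +oo[, continuous a}.
Hypothesis a_sym : forall t : R, 0 <= t -> (a t)^T = a t.
Hypothesis a_posdef : forall t : R, 0 <= t ->
  forall x : 'rV[R]_n, x != 0 -> 0 < (x *m (a t *m x^T)) 0 0.
Context {q : R} {q1 : (1 <= q%:E)%E}.
Local Notation L := (Lq n q1).
Local Notation wd := (@weak_deriv R n q q1).
Local Notation S := (sobolev_oo n q1).
Local Notation W s t := (@heat_op R n a q q1 s t).

Definition hom (v : L) (t : R) : L := if 0 <= t then W 0 t v else 0.

Lemma homE v t : 0 <= t -> hom v t = W 0 t v.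
Proof. by rewrite /hom => ->. Qed.

Lemma hom_lin c u v : hom (c *: u + v) = c *: hom u + hom v.
Proof.
apply/funext => t; change (hom (c *: u + v) t = c *: hom u t + hom v t).
have [t0|t0] := boolP (0 <= t); first by rewrite !(homE _ t0); exact: W_lin.
have z w : hom w t = 0 by rewrite /hom (negbTE t0).
by rewrite !z scaler0 addr0.
Qed.

Lemma hom_norm v t : 0 <= t -> `|hom v t| <= `|v|.
Proof. by move=> t0; rewrite (homE v t0); exact: W_norm. Qed.

Let PL : (L -> R) -> Prop := dominated (fun (_ : unit) (v : L) => `|v|).

Let NL (i : unit) (v : L) : 0 <= `|v|. Proof. exact: normr_ge0. Qed.

Lemma hom_Cl j : Cl PL j hom.
Proof.
apply: (@Cl_equation _ _ _ _ _ PL (dominated_0 _) (dominated_add NL) (@dominated_scale _ _ _ _)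
  (fun p t => derive1n p a t) hom (fun _ _ => 0)).
- by move=> i k; exact: a_tower.
- split; first by move=> v t t0; rewrite (homE v (ltW t0)); exact: inS_W0.
  move=> l al be al0; have [C C0 hC] := W0_bounded a_continuous a_sym a_posdef (q1 := q1) l al0.
  exists (fun v => C * `|v|); first by apply: dominated_scale => //; exact: (dominated_N NL tt).
  move=> v t /andP[at1 _]; have t0 := lt_le_trans al0 at1.
  by rewrite (homE v (ltW t0)); exact: hC.
- by move=> k; apply: Cl_zero; exact: dominated_0.
move=> v; have := W0_hasD a_continuous a_sym a_posdef v.
by apply: hasD_ext => t t0; rewrite (homE v (ltW t0)).
Qed.

Lemma hom_mem v : lc_set (solution_space n q1) (hom v).
Proof.
apply: solution_mem.
- by move=> t t0; rewrite /hom leNgt t0.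
- exact: Cl_smooth (hom_Cl) v.
move=> e e0.
have [d d0 hd] := W_cont (q1 := q1) a_continuous a_sym a_posdef v (lexx 0) e0.
exists d => // s s0 sd; rewrite (homE v s0) (homE v (lexx 0)) Wid; apply: hd => //.
  by rewrite subrr normr0.
by rewrite subr0 ger0_norm.
Qed.

Lemma hom_bound (i : lc_index (solution_space n q1)) : exists2 p, PL p & forall v, lc_norm i (hom v) <= p v.
Proof.
case: i => [i|[[] b]]; first exact: Cl_norm (@dominated_ge0 _ _ _ _) hom_Cl i.
exists (fun v => `|v|); first exact: (dominated_N NL tt).
move=> v; apply: sup_nneg_le; first exact: normr_ge0.
by move=> _ [t + <-]; rewrite /= in_itv/= => /andP[t0 _]; exact: hom_norm.
Qed.

Definition hom_map (v : L) : lc_elt (solution_space n q1) :=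
  SigSub (mem_set (hom_mem v)).

Lemma hom_continuous : continuous hom_map.
Proof.
apply: lc_continuous => [i f g k|v i e e0]; first exact: solution_triangle.
have [p Pp hp] := hom_bound i; have [r [d d0 hd]] := dominated_small Pp e0.
have : \forall u \near v, `|v - u| < d by apply/nbhs_normP; exists d.
apply: filterS => u uv.
have -> : \val (hom_map u) - \val (hom_map v) = hom (u - v).
  have -> : u - v = -1 *: v + u by rewrite scaleN1r addrC.
  by rewrite hom_lin scaleN1r addrC.
apply: le_lt_trans (hp _) _; apply: hd => j _.
by rewrite distrC.
Qed.

Local Notation src := (lc_elt (source_space n q1)).

Let PS : (src -> R) -> Prop :=
  dominated (fun (i : lc_index (source_space n q1)) (h : src) => lc_norm i (\val h)).

Let NS (i : lc_index (source_space n q1)) (h : src) : 0 <= lc_norm i (\val h).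
Proof. exact: source_norm_ge0. Qed.

Lemma src_C0S (h : src) : C0S (\val h).
Proof. by have [_ /C0SP[]] := set_mem (valP h). Qed.

Lemma src_norm l (b : nat) (h : src) t : 0 <= t <= b.+1%:R ->
  `|wd l (\val h t)| <= lc_norm (inr (l, b) : lc_index (source_space n q1)) (\val h).
Proof.
move=> tb; have [M _ hM] := C0S_bounded l b.+1%:R (src_C0S h).
apply: (le_supP (M := M)).
  by move=> _ [s sb <-]; apply: hM; move: sb; rewrite /= in_itv.
by exists t => //=; rewrite in_itv.
Qed.

Definition inhom (h : src) : R -> L := duhamel a (\val h).

Lemma inhom_bound l (b : nat) : exists2 p, PS p & forall (h : src) t, 0 <= t <= b.+1%:R ->
  `|wd l (inhom h t)| <= p h.
Proof.
pose i : lc_index (source_space n q1) := inr (l, b).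
exists (fun h => b.+1%:R * lc_norm i (\val h)).
  by apply: dominated_scale; [exact: ler0n|exact: (dominated_N NS i)].
move=> h t /andP[t0 tb].
rewrite (wd_duhamel a_continuous a_sym a_posdef l (src_C0S h) t0).
apply: le_trans (dprim_le a_continuous a_sym a_posdef (src_C0S h) t0 (NS i h) _) _.
  by move=> s /andP[s0 st]; apply: src_norm; rewrite s0/=; exact: le_trans tb.
by rewrite mulrC; apply: ler_wpM2r => //; exact: NS.
Qed.

Lemma inhom_Cl j : Cl PS j inhom.
Proof.
apply: (@Cl_equation _ _ _ _ _ PS (dominated_0 _) (dominated_add NS) (@dominated_scale _ _ _ _)
  (fun p t => derive1n p a t) inhom (fun h => \val h)).
- by move=> i k; exact: a_tower.
- split; first by move=> h t t0; apply: inS_duhamel => //; [exact: src_C0S|exact: ltW].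
  move=> l al be al0; have [p Pp hp] := inhom_bound l (Num.bound `|be|).
  exists p => // h t /andP[at1 tb]; apply: hp.
  rewrite (le_trans (ltW al0) at1)/=; apply: le_trans tb _; apply: le_trans (ler_norm _) _.
  apply: le_trans (ltW (archi_boundP (normr_ge0 be))) _.
  by rewrite ler_nat.
- exact: source_Cl.
by move=> h; apply: duhamel_hasD => //; exact: src_C0S.
Qed.

Lemma inhom_mem h : lc_set (solution_space n q1) (inhom h).
Proof.
apply: solution_mem.
- by move=> t t0; rewrite /inhom /duhamel leNgt t0.
- exact: Cl_smooth inhom_Cl h.
move=> e e0; have hh := src_C0S h.
pose i : lc_index (source_space n q1) := inr (fun=> 0%N, 0%N).
pose M := lc_norm i (\val h); have M0 : 0 <= M by exact: NS.
have M1 : 0 < M + 1 by rewrite ltr_wpDl.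
exists (Num.min 1 (e / (M + 1))); first by rewrite lt_min ltr01 divr_gt0.
have b s : 0 <= s -> s <= 1 -> `|inhom h s| <= M * s.
  move=> s0 s1; rewrite /inhom (duhamelE _ _ s0).
  apply: (dprim_le a_continuous a_sym a_posdef hh s0 M0) => r /andP[r0 rs].
  by apply: src_norm; rewrite r0/=; exact: le_trans s1.
have z : inhom h 0 = 0.
  by apply/eqP; rewrite -normr_le0; have := b 0 (lexx 0) ler01; rewrite mulr0.
move=> s s0; rewrite lt_min z subr0 => /andP[/ltW s1 s2]; apply: le_trans (b s s0 s1) _.
by move: s2; rewrite ltr_pdivlMr// => s2; lra.
Qed.

Lemma inhom_norm (i : lc_index (solution_space n q1)) : exists2 p, PS p & forall h, lc_norm i (inhom h) <= p h.
Proof.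
case: i => [i|[[] b]]; first exact: Cl_norm (@dominated_ge0 _ _ _ _) inhom_Cl i.
have [p Pp hp] := inhom_bound (fun=> 0%N) b; exists p => // h.
apply: sup_nneg_le; first exact: dominated_ge0 Pp.
move=> _ [t + <-]; rewrite /= in_itv/= => tb.
by have := hp h t tb; rewrite wd_id.
Qed.

Definition inhom_map (h : src) : lc_elt (solution_space n q1) :=
  SigSub (mem_set (inhom_mem h)).

Lemma inhom_lin c (u v w : src) : \val w = c *: \val u + \val v ->
  inhom w = c *: inhom u + inhom v.
Proof.
move=> E; apply/funext => t; rewrite /inhom E.
change (duhamel a (fun s => c *: \val u s + \val v s) t = c *: duhamel a (\val u) t + duhamel a (\val v) t).
by apply: duhamel_lin => //; exact: src_C0S.
Qed.

Lemma inhom_linear : lc_linear inhom_map.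
Proof.
move=> c u v; exists (SigSub (mem_set (source_lin c u v))) => //.
exact: inhom_lin.
Qed.

Lemma inhom_continuous : continuous inhom_map.
Proof.
apply: lc_continuous => [i f g k|h i e e0]; first exact: solution_triangle.
have [p Pp hp] := inhom_norm i; have [r [d d0 hd]] := dominated_small Pp e0.
have := lc_near r d0 (fun i => source_norm0 i h); apply: filterS => g gh.
pose w : src := SigSub (mem_set (source_sub h g)).
have -> : \val (inhom_map g) - \val (inhom_map h) = inhom w.
  rewrite (@inhom_lin (-1) h g w); first by rewrite scaleN1r addrC.
  by rewrite scaleN1r addrC.
by apply: le_lt_trans (hp w) _; exact: hd.
Qed.

End maps.

Theorem proposition8 (R : realType) (n : nat) (n_gt0 : (0 < n)%N)
    (a : R -> 'M[R]_n)
    (a_smooth : forall (j : nat) (t : R), 0 < t -> derivable (derive1n j a) t 1)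
    (a_continuous : {within `[0, +oo[, continuous a})
    (a_unit : forall t : R, 0 <= t -> a t \in unitmx)
    (a_sym : forall t : R, 0 <= t -> (a t)^T = a t)
    (a_posdef : forall t : R, 0 <= t ->
       forall x : 'rV[R]_n, x != 0 -> 0 < (x *m (a t *m x^T)) 0 0)
    (q : R) (q1 : (1 <= q%:E)%E) :
  (exists W0 : Lq n q1 -> lc_elt (solution_space n q1),
     [/\ forall (h : Lq n q1) (t : R), 0 <= t ->
           \val (W0 h) t = heat_op a 0 t h,
         linear (fun h : Lq n q1 => \val (W0 h) : R -> Lq n q1)
       & continuous W0]) /\
  (exists IW : lc_elt (source_space n q1) -> lc_elt (solution_space n q1),
     [/\ forall (h : lc_elt (source_space n q1)) (t : R), 0 <= t ->
           is_riemann_integral (fun s => heat_op a s t (\val h s)) 0 t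
             (\val (IW h) t),
         lc_linear IW
       & continuous IW]).
Proof.
split.
  exists (hom_map a_smooth a_continuous a_sym a_posdef); split.
  - by move=> h t t0; exact: homE.
  - by move=> c u v; exact: hom_lin.
  - exact: hom_continuous.
exists (inhom_map a_smooth a_continuous a_sym a_posdef); split.
- by move=> h t t0; apply: duhamel_riemann => //; exact: src_C0S.
- exact: inhom_linear.
- exact: inhom_continuous.
Qed.
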